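(* If $\alpha\in(0,1]$, then every phase transition in temperature of a potential in $C^\alpha(\mathbb{R})$ is persistent in $C^\alpha(\mathbb{R})$, the function $\beta_{\mathrm{crit},\alpha}\colon C^\alpha(\mathbb{R})\to(0,+\infty]$ is continuous, and we have $$\beta_{\mathrm{crit},\alpha}^{-1}(1)=\mathcal{PT}(\alpha)\subseteq\operatorname{int}(\mathcal{G}(\alpha))\quad\text{and}\quad\beta_{\mathrm{crit},\alpha}^{-1}((0,+\infty))=\operatorname{int}(\mathcal{G}(\alpha)).$$
   Context: Fix $\alpha\in(0,+\infty)$ and let $f\colon[0,1]\to[0,1]$ be the intermittent map given by $f(x)=x(1+x^{\alpha})$ if $x(1+x^{\alpha})\le 1$, and $f(x)=x(1+x^{\alpha})-1$ otherwise. Let $\mathscr{M}$ be the set of Borel probability measures on $[0,1]$ invariant by $f$; for $\nu\in\mathscr{M}$ let $h_\nu$ be its measure-theoretic entropy. For $\gamma\in(0,1]$, $C^{\gamma}(\mathbb{R})$ is the Banach space of real-valued $\gamma$-Hölder continuous functions on $[0,1]$ with norm $\|\varphi\|_\gamma=\|\varphi\|+|\varphi|_\gamma$, where $\|\varphi\|=\sup_{[0,1]}|\varphi|$ and $|\varphi|_\gamma=\sup_{x\ne y}|\varphi(x)-\varphi(y)|/|x-y|^\gamma$; interiors ($\operatorname{int}$) and boundaries of subsets are taken in this space. For a continuous $\varphi\colon[0,1]\to\mathbb{R}$ (a potential), the pressure is $P(\varphi)=\sup\{h_\nu+\int\varphi\,d\nu:\nu\in\mathscr{M}\}$, and a Gibbs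 state of $f$ for $\varphi$ is a measure in $\mathscr{M}$ attaining this supremum. $\delta_0$ is the Dirac mass at $0$. A measure $\nu\in\mathscr{M}$ is exponentially mixing if there are $C\in(0,+\infty)$ and $\rho\in(0,1)$ such that for every bounded measurable $\psi\colon[0,1]\to\mathbb{R}$, every Lipschitz $\tilde\psi\colon[0,1]\to\mathbb{R}$ and every $n\in\mathbb{N}$, $|\int\psi\circ f^n\cdot\tilde\psi\,d\nu-\int\psi\,d\nu\int\tilde\psi\,d\nu|\le C\|\psi\|\,|\tilde\psi|_1\,\rho^n$. The intermittent phase $\mathcal{I}(\gamma)$ is the set of $\varphi\in C^\gamma(\mathbb{R})$ for which there is an exponentially mixing Gibbs state of strictly positive entropy. The stationary phase $\mathcal{S}(\gamma)$ is the interior of the set of $\varphi\in C^\gamma(\mathbb{R})$ for which $\delta_0$ is the unique Gibbs state. For $\gamma\in(0,\min\{\alpha,1\}]$, the phase transition locus $\mathcal{PT}(\gamma)$ is the common boundary $\partial\mathcal{I}(\gamma)=\partial\mathcal{S}(\gamma)$ (these two boundaries coincide). A ground state of $f$ for a continuous potential $\varphi$ is a measure $\nu\in\mathscr{M}$ with $\int\varphi\,d\nu=\sup_{\nu'\in\mathscr{M}}\int\varphi\,d\nu'$. $\mathcal{G}(\gamma)$ is the set of $\varphi\in C^\gamma(\mathbb{R})$ for which $\delta_0$ is a ground state. A Hölder continuous potential $\varphi$ undergoes a phase transition in temperature if the function $\beta\mapsto P(\beta\varphi)$ fails to be real-analytic on $(0,+\infty)$; in that case there is a unique point of $(0,+\infty)$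 at which this function fails to be real-analytic, called the phase transition parameter of $\varphi$. The phase transition in temperature of $\varphi\in C^\gamma(\mathbb{R})$ is persistent in $C^\gamma(\mathbb{R})$ if every potential close to $\varphi$ in $C^\gamma(\mathbb{R})$ undergoes a phase transition in temperature whose phase transition parameter is close to that of $\varphi$ (i.e., all potentials in a neighborhood of $\varphi$ undergo a phase transition in temperature, and the phase transition parameter, as a function on this neighborhood, is continuous at $\varphi$). For $\varphi\in C^\gamma(\mathbb{R})$, $\beta_{\mathrm{crit},\gamma}(\varphi)$ is the phase transition parameter of $\varphi$ if $\varphi$ undergoes a phase transition in temperature, and $+\infty$ otherwise. *)

(* Defs.v *)
From HB Require Import structures.
From mathcomp Require Import all_boot all_order all_algebra.
From mathcomp Require Import all_classical all_reals all_analysis.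
From mathcomp Require Import ring lra.

Set Implicit Arguments.
Unset Strict Implicit.
Unset Printing Implicit Defensive.

Import Order.TTheory GRing.Theory Num.Theory.
Import numFieldNormedType.Exports.

Local Open Scope classical_set_scope.
Local Open Scope ring_scope.

(* [0, 1] with its subspace topology and its Borel sigma-algebra. *)
Record I01 (R : realType) := MkI01 {
  I01_val :> R ;
  I01P : 0 <= I01_val <= 1 }.

Section I01_instances.
Variable R : realType.

HB.instance Definition _ := [isSub for @I01_val R].
HB.instance Definition _ := [Choice of I01 R by <:].
HB.instance Definition _ :=
  PseudoMetric.copy (I01 R) (initial_topology (@I01_val R)).

Lemma I01_0P : 0 <= (0 : R) <= 1.
Proof. by rewrite lexx ler01. Qed.

Definition I01_0 : I01 R := MkI01 I01_0P.

HB.instance Definition _ := isPointed.Build (I01 R) I01_0.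

HB.instance Definition _ := @isMeasurable.Build (sigma_display (@open (I01 R)))
  (I01 R) <<s @open (I01 R) >> (@sigma_algebra0 _ setT _)
  (@sigma_algebraC _ _) (@sigma_algebra_bigcup _ setT _).

End I01_instances.

Section map.
Variables (R : realType) (alpha : R).

Definition intermittent_fun (x : R) : R :=
  let y := x * (1 + x `^ alpha) in if y <= 1 then y else y - 1.

(* The default value of insubd is never used when alpha is nonnegative, see
   val_intermittent. *)
Definition intermittent (x : I01 R) : I01 R :=
  insubd (I01_0 R) (intermittent_fun (I01_val x)).

Lemma val_intermittent (x : I01 R) :
  0 <= alpha -> I01_val (intermittent x) = intermittent_fun (I01_val x).
Proof.
move=> a0; rewrite /intermittent val_insubd.
suff -> : 0 <= intermittent_fun (I01_val x) <= 1 by [].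
have /andP[x0 x1] := I01P x.
set p := I01_val x `^ alpha.
have p0 : 0 <= p by exact: powR_ge0.
have p1 : p <= 1.
  have e1 : (1 : R) `^ alpha = 1 by rewrite powR1.
  by rewrite -e1; apply: ge0_ler_powR; rewrite ?nnegrE.
rewrite /intermittent_fun -/p /=; have [y1|y1] := leP (I01_val x * (1 + p)) 1.
  by rewrite y1 andbT mulr_ge0// addr_ge0.
by apply/andP; split; nra.
Qed.

End map.

Section entropy.
Variables (d : measure_display) (T : measurableType d) (R : realType).
Variables (f : T -> T) (nu : probability T R).

Definition finite_mpartition (k : nat) (xi : 'I_k -> set T) : Prop :=
  [/\ forall i, measurable (xi i), trivIset setT xi
    & \bigcup_i xi i = setT].

(* The cell with itinerary s of the join of the preimages of xi under the
   first n iterates of f; cells may be empty. *)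
Definition join_cell (k : nat) (xi : 'I_k -> set T) (n : nat)
    (s : {ffun 'I_n -> 'I_k}) : set T :=
  [set x | forall i : 'I_n, xi (s i) (iter i f x)].

Definition join_entropy (k : nat) (xi : 'I_k -> set T) (n : nat) : R :=
  - \sum_(s : {ffun 'I_n -> 'I_k})
      fine (nu (join_cell xi s)) * ln (fine (nu (join_cell xi s))).

Definition partition_entropy (k : nat) (xi : 'I_k -> set T) : R :=
  lim (join_entropy xi n / n%:R @[n --> \oo]).

Definition entropy : \bar R :=
  ereal_sup [set h | exists k (xi : 'I_k -> set T),
    finite_mpartition xi /\ h = (partition_entropy xi)%:E].

Definition invariant_measure : Prop :=
  forall A, measurable A -> nu (f @^-1` A) = nu A.

End entropy.

(* Measures are compared on measurable sets only: a probability may take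
   arbitrary values on the other sets. *)
Definition eq_on_measurable (d : measure_display) (T : measurableType d)
    (R : realType) (mu nu : probability T R) : Prop :=
  forall A, measurable A -> mu A = nu A.

Section hoelder_functions.
Variables (R : realType).

Definition sup_norm (phi : I01 R -> R) : R := sup (range (fun x => `|phi x|)).

Definition hoelder_quotients (gamma : R) (phi : I01 R -> R) : set R :=
  [set `|phi z.1 - phi z.2| / `|I01_val z.1 - I01_val z.2| `^ gamma
    | z in [set z : I01 R * I01 R | z.1 != z.2]].

Definition hoelder_seminorm (gamma : R) (phi : I01 R -> R) : R :=
  sup (hoelder_quotients gamma phi).

Definition is_hoelder (gamma : R) (phi : I01 R -> R) : Prop :=
  has_ubound (hoelder_quotients gamma phi).

Lemma hoelder_quotients_ge0 gamma phi q :
  hoelder_quotients gamma phi q -> 0 <= q.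
Proof. by move=> [z _ <-]; rewrite divr_ge0// powR_ge0. Qed.

Lemma hoelder_quotients_nonempty gamma phi :
  hoelder_quotients gamma phi !=set0.
Proof.
have h1 : 0 <= (1 : R) <= 1 by rewrite lexx ler01.
exists (`|phi (I01_0 R) - phi (MkI01 h1)| / `|(0:R) - 1| `^ gamma).
exists (I01_0 R, MkI01 h1) => //=.
by rewrite -(inj_eq val_inj)/= eq_sym oner_neq0.
Qed.

Lemma hoelder_quotientP gamma phi (x y : I01 R) : 
    is_hoelder gamma phi ->
  `|phi x - phi y| <= hoelder_seminorm gamma phi *
    `|I01_val x - I01_val y| `^ gamma.
Proof.
move=> hphi; have [->|xy] := eqVneq x y.
  rewrite !subrr normr0 mulr_ge0 ?powR_ge0//.
  have [q hq] := hoelder_quotients_nonempty gamma phi.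
  exact: le_trans (hoelder_quotients_ge0 hq) (ub_le_sup hphi hq).
rewrite -ler_pdivrMr; first by apply: ub_le_sup => //; exists (x, y).
by rewrite powR_gt0// normr_gt0 subr_eq0 (inj_eq val_inj).
Qed.

Lemma hoelder_seminorm_le gamma phi C :
  (forall x y : I01 R,
    `|phi x - phi y| <= C * `|I01_val x - I01_val y| `^ gamma) ->
  is_hoelder gamma phi /\ hoelder_seminorm gamma phi <= C.
Proof.
move=> hC.
have ubC : ubound (hoelder_quotients gamma phi) C.
  move=> _ [[x y]/= xy <-]; rewrite ler_pdivrMr//.
  by rewrite powR_gt0// normr_gt0 subr_eq0 (inj_eq val_inj).
split; first by exists C.
by apply: ge_sup => //; exact: hoelder_quotients_nonempty.
Qed.

Lemma is_hoelder_bounded gamma phi : is_hoelder gamma phi ->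
  exists M, forall x, `|phi x| <= M.
Proof.
move=> hphi; pose C := hoelder_seminorm gamma phi.
have C0 : 0 <= C.
  have [q hq] := hoelder_quotients_nonempty gamma phi.
  exact: le_trans (hoelder_quotients_ge0 hq) (ub_le_sup hphi hq).
have h1 : 0 <= (1 : R) <= 1 by rewrite lexx ler01.
pose o := I01_0 R; pose i := MkI01 h1.
pose D := 1 + 2^-1 `^ gamma.
have hD (t : R) : 2^-1 <= t -> t <= 1 -> t `^ gamma <= D.
  move=> t2 t1; have t0 : 0 < t by lra.
  have [g0|g0] := leP 0 gamma.
    apply: (@le_trans _ _ 1); last by rewrite lerDl powR_ge0.
    have e1 : (1 : R) `^ gamma = 1 by rewrite powR1.
    by rewrite -e1 ge0_ler_powR// nnegrE ltW.
  apply: (@le_trans _ _ (2^-1 `^ gamma)); last by rewrite lerDr.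
  rewrite -[gamma]opprK !(powRN _ (- gamma)) lef_pV2 ?posrE ?powR_gt0//.
  by apply: ge0_ler_powR; rewrite ?nnegrE ?oppr_ge0; lra.
exists (`|phi o| + `|phi i| + C * D) => x; have /andP[x0 x1] := I01P x.
have h y : 2^-1 <= `|I01_val x - I01_val y| -> `|I01_val x - I01_val y| <= 1 ->
    `|phi x| <= `|phi y| + C * D.
  move=> h2 hle1; rewrite -[phi x](subrK (phi y)) addrC.
  rewrite (le_trans (ler_normD _ _))// lerD2l.
  rewrite (le_trans (hoelder_quotientP _ _ hphi))//.
  by rewrite ler_wpM2l// hD.
have [x2|x2] := leP 2^-1 (I01_val x).
  have e : `|I01_val x - I01_val o| = I01_val x by rewrite subr0 ger0_norm.
  have := h o; rewrite e => /(_ x2 x1) /le_trans; apply.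
  by rewrite lerD2r lerDl.
have e : `|I01_val x - I01_val i| = 1 - I01_val x.
  by rewrite distrC ger0_norm// subr_ge0.
have := h i; rewrite e => ho; apply: le_trans (ho _ _) _; try lra.
by rewrite lerD2r lerDr.
Qed.

Lemma sup_norm_ge phi x M : (forall x, `|phi x| <= M) ->
  `|phi x| <= sup_norm phi.
Proof.
move=> hM; apply: ub_le_sup; last by exists x.
by exists M => _ [y _ <-].
Qed.

Lemma sup_norm_le phi M : (forall x, `|phi x| <= M) -> sup_norm phi <= M.
Proof.
move=> hM; apply: ge_sup; first by exists `|phi (I01_0 R)|, (I01_0 R).
by move=> _ [y _ <-].
Qed.

Definition hoelder_pred (gamma : R) : {pred (I01 R -> R)} :=
  fun phi => `[< is_hoelder gamma phi >].

Record hoelder_fct (gamma : R) := Hoelder {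
  hoelder_fun :> I01 R -> R ;
  hoelder_funP : hoelder_fun \in hoelder_pred gamma }.

Section hoelder_fct_space.
Variable gamma : R.

HB.instance Definition _ := [isSub for @hoelder_fun gamma].
HB.instance Definition _ := [Choice of hoelder_fct gamma by <:].

Lemma hoelderP (phi : hoelder_fct gamma) : is_hoelder gamma phi.
Proof. exact/asboolP/hoelder_funP. Qed.

Lemma hoelder_submod_closed : submod_closed (hoelder_pred gamma).
Proof.
split.
  apply/asboolP; apply: (hoelder_seminorm_le (C := 0) _).1 => x y.
  by rewrite subrr normr0 mul0r.
move=> a u v /asboolP hu /asboolP hv; apply/asboolP.
apply: (hoelder_seminorm_le
  (C := `|a| * hoelder_seminorm gamma u + hoelder_seminorm gamma v) _).1.
move=> x y; rewrite !fctE.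
rewrite (_ : _ - _ = a * (u x - u y) + (v x - v y)); last first.
  by rewrite /GRing.scale/=; ring.
rewrite (le_trans (ler_normD _ _))// mulrDl lerD ?hoelder_quotientP//.
by rewrite normrM -mulrA ler_wpM2l// hoelder_quotientP.
Qed.

HB.instance Definition _ := GRing.isSubmodClosed.Build R (I01 R -> R)
  (hoelder_pred gamma) hoelder_submod_closed.
HB.instance Definition _ := [SubChoice_isSubLmodule of hoelder_fct gamma by <:].

Definition hoelder_norm (phi : hoelder_fct gamma) : R :=
  sup_norm phi + hoelder_seminorm gamma phi.

Lemma hoelder_le_sup_norm (phi : hoelder_fct gamma) x :
  `|phi x| <= sup_norm phi.
Proof.
have [M hM] := is_hoelder_bounded (hoelderP phi); exact: sup_norm_ge hM.
Qed.

Lemma ler_hoelder_normD (u v : hoelder_fct gamma) :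
  hoelder_norm (u + v) <= hoelder_norm u + hoelder_norm v.
Proof.
rewrite /hoelder_norm addrACA lerD//.
  apply: sup_norm_le => x; rewrite (le_trans (ler_normD _ _))//.
  by rewrite lerD ?hoelder_le_sup_norm.
apply: (hoelder_seminorm_le _).2 => x y.
rewrite (_ : _ - _ = (u x - u y) + (v x - v y)); last first.
  by rewrite /= !fctE; ring.
rewrite (le_trans (ler_normD _ _))// mulrDl lerD ?hoelder_quotientP//.
  exact: hoelderP.
exact: hoelderP.
Qed.

Lemma hoelder_normZ_le (a : R) (u : hoelder_fct gamma) :
  hoelder_norm (a *: u) <= `|a| * hoelder_norm u.
Proof.
rewrite /hoelder_norm mulrDr lerD//.
  apply: sup_norm_le => x; rewrite normrM ler_wpM2l//.
  exact: hoelder_le_sup_norm.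
apply: (hoelder_seminorm_le _).2 => x y.
rewrite (_ : _ - _ = a * (u x - u y)); last first.
  by rewrite /= !fctE /GRing.scale/=; ring.
rewrite normrM -mulrA ler_wpM2l// hoelder_quotientP//.
exact: hoelderP.
Qed.

Lemma hoelder_normZ (a : R) (u : hoelder_fct gamma) :
  hoelder_norm (a *: u) = `|a| * hoelder_norm u.
Proof.
apply/eqP; rewrite eq_le hoelder_normZ_le/=.
have [->|a0] := eqVneq a 0.
  rewrite normr0 mul0r scale0r.
  apply: addr_ge0; first exact: le_trans (hoelder_le_sup_norm _ (I01_0 R)).
  have [q hq] := hoelder_quotients_nonempty gamma (0 : hoelder_fct gamma).
  exact: le_trans (hoelder_quotients_ge0 hq) (ub_le_sup (hoelderP _) hq).
have := hoelder_normZ_le a^-1 (a *: u).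
rewrite scalerA mulVf// scale1r normfV => h.
by rewrite -ler_pdivlMl// normr_gt0.
Qed.

Lemma hoelder_norm0_eq0 (u : hoelder_fct gamma) : hoelder_norm u = 0 -> u = 0.
Proof.
move=> /eqP; rewrite paddr_eq0; last 2 first.
- exact: le_trans (hoelder_le_sup_norm _ (I01_0 R)).
- have [q hq] := hoelder_quotients_nonempty gamma u.
  exact: le_trans (hoelder_quotients_ge0 hq) (ub_le_sup (hoelderP _) hq).
move=> /andP[/eqP u0 _]; apply/val_inj/funext => x.
apply/eqP; rewrite -normr_le0.
by have := hoelder_le_sup_norm u x; rewrite u0.
Qed.

HB.instance Definition _ := Lmodule_isNormed.Build R (hoelder_fct gamma)
  ler_hoelder_normD hoelder_normZ hoelder_norm0_eq0.

End hoelder_fct_space.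
End hoelder_functions.

Definition boundary (X : topologicalType) (A : set X) : set X :=
  closure A `\` A°.

Definition real_analytic_at (R : realType) (F : R -> R) (b : R) : Prop :=
  exists (a : nat -> R) (r : R), 0 < r /\
    forall x, `|x - b| < r ->
      series (fun n => a n * (x - b) ^+ n) @ \oo --> F x.

Section thermodynamics.
Variables (R : realType) (alpha : R).
Local Notation T := (I01 R).
Local Notation f := (@intermittent R alpha).
Implicit Types (phi : T -> R) (nu : probability T R).

Definition pressure (phi : T -> R) : \bar R :=
  ereal_sup [set (entropy f nu + (\int[nu]_x phi x)%:E)%E
    | nu in [set nu : probability T R | invariant_measure f nu]].

Definition gibbs_state phi nu : Prop :=
  invariant_measure f nu /\
  (entropy f nu + (\int[nu]_x phi x)%:E)%E = pressure phi.

Definition ground_state phi nu : Prop :=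
  invariant_measure f nu /\
  \int[nu]_x phi x =
    sup [set \int[nu']_x phi x
      | nu' in [set nu' : probability T R | invariant_measure f nu']].

Definition delta0 : probability T R := \d_(I01_0 R).

Definition exponentially_mixing nu : Prop :=
  exists C rho : R, [/\ 0 < C, 0 < rho < 1 &
    forall psi psi' : T -> R,
      measurable_fun setT psi -> (exists M, forall x, `|psi x| <= M) ->
      is_hoelder 1 psi' ->
      forall n : nat,
      `| \int[nu]_x (psi (iter n f x) * psi' x)
         - \int[nu]_x psi x * \int[nu]_x psi' x |
      <= C * sup_norm psi * hoelder_seminorm 1 psi' * rho ^+ n].

Definition intermittent_phase (gamma : R) : set (hoelder_fct gamma) :=
  [set phi | exists nu : probability T R,
    [/\ gibbs_state phi nu, exponentially_mixing nu & (0 < entropy f nu)%E]].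

Definition stationary_phase (gamma : R) : set (hoelder_fct gamma) :=
  [set phi : hoelder_fct gamma | gibbs_state phi delta0 /\
    forall nu, gibbs_state phi nu -> eq_on_measurable nu delta0]°.

Definition ground_set (gamma : R) : set (hoelder_fct gamma) :=
  [set phi : hoelder_fct gamma | ground_state phi delta0].

Arguments intermittent_phase : clear implicits.
Arguments stationary_phase : clear implicits.
Arguments ground_set : clear implicits.

(* For 0 < gamma <= min(alpha, 1), this is also the boundary of
   stationary_phase gamma. *)
Definition phase_transition_locus (gamma : R) : set (hoelder_fct gamma) :=
  boundary (intermittent_phase gamma).
Arguments phase_transition_locus : clear implicits.

(* The pressure is finite, because f has finite topological entropy. *)
Definition pressure_fun phi (b : R) : R :=
  fine (pressure (fun x => b * phi x)).

Definition phase_transition phi : Prop :=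
  ~ (forall b, 0 < b -> real_analytic_at (pressure_fun phi) b).

(* The point at which analyticity fails is unique. *)
Definition transition_parameter phi : R :=
  xget 0 [set b | 0 < b /\ ~ real_analytic_at (pressure_fun phi) b].

Definition persistent (gamma : R) (phi : hoelder_fct gamma) : Prop :=
  (\forall psi \near phi, phase_transition (psi : hoelder_fct gamma)) /\
  {for phi,
    continuous (fun psi : hoelder_fct gamma => transition_parameter psi)}.

Definition beta_crit (gamma : R) (phi : hoelder_fct gamma) : \bar R :=
  if `[< phase_transition phi >] then (transition_parameter phi)%:E else +oo%E.

Lemma beta_crit_gt0 (gamma : R) (phi : hoelder_fct gamma) :
  (0 < beta_crit phi)%E.
Proof.
rewrite /beta_crit; case: asboolP => // /existsNP[b /not_implyP[b0 nb]].
rewrite lte_fin /transition_parameter; case: xgetP => [c _ []//|/(_ b)].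
by case; split.
Qed.

End thermodynamics.

Arguments intermittent_phase {R} alpha gamma _.
Arguments stationary_phase {R} alpha gamma _.
Arguments ground_set {R} alpha gamma _.
Arguments phase_transition_locus {R} alpha gamma _.
Arguments beta_crit {R} alpha {gamma} phi.

(* Main.v *)
(* Let L be the transfer operator of phi, lam the exponential growth rate of L^n 1, and
   E = exp (phi 0).  A Gibbs inequality against cylinder sets bounds the entropy and gives
   P(phi) <= log lam.  If lam > E, then L preserves the cone of functions with controlled
   distortion away from the neutral point 0, resolvent limits give a positive Hoelder
   eigenfunction, and the normalized operator is a Markov operator with a spectral gap;
   its invariant functional is a measure that attains log lam, mixes exponentially and
   has positive entropy.  Hence P(phi) = max (log lam) (phi 0), and P is analytic along
   lines at phi when P(phi) > phi 0, by majorizing the formal perturbation of the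
   eigenpair.

   Call phi frozen at b when P(b phi) = b phi 0.  The set of such b > 0 is closed, upward
   closed and stays away from 0; P(b phi) is analytic off this half-line and affine on
   it, so its left endpoint is the transition parameter.  Being frozen is a closed
   condition on phi.  It is also open up to an arbitrarily small increase of b: the map
   induced by the first return to the right branch has sums of phi - phi 0 decreasing
   like - log k in the return time k, which absorbs the effect of a small alpha-Hoelder
   perturbation, because the latter is at most a small multiple of sum_(j <= k) 1/j.
   Continuity of beta_crit and persistence follow.  An exponentially mixing Gibbs state of
   positive entropy excludes freezing at 1: lowering phi near 0 by a dip of width
   x_n decreases the pressure at least polynomially in 1/n, while mixing makes the mass of
   that dip exponentially small.  Finally, - B x^alpha has pressure 0 for large B, so
   phi + e x^alpha having the ground state delta_0 forces phi to be frozen at B / e. *)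

Require Import Defs.
From HB Require Import structures.
From mathcomp Require Import all_boot all_order all_algebra.
From mathcomp Require Import all_classical all_reals all_analysis.
From mathcomp Require Import measurable_realfun.
From mathcomp Require Import zify ring lra.

Set Implicit Arguments.
Unset Strict Implicit.
Unset Printing Implicit Defensive.

Import Order.TTheory GRing.Theory Num.Theory.
Import numFieldNormedType.Exports.
Local Open Scope classical_set_scope.
Local Open Scope ring_scope.

(** * Inverse branches *)

(** In the metric [da], the power alpha of the distance, an inverse branch sends d to at most about
    d - c d^2, so distances after n branches are O(1/n) and nothing better holds near 0. Two orbits
    that leave J = [cutp, 1] along the neutral branch nevertheless have summable [da] distances:
    relative distances contract, and the sum telescopes. This gives bounded distortion, but only
    between points of J. Hence cones and eigenfunctions are first controlled on J and then
    propagated by the relation lam g = L0 g + L1 g, where L0 and L1 are the two halves of the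
    operator and L1 reads values on J only. The exponent alpha is tied to the harmonic sums along an
    excursion: a smaller exponent would replace log k by a power of k, which the return sums could
    not absorb. Two points of encoding also matter. The identities for inverse branches fail at 0,
    so the eigenmeasure must be shown to give 0 no mass. Entropy is defined through [lim], so lower
    bounds need a proof of convergence and upper bounds must cover the default value. *)

Section powR_facts.
Variables (R : realType) (alpha : R).
Hypothesis a01 : 0 < alpha <= 1.

Let a0 : 0 < alpha. Proof. by case/andP: a01. Qed.
Let a1 : alpha <= 1. Proof. by case/andP: a01. Qed.

Local Ltac lra' := have := a0; have := a1; lra.
Local Ltac nra' := have := a0; have := a1; nra.

(** With [u = ln z], both [h1] and [h2] come from [1 + v <= expR v]; in their combination with
    weights [alpha] and [1 - alpha] the terms in [u] cancel. *)
Lemma powR_le_affine (z : R) : 0 <= z -> z `^ alpha <= 1 + alpha * (z - 1).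
Proof.
rewrite le_eqVlt => /predU1P[<-|z0].
  by rewrite powR0 ?gt_eqF//; lra'.
rewrite /powR gt_eqF//; set u := ln z.
have -> : z = expR u by rewrite lnK.
have e0 : 0 < expR (alpha * u) by exact: expR_gt0.
have h1 : expR (alpha * u) * (1 + (1 - alpha) * u) <= expR u.
  have -> : expR u = expR (alpha * u) * expR ((1 - alpha) * u).
    by rewrite -expRD; congr expR; ring.
  by rewrite ler_pM2l// expR_ge1Dx.
have h2 : expR (alpha * u) * (1 - alpha * u) <= 1.
  rewrite -[leRHS](expRxMexpNx_1 (alpha * u)) ler_pM2l//.
  exact: expR_ge1Dx.
have h3 := ler_wpM2l (ltW a0) h1.
have h4 : (1 - alpha) * (expR (alpha * u) * (1 - alpha * u)) <= (1 - alpha) * 1.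
  by rewrite ler_wpM2l// subr_ge0.
by lra.
Qed.

Lemma powR1D_le (t : R) : 0 <= t -> (1 + t) `^ alpha <= 1 + t.
Proof. move=> t0; have h := @powR_le_affine (1 + t) ltac:(lra); nra'. Qed.

Lemma powR1D_ge (t : R) : 0 <= t <= 1 -> 1 + alpha / 2 * t <= (1 + t) `^ alpha.
Proof.
move=> /andP[t0 t1]; have t10 : 0 < 1 + t by lra.
(* The upper bound is applied to the inverse of [1 + t], so that taking inverses turns it into a
   lower bound. *)
have h := @powR_le_affine (1 + t)^-1 ltac:(by rewrite invr_ge0; lra).
have p0 : 0 < (1 + t) `^ alpha by exact: powR_gt0.
have e : (1 + t)^-1 `^ alpha * (1 + t) `^ alpha = 1.
  by rewrite -powRM ?invr_ge0 ?ltW// mulVf ?gt_eqF// powR1.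
set v := (1 + t)^-1 in h e.
have ev : v * (1 + t) = 1 by rewrite mulVf// gt_eqF.
have v0 : 0 < v by rewrite invr_gt0.
have h3 : 1 <= (1 + t) `^ alpha * (1 + alpha * (v - 1)).
  by rewrite -[leLHS]e mulrC ler_pM2l.
have e4 : v - 1 = - t * v by nra.
have v2 : 2^-1 <= v by rewrite lef_pV2 ?posrE; lra.
have h5 : 1 + alpha * (v - 1) <= 1 - alpha / 2 * t.
  have h8 := ler_wpM2l (mulr_ge0 (ltW a0) t0) v2; rewrite e4; nra.
have h6 : 1 <= (1 + t) `^ alpha * (1 - alpha / 2 * t).
  by apply: le_trans h3 _; rewrite ler_pM2l.
have h7 : 0 < 1 - alpha / 2 * t by nra'.
by rewrite -(ler_pM2r h7); nra.
Qed.

Lemma powR_ge_id (z : R) : 0 <= z <= 1 -> z <= z `^ alpha.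
Proof.
move=> /andP[]; rewrite le_eqVlt => /predU1P[<- _|z0 z1]; first exact: powR_ge0.
by apply: ger1_powR; rewrite ?z0.
Qed.

Lemma powR_subadd (x y : R) : 0 <= x -> 0 <= y ->
  (x + y) `^ alpha <= x `^ alpha + y `^ alpha.
Proof.
move=> x0 y0; have [s0|s0] := leP (x + y) 0.
  have -> : x + y = 0 by lra.
  by rewrite powR0 ?gt_eqF// addr_ge0 ?powR_ge0.
pose z := x / (x + y); pose w := y / (x + y).
have z0 : 0 <= z by rewrite divr_ge0// ltW.
have w0 : 0 <= w by rewrite divr_ge0// ltW.
have zw : z + w = 1 by rewrite -mulrDl divff// gt_eqF.
have hz := @powR_ge_id z ltac:(lra).
have hw := @powR_ge_id w ltac:(lra).
have xE : x = z * (x + y) by rewrite divfK// gt_eqF.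
have yE : y = w * (x + y) by rewrite divfK// gt_eqF.
have -> : x `^ alpha = z `^ alpha * (x + y) `^ alpha by rewrite -powRM -?xE// ltW.
have -> : y `^ alpha = w `^ alpha * (x + y) `^ alpha by rewrite -powRM -?yE// ltW.
rewrite -mulrDl -[leLHS]mul1r ler_wpM2r ?powR_ge0//; lra.
Qed.

Lemma powR_dist (x y : R) : 0 <= x -> 0 <= y ->
  `|x `^ alpha - y `^ alpha| <= `|x - y| `^ alpha.
Proof.
wlog yx : x y / y <= x => [hw x0 y0|x0 y0].
  have [/hw->//|/ltW xy] := leP y x.
  by rewrite distrC (distrC x) hw.
rewrite !ger0_norm ?subr_ge0//; last by rewrite ge0_ler_powR// ?nnegrE ?ltW.
rewrite lerBlDl -{1}(subrK y x) addrC.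
by rewrite powR_subadd// subr_ge0.
Qed.

Lemma powR_lt (x e : R) : 0 < e -> 0 <= x -> x < e `^ alpha^-1 -> x `^ alpha < e.
Proof.
move=> e0 x0 xe.
have -> : e = (e `^ alpha^-1) `^ alpha.
  by rewrite -powRrM mulVf ?gt_eqF// powRr1// ltW.
by rewrite gt0_ltr_powR// nnegrE// powR_ge0.
Qed.

End powR_facts.

Section branches.
Variables (R : realType) (alpha : R).
Hypothesis a01 : 0 < alpha <= 1.

Let a0 : 0 < alpha. Proof. by case/andP: a01. Qed.
Let a1 : alpha <= 1. Proof. by case/andP: a01. Qed.

Local Ltac lra' := have := a0; have := a1; lra.
Local Ltac nra' := have := a0; have := a1; nra.

Local Notation T := (I01 R).

Definition Fmap (x : R) : R := x * (1 + x `^ alpha).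

Lemma I01_ge0 (x : T) : 0 <= I01_val x. Proof. by case/andP: (I01P x). Qed.
Lemma I01_le1 (x : T) : I01_val x <= 1. Proof. by case/andP: (I01P x). Qed.
Hint Resolve I01_ge0 I01_le1 : core.

Lemma I01_1P : 0 <= (1 : R) <= 1. Proof. by rewrite lexx ler01. Qed.
Definition I01_1 : T := MkI01 I01_1P.

Lemma I01_inj (x y : T) : I01_val x = I01_val y -> x = y.
Proof. exact: val_inj. Qed.

Lemma powR_I01 (x : T) : 0 <= x `^ alpha <= 1.
Proof.
rewrite powR_ge0/=; have <- : (1 : R) `^ alpha = 1 by rewrite powR1.
by rewrite ge0_ler_powR// ?nnegrE// ltW.
Qed.

Lemma Fmap_expand (x y : R) : 0 <= y -> y <= x ->
  (x - y) * (1 + x `^ alpha) <= Fmap x - Fmap y.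
Proof.
move=> y0 yx; rewrite /Fmap.
have : y `^ alpha <= x `^ alpha by rewrite ge0_ler_powR ?nnegrE ?(ltW a0)//; lra.
by nra.
Qed.

(** Tangent inequality at [y] for the convex function [Fmap]. The excess of its slope over the ratio
    [Fmap y / y], which is [1 + y^alpha], is what makes relative distances contract in
    [dist_powR_ratio]. *)
Lemma Fmap_expand_low (x y : R) : 0 <= y -> y <= x ->
  (x - y) * (1 + (1 + alpha) * y `^ alpha) <= Fmap x - Fmap y.
Proof.
move=> y0 yx; have [x0|x0] := leP x 0.
  have -> : x = 0 by lra.
  have -> : y = 0 by lra.
  by rewrite subrr mul0r subrr.
pose z := y / x; have z0 : 0 <= z by rewrite divr_ge0// ltW.
have yE : y = z * x by rewrite divfK// gt_eqF.
have z1 : z <= 1 by rewrite ler_pdivrMr// mul1r.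
have h := powR_le_affine a01 z0.
rewrite /Fmap yE powRM ?(ltW x0)//.
have p0 : 0 <= x `^ alpha by exact: powR_ge0.
have q0 : 0 <= z `^ alpha by exact: powR_ge0.
set p := x `^ alpha in p0 *; set q := z `^ alpha in h q0 *.
have q1 : q <= 1 by nra'.
have : 0 <= x * p * ((1 - z * q) - (1 - z) * (1 + alpha) * q).
  rewrite mulr_ge0// ?mulr_ge0// ?(ltW x0)//; nra'.
by nra.
Qed.

Lemma Fmap_lt (x y : R) : 0 <= y -> y < x -> Fmap y < Fmap x.
Proof.
move=> y0 yx; have := Fmap_expand y0 (ltW yx).
by have := powR_ge0 x alpha; nra.
Qed.

Lemma Fmap_inj (x y : R) : 0 <= x -> 0 <= y -> Fmap x = Fmap y -> x = y.
Proof.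
move=> x0 y0 e; have [/(Fmap_lt x0)|/(Fmap_lt y0)|//] := ltgtP x y; lra.
Qed.

Lemma Fmap0 : Fmap 0 = 0. Proof. by rewrite /Fmap mul0r. Qed.
Lemma Fmap1 : Fmap 1 = 2. Proof. by rewrite /Fmap powR1 mul1r. Qed.

(** The absolute value gives a function continuous on the whole line, the form in which the
    intermediate value theorem is used in [Fmap_surj]. *)
Lemma continuous_norm_powR : continuous (fun x : R => `|x| `^ alpha).
Proof.
move=> x; apply/(@cvgrPdist_lt _ R^o) => e e0; near=> y.
apply: le_lt_trans (powR_dist a01 (normr_ge0 _) (normr_ge0 _)) _.
apply: le_lt_trans (_ : `|x - y| `^ alpha < _).
  by rewrite ge0_ler_powR ?nnegrE ?(ltW a0)// ler_dist_dist.
apply: powR_lt => //; near: y.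
by apply: (@cvgr_dist_lt _ R^o _ (nbhs x) _ id); [exact: cvg_id|exact: powR_gt0].
Unshelve. all: by end_near. Qed.

Lemma Fmap_surj (u : R) : 0 <= u <= 2 -> exists y : T, Fmap y = u.
Proof.
move=> u02; pose G (x : R) := `|x| * (1 + `|x| `^ alpha).
have cG : continuous G.
  move=> x; apply: (@continuousM R R^o (fun y : R => `|y|)).
    exact: (@norm_continuous R R^o).
  by apply: (@continuousD R R^o R^o (fun=> 1));
    [exact: cst_continuous|exact: continuous_norm_powR].
have GF (x : R) : 0 <= x -> G x = Fmap x by move=> x0; rewrite /G ger0_norm.
have [|y] := @IVT R G 0 1 u ler01 (continuous_subspaceT cG).
  by rewrite !GF// Fmap0 Fmap1 minEle maxEle ler0n.
rewrite in_itv/= => y01; have y0 : 0 <= y by case/andP: y01.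
by rewrite GF// => <-; exists (MkI01 y01).
Qed.

(* Inverse branches: i selects the branch, false being the one fixing 0. *)
Definition br (i : bool) (x : T) : T :=
  xget (I01_0 R) [set y : T | Fmap y = I01_val x + i%:R].

Lemma brE i x : Fmap (br i x) = I01_val x + i%:R.
Proof.
rewrite /br; case: xgetP => [y -> //|/= h].
have [|y hy] := @Fmap_surj (I01_val x + i%:R); last by have := h y; rewrite hy.
have := I01_ge0 x; have := I01_le1 x; case: i {h} => /=; lra.
Qed.

Definition cutp : R := br true (I01_0 R).

Lemma cutE : Fmap cutp = 1. Proof. by rewrite /cutp brE/= add0r. Qed.

Lemma cut_gt0 : 0 < cutp.
Proof.
have : 0 <= cutp by exact: I01_ge0.
rewrite le_eqVlt => /predU1P[e|//].
by have := cutE; rewrite -e Fmap0; lra.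
Qed.

Lemma Fmap_le (x y : R) : 0 <= x -> 0 <= y -> (Fmap x <= Fmap y) = (x <= y).
Proof.
move=> x0 y0; have [xy|yx|->] := ltgtP x y; last by rewrite lexx.
  by rewrite ltW// Fmap_lt.
by apply/negbTE; rewrite -ltNge Fmap_lt.
Qed.

Lemma br0_le (x : T) : I01_val (br false x) <= cutp.
Proof.
by rewrite -(Fmap_le (I01_ge0 _) (ltW cut_gt0)) brE cutE addr0.
Qed.

Lemma br1_ge (x : T) : cutp <= I01_val (br true x).
Proof. by rewrite -(Fmap_le (ltW cut_gt0) (I01_ge0 _)) brE cutE lerDr. Qed.

(** The point 0 is excluded because [br true] sends it to [cutp], which belongs to the left branch
    of [f]: there [f] takes the value 1, not 0. *)
Lemma br_int (x : T) i : 0 < I01_val x -> (cutp < I01_val (br i x)) = i.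
Proof.
move=> x0; rewrite ltNge -Fmap_le ?brE ?cutE ?(ltW cut_gt0)//.
by case: i => /=; have := I01_le1 x; rewrite -ltNge; lra.
Qed.

Lemma br0_0 : br false (I01_0 R) = I01_0 R.
Proof. by apply: I01_inj; apply: Fmap_inj => //; rewrite brE Fmap0/= addr0. Qed.

Lemma br_gt0 i (x : T) : (0 < I01_val x) -> 0 < I01_val (br i x).
Proof.
move=> x0; rewrite lt_neqAle I01_ge0 andbT; apply/eqP => e.
by have := brE i x; rewrite -e Fmap0; case: (i) => /=; lra.
Qed.

Lemma br1_gt0 (x : T) : 0 < I01_val (br true x).
Proof. exact: lt_le_trans cut_gt0 (br1_ge x). Qed.

Local Notation f := (@intermittent R alpha).

Lemma intermittentE (x : T) :
  I01_val (f x) = if I01_val x <= cutp then Fmap x else Fmap x - 1.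
Proof.
rewrite val_intermittent ?(ltW a0)// /intermittent_fun -/(Fmap x).
by rewrite -(Fmap_le (I01_ge0 _) (ltW cut_gt0)) cutE.
Qed.

Definition digit (x : T) : bool := cutp < I01_val x.

Lemma br_intermittent (x : T) : br (digit x) (f x) = x.
Proof.
apply: I01_inj; apply: Fmap_inj => //; rewrite brE intermittentE /digit leNgt.
by case: (cutp < I01_val x) => /=; lra.
Qed.

Lemma digit_br i (x : T) : 0 < I01_val x -> digit (br i x) = i.
Proof. exact: br_int. Qed.

Lemma intermittent_br i (x : T) : 0 < I01_val x -> f (br i x) = x.
Proof.
move=> x0; apply: I01_inj; rewrite intermittentE leNgt br_int// brE.
by case: i => /=; lra.
Qed.

Lemma intermittent0 : f (I01_0 R) = I01_0 R.
Proof. by apply: I01_inj; rewrite intermittentE (ltW cut_gt0) Fmap0. Qed.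

(* da is the metric in which exponent alpha Hoelder functions are Lipschitz. *)
Definition da (x y : T) : R := `|I01_val x - I01_val y| `^ alpha.

Lemma da_ge0 x y : 0 <= da x y. Proof. exact: powR_ge0. Qed.

Lemma da_sym x y : da x y = da y x. Proof. by rewrite /da distrC. Qed.

Lemma dist_I01 (x y : T) : `|I01_val x - I01_val y| <= 1.
Proof.
have := I01_ge0 x; have := I01_ge0 y; have := I01_le1 x; have := I01_le1 y.
by rewrite ler_norml; lra.
Qed.

Lemma da_le1 x y : da x y <= 1.
Proof.
have <- : (1 : R) `^ alpha = 1 by rewrite powR1.
by rewrite ge0_ler_powR ?nnegrE ?(ltW a0) ?dist_I01.
Qed.

Lemma dist_le_da (x y : T) : `|I01_val x - I01_val y| <= da x y.
Proof. by apply: powR_ge_id; rewrite ?normr_ge0 ?dist_I01. Qed.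

Lemma le_powR_alpha (x y : R) : 0 <= x -> x <= y -> x `^ alpha <= y `^ alpha.
Proof.
by move=> x0 xy; rewrite ge0_ler_powR// ?nnegrE ?(ltW a0)// (le_trans x0).
Qed.

(** The larger of two points at distance D lies at least D away from the neutral point, so the
    expansion is at least [1 + D^alpha]. *)
Lemma br_expand i (x y : T) : `|I01_val (br i x) - I01_val (br i y)| *
    (1 + da (br i x) (br i y)) <= `|I01_val x - I01_val y|.
Proof.
wlog xy : x y / br i y <= br i x :> R => [hw|].
  have [/hw//|/ltW /hw] := leP (I01_val (br i y)) (I01_val (br i x)).
  by rewrite distrC da_sym (distrC (I01_val x)).
have h := Fmap_expand (I01_ge0 _) xy.
have e : Fmap (br i x) - Fmap (br i y) = I01_val x - I01_val y by rewrite !brE; ring.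
rewrite e in h.
have d0 : 0 <= I01_val (br i x) - I01_val (br i y) by rewrite subr_ge0.
rewrite /da ger0_norm//; apply: le_trans (ler_norm _); apply: le_trans h.
rewrite ler_wpM2l// lerD2l le_powR_alpha//.
by rewrite lerBlDr lerDl.
Qed.

Lemma da_br_expand i (x y : T) :
  da (br i x) (br i y) * (1 + alpha / 2 * da (br i x) (br i y)) <= da x y.
Proof.
have h := br_expand i x y; set D := `|_| in h.
have e1 : 0 <= da (br i x) (br i y) <= 1 by rewrite da_ge0 da_le1.
apply: le_trans (_ : (D * (1 + da (br i x) (br i y))) `^ alpha <= _); last first.
  by rewrite le_powR_alpha// mulr_ge0 ?normr_ge0// addr_ge0// da_ge0.
rewrite powRM// ?normr_ge0//; last by lra.
by rewrite ler_wpM2l ?da_ge0// powR1D_ge.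
Qed.

Lemma da_br_le i (x y : T) : da (br i x) (br i y) <= da x y.
Proof.
have := da_br_expand i x y; have := da_ge0 (br i x) (br i y).
by nra'.
Qed.

Definition kappa : R := (1 + cutp `^ alpha) `^ (- alpha).

Lemma cuta_gt0 : 0 < cutp `^ alpha. Proof. by rewrite powR_gt0// cut_gt0. Qed.

Lemma kappa_gt0 : 0 < kappa.
Proof. by rewrite powR_gt0// addr_gt0// cuta_gt0. Qed.

Lemma kappa_lt1 : kappa < 1.
Proof.
rewrite /kappa powRN invf_lt1 ?powR_gt0 ?addr_gt0 ?cuta_gt0//.
have e1 : (1 : R) `^ alpha = 1 by rewrite powR1.
by rewrite -[ltLHS]e1 gt0_ltr_powR ?nnegrE// ?ltrDl ?cuta_gt0// addr_ge0// powR_ge0.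
Qed.

Lemma da_br1 (x y : T) : da (br true x) (br true y) <= kappa * da x y.
Proof.
wlog xy : x y / br true y <= br true x :> R => [hw|].
  have [/hw//|/ltW /hw] := leP (I01_val (br true y)) (I01_val (br true x)).
  by rewrite da_sym (da_sym x).
rewrite /kappa powRN -ler_pdivrMl ?invrK ?invr_gt0 ?powR_gt0 ?addr_gt0 ?cuta_gt0//.
rewrite /da -powRM ?normr_ge0 ?addr_ge0 ?powR_ge0//.
rewrite le_powR_alpha ?mulr_ge0 ?normr_ge0 ?addr_ge0 ?powR_ge0//.
have h := Fmap_expand (I01_ge0 _) xy.
have e : Fmap (br true x) - Fmap (br true y) = I01_val x - I01_val y by rewrite !brE; ring.
rewrite e in h.
have d0 : 0 <= I01_val (br true x) - I01_val (br true y) by rewrite subr_ge0.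
rewrite ger0_norm//; apply: le_trans (ler_norm _); apply: le_trans h.
rewrite mulrC ler_wpM2l// lerD2l le_powR_alpha ?(ltW cut_gt0)//.
exact: le_trans (br1_ge y) xy.
Qed.

Definition qa : R := alpha / 4.

Lemma qa_gt0 : 0 < qa. Proof. by rewrite divr_gt0. Qed.

(** By [da_br_expand] the inverse of [da] grows by a definite amount under every inverse branch. The
    increment [qa = alpha / 4] is half of the coefficient there; the other half pays for the second
    order error. *)
Lemma da_br_decay i (x y : T) (z : R) : 1 <= z ->
  da x y <= z^-1 -> da (br i x) (br i y) <= (z + qa)^-1.
Proof.
move=> z1 h; have h2 := da_br_expand i x y.
set e := da _ _ in h2 *; rewrite leNgt; apply/negP => he.
have q0 := qa_gt0.
have zq : 0 < z + qa by lra.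
set w := (z + qa)^-1 in he.
have w0 : 0 < w by rewrite invr_gt0.
have wE : w * (z + qa) = 1 by rewrite mulVf// gt_eqF.
have h3 : z^-1 < w * (1 + alpha / 2 * w).
  rewrite -(ltr_pM2r (lt_le_trans ltr01 z1)) mulVf ?(gt_eqF (lt_le_trans ltr01 z1))//.
  have -> : w * (1 + alpha / 2 * w) * z = w * z + (2 * qa) * w * (w * z).
    by rewrite /qa; field.
  have -> : w * z = 1 - w * qa by lra.
  have qq : qa <= 4^-1 by rewrite /qa; lra'.
  have w1 : w <= 1 by rewrite invf_le1; lra.
  have w2 : 0 < w * qa by rewrite mulr_gt0.
  have w3 : w * qa <= 4^-1 by nra.
  have -> : 2 * qa * w = 2 * (w * qa) by ring.
  by set v := w * qa in w2 w3 *; nra.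
have : w * (1 + alpha / 2 * w) < e * (1 + alpha / 2 * e); last by lra.
have he2 : w * w < e * e by nra.
by have := a0; nra.
Qed.

Fixpoint brw (w : seq bool) (x : T) : T :=
  if w is i :: w' then br i (brw w' x) else x.

Lemma da_brw w (x y : T) : da (brw w x) (brw w y) <= (1 + qa * (size w)%:R)^-1.
Proof.
elim: w => [|i w IH] /=; first by rewrite mulr0 addr0 invr1 da_le1.
rewrite -natr1 mulrDr mulr1 addrA; apply: da_br_decay => //.
by rewrite lerDl mulr_ge0// ltW// qa_gt0.
Qed.

Local Notation b0 := (br false).

Lemma iter_br0 k x : iter k b0 x = brw (nseq k false) x.
Proof. by elim: k => //= k ->. Qed.

Lemma iter_br0_0 k : iter k b0 (I01_0 R) = I01_0 R.
Proof. by elim: k => //= k ->; exact: br0_0. Qed.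

Lemma iter_br0_upper k (x : T) :
  I01_val (iter k b0 x) `^ alpha <= (1 + qa * k%:R)^-1.
Proof.
have := da_brw (nseq k false) x (I01_0 R).
by rewrite -!iter_br0 iter_br0_0 size_nseq /da subr0 ger0_norm.
Qed.

Lemma da0E (x : T) : da x (I01_0 R) = I01_val x `^ alpha.
Proof. by rewrite /da subr0 ger0_norm. Qed.

Lemma br0_powR (x : T) : I01_val x `^ alpha =
  I01_val (b0 x) `^ alpha * (1 + I01_val (b0 x) `^ alpha) `^ alpha.
Proof.
have := brE false x; rewrite /= addr0 => <-; rewrite /Fmap powRM//.
by rewrite addr_ge0// powR_ge0.
Qed.

(** Converse to [iter_br0_upper]: by [powR1D_le] the inverse of [x^alpha] grows by at most 1 at each
    neutral step. *)
Lemma iter_br0_lower k (x : T) (z : R) : 1 <= z ->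
  z^-1 <= I01_val x `^ alpha ->
  (z + k%:R)^-1 <= I01_val (iter k b0 x) `^ alpha.
Proof.
move=> z1 h; elim: k => [|k IH] /=; first by rewrite addr0.
rewrite br0_powR in IH; set e := I01_val (b0 _) `^ alpha in IH *.
have e0 : 0 <= e by exact: powR_ge0.
have h1 : (1 + e) `^ alpha <= 1 + e by exact: powR1D_le.
rewrite -natr1 addrA; set y := z + k%:R in IH *.
have y1 : 1 <= y by rewrite /y (le_trans z1)// lerDl.
have h2 : y^-1 <= e * (1 + e) by rewrite (le_trans IH)// ler_wpM2l.
rewrite leNgt; apply/negP => he.
have : e * (1 + e) < y^-1; last by lra.
set w := (y + 1)^-1 in he.
have w0 : 0 < w by rewrite invr_gt0; lra.
have wE : w * (y + 1) = 1 by rewrite mulVf// gt_eqF//; lra.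
rewrite -(ltr_pM2r (_ : 0 < y)) ?mulVf ?gt_eqF//; try lra.
have w1 : w <= 1 by rewrite invf_le1; lra.
have -> : e * (1 + e) * y = (e * y) * (1 + e) by ring.
have : e * y < 1 - w by nra.
have : 0 <= e * y by rewrite mulr_ge0//; lra.
by nra.
Qed.

(** Write y' for [b0 y]. [Fmap] stretches distances by [1 + (1 + alpha) y'^alpha] but y' itself only
    by [1 + y'^alpha], so the distance relative to the lower point contracts by
    [1 + alpha / 2 * y'^alpha]. After raising to the power alpha, the ratio of [da] to [y^alpha]
    drops by a multiple of the next [da], and the distances can be telescoped. *)
Lemma dist_powR_ratio (x y : T) : 0 < I01_val y -> I01_val y <= I01_val x ->
  (alpha ^+ 2 / 4) * da (b0 x) (b0 y) <=
    da x y / I01_val y `^ alpha - da (b0 x) (b0 y) / I01_val (b0 y) `^ alpha.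
Proof.
move=> y0 yx.
have y'0 := br_gt0 false y0.
have b01 : b0 y <= b0 x :> R by rewrite -Fmap_le// !brE/= !addr0.
have h := Fmap_expand_low (I01_ge0 _) b01; rewrite !brE /= !addr0 in h.
have pE : 0 <= I01_val (b0 y) `^ alpha <= 1 by exact: powR_I01.
have p0 : 0 < b0 y `^ alpha by exact: powR_gt0.
have yE : I01_val y = I01_val (b0 y) * (1 + I01_val (b0 y) `^ alpha).
  by have := brE false y; rewrite /= addr0 => <-.
set p := I01_val (b0 y) `^ alpha in h pE p0 yE *.
set D := I01_val (b0 x) - I01_val (b0 y) in h.
have D0 : 0 <= D by rewrite subr_ge0.
set y' := I01_val (b0 y) in y'0 yE *.
have h1 : (D / y') * (1 + alpha / 2 * p) <= (I01_val x - I01_val y) / I01_val y.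
  rewrite ler_pdivlMr// {1}yE; apply: le_trans h.
  have -> : D / y' * (1 + alpha / 2 * p) * (y' * (1 + p)) =
    D * ((1 + alpha / 2 * p) * (1 + p)) by field; rewrite gt_eqF.
  rewrite ler_wpM2l//; have /andP[_ p1] := pE.
  have := mulr_ge0 (mulr_ge0 (ltW a0) (ltW p0)) (_ : 0 <= 1 - p); rewrite subr_ge0 => /(_ p1); lra.
have q0 : 0 <= D / y' by rewrite divr_ge0// ltW.
have h2 : (D / y') `^ alpha * (1 + (alpha ^+ 2 / 4) * p) <= da x y / I01_val y `^ alpha.
  have -> : da x y / I01_val y `^ alpha = ((I01_val x - I01_val y) / I01_val y) `^ alpha.
    rewrite /da ger0_norm ?subr_ge0// powRM ?subr_ge0 ?invr_ge0//.
    by rewrite -(powR_inv1 (I01_ge0 y)) powRAC powR_inv1// powR_ge0.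
  apply: le_trans (_ : ((D / y') * (1 + alpha / 2 * p)) `^ alpha <= _); last first.
    rewrite le_powR_alpha// mulr_ge0// addr_ge0// !mulr_ge0// ?(ltW p0)//.
    exact: ltW.
  have t0 : 0 <= alpha / 2 * p by rewrite !mulr_ge0// ?(ltW p0)// ltW.
  have t2 : 0 <= 1 + alpha / 2 * p by rewrite addr_ge0.
  rewrite (powRM _ q0 t2).
  rewrite ler_wpM2l ?powR_ge0//.
  have /andP[_ p1] := pE.
  have t1 : alpha / 2 * p <= 1 by nra'.
  apply: le_trans (powR1D_ge a01 _); last by rewrite t0.
  by rewrite lerD2l expr2; lra.
have e3 : (D / y') `^ alpha = da (b0 x) (b0 y) / p.
  rewrite /da ger0_norm// powRM ?invr_ge0 ?(ltW y'0)//.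
  by rewrite -(powR_inv1 (ltW y'0)) powRAC powR_inv1// powR_ge0.
rewrite e3 in h2; rewrite lerBrDr; apply: le_trans h2.
have -> : da (b0 x) (b0 y) / p * (1 + alpha ^+ 2 / 4 * p) =
  alpha ^+ 2 / 4 * da (b0 x) (b0 y) + da (b0 x) (b0 y) / p.
  by field; rewrite gt_eqF.
by [].
Qed.

Lemma sum_da_br0_ratio k (x y : T) : 0 < I01_val y -> I01_val y <= I01_val x ->
  \sum_(j < k) alpha ^+ 2 / 4 * da (iter j.+1 b0 x) (iter j.+1 b0 y) <=
  da x y / I01_val y `^ alpha.
Proof.
elim: k x y => [|k IH] x y y0 yx.
  by rewrite big_ord0 divr_ge0 ?da_ge0 ?powR_ge0.
rewrite big_ord_recl /=.
have b01 : I01_val (b0 y) <= I01_val (b0 x) by rewrite -Fmap_le// !brE/= !addr0.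
have := IH _ _ (br_gt0 false y0) b01.
rewrite (eq_bigr (fun j : 'I_k => alpha ^+ 2 / 4 *
    da (iter j.+2 b0 x) (iter j.+2 b0 y))) => [|j _]; last by rewrite -!iterSr.
by have := dist_powR_ratio y0 yx; lra.
Qed.

Definition CD : R := (alpha ^+ 2 / 4 * cutp `^ alpha)^-1.

Lemma CD_gt0 : 0 < CD.
Proof. by rewrite invr_gt0 !mulr_gt0 ?cuta_gt0 ?exprn_gt0. Qed.

(** Bounded distortion of the neutral branch, uniform in [k]: the telescoped sum is at most the
    initial ratio, whose denominator is bounded below on [[cutp, 1]]. *)
Lemma sum_da_br0 k (x y : T) : cutp <= I01_val x -> cutp <= I01_val y ->
  \sum_(j < k) da (iter j.+1 b0 x) (iter j.+1 b0 y) <= CD * da x y.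
Proof.
wlog yx : x y / I01_val y <= I01_val x => [hw cx cy|cx cy].
  have [/hw|/ltW/hw] := leP (I01_val y) (I01_val x); first exact.
  by under eq_bigr do rewrite da_sym; rewrite da_sym; exact.
have y0 : 0 < I01_val y by exact: lt_le_trans cut_gt0 cy.
have h := sum_da_br0_ratio k y0 yx; rewrite -big_distrr/= in h.
have a2 : 0 < alpha ^+ 2 / 4 by rewrite divr_gt0 ?exprn_gt0.
have -> : CD * da x y = (alpha ^+ 2 / 4)^-1 * ((cutp `^ alpha)^-1 * da x y).
  by rewrite /CD invfM mulrA.
rewrite ler_pdivlMl// mulrC.
rewrite mulrC [leRHS]mulrC; apply: le_trans h _; rewrite ler_wpM2l ?da_ge0//.
by rewrite lef_pV2 ?posrE ?cuta_gt0 ?powR_gt0// le_powR_alpha// ltW// cut_gt0.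
Qed.

End branches.

(** * The transfer operator *)

Section real_facts.
Variable R : realType.

Lemma sum_geometric_le (r : R) n : 0 <= r < 1 -> \sum_(k < n) r ^+ k <= (1 - r)^-1.
Proof.
move=> /andP[r0 r1]; have r10 : 0 < 1 - r by rewrite subr_gt0.
suff -> : \sum_(k < n) r ^+ k = (1 - r ^+ n) / (1 - r).
  by rewrite -[leRHS]mul1r ler_wpM2r ?invr_ge0 ?(ltW r10)// lerBlDr lerDl exprn_ge0.
elim: n => [|n IH]; first by rewrite big_ord0 expr0 subrr mul0r.
by rewrite big_ord_recr/= IH exprS; field; rewrite gt_eqF.
Qed.

Lemma expr_small (r e : R) : 0 <= r < 1 -> 0 < e -> exists n, r ^+ n <= e.
Proof.
move=> /andP[r0 r1] e0; have := @cvg_expr R r; rewrite ger0_norm// => /(_ r1).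
move=> /(@cvgrPdist_lt _ R^o) /(_ e e0)[N _ /(_ N (leqnn _))].
by rewrite sub0r normrN ger0_norm ?exprn_ge0// => /ltW ?; exists N.
Qed.

Lemma fmap_ultra (X Y : Type) (U : set_system X) (UU : UltraFilter U) (u : X -> Y) :
  UltraFilter (u @ U).
Proof.
split; first exact: fmap_proper_filter.
move=> G PG sG; apply/seteqP; split => A; last exact: sG.
move=> GA; have [//|nA] := in_ultra_setVsetC (u @^-1` A) UU.
have /filter_ex[y [? ?]] : G (A `&` ~` A) by apply: filterI => //; exact: sG.
by [].
Qed.

Lemma bounded_cvg_ultra (U : set_system nat) (UU : UltraFilter U) (u : nat -> R) (M : R) :
  (forall n, `|u n| <= M) -> cvg (u n @[n --> U]).
Proof.
move=> uM; have := @segment_compact R (- M) M; rewrite compact_ultra => /(_ (u @ U)).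
case=> [||p [_ up]]; last by apply/cvg_ex; exists p.
  exact: fmap_ultra.
apply: (@filterS _ U _ setT) => [n _|]; last exact: filterT.
by rewrite /= in_itv/= -ler_norml.
Qed.

(** Along such an ultrafilter the values of a uniformly bounded sequence of functions converge at
    all points at once, and ordinary limits are kept; no subsequence has to be extracted. *)
Lemma ultra_infty : exists U : set_system nat, UltraFilter U /\
  forall (u : nat -> R) (l : R), u n @[n --> \oo] --> l -> u n @[n --> U] --> l.
Proof.
have [U [UU sU]] := @ultraFilterLemma nat \oo _.
exists U; split => // u l ul.
by apply: cvg_trans ul; apply: cvg_app => A /sU.
Qed.

End real_facts.

Section transfer_operator.
Variables (R : realType) (alpha : R).
Local Notation T := (I01 R).
Local Notation br := (br alpha).
Local Notation b0 := (br false).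

Definition hol (B : R) (h : T -> R) := forall x y : T, `|h x - h y| <= B * da alpha x y.

Definition brop (phi : T -> R) (i : bool) (h : T -> R) : T -> R :=
  fun x => expR (phi (br i x)) * h (br i x).

(** Ruelle transfer operator, extended continuously to 0: there the sum keeps the point [cutp]
    although [f] maps it to 1, so that Hoelder functions remain Hoelder. *)
Definition tr (phi : T -> R) (h : T -> R) : T -> R :=
  fun x => brop phi false h x + brop phi true h x.

Variable phi : T -> R.
Local Notation L0 := (brop phi false).
Local Notation L1 := (brop phi true).
Local Notation L := (tr phi).
Local Notation one := (fun=> 1 : R).

Lemma brop_le i h h' : (forall x, h x <= h' x) -> forall x, brop phi i h x <= brop phi i h' x.
Proof. by move=> hh x; rewrite ler_wpM2l ?expR_ge0. Qed.

Lemma brop_ge0 i h : (forall x, 0 <= h x) -> forall x, 0 <= brop phi i h x.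
Proof. by move=> hh x; rewrite mulr_ge0 ?expR_ge0. Qed.

Lemma tr_le h h' : (forall x, h x <= h' x) -> forall x, L h x <= L h' x.
Proof. by move=> hh x; rewrite lerD// brop_le. Qed.

Lemma iter_tr_le n h h' : (forall x, h x <= h' x) ->
  forall x, iter n L h x <= iter n L h' x.
Proof. by move=> hh; elim: n => //= n IH x; exact: tr_le. Qed.

Lemma iter_tr_ge0 n h : (forall x, 0 <= h x) -> forall x, 0 <= iter n L h x.
Proof. by move=> hh; elim: n => //= n IH x; rewrite addr_ge0// brop_ge0. Qed.

Lemma iter_brop0_ge0 k h : (forall x, 0 <= h x) -> forall x, 0 <= iter k L0 h x.
Proof. by move=> hh; elim: k => //= k IH x; exact: brop_ge0. Qed.

Lemma tr_scale a h x : L (fun z => a * h z) x = a * L h x.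
Proof. by rewrite /tr /brop; ring. Qed.

Lemma iter_tr_scale n a h x : iter n L (fun z => a * h z) x = a * iter n L h x.
Proof.
elim: n x => //= n IH x; rewrite -tr_scale; congr (L _ x); exact: funext.
Qed.

Lemma tr_gt0 h : (forall x, 0 < h x) -> forall x, 0 < L h x.
Proof. by move=> hh x; rewrite addr_gt0// mulr_gt0// expR_gt0. Qed.

Definition nsum k (x : T) : R := \sum_(j < k) phi (iter j.+1 b0 x).

Lemma nsumS k x : nsum k.+1 x = phi (b0 x) + nsum k (b0 x).
Proof.
rewrite /nsum big_ord_recl; congr (_ + _); apply: eq_bigr => j _.
by rewrite -iterSr.
Qed.

Lemma iter_brop0 k u x : iter k L0 u x = expR (nsum k x) * u (iter k b0 x).
Proof.
elim: k x => [|k IH] x; first by rewrite /nsum big_ord0 expR0 mul1r.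
by rewrite iterS /brop -/(brop _ _) IH nsumS expRD mulrA iterSr.
Qed.

Lemma brop_sum i n (F : 'I_n -> T -> R) x :
  brop phi i (fun z => \sum_(k < n) F k z) x = \sum_(k < n) brop phi i (F k) x.
Proof. by rewrite /brop mulr_sumr. Qed.

Lemma tr_sum n (F : 'I_n -> T -> R) x :
  L (fun z => \sum_(k < n) F k z) x = \sum_(k < n) L (F k) x.
Proof. by rewrite /tr !brop_sum big_split. Qed.

(* Sorting the words by the length k of their final run in the neutral branch. *)
Lemma iter_tr_decomp n h x : iter n L h x = iter n L0 h x +
  \sum_(k < n) iter k L0 (L1 (iter (n - k.+1) L h)) x.
Proof.
elim: n x => [|n IH] x; first by rewrite big_ord0 addr0.
rewrite big_ord_recl/= subSS subn0 {1}/tr.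
have -> : L0 (iter n L h) x = L0 (iter n L0 h) x +
    \sum_(k < n) L0 (iter k L0 (L1 (iter (n - k.+1) L h))) x.
  by rewrite {1}/brop IH mulrDr mulr_sumr.
by rewrite -addrA [X in _ + X]addrC.
Qed.

Definition insup (s : R) : Prop :=
  0 < s /\ exists C, forall n x, iter n L one x <= C * s ^+ n.

Lemma insup_le s s' : insup s -> s <= s' -> insup s'.
Proof.
move=> [s0 [C hC]] ss; split; first exact: lt_le_trans ss.
exists `|C| => n x; apply: le_trans (hC n x) _.
apply: le_trans (_ : `|C| * s ^+ n <= _).
  by rewrite ler_wpM2r ?exprn_ge0 ?ler_norm// ltW.
by rewrite ler_wpM2l// lerXn2r// nnegrE ltW// (lt_le_trans s0).
Qed.

Lemma insup_subinvariant s h c M : 0 < c -> (forall x, c <= h x <= M) ->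
  (forall x, L h x <= s * h x) -> insup s.
Proof.
move=> c0 hh hs.
have h0 x : 0 < h x by apply: lt_le_trans c0 _; case/andP: (hh x).
have s0 : 0 < s.
  have := lt_le_trans (tr_gt0 h0 (I01_0 R)) (hs _).
  by rewrite pmulr_lgt0// h0.
have hn n x : iter n L h x <= s ^+ n * h x.
  elim: n x => [|n IH] x /=; first by rewrite expr0 mul1r.
  apply: le_trans (tr_le IH x) _; rewrite tr_scale exprSr -mulrA ler_wpM2l//.
  by rewrite exprn_ge0// ltW.
split=> //; exists (c^-1 * M) => n x.
have : iter n L (fun z => c * one z) x <= iter n L h x.
  by apply: iter_tr_le => z; rewrite mulr1; case/andP: (hh z).
rewrite iter_tr_scale -ler_pdivlMl// => /le_trans; apply.
rewrite -mulrA ler_wpM2l ?invr_ge0 ?(ltW c0)//; apply: le_trans (hn n x) _.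
by rewrite mulrC ler_wpM2r ?exprn_ge0 ?(ltW s0)//; case/andP: (hh x).
Qed.

End transfer_operator.

(** * A cone of functions with bounded distortion on [[cutp, 1]] *)

Section cone.
Variables (R : realType) (alpha : R).
Hypothesis a01 : 0 < alpha <= 1.
Local Notation T := (I01 R).
Local Notation br := (br alpha).
Local Notation b0 := (br false).
Local Notation da := (da alpha).
Local Notation one := (fun=> 1 : R).
Variables (phi : T -> R) (H : R).
Hypothesis H0 : 0 <= H.
Hypothesis phi_hol : hol alpha H phi.
Local Notation L0 := (brop alpha phi false).
Local Notation L1 := (brop alpha phi true).
Local Notation L := (tr alpha phi).
Local Notation x0 := (I01_0 R).
Local Notation x1 := (I01_1 R).
Local Notation nsum := (nsum alpha phi).

Definition inJ (x : T) := cutp alpha <= I01_val x.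

Lemma inJ_br1 x : inJ (br true x). Proof. exact: br1_ge. Qed.

Lemma inJ1 : inJ x1. Proof. exact: I01_le1. Qed.

Lemma phi_le x : phi x <= phi x0 + H.
Proof.
have /ler_normlP[_] := phi_hol x x0.
have : H * da x x0 <= H by rewrite ler_piMr// da_le1.
lra.
Qed.

Lemma phi_ge x : phi x0 - H <= phi x.
Proof.
have /ler_normlP[] := phi_hol x x0.
have : H * da x x0 <= H by rewrite ler_piMr// da_le1.
lra.
Qed.

Lemma expR_phi_le x : expR (phi x) <= expR (phi x0 + H).
Proof. by rewrite ler_expR phi_le. Qed.

(** Along the neutral branch [phi - phi x0] is at most [H / (1 + q j)] at the step [j], hence at
    most [d] beyond the index [N]. Each earlier term costs at most [H], which yields a constant
    independent of [k] and [x]. *)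
Lemma nsum_le (d : R) : 0 < d -> exists j0 : R, 0 <= j0 /\
  forall k x, nsum k x <= k%:R * (phi x0 + d) + j0.
Proof.
move=> d0; pose q := qa alpha; have q0 : 0 < q by exact: qa_gt0.
pose N := (Num.truncn (H / (q * d))).+1.
have hN : H <= d * (q * N%:R).
  have : H / (q * d) <= N%:R by rewrite ltW// truncnS_gt.
  have qd : 0 < q * d by rewrite mulr_gt0.
  by rewrite ler_pdivrMr// => /le_trans; apply; have -> : N%:R * (q * d) = d * (q * N%:R) by ring.
exists (H * N%:R); split; first by rewrite mulr_ge0.
move=> k x.
suff : nsum k x <= k%:R * (phi x0 + d) + H * (minn k N)%:R.
  move=> /le_trans; apply; rewrite lerD2l ler_wpM2l// ler_nat geq_minr//.
elim: k => [|k IH]; first by rewrite /nsum big_ord0 min0n !mul0r mulr0 addr0.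
set y := iter k.+1 b0 x.
have -> : nsum k.+1 x = nsum k x + phi y by rewrite /nsum big_ord_recr.
have h1 : phi y <= phi x0 + H * (1 + q * k.+1%:R)^-1.
  have /ler_normlP[_] := phi_hol y x0; rewrite da0E.
  have := ler_wpM2l H0 (iter_br0_upper a01 k.+1 x); rewrite -/y -/q; lra.
have m : (minn k.+1 N = minn k N + (k < N))%N.
  case: (ltnP k N) => kN; first by rewrite (minn_idPl kN) addn1.
  by rewrite (minn_idPr (leqW kN)) addn0.
rewrite m natrD -natr1.
have [kN|Nk] := ltnP k N.
  have : H * (1 + q * k.+1%:R)^-1 <= H.
    have qk : 0 <= q * k.+1%:R by rewrite mulr_ge0// ltW.
    by rewrite ler_piMr// invf_le1 ?lerDl// ltr_pwDl.
  by rewrite /= mulr1n; move: IH; rewrite (minn_idPl (ltnW kN)); lra.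
have : H * (1 + q * k.+1%:R)^-1 <= d.
  rewrite ler_pdivrMr; last by rewrite addr_gt0// mulr_gt0.
  apply: le_trans hN _; rewrite ler_wpM2l ?(ltW d0)//.
  apply: le_trans (_ : q * k.+1%:R <= _); last by rewrite lerDr.
  by rewrite ler_wpM2l ?(ltW q0)// ler_nat ltnW.
by rewrite /= mulr0n; move: IH; rewrite (minn_idPr Nk); lra.
Qed.

(** Half of the gap between [ln s] and [phi x0] controls the neutral sums, the other half absorbs
    the factor [k.+1]. That factor is kept for [eigenfunction], where the variation of [nsum k]
    costs a factor [k]. *)
Lemma neutral_growth (s : R) : expR (phi x0) < s -> exists C, 0 < C /\
  forall k x, k.+1%:R * expR (nsum k x) <= C * s ^+ k.
Proof.
move=> Es; have s0 : 0 < s by apply: lt_trans Es; exact: expR_gt0.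
pose d := (ln s - phi x0) / 2.
have d0 : 0 < d by rewrite divr_gt0// subr_gt0 -[phi x0]expRK ltr_ln ?posrE ?expR_gt0.
have [j0 [j00 hj]] := nsum_le d0.
have Di : 0 < 1 + d^-1 by rewrite addr_gt0// invr_gt0.
exists ((1 + d^-1) * expR j0); split; first by rewrite mulr_gt0 ?expR_gt0.
move=> k x.
have h1 : k.+1%:R <= (1 + d^-1) * expR (k%:R * d).
  apply: le_trans (_ : (1 + d^-1) * (1 + k%:R * d) <= _); last first.
    by rewrite ler_wpM2l ?(ltW Di)// expR_ge1Dx.
  have -> : (1 + d^-1) * (1 + k%:R * d) = k.+1%:R + d^-1 + k%:R * d.
    by rewrite -natr1; field; rewrite gt_eqF.
  have : 0 <= d^-1 by rewrite invr_ge0 ltW.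
  have : 0 <= k%:R * d by rewrite mulr_ge0// ltW.
  lra.
have h2 : expR (nsum k x) <= expR (k%:R * (phi x0 + d)) * expR j0.
  by rewrite -expRD ler_expR.
have -> : s ^+ k = expR (k%:R * d) * expR (k%:R * (phi x0 + d)).
  rewrite -expRD -mulrDr expRM_natl.
  by have -> : d + (phi x0 + d) = ln s; [rewrite /d; field|rewrite lnK].
apply: le_trans (ler_pM _ _ h1 h2) _; rewrite ?expR_ge0//.
have -> : (1 + d^-1) * expR (k%:R * d) * (expR (k%:R * (phi x0 + d)) * expR j0) =
  (1 + d^-1) * expR j0 * (expR (k%:R * d) * expR (k%:R * (phi x0 + d))) by ring.
by [].
Qed.

Lemma nsum_dist k x y : inJ x -> inJ y ->
  `|nsum k x - nsum k y| <= H * CD alpha * da x y.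
Proof.
move=> Jx Jy; rewrite /nsum -sumrB; apply: le_trans (ler_norm_sum _ _ _) _.
rewrite -mulrA; apply: le_trans (ler_wpM2l H0 (sum_da_br0 a01 k Jx Jy)).
by rewrite mulr_sumr; apply: ler_sum => j _; exact: phi_hol.
Qed.

Definition KJ (D : R) (h : T -> R) :=
  forall x y, inJ x -> inJ y -> h x <= expR (D * da x y) * h y.

(** Fixed point of D = H (CD + 1) + kappa D: [H * CD] is the distortion of a neutral run, [H] that
    of one passage through the right branch, and [kappa * D] what the function inherits after that
    passage. *)
Definition Dcone : R := H * (CD alpha + 1) / (1 - kappa alpha).

Let k1 : 0 < 1 - kappa alpha. Proof. by rewrite subr_gt0 kappa_lt1. Qed.

Lemma Dcone_ge0 : 0 <= Dcone.
Proof. by rewrite divr_ge0 ?(ltW k1)// mulr_ge0// addr_ge0// ltW// CD_gt0. Qed.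

Lemma DconeE : H * (CD alpha + 1) + kappa alpha * Dcone = Dcone.
Proof. by rewrite /Dcone; field; rewrite gt_eqF. Qed.

(** Distortion of [h] on J alone is not stable, because [L0] brings to J the values of [h] off J.
    Imposing it on all [iter k L0 h] is stable: [L0^k (L h)] is [L0^(k+1) h] plus [L0^k (L1 h)], and
    the last term reads [h] on J only. *)
Definition incone (h : T -> R) :=
  (forall x, 0 <= h x) /\ forall k, KJ Dcone (iter k L0 h).

Lemma incone_KJ h : incone h -> KJ Dcone h. Proof. by move=> [_ /(_ 0%N)]. Qed.

Lemma incone1 : incone one.
Proof.
split=> // k x y Jx Jy; rewrite !iter_brop0 !mulr1 -expRD ler_expR.
have /ler_normlP[_ h] := nsum_dist k Jx Jy.
have : H * CD alpha * da x y <= Dcone * da x y.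
  rewrite ler_wpM2r ?da_ge0// -DconeE.
  have h1 : 0 <= kappa alpha * Dcone.
    by rewrite mulr_ge0 ?Dcone_ge0// ltW// kappa_gt0.
  have := H0; lra.
lra.
Qed.

Lemma incone_tr h : incone h -> incone (L h).
Proof.
move=> hh; have [h0 hk] := hh; split.
  by move=> x; rewrite addr_ge0// brop_ge0.
move=> k x y Jx Jy.
have e z : iter k L0 (L h) z = iter k.+1 L0 h z + iter k L0 (L1 h) z.
  by rewrite iterSr !iter_brop0 /tr mulrDr.
rewrite !e mulrDr lerD ?hk// !iter_brop0 /brop.
set x' := iter k b0 x; set y' := iter k b0 y.
have dxy : da x' y' <= da x y.
  by rewrite /x' /y' !iter_br0; elim: (nseq k false) => //= i w /(le_trans (da_br_le a01 _ _ _)).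
have h1 := incone_KJ hh (inJ_br1 x') (inJ_br1 y').
have /ler_normlP[_ h2] := nsum_dist k Jx Jy.
have /ler_normlP[_ h3] := phi_hol (br true x') (br true y').
have h4 := da_br1 a01 x' y'.
rewrite mulrA -expRD; apply: le_trans (ler_wpM2l (expR_ge0 _) h1) _.
rewrite !mulrA -!expRD ler_wpM2r// ler_expR.
have h5 : H * da (br true x') (br true y') <= H * da x y.
  by rewrite ler_wpM2l// (le_trans (da_br_le a01 _ _ _)).
have h6 : Dcone * da (br true x') (br true y') <= Dcone * (kappa alpha * da x y).
  rewrite ler_wpM2l ?Dcone_ge0// (le_trans h4)// ler_wpM2l// ltW//.
  exact: kappa_gt0.
have -> : Dcone * da x y =
    H * CD alpha * da x y + H * da x y + Dcone * (kappa alpha * da x y).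
  by rewrite -{1}DconeE; ring.
lra.
Qed.

Lemma incone_iter n : incone (iter n L one).
Proof. by elim: n => [|n IH]; [exact: incone1|exact: incone_tr]. Qed.

Lemma KJ_sum D n (w : 'I_n -> R) (F : 'I_n -> T -> R) :
  (forall i, 0 <= w i) -> (forall i, KJ D (F i)) -> KJ D (fun x => \sum_(i < n) w i * F i x).
Proof.
move=> w0 hF x y Jx Jy; rewrite mulr_sumr; apply: ler_sum => i _.
by rewrite mulrCA ler_wpM2l// hF.
Qed.

Lemma KJ_le D h x y : 0 <= D -> (forall z, 0 <= h z) -> KJ D h -> inJ x -> inJ y ->
  h x <= expR D * h y.
Proof.
move=> D0 h0 hK Jx Jy; apply: le_trans (hK _ _ Jx Jy) _.
by rewrite ler_wpM2r// ler_expR ler_piMr// da_le1.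
Qed.

End cone.

Lemma cvg_sum_ord (R : realType) (X : Type) (U : set_system X) (FU : Filter U) n
    (F : 'I_n -> X -> R) (l : 'I_n -> R) :
  (forall k, F k m @[m --> U] --> l k) ->
  \sum_(k < n) F k m @[m --> U] --> \sum_(k < n) l k.
Proof.
elim: n F l => [|n IH] F l h.
  by under eq_fun do rewrite big_ord0; rewrite big_ord0; exact: cvg_cst.
under eq_fun do rewrite big_ord_recl; rewrite big_ord_recl.
by apply: cvgD; [exact: h|apply: IH => k; exact: h].
Qed.

(** * Growth rate and eigenfunctions *)

Section growth.
Variables (R : realType) (alpha : R).
Hypothesis a01 : 0 < alpha <= 1.
Local Notation T := (I01 R).
Local Notation br := (br alpha).
Local Notation b0 := (br false).
Local Notation da := (da alpha).
Local Notation one := (fun=> 1 : R).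
Variables (phi : T -> R) (H : R).
Hypothesis H0 : 0 <= H.
Hypothesis phi_hol : hol alpha H phi.
Local Notation L0 := (brop alpha phi false).
Local Notation L1 := (brop alpha phi true).
Local Notation L := (tr alpha phi).
Local Notation x0 := (I01_0 R).
Local Notation x1 := (I01_1 R).
Local Notation nsum := (nsum alpha phi).
Local Notation insup := (insup alpha phi).
Local Notation inJ := (inJ alpha).
Local Notation E := (expR (phi x0)).
Local Notation KJ := (KJ alpha).
Local Notation D := (Dcone alpha H).

Let b1J x : inJ (br true x). Proof. exact: inJ_br1. Qed.

Lemma brop1_le_J (h : T -> R) (M : R) : 0 <= M -> (forall x, inJ x -> h x <= M) ->
  forall x, L1 h x <= expR (phi x0 + H) * M.
Proof.
move=> M0 hM x; rewrite /brop; apply: le_trans (ler_wpM2l (expR_ge0 _) (hM _ (b1J x))) _.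
by rewrite ler_wpM2r// (expR_phi_le a01 H0 phi_hol).
Qed.

(* Subinvariance on J of the induced operator sum_k s^(-k-1) L0^k L1. *)
Lemma insup_induced (s eta c M : R) (v : T -> R) : E < s -> 0 < eta -> 0 < c ->
  (forall x, inJ x -> c <= v x <= M) ->
  (forall n x, inJ x ->
    \sum_(k < n) s ^- k.+1 * iter k L0 (L1 v) x <= (1 - eta) * v x) ->
  insup s.
Proof.
move=> Es eta0 c0 hv hs.
have s0 : 0 < s by apply: lt_trans Es; exact: expR_gt0.
(* An intermediate rate turns the neutral contributions into a geometric series of ratio
   [s' / s]. *)
have [s' Es' ss'] : exists2 s', E < s' & s' < s.
  by exists ((E + s) / 2); lra.
have s'0 : 0 < s' by apply: lt_trans Es'; exact: expR_gt0.
have [C [C0 hC]] := neutral_growth a01 H0 phi_hol Es'.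
have hC1 k x : expR (nsum k x) <= C * s' ^+ k.
  by apply: le_trans (hC k x); rewrite ler_peMl ?expR_ge0// ler1n.
have M0 : 0 <= M.
  by have /andP[? ?] := hv _ (inJ1 alpha); apply: le_trans (ltW c0) _; lra.
(* Chosen so that the spare share [eta * v] absorbs the purely neutral term of [iter_tr_decomp],
   which is at most [C * s ^+ n]. *)
pose K := C / (eta * c).
have ec : 0 < eta * c by rewrite mulr_gt0.
have K0 : 0 < K by rewrite divr_gt0.
have claim1 n x : inJ x -> iter n L one x <= K * s ^+ n * v x.
  elim/ltn_ind: n x => n IH x Jx; rewrite iter_tr_decomp.
  have h1 : iter n L0 one x <= K * s ^+ n * (eta * v x).
    rewrite iter_brop0 mulr1; apply: le_trans (hC1 n x) _.
    apply: le_trans (_ : C * s ^+ n <= _).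
      by rewrite ler_wpM2l ?(ltW C0)// lerXn2r ?nnegrE// ltW.
    have -> : K * s ^+ n * (eta * v x) = (K * (eta * v x)) * s ^+ n by ring.
    rewrite ler_wpM2r ?exprn_ge0 ?(ltW s0)// /K mulrAC ler_pdivlMr//.
    rewrite ler_wpM2l ?(ltW C0)// ler_wpM2l ?(ltW eta0)//.
    by case/andP: (hv _ Jx).
  have h2 : \sum_(k < n) iter k L0 (L1 (iter (n - k.+1) L one)) x <=
      K * s ^+ n * ((1 - eta) * v x).
    apply: le_trans (ler_wpM2l _ (hs n x Jx)); last first.
      by rewrite mulr_ge0 ?exprn_ge0// ltW.
    rewrite mulr_sumr; apply: ler_sum => k _.
    rewrite !iter_brop0.
    have -> : K * s ^+ n * (s ^- k.+1 * (expR (nsum k x) * L1 v (iter k b0 x))) =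
       expR (nsum k x) * (K * s ^+ (n - k.+1) * L1 v (iter k b0 x)).
      have -> : s ^+ n = s ^+ k.+1 * s ^+ (n - k.+1) by rewrite -exprD subnKC.
      have s1 : s ^+ k.+1 != 0 by rewrite expf_eq0/= gt_eqF.
      by set w := s ^+ k.+1 in s1 *; field.
    rewrite ler_wpM2l ?expR_ge0// /brop.
    set y := br true _; rewrite mulrCA ler_wpM2l ?expR_ge0//.
    by apply: IH; [rewrite ltn_subrL/= (leq_ltn_trans _ (ltn_ord k))|exact: b1J].
  apply: le_trans (lerD h1 h2) _.
  by rewrite -mulrDr; have -> : eta * v x + (1 - eta) * v x = v x by ring.
have r01 : 0 <= s' / s < 1.
  by rewrite divr_ge0 ?(ltW s'0) ?(ltW s0)//= ltr_pdivrMr// mul1r.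
pose B := expR (phi x0 + H) * (K * M).
have B0 : 0 <= B by rewrite mulr_ge0 ?expR_ge0// mulr_ge0// ltW.
split=> //; exists (C + C * B / s * (1 - s' / s)^-1) => n x.
rewrite iter_tr_decomp mulrDl lerD//.
  rewrite iter_brop0 mulr1; apply: le_trans (hC1 n x) _.
  by rewrite ler_wpM2l ?(ltW C0)// lerXn2r ?nnegrE// ltW.
apply: le_trans (_ : \sum_(k < n) C * B / s * s ^+ n * (s' / s) ^+ k <= _); last first.
  rewrite -mulr_sumr [leRHS]mulrAC ler_wpM2l//.
    rewrite mulr_ge0 ?exprn_ge0 ?(ltW s0)// divr_ge0 ?(ltW s0)// mulr_ge0//.
    exact: ltW.
  exact: sum_geometric_le.
apply: ler_sum => k _; rewrite iter_brop0.
have -> : C * B / s * s ^+ n * (s' / s) ^+ k = (C * s' ^+ k) * (B * s ^+ (n - k.+1)).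
  have -> : s ^+ n = s ^+ k.+1 * s ^+ (n - k.+1) by rewrite -exprD subnKC.
  have s1 : s ^+ k != 0 by rewrite expf_eq0 gt_eqF// andbF.
  by rewrite expr_div_n exprS; field; rewrite s1 gt_eqF.
apply: ler_pM; rewrite ?expR_ge0//.
  by apply: brop_ge0 => z; exact: iter_tr_ge0.
have -> : B * s ^+ (n - k.+1) = expR (phi x0 + H) * (K * s ^+ (n - k.+1) * M).
  by rewrite /B; ring.
apply: brop1_le_J.
  by rewrite mulr_ge0// mulr_ge0 ?exprn_ge0 ?(ltW s0) ?(ltW K0).
move=> z Jz; apply: le_trans (claim1 _ _ Jz) _.
rewrite ler_wpM2l ?(mulr_ge0 (ltW K0) (exprn_ge0 _ (ltW s0)))//.
by case/andP: (hv _ Jz).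
Qed.

Lemma insup_big : insup (2 * expR (phi x0 + H)).
Proof.
apply: (@insup_subinvariant _ _ _ _ one 1 1) => // [x|x]; first by rewrite lexx.
rewrite /tr /brop !mulr1.
have := expR_phi_le a01 H0 phi_hol (br false x).
have := expR_phi_le a01 H0 phi_hol (br true x); lra.
Qed.

(* Exponential of the growth rate of the iterates of the transfer operator. *)
Definition lam : R := inf [set s | insup s].

Let lam_lb : lbound [set s | insup s] 0.
Proof. by move=> s [/ltW]. Qed.

Lemma lam_set_nonempty : [set s | insup s] !=set0.
Proof. by exists (2 * expR (phi x0 + H)); exact: insup_big. Qed.

Lemma lam_insup s : lam < s -> insup s.
Proof.
move=> ls; have [t it ts] := inf_lt lam_set_nonempty ls.
exact: insup_le it (ltW ts).
Qed.

Lemma lam_le s : insup s -> lam <= s.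
Proof. by move=> h; apply: ge_inf => //; exists 0. Qed.

(** Truncated Neumann series of the resolvent (s - L)^(-1) applied to the constant 1. The last term
    of [tr_hs] is the truncation error, made uniformly small by [hs_tail] when [s] exceeds [lam]. *)
Definition hs (s : R) N (x : T) : R := \sum_(n < N) s ^- n.+1 * iter n L one x.

Lemma tr_hs s N x : 0 < s ->
  L (hs s N) x = s * hs s N x - 1 + s ^- N * iter N L one x.
Proof.
move=> s0; rewrite /hs tr_sum; elim: N => [|N IH].
  by rewrite !big_ord0 expr0 invr1 mulr1 mulr0/=; ring.
rewrite !big_ord_recr/= IH tr_scale.
rewrite -/(iter N.+1 L one x) exprSr; field.
by rewrite expf_eq0/= gt_eqF//= andbF.
Qed.

Lemma hs_ge0 s N x : 0 < s -> 0 <= hs s N x.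
Proof.
move=> s0; apply: sumr_ge0 => n _; rewrite mulr_ge0 ?invr_ge0 ?exprn_ge0 ?(ltW s0)//.
exact: iter_tr_ge0.
Qed.

Lemma hs_KJ s N : 0 < s -> KJ D (hs s N).
Proof.
move=> s0; apply: KJ_sum => n; first by rewrite invr_ge0 exprn_ge0// ltW.
exact/incone_KJ/(incone_iter a01 H0 phi_hol).
Qed.

Lemma hs_bounded (s : R) N : 0 < s -> exists M : R, forall x, 0 <= hs s N x <= M.
Proof.
move=> s0; have [_ [C hC]] := insup_big.
exists (\sum_(n < N) s ^- n.+1 * (C * (2 * expR (phi x0 + H)) ^+ n)) => x.
rewrite hs_ge0//=; apply: ler_sum => n _.
by rewrite ler_wpM2l// invr_ge0 exprn_ge0// ltW.
Qed.

Lemma hs_tail (s e : R) : lam < s -> 0 < e -> exists N, forall x, s ^- N * iter N L one x <= e.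
Proof.
move=> ls e0; have [t it ts] := inf_lt lam_set_nonempty ls.
have [t0 [C hC]] := it; have s0 := lt_trans t0 ts.
have C0 : 0 < C.
  by have := hC 0%N x0; rewrite expr0 mulr1; exact: lt_le_trans.
have r01 : 0 <= t / s < 1.
  by rewrite divr_ge0 ?(ltW t0) ?(ltW s0)//= ltr_pdivrMr// mul1r.
have [N hN] := expr_small r01 (divr_gt0 e0 C0).
exists N => x; apply: le_trans (ler_wpM2l _ (hC N x)) _.
  by rewrite invr_ge0 exprn_ge0// ltW.
rewrite mulrCA mulrC -ler_pdivlMr//.
by rewrite expr_div_n mulrC in hN.
Qed.

(* The value at 1 controls everything, because off J the neutral branch only
   contributes the geometric series of ratio E / s. *)
Lemma global_bound (l : R) : E < l -> exists B : R, 0 < B /\ forall (s : R) (h : T -> R), l <= s ->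
  (exists M, forall x, 0 <= h x <= M) -> (forall x, s * h x <= L h x + 1) ->
  KJ D h -> forall x, h x <= B * (1 + h x1).
Proof.
move=> El; have [s' Es' s'l] : exists2 s', E < s' & s' < l.
  by exists ((E + l) / 2); lra.
have s'0 : 0 < s' by apply: lt_trans Es'; exact: expR_gt0.
have l0 := lt_trans s'0 s'l.
have [C [C0 hC]] := neutral_growth a01 H0 phi_hol Es'.
have hC1 k x : expR (nsum k x) <= C * s' ^+ k.
  by apply: le_trans (hC k x); rewrite ler_peMl ?expR_ge0// ler1n.
have r01 : 0 <= s' / l < 1.
  by rewrite divr_ge0 ?(ltW s'0) ?(ltW l0)//= ltr_pdivrMr// mul1r.
pose G := expR (phi x0 + H) * expR D + 1.
have G1 : 1 <= G by rewrite lerDr mulr_ge0 ?expR_ge0.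
pose B := 1 + C / l * (1 - s' / l)^-1 * G.
have C1 : 0 < C / l * (1 - s' / l)^-1.
  by rewrite !mulr_gt0 ?invr_gt0 ?subr_gt0//; case/andP: r01.
have B0 : 0 < B by rewrite addr_gt0// mulr_gt0//; lra.
exists B; split=> // s h ls [M hM] hs hK x.
have s0 := lt_le_trans l0 ls.
have h0 z : 0 <= h z by case/andP: (hM z).
have D0 : 0 <= D := Dcone_ge0 a01 H0.
set A := G * (1 + h x1).
have A0 : 0 <= A by rewrite mulr_ge0 ?addr_ge0//; lra.
have hA z : L1 h z + 1 <= A.
  have : L1 h z <= expR (phi x0 + H) * (expR D * h x1).
    apply: brop1_le_J; first by rewrite mulr_ge0 ?expR_ge0.
    by move=> y Jy; apply: KJ_le (inJ1 alpha).
  rewrite /A /G; have := h0 x1; have := mulr_ge0 (expR_ge0 (phi x0 + H)) (expR_ge0 D).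
  by set u := expR _; set w := expR D; nra.
(* The inequality s h <= L0 h + (L1 h + 1) is iterated [k] times along the neutral branch, with [A]
   in place of the bracket. *)
have hk k z : h z <= s ^- k * iter k L0 h z +
    \sum_(j < k) s ^- j.+1 * (C * s' ^+ j * A).
  elim: k z => [|k IH] z; first by rewrite big_ord0 expr0 invr1 mul1r addr0.
  rewrite big_ord_recr/= addrA; apply: le_trans (IH z) _.
  rewrite -/(iter k.+1 L0 h z) addrAC lerD2r.
  have -> : s ^- k.+1 * iter k.+1 L0 h z + s ^- k.+1 * (C * s' ^+ k * A) =
     s ^- k.+1 * (iter k.+1 L0 h z + C * s' ^+ k * A) by rewrite mulrDr.
  rewrite exprS invfM [s^-1 * _]mulrC -[leRHS]mulrA.
  apply: ler_wpM2l; first by rewrite invr_ge0 exprn_ge0// ltW.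
  rewrite ler_pdivlMl// iterSr !iter_brop0.
  set w := iter k b0 z.
  have e : s * (expR (nsum k z) * h w) <= expR (nsum k z) * (L0 h w + A).
    rewrite mulrCA ler_wpM2l ?expR_ge0//; apply: le_trans (hs w) _.
    by rewrite /tr -addrA lerD2l.
  apply: le_trans e _; rewrite mulrDr lerD2l ler_wpM2r//.
have sumle k : \sum_(j < k) s ^- j.+1 * (C * s' ^+ j * A) <= C / l * (1 - s' / l)^-1 * A.
  apply: le_trans (_ : \sum_(j < k) C / l * A * (s' / l) ^+ j <= _); last first.
    rewrite -mulr_sumr [leRHS]mulrAC ler_wpM2l ?sum_geometric_le//.
    by rewrite mulr_ge0// divr_ge0// ltW.
  apply: ler_sum => j _.
  have -> : C / l * A * (s' / l) ^+ j = l ^- j.+1 * (C * s' ^+ j * A).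
    by rewrite expr_div_n exprS; field; rewrite expf_eq0/= gt_eqF//= andbF.
  rewrite ler_wpM2r//.
    by rewrite mulr_ge0// mulr_ge0 ?exprn_ge0// ltW.
  by rewrite lef_pV2 ?posrE ?exprn_gt0// lerXn2r ?nnegrE// ltW.
have [k hk0] : exists k, C * M * (s' / l) ^+ k <= 1.
  have CM0 : 0 < C * `|M| + 1 by rewrite ltr_wpDl// mulr_ge0// ltW.
  have [k hk'] := expr_small r01 (divr_gt0 ltr01 CM0); exists k.
  apply: le_trans (_ : (C * `|M| + 1) * (s' / l) ^+ k <= _).
    rewrite ler_wpM2r ?exprn_ge0//; first by case/andP: r01.
    by apply: le_trans (_ : C * `|M| <= _); [rewrite ler_wpM2l ?ler_norm// ltW|rewrite lerDl].
  by rewrite mulrC -ler_pdivlMr.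
have hl1 : s ^- k * iter k L0 h x <= 1.
  apply: le_trans hk0; rewrite iter_brop0.
  have -> : C * M * (s' / l) ^+ k = l ^- k * ((C * s' ^+ k) * M).
    by rewrite expr_div_n; ring.
  apply: ler_pM; rewrite ?mulr_ge0 ?invr_ge0 ?exprn_ge0 ?expR_ge0 ?(ltW s0)//.
    by rewrite lef_pV2 ?posrE ?exprn_gt0// lerXn2r ?nnegrE// ltW.
  by apply: ler_pM; rewrite ?expR_ge0//; case/andP: (hM (iter k b0 x)).
apply: le_trans (hk k x) _; apply: le_trans (lerD hl1 (sumle k)) _.
rewrite /B /A; have := h0 x1; have : 0 <= C / l * (1 - s' / l)^-1 * G.
  by rewrite mulr_ge0 ?(ltW C1)//; lra.
by set u := C / l * _; set w := h x1; nra.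
Qed.

Lemma hs_subinv (s : R) N : 0 < s -> (forall x, s ^- N * iter N L one x <= 1) ->
  (forall x, L (hs s N) x <= s * hs s N x) /\
  (forall x, s * hs s N x <= L (hs s N) x + 1).
Proof.
move=> s0 h1; have h0 x : 0 <= s ^- N * iter N L one x.
  by rewrite mulr_ge0 ?invr_ge0 ?exprn_ge0 ?(ltW s0)// iter_tr_ge0.
by split=> x; rewrite tr_hs//; have := h0 x; have := h1 x; lra.
Qed.

Lemma hs_ge s N x : 0 < s -> (0 < N)%N -> s^-1 <= hs s N x.
Proof.
move=> s0; case: N => // N _; rewrite /hs big_ord_recl/= expr1 mulr1 lerDl.
apply: sumr_ge0 => n _; rewrite mulr_ge0 ?invr_ge0 ?exprn_ge0 ?(ltW s0)//.
exact: (@iter_tr_ge0 _ _ _ n.+1).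
Qed.

(* Otherwise hs s N would witness insup (s - 1 / (2 B)) with B its upper bound. *)
Lemma hs_diverges (M : R) : E < lam -> 0 < M -> exists d : R, 0 < d /\
  forall (s : R) N, lam < s -> s < lam + d ->
    (forall x, s ^- N * iter N L one x <= 2^-1) -> M <= hs s N x1.
Proof.
move=> El M0; have [B [B0 hB]] := global_bound El.
pose B' := B * (1 + M); have B'0 : 0 < B' by rewrite mulr_gt0// addr_gt0.
pose d := (2 * B')^-1; have d0 : 0 < d by rewrite invr_gt0 mulr_gt0.
exists d; split=> // s N ls sd htail.
have s0 : 0 < s by apply: lt_trans ls; apply: lt_trans El; exact: expR_gt0.
have N0 : (0 < N)%N.
  case: N htail => // /(_ x0).
  by rewrite /= expr0 invr1 mul1r leNgt invf_lt1// ltr1n.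
rewrite leNgt; apply/negP => hM.
have [h1 h2] : (forall x, L (hs s N) x <= s * hs s N x) /\
  (forall x, s * hs s N x <= L (hs s N) x + 1).
  by apply: hs_subinv => // x; apply: le_trans (htail x) _; lra.
have hb x : hs s N x <= B'.
  apply: le_trans (hB s _ (ltW ls) (hs_bounded N s0) h2 (hs_KJ N s0) x) _.
  by rewrite ler_wpM2l ?(ltW B0)//; lra.
suff : insup (s - d) by move=> /lam_le; lra.
apply: (@insup_subinvariant _ _ _ _ (hs s N) s^-1 B'); first by rewrite invr_gt0.
  by move=> x; rewrite hs_ge// hb.
move=> x; rewrite tr_hs// mulrBl.
have : d * hs s N x <= 2^-1.
  apply: le_trans (ler_wpM2l (ltW d0) (hb x)) _.
  by rewrite /d invfM -mulrA mulVf ?mulr1// gt_eqF.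
by have := htail x; lra.
Qed.

Lemma KJ_ge_expN (h : T -> R) x : (forall z, 0 <= h z) -> KJ D h -> h x1 = 1 ->
  inJ x -> expR (- D) <= h x <= expR D.
Proof.
move=> h0 hK h1 Jx; have D0 := Dcone_ge0 a01 H0.
have := KJ_le a01 D0 h0 hK Jx (inJ1 alpha).
have := KJ_le a01 D0 h0 hK (inJ1 alpha) Jx.
by rewrite h1 mulr1 -ler_pdivrMl ?expR_gt0// mulr1 -expRN => -> ->.
Qed.

(* Pointwise limits along an ultrafilter suffice, since L involves two points only. *)
Lemma eigenfunction_bounded : E < lam -> exists (g : T -> R) (M : R),
  [/\ forall x, 0 <= g x <= M, g x1 = 1, KJ D g & forall x, L g x = lam * g x].
Proof.
move=> El; have [B [B0 hB]] := global_bound El.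
have l0 : 0 < lam by apply: lt_trans El; exact: expR_gt0.
have ex (n : nat) : exists h : T -> R, exists s : R,
    [/\ forall x, 0 <= h x <= 2 * B, h x1 = 1, KJ D h, lam < s < lam + n.+1%:R^-1
      & forall x, `|s * h x - L h x| <= n.+1%:R^-1].
  have [d [d0 hd]] := hs_diverges El (ltr0Sn R n).
  pose e := Num.min d n.+1%:R^-1.
  have e0 : 0 < e by rewrite lt_min d0 invr_gt0 ltr0n.
  pose s := lam + e / 2.
  have ls : lam < s by rewrite ltrDl divr_gt0.
  have s0 := lt_trans l0 ls.
  have i2 : (0 : R) < 2^-1 by rewrite invr_gt0.
  have [N hN] := hs_tail ls i2.
  have hM : n.+1%:R <= hs s N x1.
    apply: hd => //; rewrite ltrD2l.
    have : e <= d by rewrite ge_min lexx.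
    lra.
  have m0 : 0 < hs s N x1 by apply: lt_le_trans hM; rewrite ltr0n.
  have [h1 h2] : (forall x, L (hs s N) x <= s * hs s N x) /\
    (forall x, s * hs s N x <= L (hs s N) x + 1).
    by apply: hs_subinv => // x; apply: le_trans (hN x) _; lra.
  exists (fun x => (hs s N x1)^-1 * hs s N x), s; split.
  - move=> x; rewrite mulr_ge0 ?invr_ge0 ?hs_ge0 ?(ltW m0)//= ler_pdivrMl//.
    apply: le_trans (hB s _ (ltW ls) (hs_bounded N s0) h2 (hs_KJ N s0) x) _.
    have : 1 <= hs s N x1 by apply: le_trans hM; rewrite ler1n.
    by set w := hs s N x1; nra.
  - by rewrite mulVf// gt_eqF.
  - move=> x y Jx Jy; rewrite mulrCA ler_wpM2l ?invr_ge0 ?(ltW m0)//.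
    exact: hs_KJ.
  - rewrite ls ltrD2l/=; have e2 : e / 2 < e by lra.
    by apply: lt_le_trans e2 _; rewrite ge_min lexx orbT.
  - move=> x; rewrite tr_scale mulrCA -mulrBr normrM ger0_norm ?invr_ge0 ?(ltW m0)//.
    apply: le_trans (_ : (hs s N x1)^-1 * 1 <= _).
      rewrite ler_wpM2l ?invr_ge0 ?(ltW m0)// ler_norml.
      by have := h1 x; have := h2 x; lra.
    by rewrite mulr1 lef_pV2 ?posrE ?ltr0n.
have [h /(_ _) /cid hs_] := choice ex.
pose s n := projT1 (hs_ n).
have hP n : [/\ forall x, 0 <= h n x <= 2 * B, h n x1 = 1, KJ D (h n),
    lam < s n < lam + n.+1%:R^-1 & forall x, `|s n * h n x - L (h n) x| <= n.+1%:R^-1].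
  exact: projT2 (hs_ n).
have [U [UU hU]] := ultra_infty R.
have UF : ProperFilter U by exact: ultra_proper.
have cv x : cvg (h n x @[n --> U]).
  apply: (bounded_cvg_ultra UU (M := 2 * B)) => n; have [/(_ x)/andP[p q] _ _ _ _] := hP n.
  by rewrite ger0_norm.
pose g x := lim (h n x @[n --> U]).
have hg x : h n x @[n --> U] --> g x by exact: cv.
exists g, (2 * B); split.
- move=> x; apply/andP; split.
    by apply: limr_ge => //; apply: nearW => n; have [/(_ x)/andP[]] := hP n.
  by apply: limr_le => //; apply: nearW => n; have [/(_ x)/andP[]] := hP n.
- have := hg x1; have -> : (fun n => h n x1) = cst 1.
    by apply: funext => n; have [_ ->] := hP n.
  by move=> h1; apply: (@cvg_unique _ (@Rhausdorff R) _ _ _ _ h1); exact: cvg_cst.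
- move=> x y Jx Jy.
  have h1 : expR (D * da x y) * h n y @[n --> U] --> expR (D * da x y) * g y.
    exact: cvgMl_tmp.
  apply: (ler_cvg_to (hg x) h1); apply: nearW => n.
  by have [_ _ /(_ x y Jx Jy)] := hP n.
- move=> x; have h1 : L (h n) x @[n --> U] --> L g x.
    by apply: cvgD; apply: cvgMl_tmp.
  have h2 : lam * h n x - L (h n) x @[n --> U] --> lam * g x - L g x.
    by apply: cvgB => //; exact: cvgMl_tmp.
  have h3 : lam * h n x - L (h n) x @[n --> U] --> (0 : R).
    apply: hU; apply/(@cvgrPdist_le _ R^o) => e e0.
    have c0 : 0 < 2 * B + 1 by lra.
    have := @near_infty_natSinv_lt R (PosNum (divr_gt0 e0 c0)).
    apply: filterS => n /= hn.
    have [/(_ x) hx _ _ hs1 /(_ x) hs2] := hP n.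
    rewrite sub0r normrN.
    have -> : lam * h n x - L (h n) x =
       (s n * h n x - L (h n) x) - (s n - lam) * h n x by ring.
    apply: le_trans (ler_normB _ _) _; rewrite normrM.
    have k0 : 0 <= h n x by case/andP: hx.
    have /andP[sa sb] := hs1; have /andP[_ hx2] := hx.
    set i := n.+1%:R^-1 in hn sb hs2 *.
    rewrite (ger0_norm k0) ger0_norm; last by lra.
    have k1 : (s n - lam) * h n x <= i * (2 * B) by apply: ler_pM => //; lra.
    rewrite ltr_pdivlMr// in hn; lra.
  have h4 : lam * g x - L g x = 0.
    apply/eqP; rewrite eq_le; apply/andP; split.
      by apply: (ler_cvg_to h2 h3); apply: nearW => n.
    by apply: (ler_cvg_to h3 h2); apply: nearW => n.
  lra.
Qed.

Lemma expR_lip (a b M : R) : a <= M -> b <= M -> `|expR a - expR b| <= expR M * `|a - b|.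
Proof.
wlog ba : a b / b <= a => [hw aM bM|aM _].
  have [/hw|/ltW/hw] := leP b a; first exact.
  by rewrite distrC (distrC a); exact.
rewrite !ger0_norm ?subr_ge0 ?ler_expR//.
apply: le_trans (_ : expR a * (a - b) <= _); last first.
  by rewrite ler_wpM2r ?subr_ge0// ler_expR.
have := ler_wpM2l (expR_ge0 a) (expR_ge1Dx (b - a)).
rewrite -expRD; have -> : a + (b - a) = b by ring.
lra.
Qed.

Lemma brop_hol i (h : T -> R) A B : (forall x, inJ x \/ i = false -> `|h x| <= A) -> 0 <= A ->
  (forall x y, `|h (br i x) - h (br i y)| <= B * da x y) -> 0 <= B ->
  hol alpha (expR (phi x0 + H) * (H * A + B)) (brop alpha phi i h).
Proof.
move=> hA A0 hB B0 x y; rewrite /brop.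
have -> : expR (phi (br i x)) * h (br i x) - expR (phi (br i y)) * h (br i y) =
   (expR (phi (br i x)) - expR (phi (br i y))) * h (br i x) +
   expR (phi (br i y)) * (h (br i x) - h (br i y)) by ring.
apply: le_trans (ler_normD _ _) _; rewrite !normrM.
have e1 := expR_lip (phi_le a01 H0 phi_hol (br i x)) (phi_le a01 H0 phi_hol (br i y)).
have e2 : `|phi (br i x) - phi (br i y)| <= H * da x y.
  by apply: le_trans (phi_hol _ _) _; rewrite ler_wpM2l// da_br_le.
have e3 : `|h (br i x)| <= A by apply: hA; case: (i); [left; exact: b1J|right].
rewrite (ger0_norm (expR_ge0 (phi (br i y)))).
have -> : expR (phi x0 + H) * (H * A + B) * da x y =
  expR (phi x0 + H) * (H * da x y) * A + expR (phi x0 + H) * (B * da x y) by ring.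
apply: lerD; apply: ler_pM => //; rewrite ?expR_ge0//.
  by apply: le_trans e1 _; rewrite ler_wpM2l ?expR_ge0.
exact: (expR_phi_le a01 H0 phi_hol).
Qed.

(** The lower bound on [g] comes from [L1] alone, which lands in J. For the Hoelder bound, lam g =
    L0 g + u with u = [L1 g] is unrolled into the series of [lam^(-j-1) L0^j u]. Here [u] is Hoelder
    since it reads [g] on J, and the constant of [L0^j u] grows at most like [s' ^+ j] with
    [s' < lam]. The remainder [lam^(-k) L0^k g] tends to 0 uniformly. *)
Lemma eigenfunction : E < lam -> exists (g : T -> R) (c M B : R),
  [/\ 0 < c, forall x, c <= g x <= M, hol alpha B g & forall x, L g x = lam * g x].
Proof.
move=> El; have l0 : 0 < lam by apply: lt_trans El; exact: expR_gt0.
have [g [M [gM g1 gK gL]]] := eigenfunction_bounded El.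
have g0 x : 0 <= g x by case/andP: (gM x).
have M0 : 0 <= M by case/andP: (gM x0) => /le_trans/[apply].
have D0 := Dcone_ge0 a01 H0.
pose c := lam^-1 * (expR (phi x0 - H) * expR (- D)).
have c0 : 0 < c by rewrite mulr_gt0 ?invr_gt0 ?mulr_gt0 ?expR_gt0.
have gc x : c <= g x.
  rewrite ler_pdivrMl// -gL /tr; apply: le_trans (_ : L1 g x <= _); last first.
    by rewrite lerDr brop_ge0.
  rewrite /brop; apply: ler_pM; rewrite ?expR_ge0 ?ler_expR ?(phi_ge a01 H0 phi_hol)//.
  by have /andP[] := KJ_ge_expN g0 gK g1 (b1J x).
have [s' Es' s'l] : exists2 s', E < s' & s' < lam by exists ((E + lam) / 2); lra.
have s'0 : 0 < s' by apply: lt_trans Es'; exact: expR_gt0.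
have [C [C0 hC]] := neutral_growth a01 H0 phi_hol Es'.
have hC1 k x : expR (nsum k x) <= C * s' ^+ k.
  by apply: le_trans (hC k x); rewrite ler_peMl ?expR_ge0// ler1n.
have r01 : 0 <= s' / lam < 1.
  by rewrite divr_ge0 ?(ltW s'0) ?(ltW l0)//= ltr_pdivrMr// mul1r.
have gJ x : inJ x -> g x <= expR D.
  by move=> Jx; have /andP[] := KJ_ge_expN g0 gK g1 Jx.
(* on J, the cone condition is a Hoelder bound *)
have gJh x y : `|g (br true x) - g (br true y)| <= expR D * (expR D * D) * da x y.
  wlog gxy : x y / g (br true y) <= g (br true x) => [hw|].
    have [/hw|/ltW/hw] := leP (g (br true y)) (g (br true x)); first exact.
    by rewrite distrC da_sym; exact.
  rewrite ger0_norm ?subr_ge0//.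
  have h1 := gK _ _ (b1J x) (b1J y).
  have h2 : D * da (br true x) (br true y) <= D * da x y by rewrite ler_wpM2l// da_br_le.
  have h3 := @expR_lip (D * da x y) 0 D.
  have h4 : D * da x y <= D by rewrite ler_piMr// da_le1.
  have := h3 h4 D0; rewrite expR0 subr0 (ger0_norm (mulr_ge0 D0 (da_ge0 _ _ _))).
  move=> /(le_trans (ler_norm _)) h5.
  have h6 : g (br true x) - g (br true y) <= (expR (D * da x y) - 1) * g (br true y).
    rewrite mulrBl mul1r lerD2r; apply: le_trans h1 _.
    by rewrite ler_wpM2r// ler_expR.
  apply: le_trans h6 _; rewrite mulrC.
  have -> : expR D * (expR D * D) * da x y = expR D * (expR D * (D * da x y)) by ring.
  apply: ler_pM => //; first by rewrite subr_ge0 -expR0 ler_expR mulr_ge0// da_ge0.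
  exact: gJ (b1J y).
pose u := L1 g; pose A := expR (phi x0 + H) * expR D.
have uA x : 0 <= u x <= A.
  rewrite brop_ge0//=; apply: brop1_le_J; first exact: expR_ge0.
  by move=> z; exact: gJ.
pose W := expR (phi x0 + H) * (H * expR D + expR D * (expR D * D)).
have e0 := mulr_ge0 (expR_ge0 D) (mulr_ge0 (expR_ge0 D) D0).
have uW : hol alpha W u.
  apply: brop_hol; [|exact: expR_ge0|exact: gJh|exact: e0].
  by move=> x [Jx|//]; rewrite ger0_norm// gJ.
have A0 : 0 <= A by rewrite mulr_ge0 ?expR_ge0.
have W0 : 0 <= W.
  by rewrite mulr_ge0 ?expR_ge0// addr_ge0// mulr_ge0// expR_ge0.
have dk k x y : da (iter k b0 x) (iter k b0 y) <= da x y.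
  by rewrite !iter_br0; elim: (nseq k false) => //= i w /(le_trans (da_br_le a01 _ _ _)).
have nk k x y : `|nsum k x - nsum k y| <= k%:R * (H * da x y).
  rewrite /nsum -sumrB; apply: le_trans (ler_norm_sum _ _ _) _.
  have -> : k%:R * (H * da x y) = \sum_(j < k) H * da x y.
    by rewrite sumr_const card_ord mulr_natl.
  by apply: ler_sum => j _; apply: le_trans (phi_hol _ _) _; rewrite ler_wpM2l.
have kb k x y : `|iter k L0 u x - iter k L0 u y| <= C * s' ^+ k * (H * A + W) * da x y.
  have Ck : 0 < C * s' ^+ k by rewrite mulr_gt0 ?exprn_gt0.
  rewrite !iter_brop0; set a := nsum k x; set b := nsum k y.
  set ux := u _; set uy := u _.
  have -> : expR a * ux - expR b * uy = (expR a - expR b) * ux + expR b * (ux - uy) by ring.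
  apply: le_trans (ler_normD _ _) _.
  rewrite (normrM (expR a - expR b)) (normrM (expR b)).
  have m1 : `|ux| <= A by have /andP[? ?] := uA (iter k b0 x); rewrite ger0_norm.
  have m2 : `|ux - uy| <= W * da x y.
    by apply: le_trans (uW _ _) _; rewrite ler_wpM2l.
  rewrite (ger0_norm (expR_ge0 b)).
  have m3 : `|expR a - expR b| <= C * s' ^+ k * (H * da x y).
    pose m := Num.max a b.
    have am : a <= m by rewrite le_max lexx.
    have bm : b <= m by rewrite le_max lexx orbT.
    apply: le_trans (expR_lip am bm) _.
    apply: le_trans (ler_wpM2l (expR_ge0 _) (nk k x y)) _.
    rewrite [leLHS]mulrA ler_wpM2r ?(mulr_ge0 H0 (da_ge0 _ _ _))//.
    have mk z : expR (nsum k z) * k%:R <= C * s' ^+ k.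
      apply: le_trans (hC k z); rewrite mulrC ler_wpM2r ?expR_ge0// ler_nat//.
    by rewrite /m; case: (leP a b) => _; exact: mk.
  have -> : C * s' ^+ k * (H * A + W) * da x y =
    C * s' ^+ k * (H * da x y) * A + C * s' ^+ k * (W * da x y) by ring.
  by apply: lerD; apply: ler_pM => //; rewrite ?expR_ge0//; exact: hC1.
have tel k x y : `|g x - g y| <= lam ^- k * `|iter k L0 g x - iter k L0 g y| +
    \sum_(j < k) lam ^- j.+1 * `|iter j L0 u x - iter j L0 u y|.
  elim: k => [|k IH]; first by rewrite big_ord0 expr0 invr1 mul1r addr0.
  rewrite big_ord_recr/= addrA; apply: le_trans IH _; rewrite addrAC lerD2r.
  have st z : lam * iter k L0 g z = iter k.+1 L0 g z + iter k L0 u z.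
    by rewrite iterSr !iter_brop0 mulrCA -gL /tr mulrDr.
  rewrite exprS invfM [lam^-1 * _]mulrC -!mulrA -mulrDr ler_wpM2l ?invr_ge0 ?exprn_ge0 ?(ltW l0)//.
  rewrite -mulrDr ler_pdivlMl// -[X in X * _](ger0_norm (ltW l0)) -normrM mulrBr !st.
  by rewrite opprD addrACA; exact: ler_normD.
pose B := C / lam * (H * A + W) * (1 - s' / lam)^-1.
exists g, c, M, B; split=> //; first by move=> x; rewrite gc; case/andP: (gM x).
move=> x y; apply/ler_addgt0Pr => e ep.
have CM0 : 0 < 2 * C * M + 1 by rewrite ltr_wpDl// !mulr_ge0// ltW.
have [k hk] := expr_small r01 (divr_gt0 ep CM0).
apply: le_trans (tel k x y) _; rewrite addrC; apply: lerD.
  apply: le_trans (_ : \sum_(j < k) C / lam * (H * A + W) * da x y * (s' / lam) ^+ j <= _).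
    apply: ler_sum => j _; apply: le_trans (ler_wpM2l _ (kb j x y)) _.
      by rewrite invr_ge0 exprn_ge0// ltW.
    have l1 : lam ^+ j != 0 by rewrite expf_eq0 gt_eqF// andbF.
    have -> : lam ^- j.+1 * (C * s' ^+ j * (H * A + W) * da x y) =
      C / lam * (H * A + W) * da x y * (s' / lam) ^+ j.
      by rewrite expr_div_n exprS; field; rewrite l1 gt_eqF.
    exact: lexx.
  rewrite -mulr_sumr /B [leRHS]mulrAC ler_wpM2l ?sum_geometric_le//.
  rewrite mulr_ge0 ?da_ge0// mulr_ge0 ?divr_ge0 ?(ltW C0) ?(ltW l0)//.
  by rewrite addr_ge0// mulr_ge0.
rewrite ler_pdivlMr// in hk; apply: le_trans hk.
have gk z : `|iter k L0 g z| <= C * s' ^+ k * M.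
  rewrite iter_brop0 normrM !ger0_norm ?expR_ge0//.
  by apply: ler_pM; rewrite ?expR_ge0//; case/andP: (gM (iter k b0 z)).
apply: le_trans (_ : lam ^- k * (2 * (C * s' ^+ k * M)) <= _).
  rewrite ler_wpM2l ?invr_ge0 ?exprn_ge0 ?(ltW l0)//.
  apply: le_trans (ler_normB _ _) _; have := gk x; have := gk y; lra.
have -> : lam ^- k * (2 * (C * s' ^+ k * M)) = (s' / lam) ^+ k * (2 * C * M).
  by rewrite expr_div_n; ring.
by rewrite ler_wpM2l ?exprn_ge0//; [case/andP: r01|rewrite lerDl].
Qed.

(* At the threshold lam <= E the limit of the normalized hs is only subinvariant
   for the induced operator. *)
Lemma induced_subinvariant : lam <= E -> exists v : T -> R,
  (forall x, inJ x -> expR (- D) <= v x <= expR D) /\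
  forall n x, inJ x -> \sum_(k < n) E ^- k.+1 * iter k L0 (L1 v) x <= v x.
Proof.
move=> lE.
have ex (n : nat) : exists h : T -> R,
    [/\ forall x, 0 <= h x, h x1 = 1, KJ D h
      & forall x, L h x <= (E + n.+1%:R^-1) * h x].
  pose s := E + n.+1%:R^-1 : R.
  have ls : lam < s by apply: le_lt_trans lE _; rewrite ltrDl invr_gt0.
  have s0 : 0 < s by rewrite addr_gt0 ?expR_gt0 ?invr_gt0.
  have i2 : (0 : R) < 2^-1 by rewrite invr_gt0.
  have [N hN] := hs_tail ls i2.
  have N0 : (0 < N)%N.
    case: N hN => // /(_ x0).
    by rewrite /= expr0 invr1 mul1r leNgt invf_lt1// ltr1n.
  have m0 : 0 < hs s N x1 by apply: lt_le_trans (hs_ge x1 s0 N0); rewrite invr_gt0.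
  have [h1 _] : (forall x, L (hs s N) x <= s * hs s N x) /\
    (forall x, s * hs s N x <= L (hs s N) x + 1).
    by apply: hs_subinv => // x; apply: le_trans (hN x) _; lra.
  exists (fun x => (hs s N x1)^-1 * hs s N x); split.
  - by move=> x; rewrite mulr_ge0 ?invr_ge0 ?hs_ge0 ?(ltW m0).
  - by rewrite mulVf// gt_eqF.
  - move=> x y Jx Jy; rewrite mulrCA ler_wpM2l ?invr_ge0 ?(ltW m0)//.
    exact: hs_KJ.
  - by move=> x; rewrite tr_scale mulrCA ler_wpM2l ?invr_ge0 ?(ltW m0).
have [h hP] := choice ex.
have [U [UU hU]] := ultra_infty R.
have UF : ProperFilter U by exact: ultra_proper.
have hb n x : inJ x -> expR (- D) <= h n x <= expR D.
  by move=> Jx; have [? ? ? _] := hP n; exact: KJ_ge_expN.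
pose v x := lim (h n x @[n --> U]).
have hv x : inJ x -> h n x @[n --> U] --> v x.
  move=> Jx; have : cvg (h n x @[n --> U]); last by [].
  apply: (bounded_cvg_ultra UU (M := expR D)) => n; have /andP[p q] := hb n x Jx.
  by rewrite ger0_norm// (le_trans _ p)// expR_ge0.
exists v; split.
  move=> x Jx; apply/andP; split.
    by apply: limr_ge; [exact: hv|apply: nearW => n; case/andP: (hb n x Jx)].
  by apply: limr_le; [exact: hv|apply: nearW => n; case/andP: (hb n x Jx)].
move=> n x Jx.
pose s m := E + m.+1%:R^-1 : R.
have s0 m : 0 < s m by rewrite addr_gt0 ?expR_gt0 ?invr_gt0.
have sE : s m @[m --> U] --> E.
  apply: hU; rewrite -[X in _ --> X]addr0; apply: cvgD; first exact: cvg_cst.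
  exact: cvg_harmonic.
(* Subinvariance of [h m] is unrolled [n] times along the neutral branch, and the nonnegative
   remainder is dropped. *)
have fin m : \sum_(k < n) s m ^- k.+1 * iter k L0 (L1 (h m)) x <= h m x.
  have [h0 _ _ hL] := hP m.
  suff : s m ^- n * iter n L0 (h m) x +
    \sum_(k < n) s m ^- k.+1 * iter k L0 (L1 (h m)) x <= h m x.
    apply: le_trans; rewrite lerDr mulr_ge0 ?invr_ge0 ?exprn_ge0 ?(ltW (s0 m))//.
    exact: iter_brop0_ge0.
  elim: n => [|k IH]; first by rewrite big_ord0 expr0 invr1 mul1r addr0.
  apply: le_trans IH; rewrite big_ord_recr/= addrCA addrC lerD2r.
  rewrite exprS invfM [(s m)^-1 * _]mulrC -!mulrA -mulrDr.
  rewrite ler_wpM2l ?invr_ge0 ?exprn_ge0 ?(ltW (s0 m))//.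
  rewrite -mulrDr ler_pdivrMl// -iterS iterSr !iter_brop0 [leRHS]mulrCA -mulrDr.
  by rewrite ler_wpM2l ?expR_ge0//; exact: hL.
have h1 : \sum_(k < n) s m ^- k.+1 * iter k L0 (L1 (h m)) x @[m --> U] -->
   \sum_(k < n) E ^- k.+1 * iter k L0 (L1 v) x.
  apply: cvg_sum_ord => k.
  apply: cvgM.
    apply: cvgV; first by rewrite expf_eq0/= gt_eqF ?expR_gt0.
    by apply: (@cvg_comp _ _ _ s (fun z : R => z ^+ k.+1)); [exact: sE|exact: exprn_continuous].
  have -> : (fun m => iter k L0 (L1 (h m)) x) = (fun m => expR (nsum k x) *
      (expR (phi (br true (iter k b0 x))) * h m (br true (iter k b0 x)))).
    by apply: funext => m; rewrite iter_brop0.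
  by rewrite iter_brop0; do 2 apply: cvgMl_tmp; exact/hv/b1J.
by apply: (ler_cvg_to h1 (hv x Jx)); apply: nearW => m; exact: fin.
Qed.

End growth.

(** * The entropy bound *)

Section bounded_integration.
Context {d : measure_display} {T : measurableType d} {R : realType}.
Variable nu : probability T R.
Implicit Types h : T -> R.

Definition bm h := measurable_fun setT h /\ exists M : R, forall x, `|h x| <= M.

Lemma bm_integrable h : bm h -> nu.-integrable setT (EFin \o h).
Proof.
move=> [mh [M hM]]; apply: measurable_bounded_integrable => //.
  by rewrite [X in (X < _)%E]probability_setT ltry.
exists M; split; first exact: num_real.
by move=> y My x _; apply: le_trans (hM x) (ltW My).
Qed.
Hint Resolve bm_integrable : core.

Lemma bm_cst (c : R) : bm (fun=> c).
Proof. by split; [exact: measurable_cst|exists `|c|]. Qed.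

Lemma bmD h h' : bm h -> bm h' -> bm (fun x => h x + h' x).
Proof.
move=> [mh [M hM]] [mh' [M' hM']]; split; first exact: measurable_funD.
by exists (M + M') => x; apply: le_trans (ler_normD _ _) _; rewrite lerD.
Qed.

Lemma bmM h h' : bm h -> bm h' -> bm (fun x => h x * h' x).
Proof.
move=> [mh [M hM]] [mh' [M' hM']]; split; first exact: measurable_funM.
by exists (M * M') => x; rewrite normrM ler_pM.
Qed.

Lemma bmZ (c : R) h : bm h -> bm (fun x => c * h x).
Proof. by move=> bh; apply: bmM => //; exact: bm_cst. Qed.

Lemma bmB h h' : bm h -> bm h' -> bm (fun x => h x - h' x).
Proof.
move=> bh bh'; have -> : (fun x => h x - h' x) = (fun x => h x + (-1) * h' x).
  by apply: funext => x; rewrite mulN1r.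
by apply: bmD => //; exact: bmZ.
Qed.

Lemma bm_sum (I : Type) (s : seq I) (F : I -> T -> R) :
  (forall i, bm (F i)) -> bm (fun x => \sum_(i <- s) F i x).
Proof.
move=> bF; elim: s => [|i s IH].
  by under eq_fun do rewrite big_nil; exact: bm_cst.
by under eq_fun do rewrite big_cons; exact: bmD.
Qed.

Lemma RintD h h' : bm h -> bm h' ->
  \int[nu]_x (h x + h' x) = \int[nu]_x h x + \int[nu]_x h' x.
Proof. by move=> bh bh'; rewrite RintegralD//; exact: bm_integrable. Qed.

Lemma RintB h h' : bm h -> bm h' ->
  \int[nu]_x (h x - h' x) = \int[nu]_x h x - \int[nu]_x h' x.
Proof. by move=> bh bh'; rewrite RintegralB//; exact: bm_integrable. Qed.

Lemma RintZ (c : R) h : bm h -> \int[nu]_x (c * h x) = c * \int[nu]_x h x.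
Proof. by move=> bh; rewrite RintegralZl//; exact: bm_integrable. Qed.

Lemma Rint_cst (c : R) : \int[nu]_x c = c.
Proof. by rewrite Rintegral_cst// [X in fine X]probability_setT/= mulr1. Qed.

Lemma Rint_le h h' : bm h -> bm h' -> (forall x, h x <= h' x) ->
  \int[nu]_x h x <= \int[nu]_x h' x.
Proof. by move=> bh bh' hh; apply: le_Rintegral => //; exact: bm_integrable. Qed.

Lemma Rint_norm h (M : R) : bm h -> (forall x, `|h x| <= M) -> `|\int[nu]_x h x| <= M.
Proof.
move=> bh hM; rewrite ler_norml -(Rint_cst M) -(Rint_cst (- _)).
apply/andP; split; apply: Rint_le => //; try exact: bm_cst;
  by move=> x; rewrite ?Rint_cst; have := hM x; rewrite ler_norml => /andP[].
Qed.

Lemma Rint_sum (I : Type) (s : seq I) (F : I -> T -> R) : (forall i, bm (F i)) ->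
  \int[nu]_x (\sum_(i <- s) F i x) = \sum_(i <- s) \int[nu]_x F i x.
Proof.
move=> bF; elim: s => [|i s IH].
  by under eq_Rintegral do rewrite big_nil; rewrite Rint_cst big_nil.
under eq_Rintegral do rewrite big_cons.
by rewrite RintD// ?IH ?big_cons//; exact: bm_sum.
Qed.

Lemma bm_indic (A : set T) : measurable A -> bm (\1_A : T -> R).
Proof.
move=> mA; split; first exact: measurable_indic.
by exists 1 => x; rewrite indicE; case: (x \in A); rewrite ?normr0 ?normr1.
Qed.

Lemma Rint_indic (A : set T) : measurable A -> \int[nu]_x \1_A x = fine (nu A).
Proof. by move=> mA; rewrite /Rintegral integral_indic// setIT. Qed.

Lemma prob_ge0 (A : set T) : 0 <= fine (nu A).
Proof. exact: fine_ge0. Qed.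

Lemma prob_fin (A : set T) : measurable A -> nu A = (fine (nu A))%:E.
Proof. by move=> mA; rewrite fineK// fin_num_measure. Qed.

Lemma prob_le (A B : set T) : measurable A -> measurable B -> A `<=` B ->
  fine (nu A) <= fine (nu B).
Proof.
by move=> mA mB AB; rewrite fine_le ?fin_num_measure// le_measure// inE.
Qed.

Lemma prob_setD (A B : set T) : measurable A -> measurable B -> A `<=` B ->
  fine (nu (B `\` A)) = fine (nu B) - fine (nu A).
Proof.
move=> mA mB AB; have mD : measurable (B `\` A) by exact: measurableD.
rewrite -!Rint_indic// -RintB; try exact: bm_indic.
apply: eq_Rintegral => x _; rewrite !indicE in_setD.
have [xA|_] := boolP (x \in A); last by rewrite andbT subr0.
by rewrite (mem_set (AB _ (set_mem xA))) subrr.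
Qed.

Lemma pr_sum_le (I : finType) (A : set T) (F : I -> set T) : measurable A ->
  (forall i, measurable (F i)) -> (forall x, A x -> exists i, F i x) ->
  fine (nu A) <= \sum_i fine (nu (F i)).
Proof.
move=> mA mF AF; rewrite -Rint_indic//.
under eq_bigr do rewrite -Rint_indic//.
rewrite -Rint_sum => [|i]; last exact: bm_indic.
apply: Rint_le; [exact: bm_indic|by apply: bm_sum => i; exact: bm_indic|].
move=> x; rewrite indicE; have [/set_mem xA|_] := boolP (x \in A); last first.
  by apply: sumr_ge0 => i _; rewrite indicE.
have [i Fi] := AF x xA; rewrite (bigD1 i)//= indicE mem_set// lerDl.
by apply: sumr_ge0 => j _; rewrite indicE.
Qed.

Section finite_valued.
Variables (A : finType) (X : T -> A).
Hypothesis mX : forall a, measurable [set x | X x = a].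

Lemma finite_valuedE (F : A -> R) x :
  F (X x) = \sum_a F a * \1_[set y | X y = a] x.
Proof.
rewrite (bigD1 (X x))//= indicE mem_set// mulr1 big1 ?addr0// => a aX.
by rewrite indicE memNset ?mulr0//= => e; rewrite -e eqxx in aX.
Qed.

Lemma bm_finite_valued (F : A -> R) : bm (fun x => F (X x)).
Proof.
under eq_fun do rewrite finite_valuedE.
by apply: bm_sum => a; apply: bmZ; exact: bm_indic.
Qed.

Lemma Rint_finite_valued (F : A -> R) :
  \int[nu]_x F (X x) = \sum_a F a * fine (nu [set x | X x = a]).
Proof.
under eq_Rintegral do rewrite finite_valuedE.
rewrite Rint_sum => [|a]; last by apply: bmZ; exact: bm_indic.
by apply: eq_bigr => a _; rewrite RintZ ?Rint_indic//; exact: bm_indic.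
Qed.

Lemma sum_finite_valued : \sum_a fine (nu [set x | X x = a]) = 1.
Proof.
rewrite -[RHS]Rint_cst -/(fun=> 1 : R).
have := Rint_finite_valued (fun=> 1 : R) => ->.
by apply: eq_bigr => a _; rewrite mul1r.
Qed.

End finite_valued.

Definition shannon (A : finType) (X : T -> A) : R :=
  - \sum_a fine (nu [set x | X x = a]) * ln (fine (nu [set x | X x = a])).

Lemma measurable_pair_valued (A B : finType) (X : T -> A) (W : T -> B) :
  (forall a, measurable [set x | X x = a]) -> (forall b, measurable [set x | W x = b]) ->
  forall p, measurable [set x | (X x, W x) = p].
Proof.
move=> mX mW [a b]; rewrite (_ : [set _ | _] = [set x | X x = a] `&` [set x | W x = b]).
  exact: measurableI.
by apply/seteqP; split => x /= [-> ->].
Qed.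

(* The auxiliary variable W only increases the entropy, and may be used to choose q. *)
Lemma gibbs_inequality (A B : finType) (X : T -> A) (W : T -> B) (q : A * B -> R) :
  (forall a, measurable [set x | X x = a]) -> (forall b, measurable [set x | W x = b]) ->
  (forall p, 0 < q p) -> \sum_p q p <= 1 ->
  shannon X <= - \int[nu]_x ln (q (X x, W x)).
Proof.
move=> mX mW q0 q1; have mXW := measurable_pair_valued mX mW.
rewrite /shannon lerN2 (Rint_finite_valued mXW (fun p => ln (q p))).
pose p ab := fine (nu [set x | (X x, W x) = ab]).
pose F a := fine (nu [set x | X x = a]).
have -> : \sum_a fine (nu [set x | X x = a]) * ln (fine (nu [set x | X x = a])) =
    \sum_ab ln (F ab.1) * p ab.
  rewrite -(Rint_finite_valued mXW (fun ab => ln (F ab.1)))/=.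
  rewrite (Rint_finite_valued mX (fun a => ln (F a))).
  by apply: eq_bigr => a _; rewrite mulrC.
rewrite -subr_le0 -sumrB; apply: le_trans (_ : \sum_ab (q ab - p ab) <= _); last first.
  by rewrite sumrB (sum_finite_valued mXW) subr_le0.
apply: ler_sum => ab _; rewrite -mulrBl -/(p ab).
have := prob_ge0 [set x | (X x, W x) = ab]; rewrite -/(p ab) le_eqVlt => /predU1P[<-|p0].
  by rewrite mulr0 subr0 ltW.
have pF : p ab <= F ab.1 by apply: prob_le => // x/= <-.
have F0 : 0 < F ab.1 := lt_le_trans p0 pF.
have h1 : ln (p ab) <= ln (F ab.1) by rewrite ler_ln.
have h2 : ln (q ab) - ln (p ab) <= q ab / p ab - 1.
  rewrite -ln_div ?posrE// -[in leLHS](subrK 1 (q ab / p ab)) addrC.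
  by apply: le_ln1Dx; rewrite ltrBrDl subrr divr_gt0.
have h3 : ln (q ab) - ln (F ab.1) <= q ab / p ab - 1 by lra.
have := ler_wpM2r (ltW p0) h3; rewrite [leRHS]mulrBl divfK ?gt_eqF// mul1r.
exact.
Qed.

End bounded_integration.

(** * Borel sets of the interval, measurability of the map, invariance of integrals *)

Section I01_measurability.
Variables (R : realType) (alpha : R).
Hypothesis a01 : 0 < alpha <= 1.
Local Notation T := (I01 R).
Local Notation br := (br alpha).
Local Notation f := (@intermittent R alpha).

Lemma I01_nbhsP (x : T) (A : set T) :
  nbhs x A <-> exists2 e : R, 0 < e & forall y : T, `|I01_val x - I01_val y| < e -> A y.
Proof. by split=> [/nbhs_ballP[e e0 h]|[e e0 h]]; [|apply/nbhs_ballP]; exists e. Qed.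

Lemma measurable_I01_val : measurable_fun setT (@I01_val R).
Proof.
apply: (measurability (@RGenOpens.G R)); first exact: RGenOpens.measurableE.
move=> _ [_ [a [b ->]] <-]; have oA : open `]a, b[%classic by exact: interval_open.
set A := `]a, b[%classic in oA *.
rewrite setTI; apply: sub_sigma_algebra.
by apply: open_comp => // x _; exact: initial_continuous.
Qed.

Lemma measurable_I01P (A : set T) : measurable A ->
  exists2 B : set R, measurable B & A = @I01_val R @^-1` B.
Proof.
have : <<s @open T >> `<=` preimage_set_system setT (@I01_val R) (@measurable _ R).
  apply: smallest_sub.
    by apply: sigma_algebra_preimage; exact: sigma_algebra_measurable.
  move=> U oU; have [V oV <-] : exists2 V : set R, open V & @I01_val R @^-1` V = U by [].
  by exists V; rewrite ?setTI//; exact: open_measurable.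
by move=> sub /sub[B mB <-]; exists B; rewrite ?setTI.
Qed.

Lemma measurable_to_I01 (d : measure_display) (X : measurableType d) (h : X -> T) :
  measurable_fun setT (fun x => I01_val (h x)) -> measurable_fun setT h.
Proof.
move=> mh _ A /measurable_I01P[B mB ->].
by have := mh measurableT B mB.
Qed.

Lemma measurable_hol B (h : T -> R) : hol alpha B h -> measurable_fun setT h.
Proof.
move=> hB; apply: (measurability (@RGenOpens.G R)); first exact: RGenOpens.measurableE.
move=> _ [_ [a [b ->]] <-]; have oA : open `]a, b[%classic by exact: interval_open.
set A := `]a, b[%classic in oA *.
rewrite setTI; apply: sub_sigma_algebra.
have oP : forall U : set T, (forall x, U x -> nbhs x U) -> open U.
  by move=> U hU; rewrite openE.
apply: oP => x Ax.
have /nbhs_ballP[e/= e0 hA] : nbhs (h x) A by exact: open_nbhs_nbhs.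
have c0 : 0 < `|B| + 1 by rewrite ltr_wpDl.
apply/I01_nbhsP; exists ((e / (`|B| + 1)) `^ alpha^-1); first by apply/powR_gt0/divr_gt0.
move=> y xy; apply: hA; rewrite /ball/=; apply: le_lt_trans (hB x y) _.
have : da alpha x y < e / (`|B| + 1) by apply: powR_lt => //; rewrite divr_gt0.
rewrite ltr_pdivlMr// mulrC => h2; apply: le_lt_trans h2.
by rewrite ler_wpM2r ?da_ge0// (le_trans (ler_norm B))// lerDl.
Qed.

Lemma hol_bounded B (h : T -> R) x : hol alpha B h -> 0 <= B ->
  `|h x| <= `|h (I01_0 R)| + B.
Proof.
move=> hB B0; rewrite -[h x](subrK (h (I01_0 R))) addrC.
apply: le_trans (ler_normD _ _) _; rewrite lerD2l; apply: le_trans (hB _ _) _.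
by rewrite ler_piMr// da_le1.
Qed.

Lemma hol_ge0 B (h : T -> R) : hol alpha B h -> 0 <= B.
Proof.
move=> /(_ (I01_0 R) (I01_1 R)); rewrite /da/= sub0r normrN normr1 powR1 mulr1.
exact: le_trans.
Qed.

Lemma bm_hol B (h : T -> R) : hol alpha B h -> bm h.
Proof.
move=> hB; split; first exact: measurable_hol hB.
by exists (`|h (I01_0 R)| + B) => x; apply: hol_bounded => //; exact: hol_ge0 hB.
Qed.

Lemma measurable_br i : measurable_fun setT (br i).
Proof.
apply: measurable_to_I01; apply: (@measurable_hol 1) => x y; rewrite mul1r.
by apply: le_trans (dist_le_da a01 _ _) _; exact: da_br_le.
Qed.

Lemma measurable_digit : measurable [set x : T | digit alpha x].
Proof.
rewrite (_ : [set _ | _] = @I01_val R @^-1` `]cutp alpha, +oo[).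
  by rewrite -[_ @^-1` _]setTI; apply: measurable_I01_val => //; exact: measurable_itv.
by apply/seteqP; split => x; rewrite /= in_itv/= andbT.
Qed.

Lemma measurable_intermittent : measurable_fun setT f.
Proof.
apply: measurable_to_I01.
under eq_fun do rewrite (intermittentE a01).
have mF : measurable_fun setT (fun x : T => Fmap alpha x).
  apply: (measurableT_comp (f := Fmap alpha)); last exact: measurable_I01_val.
  apply: measurable_funM => //; apply: measurable_funD => //.
apply: measurable_fun_ifT => //; last exact: measurable_funB.
by apply: measurable_fun_ler => //; exact: measurable_I01_val.
Qed.

Lemma measurable_iter_intermittent n : measurable_fun setT (iter n f).
Proof.
elim: n => [|n IH]; first exact: measurable_id.
by apply: (measurableT_comp (f := f)) => //; exact: measurable_intermittent.
Qed.

Variable nu : probability T R.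
Hypothesis nu_inv : invariant_measure f nu.

Lemma bm_comp (h : T -> R) (g : T -> T) : measurable_fun setT g -> bm h -> bm (fun x => h (g x)).
Proof.
move=> mg [mh [M hM]]; split; first exact: (measurableT_comp (f := h)).
by exists M.
Qed.

Lemma Rint_comp_invariant (h : T -> R) : bm h ->
  \int[nu]_x h (f x) = \int[nu]_x h x.
Proof.
move=> bh; have mf := measurable_intermittent.
rewrite /Rintegral; congr fine.
have e := @integral_pushforward _ _ T T R f mf nu setT (EFin \o h).
rewrite preimage_setT/= in e; rewrite -e//.
- by apply: eq_measure_integral => A mA _; exact: nu_inv.
- by apply/measurable_EFinP; case: bh.
- exact: (bm_integrable nu (bm_comp mf bh)).
Qed.

Lemma Rint_iter_invariant n (h : T -> R) : bm h ->
  \int[nu]_x h (iter n f x) = \int[nu]_x h x.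
Proof.
move=> bh; elim: n => // n IH.
under eq_Rintegral do rewrite iterSr.
rewrite (Rint_comp_invariant (h := fun x => h (iter n f x)))//.
by apply: bm_comp => //; exact: measurable_iter_intermittent.
Qed.

End I01_measurability.

(** * Itineraries, and approximation of Borel sets by cylinders *)

Section itineraries.
Variables (R : realType) (alpha : R).
Hypothesis a01 : 0 < alpha <= 1.
Local Notation T := (I01 R).
Local Notation br := (br alpha).
Local Notation brw := (brw alpha).
Local Notation f := (@intermittent R alpha).

Fixpoint itin (m : nat) (x : T) : seq bool :=
  if m is m'.+1 then digit alpha x :: itin m' (f x) else [::].

Lemma size_itin m x : size (itin m x) = m.
Proof. by elim: m x => //= m IH x; rewrite IH. Qed.

Lemma take_itin m n x : (m <= n)%N -> take m (itin n x) = itin m x.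
Proof.
by elim: m n x => [|m IH] [|n] x //=; rewrite ?take0// ltnS => /IH ->.
Qed.

Lemma drop_itin j m x : drop j (itin (j + m) x) = itin m (iter j f x).
Proof. elim: j x => [|j IH] x; first by rewrite drop0.
by rewrite addSn/= IH -iterSr. Qed.

Lemma brw_itin m x : brw (itin m x) (iter m f x) = x.
Proof.
elim: m x => //= m IH x; rewrite -iterS iterSr IH; exact: br_intermittent.
Qed.

Lemma measurable_itin m (B : pred (seq bool)) : measurable [set x | B (itin m x)].
Proof.
elim: m B => [|m IH] B /=.
  case: (B [::]).
    by rewrite (_ : [set _ | _] = setT)//; apply/seteqP; split.
  by rewrite (_ : [set _ | _] = set0)//; apply/seteqP; split.
have mD := @measurable_digit R alpha.
have mf (C : set T) : measurable C -> measurable (f @^-1` C).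
  by move=> mC; rewrite -[_ @^-1` _]setTI; exact: measurable_intermittent.
rewrite (_ : [set _ | _] =
   ([set x | digit alpha x] `&` f @^-1` [set x | B (true :: itin m x)]) `|`
   (~` [set x | digit alpha x] `&` f @^-1` [set x | B (false :: itin m x)])).
  apply: measurableU; apply: measurableI => //.
  - by apply: mf; exact: (IH (fun w => B (true :: w))).
  - exact: measurableC.
  - by apply: mf; exact: (IH (fun w => B (false :: w))).
apply/seteqP; split => x /=; first by case: (digit alpha x) => ?; [left|right].
by case=> -[]; case: (digit alpha x).
Qed.

Definition itint (m : nat) (x : T) : m.-tuple bool :=
  @Tuple m _ (itin m x) (introT eqP (size_itin m x)).

Lemma measurable_itint m (t : m.-tuple bool) : measurable [set x | itint m x = t].
Proof.
rewrite (_ : [set _ | _] = [set x | itin m x == t :> seq bool]).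
  exact: (measurable_itin m (pred1 (t : seq bool))).
apply/seteqP; split => x /=; first by move=> <-; exact: eqxx.
by move=> /eqP h; apply: val_inj.
Qed.

Lemma sum_tupleS m (F : seq bool -> R) :
  \sum_(t : m.+1.-tuple bool) F t =
  \sum_(t : m.-tuple bool) (F (false :: t) + F (true :: t)).
Proof.
rewrite (reindex (fun p : m.-tuple bool * bool => [tuple of p.2 :: p.1]))/=.
  rewrite -(pair_big predT predT (fun t b => F (b :: (t : m.-tuple bool))))/=.
  by apply: eq_bigr => t _; rewrite big_bool/= addrC.
exists (fun t : m.+1.-tuple bool => ([tuple of behead t], thead t)) => [[t b] _|t _].
  by congr (_, _); apply: val_inj.
by apply: val_inj; case/tupleP: t.
Qed.

Local Notation x1 := (I01_1 R).

Section birkhoff_sums.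
Variable phi : T -> R.
Local Notation L := (tr alpha phi).

(* Birkhoff sum along the first n digits of w, computed at the endpoint 1. *)
Definition wsum (n : nat) (w : seq bool) : R := \sum_(j < n) phi (brw (drop j w) x1).

(** Each application of the transfer operator chooses one more leading digit, so its n-th iterate
    enumerates the first [n] digits; the remaining [m] digits only locate the base point. *)
Lemma sum_wsum n m (h : T -> R) :
  \sum_(t : (n + m).-tuple bool) expR (wsum n t) * h (brw t x1) =
  \sum_(t : m.-tuple bool) iter n L h (brw t x1).
Proof.
elim: n h => [|n IH] h.
  by apply: eq_bigr => t _; rewrite /wsum big_ord0 expR0 mul1r.
rewrite addSn (sum_tupleS (n + m) (fun t => expR (wsum n.+1 t) * h (brw t x1))).
rewrite iterSr -IH; apply: eq_bigr => t _.
have e b : expR (wsum n.+1 (b :: t)) = expR (phi (br b (brw t x1))) * expR (wsum n t).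
  by rewrite /wsum big_ord_recl expRD.
by rewrite !e /tr /brop/=; ring.
Qed.

End birkhoff_sums.

Variable nu : probability T R.

Local Ltac btauto :=
  have ? : is_true true by []; have ? : ~ is_true false by []; tauto.

Definition sd (A C : set T) := (A `\` C) `|` (C `\` A).

(** Membership, up to [nu]-null sets, in the sigma-algebra generated by the itineraries. The closure
    properties below make the class a sigma-algebra. *)
Definition approx (A : set T) : Prop := measurable A /\
  forall e : R, 0 < e -> exists m (B : pred (seq bool)),
    (nu (sd A [set x | B (itin m x)]) <= e%:E)%E.

Lemma measurable_sd A C : measurable A -> measurable C -> measurable (sd A C).
Proof. by move=> mA mC; apply: measurableU; exact: measurableD. Qed.

Lemma approxC A : approx A -> approx (~` A).
Proof.
move=> [mA hA]; split=> [|e /hA[m [B hB]]]; first exact: measurableC.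
exists m, (predC B); apply: le_trans hB.
rewrite (_ : sd (~` A) _ = sd A [set x | B (itin m x)])//.
by apply/seteqP; split => x /=; rewrite /sd/=;
  have [] := pselect (A x); case: (B (itin m x)) => /=; btauto.
Qed.

Lemma approx0 : approx set0.
Proof.
split=> // e e0; exists 0%N, pred0.
rewrite (_ : sd _ _ = set0) ?measure0 ?lee_fin ?ltW//.
by apply/seteqP; split => x //; rewrite /sd/= => -[[//]|[//]].
Qed.

Lemma approxU A C : approx A -> approx C -> approx (A `|` C).
Proof.
move=> [mA hA] [mC hC]; split=> [|e e0]; first exact: measurableU.
have [m [B hB]] := hA _ (divr_gt0 e0 (ltr0Sn R 1)).
have [m' [B' hB']] := hC _ (divr_gt0 e0 (ltr0Sn R 1)).
exists (m + m')%N, (fun w => B (take m w) || B' (take m' w)).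
have mB := measurable_itin m B; have mB' := measurable_itin m' B'.
apply: (@le_trans _ _ (nu (sd A [set x | B (itin m x)] `|` sd C [set x | B' (itin m' x)]))).
  apply: le_measure; rewrite ?inE.
  - apply: measurable_sd; first exact: measurableU.
    exact: (measurable_itin _ (fun w => B (take m w) || B' (take m' w))).
  - by apply: measurableU; exact: measurable_sd.
  - move=> x; rewrite /sd/= !take_itin ?leq_addr ?leq_addl//.
    by have [] := pselect (A x); have [] := pselect (C x);
      case: (B (itin m x)); case: (B' (itin m' x)) => /=; btauto.
apply: le_trans (measureU2 _ _ _) _; try exact: measurable_sd.
by apply: le_trans (leeD hB hB') _; rewrite -EFinD lee_fin -splitr.
Qed.

Lemma approx_bigcup (F : (set T)^nat) : (forall i, approx (F i)) -> approx (\bigcup_i F i).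
Proof.
move=> hF; have mF i : measurable (F i) by case: (hF i).
have mU : measurable (\bigcup_i F i) by exact: bigcupT_measurable.
split=> // e e0.
pose G n := \big[setU/set0]_(i < n.+1) F i.
have aG n : approx (G n).
  rewrite /G; elim: n.+1 => [|k IH]; first by rewrite big_ord0; exact: approx0.
  by rewrite big_ord_recr; exact: approxU.
have mG n : measurable (G n) by case: (aG n).
have UG : \bigcup_n G n = \bigcup_i F i by rewrite bigcup_bigsetU_bigcup.
have /fine_cvgP[_ cG] : nu \o G @ \oo --> (fine (nu (\bigcup_i F i)))%:E.
  rewrite -prob_fin// -UG; apply: nondecreasing_cvg_mu => //; first by rewrite UG.
  by apply/nondecreasing_seqP => n; rewrite subsetEset /G [X in _ `<=` X]big_ord_recr => x; left.
have e2 : 0 < e / 2 by rewrite divr_gt0.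
have /cvgrPdist_le/(_ _ e2)[N _ /(_ N (leqnn _))/= hN] := cG.
have [_ /(_ _ e2)[m [B hB]]] := aG N.
exists m, B; have mB := measurable_itin m B.
have GU : G N `<=` \bigcup_i F i by rewrite -UG; exact: bigcup_sup.
apply: (@le_trans _ _ (nu ((\bigcup_i F i `\` G N) `|` sd (G N) [set x | B (itin m x)]))).
  apply: le_measure; rewrite ?inE.
  - exact: measurable_sd.
  - by apply: measurableU; [exact: measurableD|exact: measurable_sd].
  - move=> x; rewrite /sd/=; have := GU x.
    by have [] := pselect (G N x); have [] := pselect ((\bigcup_i F i) x); tauto.
apply: le_trans (measureU2 _ _ _) _; [exact: measurableD|exact: measurable_sd|].
apply: (@le_trans _ _ ((e / 2)%:E + (e / 2)%:E)%E); last first.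
  by rewrite -EFinD lee_fin -splitr.
apply: leeD => //.
suff : (nu (\bigcup_i F i `\` G N) <= (e / 2)%:E)%E by [].
rewrite prob_fin; last exact: measurableD.
by rewrite prob_setD// lee_fin (le_trans (ler_norm _) hN).
Qed.

(** [brw w x1] is the right end of the cylinder of [w], at distance at most [1 / (1 + qa N)] from
    its points. The set of cylinders with right end below [a] thus differs from the ray only in a
    thin strip [E N] to the left of [a], and the strips decrease to the empty set. *)
Lemma approx_ray (a : R) : approx [set x : T | I01_val x < a].
Proof.
have mA : measurable [set x : T | I01_val x < a].
  rewrite (_ : [set _ | _] = @I01_val R @^-1` `]-oo, a[).
    by rewrite -[_ @^-1` _]setTI; apply: measurable_I01_val => //; exact: measurable_itv.
  by apply/seteqP; split => x; rewrite /= in_itv.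
split=> // e e0; have q0 := qa_gt0 a01.
pose E m := [set x : T | a - (1 + qa alpha * m%:R)^-1 <= I01_val x < a].
have qm m : 0 < 1 + qa alpha * m%:R by rewrite ltr_wpDr// mulr_ge0// ltW.
have mE m : measurable (E m).
  rewrite (_ : E m = @I01_val R @^-1` `[a - (1 + qa alpha * m%:R)^-1, a[).
    by rewrite -[_ @^-1` _]setTI; apply: measurable_I01_val => //; exact: measurable_itv.
  by apply/seteqP; split => x; rewrite /= in_itv.
have E0 : \bigcap_m E m = set0.
  apply/seteqP; split => x // hx; have /andP[_ xa] := hx 0%N I.
  have ax : 0 < a - I01_val x by rewrite subr_gt0.
  pose N := (Num.truncn ((a - I01_val x)^-1 / qa alpha)).+1.
  have /andP[h _] := hx N I.
  have hN : (a - I01_val x)^-1 < qa alpha * N%:R.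
    by rewrite mulrC -ltr_pdivrMr//; exact: truncnS_gt.
  have : (1 + qa alpha * N%:R)^-1 < a - I01_val x.
    rewrite -[ltRHS]invrK ltf_pV2 ?posrE ?invr_gt0//.
    by apply: lt_trans hN _; rewrite ltrDr.
  by lra.
have /fine_cvgP[_ cE] : nu \o E @ \oo --> (0%R)%:E.
  have -> : (0%R)%:E = nu (\bigcap_m E m) by rewrite E0 measure0.
  apply: nonincreasing_cvg_mu => //.
  - by rewrite -ge0_fin_numE// fin_num_measure.
  - by rewrite E0.
  - apply/nonincreasing_seqP => n; rewrite subsetEset => x /andP[h xa]; apply/andP; split=> //.
    apply: le_trans h; rewrite lerD2l lerN2 lef_pV2 ?posrE// lerD2l.
    by rewrite ler_wpM2l ?ler_nat// ltW.
have /cvgrPdist_le/(_ _ e0)[N _ /(_ N (leqnn _))/= hN] := cE.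
exists N, (fun w => I01_val (brw w x1) < a).
apply: (@le_trans _ _ (nu (E N))); last first.
  by rewrite prob_fin// lee_fin; move: hN; rewrite sub0r normrN; exact/le_trans/ler_norm.
apply: le_measure; rewrite ?inE//.
  by apply: measurable_sd => //; exact: (measurable_itin _ (fun w => I01_val (brw w x1) < a)).
have mono w (x y : T) : I01_val x <= I01_val y -> I01_val (brw w x) <= I01_val (brw w y).
  elim: w => //= i w IH /IH h.
  by rewrite -(Fmap_le a01) ?I01_ge0// !(brE a01) lerD2r.
move=> x; rewrite /sd/E/=.
have xw : I01_val x <= I01_val (brw (itin N x) x1).
  by rewrite -{1}(brw_itin N x) mono// I01_le1.
case=> [[xa /negP]|[wa xa]]; last by exfalso; apply: xa; exact: le_lt_trans wa.
rewrite -leNgt => aw; rewrite xa andbT lerBlDr -lerBlDl.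
have := da_brw a01 (itin N x) x1 (iter N f x).
rewrite size_itin brw_itin => /(le_trans (dist_le_da a01 _ _)).
by move=> /(le_trans (ler_norm _)); lra.
Qed.

(** The digit partition is generating: rays generate the Borel sets and are approximable. *)
Lemma approx_measurable (A : set T) : measurable A -> approx A.
Proof.
move=> /measurable_I01P[B mB ->].
have : (@RGenInftyO.G R).-sigma.-measurable `<=`
    [set B : set R | approx (@I01_val R @^-1` B)].
  apply: smallest_sub.
    split => [|C hC|F hF]; rewrite /=.
    - by rewrite preimage_set0; exact: approx0.
    - by rewrite setTD preimage_setC; exact: approxC.
    - by rewrite preimage_bigcup; exact: approx_bigcup.
  move=> _ [a ->]/=; rewrite (_ : _ @^-1` _ = [set x : T | I01_val x < a]).
    exact: approx_ray.
  by apply/seteqP; split => x; rewrite /= in_itv.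
by apply; rewrite -RGenInftyO.measurableE.
Qed.

(* The point of the itinerary determines the index of the cell with small error. *)
Lemma approx_index k (idx : T -> 'I_k) (e : R) :
  (forall i, measurable [set x | idx x = i]) -> 0 < e -> (0 < k)%N ->
  exists m0 (b : seq bool -> 'I_k), forall m, (m0 <= m)%N ->
    fine (nu [set x | idx x != b (take m0 (itin m x))]) <= e.
Proof.
move=> mi e0 k0; have ek : 0 < e / k%:R by rewrite divr_gt0 ?ltr0n.
have h (i : 'I_k) : exists p : nat * pred (seq bool),
    fine (nu (sd [set x | idx x = i] [set x | p.2 (itin p.1 x)])) <= e / k%:R.
  have [_ /(_ _ ek)[m [B hB]]] := approx_measurable (mi i).
  exists (m, B); rewrite -lee_fin -prob_fin//; apply: measurable_sd => //.
  exact: measurable_itin.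
have [p hp] := choice h.
pose m0 := (\sum_i (p i).1)%N.
have pm i : ((p i).1 <= m0)%N by rewrite /m0 (bigD1 i)//= leq_addr.
pose b w : 'I_k := if [pick i | (p i).2 (take (p i).1 w)] is Some i then i else Ordinal k0.
exists m0, b => m mm.
have mS i : measurable (sd [set x | idx x = i] [set x | (p i).2 (itin (p i).1 x)]).
  by apply: measurable_sd => //; exact: measurable_itin.
have tk i x : take (p i).1 (take m0 (itin m x)) = itin (p i).1 x.
  by rewrite take_itin// take_itin.
have sub : [set x | idx x != b (take m0 (itin m x))] `<=`
    \big[setU/set0]_(i < k) sd [set x | idx x = i] [set x | (p i).2 (itin (p i).1 x)].
  move=> x /= hx; rewrite -bigcup_seq/=; move: hx; rewrite /b.
  case: pickP => [i|/(_ (idx x))]; rewrite tk => pi.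
    by move=> /eqP ni; exists i; [rewrite /= mem_index_enum|right].
  by move=> _; exists (idx x); [rewrite /= mem_index_enum|left; split => //; rewrite /= pi].
have mb : measurable [set x | idx x != b (take m0 (itin m x))].
  rewrite (_ : [set _ | _] = ~` \big[setU/set0]_(i < k)
     ([set x | idx x = i] `&` [set x | b (take m0 (itin m x)) == i])).
    apply: measurableC; apply: bigsetU_measurable => i _; apply: measurableI => //.
    exact: (measurable_itin _ (fun w => b (take m0 w) == i)).
  apply/seteqP; split => x /=; rewrite -bigcup_seq/=.
    by move=> /eqP hx [i _ [/= e1 /eqP e2]]; apply: hx; rewrite e1 e2.
  move=> hx; apply/eqP => e1; apply: hx; exists (idx x); first by rewrite /= mem_index_enum.
  by split=> //=; rewrite -e1.
apply: (@le_trans _ _ (\sum_(i < k) e / k%:R)); last first.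
  by rewrite sumr_const card_ord -[_ *+ k]mulr_natr divfK// pnatr_eq0 -lt0n.
apply: le_trans (_ : \sum_(i < k) fine (nu (sd [set x | idx x = i]
    [set x | (p i).2 (itin (p i).1 x)])) <= _); last exact: ler_sum.
by apply: pr_sum_le => // x /sub; rewrite -bigcup_seq => -[i _ ?]; exists i.
Qed.

End itineraries.

(** * Upper bound for entropy plus integral by the growth rate of the transfer operator *)

Section entropy_bound.
Variables (R : realType) (alpha : R).
Hypothesis a01 : 0 < alpha <= 1.
Local Notation T := (I01 R).
Local Notation f := (@intermittent R alpha).
Variables (phi : T -> R) (H : R).
Hypothesis H0 : 0 <= H.
Hypothesis phi_hol : hol alpha H phi.
Variable nu : probability T R.
Hypothesis nu_inv : invariant_measure f nu.
Local Notation insup := (insup alpha phi).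
Local Notation x1 := (I01_1 R).

(** The [j]-th iterate shares [n - j + m] digits with the point used by [wsum]; the [m] surplus
    digits keep every error below [H / (1 + qa m)], even that of the last term. *)
Lemma wsum_itin n m x :
  \sum_(j < n) phi (iter j f x) - n%:R * (H * (1 + qa alpha * m%:R)^-1) <=
  wsum alpha phi n (itin alpha (n + m) x).
Proof.
have q0 := qa_gt0 a01.
have -> : n%:R * (H * (1 + qa alpha * m%:R)^-1) = \sum_(j < n) H * (1 + qa alpha * m%:R)^-1.
  by rewrite sumr_const card_ord mulr_natl.
rewrite -sumrB; apply: ler_sum => j _.
have -> : (n + m = j + (n - j + m))%N by rewrite addnA subnKC// ltnW.
rewrite drop_itin.
set w := itin _ _ _; set y := iter j f x.
have h1 := phi_hol y (brw alpha w x1).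
have h2 := da_brw a01 w (iter (n - j + m) f y) x1.
rewrite brw_itin// size_itin in h2.
have h3 : (1 + qa alpha * (n - j + m)%:R)^-1 <= (1 + qa alpha * m%:R)^-1.
  have qm i : 0 < 1 + qa alpha * i%:R by rewrite ltr_wpDr// mulr_ge0// ltW.
  by rewrite lef_pV2 ?posrE ?qm// lerD2l ler_wpM2l ?(ltW q0)// ler_nat leq_addl.
have := ler_wpM2l H0 (le_trans h2 h3); have := ler_norm (phi y - phi (brw alpha w x1)).
by lra.
Qed.

Section partition.
Variables (k : nat) (idx : T -> 'I_k).
Hypothesis midx : forall i, measurable [set x | idx x = i].

Definition itidx n (x : T) : {ffun 'I_n -> 'I_k} := [ffun j : 'I_n => idx (iter j f x)].

Lemma measurable_itidx n s : measurable [set x | itidx n x = s].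
Proof.
rewrite (_ : [set _ | _] = \bigcap_(j in [set` (finset.setT : {set 'I_n})])
    (iter j f @^-1` [set x | idx x = s j])).
  apply: fin_bigcap_measurable => // j _; rewrite -[_ @^-1` _]setTI.
  exact: measurable_iter_intermittent.
apply/seteqP; split => x /= h.
  by move=> j _; rewrite /= -h ffunE.
by apply/ffunP => j; rewrite ffunE; apply: h; rewrite /= inE.
Qed.

(* A stochastic matrix close to the identity with positive entries, so that its
   logarithm is finite. *)
Definition softmatch (d : R) (i b : 'I_k) : R :=
  d / k%:R + (if i == b then 1 - d else 0).

Lemma softmatch_sum d b : (0 < k)%N -> \sum_i softmatch d i b = 1.
Proof.
move=> k0; rewrite big_split/= sumr_const card_ord -[_ *+ k]mulr_natr divfK.
  by rewrite -big_mkcond/= big_pred1_eq; ring.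
by rewrite pnatr_eq0 -lt0n.
Qed.

(** Gibbs inequality for the itinerary in the partition, with the digit word as auxiliary variable.
    The reference weights [q] give a word its Boltzmann factor and then guess the partition index
    from the digits through [softmatch]. Correct guesses cost [- ln (1 - d)] each; wrong ones cost
    [ln (k / d)] and occur with probability at most [e]. *)
Lemma shannon_bound (s d e : R) m0 (b : seq bool -> 'I_k) : insup s ->
  0 < d < 1 -> (0 < k)%N ->
  (forall m, (m0 <= m)%N -> fine (nu [set x | idx x != b (take m0 (itin alpha m x))]) <= e) ->
  forall m, (m0 <= m)%N -> exists C, forall n,
  shannon nu (itidx n) <= C + n%:R * (ln s - \int[nu]_x phi x +
     H * (1 + qa alpha * m%:R)^-1 - ln (1 - d) + ln (k%:R / d) * e).
Proof.
move=> [s0 [C hC]] /andP[d0 d1] k0 he m mm.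
have kR : (0 : R) < k%:R by rewrite ltr0n.
have dk : 0 < d / k%:R by rewrite divr_gt0.
have C0 : 0 < C by have := hC 0%N x1; rewrite expr0 mulr1; exact: lt_le_trans.
pose Cm := 2 ^+ m * C.
have Cm0 : 0 < Cm by rewrite mulr_gt0// exprn_gt0.
exists (ln Cm) => n.
pose N := (n + m)%N.
pose bj (t : seq bool) (j : nat) := b (take m0 (drop j t)).
pose Z := Cm * s ^+ n.
have Z0 : 0 < Z by rewrite mulr_gt0// exprn_gt0.
(* The normalization [Z] is 2^m C s^n: by [sum_wsum] the Boltzmann factors sum to the values of the
   n-th iterate at the 2^m base points, each at most C s^n. *)
pose q (p : {ffun 'I_n -> 'I_k} * N.-tuple bool) : R :=
  Z^-1 * expR (wsum alpha phi n p.2) * \prod_(j < n) softmatch d (p.1 j) (bj p.2 j).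
have r0 i b' : 0 < softmatch d i b'.
  by rewrite /softmatch; case: (i == b'); lra.
have q0 p : 0 < q p.
  by apply: mulr_gt0; [rewrite mulr_gt0 ?invr_gt0 ?expR_gt0|exact: prodr_gt0].
have q1 : \sum_p q p <= 1.
  rewrite -(pair_big predT predT (fun s t => q (s, t)))/= exchange_big/=.
  have -> : \sum_(t : N.-tuple bool) \sum_(i : {ffun 'I_n -> 'I_k}) q (i, t) =
      Z^-1 * \sum_(t : N.-tuple bool) expR (wsum alpha phi n t) * 1.
    rewrite mulr_sumr; apply: eq_bigr => t _; rewrite /q/= -mulr_sumr mulr1.
    rewrite -(bigA_distr_bigA (fun (j : 'I_n) i => softmatch d i (bj t j)))/=.
    by rewrite big1 ?mulr1// => j _; exact: softmatch_sum.
  rewrite ler_pdivrMl// mulr1 (sum_wsum alpha phi n m (fun=> 1)).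
  apply: le_trans (_ : \sum_(t : m.-tuple bool) C * s ^+ n <= _).
    by apply: ler_sum => t _; exact: hC.
  rewrite sumr_const card_tuple card_bool -mulr_natl natrX /Z /Cm.
  by rewrite mulrA.
have hgibbs := gibbs_inequality nu (@measurable_itidx n) (@measurable_itint _ _ a01 N) q0 q1.
apply: le_trans hgibbs _.
have lnq x : - ln (q (itidx n x, itint alpha N x)) = ln Cm + n%:R * ln s -
   wsum alpha phi n (itin alpha N x) + \sum_(j < n)
     - ln (softmatch d (idx (iter j f x)) (b (take m0 (itin alpha m (iter j f x))))).
  rewrite /q/= lnM ?posrE ?mulr_gt0 ?invr_gt0 ?expR_gt0//; last exact: prodr_gt0.
  rewrite lnM ?posrE ?invr_gt0 ?expR_gt0// lnV ?posrE// expRK /Z lnM ?posrE ?exprn_gt0//.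
  rewrite lnXn// -mulr_natl sumrN.
  have -> : ln (\prod_(j < n) softmatch d (itidx n x j) (bj (itin alpha N x) j)) =
      \sum_(j < n) ln (softmatch d (idx (iter j f x)) (b (take m0 (itin alpha m (iter j f x))))).
    have lnp (I : Type) (r : seq I) (F : I -> R) : (forall i, 0 < F i) ->
        ln (\prod_(i <- r) F i) = \sum_(i <- r) ln (F i).
      move=> F0; elim: r => [|i r IH]; first by rewrite !big_nil ln1.
      by rewrite !big_cons lnM ?posrE ?prodr_gt0// IH.
    rewrite lnp => [|j]; last exact: r0.
    apply: eq_bigr => j _; rewrite ffunE; congr (ln (softmatch _ _ _)).
    rewrite /bj /N.
    have -> : (n + m = j + (n - j + m))%N by rewrite addnA subnKC// ltnW.
    by rewrite drop_itin !take_itin// (leq_trans mm)// leq_addl.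
  by ring.
pose g x : R := - ln (softmatch d (idx x) (b (take m0 (itin alpha m x)))).
pose bad := [set x | idx x != b (take m0 (itin alpha m x))].
have mbad : measurable bad.
  rewrite (_ : bad = ~` \big[setU/set0]_(i < k)
     ([set x | idx x = i] `&` [set x | b (take m0 (itin alpha m x)) == i])).
    apply: measurableC; apply: bigsetU_measurable => i _; apply: measurableI => //.
    exact: (measurable_itin a01 _ (fun w => b (take m0 w) == i)).
  apply/seteqP; split => x; rewrite /bad/= -bigcup_seq/=.
    by move=> /eqP hx [i _ [/= e1 /eqP e2]]; apply: hx; rewrite e1 e2.
  move=> hx; apply/eqP => e1; apply: hx; exists (idx x); first by rewrite /= mem_index_enum.
  by split=> //=; rewrite -e1.
have bg : bm g.
  have := bm_finite_valued (X := fun x => (idx x, itint alpha m x))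
    (measurable_pair_valued midx (@measurable_itint _ _ a01 m))
    (fun p => - ln (softmatch d p.1 (b (take m0 p.2)))).
  exact.
have Ig : \int[nu]_x g x <= - ln (1 - d) + ln (k%:R / d) * e.
  have kd : 1 <= k%:R / d.
    rewrite ler_pdivlMr// mul1r; apply: le_trans (ltW d1) _; by rewrite ler1n.
  apply: le_trans (_ : \int[nu]_x (- ln (1 - d) + ln (k%:R / d) * \1_bad x) <= _).
    apply: Rint_le => //; first by apply: bmD; [exact: bm_cst|apply: bmZ; exact: bm_indic].
    have hd : ln (1 - d) <= 0 by apply: ln_le0; lra.
    move=> x; rewrite /g indicE /softmatch; have [/eqP e1|e1] := boolP (idx x == _).
      rewrite memNset ?mulr0 ?addr0; last by rewrite /bad/= e1 eqxx.
      by rewrite lerN2 ler_ln ?posrE; lra.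
    rewrite mem_set// mulr1 addr0 -[d / _]invrK invf_div lnV ?posrE ?divr_gt0//; lra.
  rewrite RintD; [|exact: bm_cst|by apply: bmZ; exact: bm_indic].
  rewrite Rint_cst RintZ ?Rint_indic//; last exact: bm_indic.
  by rewrite lerD2l ler_wpM2l ?ln_ge0//; exact: he.
have bphi : bm phi by exact: bm_hol phi_hol.
have biter (h : T -> R) j : bm h -> bm (fun x => h (iter j f x)).
  by move=> bh; apply: bm_comp => //; exact: measurable_iter_intermittent.
have bw : bm (fun x => wsum alpha phi n (itin alpha N x)).
  exact: (bm_finite_valued (@measurable_itint _ _ a01 N) (fun t => wsum alpha phi n t)).
have bS : bm (fun x => \sum_(j < n) phi (iter j f x)) by apply: bm_sum => j; exact: biter.
have bG : bm (fun x => \sum_(j < n) g (iter j f x)) by apply: bm_sum => j; exact: biter.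
rewrite -mulN1r -RintZ; last first.
  have := bm_finite_valued (measurable_pair_valued (@measurable_itidx n) (@measurable_itint _ _ a01 N))
    (fun p => ln (q p)).
  exact.
under eq_Rintegral do rewrite mulN1r lnq.
rewrite RintD; [|by apply: bmB => //; exact: bm_cst|exact: bG].
rewrite RintB//; last exact: bm_cst.
rewrite Rint_cst.
have -> : \int[nu]_x (\sum_(j < n) g (iter j f x)) = n%:R * \int[nu]_x g x.
  rewrite Rint_sum => [|j]; last exact: biter.
  under eq_bigr do rewrite (Rint_iter_invariant a01 nu_inv)//.
  by rewrite sumr_const card_ord mulr_natl.
have hw : n%:R * \int[nu]_x phi x - n%:R * (H * (1 + qa alpha * m%:R)^-1) <=
    \int[nu]_x wsum alpha phi n (itin alpha N x).
  have -> : n%:R * \int[nu]_x phi x = \int[nu]_x (\sum_(j < n) phi (iter j f x)).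
    rewrite Rint_sum => [|j]; last exact: biter.
    under eq_bigr do rewrite (Rint_iter_invariant a01 nu_inv)//.
    by rewrite sumr_const card_ord mulr_natl.
  rewrite -[X in _ - X](Rint_cst nu) -RintB//; last exact: bm_cst.
  apply: Rint_le => //; first by apply: bmB => //; exact: bm_cst.
  by move=> x; exact: wsum_itin.
have := ler_wpM2l (ler0n R n) Ig; rewrite /= in hw *; lra.
Qed.

Lemma shannon_growth (s e : R) : insup s -> 0 < e -> (0 < k)%N -> exists C, forall n,
  shannon nu (itidx n) <= C + n%:R * (ln s - \int[nu]_x phi x + e).
Proof.
move=> hs e0 k0; have q0 := qa_gt0 a01.
(* The three errors get a third of [e] each: [d] makes the cost of a correct guess equal to it, then
   [e'] controls the wrong guesses, and finally [m] the Hoelder error. *)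
pose d := 1 - expR (- (e / 3)).
have d01 : 0 < d < 1.
  by rewrite subr_gt0 expR_lt1 gtrBl expR_gt0 oppr_lt0 divr_gt0.
have [d0 d1] := andP d01.
have kd : 0 <= ln (k%:R / d).
  rewrite ln_ge0// ler_pdivlMr// mul1r (le_trans (ltW d1))// ler1n//.
pose e' := e / (3 * (ln (k%:R / d) + 1)).
have l1 : 0 < ln (k%:R / d) + 1 by rewrite ltr_wpDl.
have e'0 : 0 < e' by rewrite divr_gt0// mulr_gt0.
have [m0 [b hb]] := approx_index a01 nu midx e'0 k0.
pose m := (m0 + (Num.truncn (3 * H / (e * qa alpha))).+1)%N.
have [C hC] := shannon_bound hs d01 k0 hb (leq_addr _ _ : (m0 <= m)%N).
exists C => n; apply: le_trans (hC n) _; rewrite lerD2l ler_wpM2l//.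
have h1 : ln (1 - d) = - (e / 3) by rewrite /d opprB addrCA subrr addr0 expRK.
have h2 : ln (k%:R / d) * e' <= e / 3.
  have -> : e / 3 = (ln (k%:R / d) + 1) * e' by rewrite /e'; field; rewrite gt_eqF.
  by rewrite ler_wpM2r ?(ltW e'0)// lerDl.
have h3 : H * (1 + qa alpha * m%:R)^-1 <= e / 3.
  have qm : 0 < 1 + qa alpha * m%:R by rewrite ltr_wpDr// mulr_ge0// ltW.
  rewrite ler_pdivrMr//.
  have : 3 * H / (e * qa alpha) <= m%:R.
    apply: le_trans (ltW (truncnS_gt _)) _.
    by rewrite ler_nat leq_addl.
  have eq0 : 0 < e * qa alpha by rewrite mulr_gt0.
  by rewrite ler_pdivrMr//; lra.
by rewrite h1; lra.
Qed.

End partition.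

Lemma shannon_ge0 (A : finType) (X : T -> A) :
  (forall a, measurable [set x | X x = a]) -> 0 <= shannon nu X.
Proof.
move=> mX; rewrite /shannon oppr_ge0; apply: sumr_le0 => a _.
rewrite mulr_ge0_le0 ?prob_ge0// ln_le0//.
rewrite -(_ : fine (nu setT) = 1); first by apply: prob_le.
by rewrite probability_setT.
Qed.

Lemma entropy_le (s : R) : insup s ->
  (entropy f nu + (\int[nu]_x phi x)%:E <= (ln s)%:E)%E.
Proof.
move=> hs; rewrite -leeBrDr// -EFinB; apply: ub_ereal_sup => _ [k [xi [[mxi txi cxi] ->]]].
rewrite lee_fin.
have ex x : exists i, xi i x by have : [set: T] x by []; rewrite -cxi => -[i _ ?]; exists i.
have [idx hidx] := choice ex.
have uniq i x : xi i x -> idx x = i.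
  by move=> xix; apply: (txi _ _ I I); exists x.
have E i : [set x | idx x = i] = xi i.
  by apply/seteqP; split => x /=; [move=> <-|exact: uniq].
have midx i : measurable [set x | idx x = i] by rewrite E.
have k0 : (0 < k)%N by exact: leq_ltn_trans (leq0n _) (ltn_ord (idx (I01_0 R))).
have jE n : join_entropy f nu xi n = shannon nu (itidx idx n).
  rewrite /join_entropy /shannon; congr (- _); apply: eq_bigr => u _.
  suff -> : join_cell f xi u = [set x | itidx idx n x = u] by [].
  apply/seteqP; split => x /= h.
    by apply/ffunP => j; rewrite ffunE; exact: uniq.
  by move=> j; rewrite -h ffunE.
set l := ln s - \int[nu]_x phi x.
have hn n : 0 <= join_entropy f nu xi n.
  by rewrite jE; apply: shannon_ge0 => u; exact: measurable_itidx.
have near_le (e : R) : 0 < e -> \forall n \near \oo, join_entropy f nu xi n / n%:R <= l + e.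
  move=> e0; have e2 : 0 < e / 2 by rewrite divr_gt0.
  have [C hC] := shannon_growth midx hs e2 k0.
  near=> n; have n0 : (0 : R) < n%:R by rewrite ltr0n; near: n; exact: nbhs_infty_gt.
  rewrite ler_pdivrMr// jE; apply: le_trans (hC n) _.
  have : C <= n%:R * (e / 2).
    rewrite -ler_pdivrMr//; near: n; exact: nbhs_infty_ger.
  by rewrite -/l; lra.
(* This covers the case of a divergent sequence, for which [lim] is the default value 0. *)
have l0 : 0 <= l.
  apply/ler_addgt0Pr => e e0; have [N _ /(_ N.+1 (leqnSn N))/=] := near_le e e0.
  by apply: le_trans; rewrite divr_ge0.
rewrite /partition_entropy; have [cv|ncv] := pselect (cvg (join_entropy f nu xi n / n%:R @[n --> \oo])).
  by apply/ler_addgt0Pr => e e0; apply: limr_le => //; exact: near_le.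
by rewrite dvgP.
Unshelve. all: by end_near. Qed.

End entropy_bound.

(** * Spectral gap *)

Section spectral_gap.
Variables (R : realType) (alpha : R).
Hypothesis a01 : 0 < alpha <= 1.
Local Notation T := (I01 R).
Local Notation br := (br alpha).
Local Notation da := (da alpha).
Local Notation hol := (hol alpha).
Local Notation x0 := (I01_0 R).

Definition eigenpair (phi g : T -> R) (l : R) : Prop :=
  [/\ 0 < l, exists c M, 0 < c /\ forall x, c <= g x <= M, exists B, hol B g,
      exists H, hol H phi & forall x, tr alpha phi g x = l * g x].

Variables (phi g : T -> R) (l : R).
Hypothesis ep : eigenpair phi g l.

Let l0 : 0 < l. Proof. by case: ep. Qed.

Definition weight (i : bool) (x : T) : R := expR (phi (br i x)) * g (br i x) / (l * g x).

(** Conjugate of the transfer operator, [tr (g h) / (l g)]; it fixes constants by [weight_sum]. *)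
Definition markov_op (h : T -> R) (x : T) : R :=
  weight false x * h (br false x) + weight true x * h (br true x).

Local Notation M := markov_op.

Lemma eigen_gt0 x : 0 < g x.
Proof. by case: ep => _ [c [b [c0 /(_ x)/andP[h _]]]] _ _ _; exact: lt_le_trans h. Qed.

Lemma weight_gt0 i x : 0 < weight i x.
Proof. by rewrite divr_gt0 ?mulr_gt0 ?expR_gt0 ?eigen_gt0. Qed.

Lemma weight_sum x : weight false x + weight true x = 1.
Proof.
rewrite /weight -mulrDl; case: ep => _ _ _ _ /(_ x); rewrite /tr /brop => ->.
by rewrite divff// mulf_neq0// gt_eqF// eigen_gt0.
Qed.

Lemma weight_ge : exists d, 0 < d <= 2^-1 /\ forall i x, d <= weight i x.
Proof.
case: ep => _ [c [b [c0 hb]]] _ [H hH] _.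
have H0 := hol_ge0 hH.
have b0 : 0 < b by have /andP[h1 h2] := hb x0; apply: lt_le_trans c0 (le_trans h1 h2).
pose e := expR (phi x0 - H) * c / (l * b).
have e0 : 0 < e by rewrite divr_gt0 ?mulr_gt0 ?expR_gt0.
exists (Num.min e 2^-1); split.
  by rewrite lt_min e0 invr_gt0 ltr0n ge_min lexx orbT.
move=> i x; rewrite ge_min; apply/orP; left; rewrite /e /weight.
apply: ler_pM; rewrite ?mulr_ge0 ?invr_ge0 ?mulr_ge0 ?expR_ge0 ?(ltW c0) ?(ltW b0) ?(ltW l0)//.
  apply: ler_pM; rewrite ?expR_ge0 ?(ltW c0)//.
    by rewrite ler_expR (phi_ge a01 H0 hH).
  by case/andP: (hb (br i x)).
rewrite lef_pV2 ?posrE ?mulr_gt0 ?eigen_gt0// ler_wpM2l ?(ltW l0)//.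
by case/andP: (hb x).
Qed.

Lemma holM A B a b (h h' : T -> R) : hol A h -> (forall x, `|h x| <= a) ->
  hol B h' -> (forall x, `|h' x| <= b) -> hol (A * b + a * B) (fun x => h x * h' x).
Proof.
move=> hA ha hB hb x y.
have -> : h x * h' x - h y * h' y = (h x - h y) * h' x + h y * (h' x - h' y) by ring.
apply: le_trans (ler_normD _ _) _; rewrite !normrM mulrDl.
have -> : A * b * da x y = A * da x y * b by ring.
have -> : a * B * da x y = a * (B * da x y) by ring.
by apply: lerD; apply: ler_pM.
Qed.

Lemma holD A B (h h' : T -> R) : hol A h -> hol B h' -> hol (A + B) (fun x => h x + h' x).
Proof.
move=> hA hB x y; rewrite opprD addrACA mulrDl; apply: le_trans (ler_normD _ _) _.
exact: lerD.
Qed.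

Lemma holZ A (c : R) (h : T -> R) : hol A h -> hol (`|c| * A) (fun x => c * h x).
Proof. by move=> hA x y; rewrite -mulrBr normrM -mulrA ler_wpM2l. Qed.

Lemma hol_cst (c : R) : hol 0 (fun=> c).
Proof. by move=> x y; rewrite subrr normr0 mul0r. Qed.

Lemma hol_le A B (h : T -> R) : hol A h -> A <= B -> hol B h.
Proof. by move=> hA AB x y; apply: le_trans (hA x y) _; rewrite ler_wpM2r ?da_ge0. Qed.

Lemma hol_inv A c (h : T -> R) : 0 < c -> (forall x, c <= h x) -> hol A h ->
  hol (A / c ^+ 2) (fun x => (h x)^-1).
Proof.
move=> c0 hc hA x y.
have hx := lt_le_trans c0 (hc x); have hy := lt_le_trans c0 (hc y).
have -> : (h x)^-1 - (h y)^-1 = (h y - h x) / (h x * h y) by field; rewrite !gt_eqF.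
rewrite normrM mulrAC ler_pM//.
  by rewrite distrC.
rewrite ger0_norm ?invr_ge0 ?mulr_ge0 ?(ltW hx) ?(ltW hy)//.
by rewrite lef_pV2 ?posrE ?exprn_gt0 ?mulr_gt0// expr2 ler_pM// ltW.
Qed.

Lemma hol_br A i (h : T -> R) : 0 <= A -> hol A h -> hol A (fun x => h (br i x)).
Proof. by move=> A0 hA x y; apply: le_trans (hA _ _) _; rewrite ler_wpM2l// da_br_le. Qed.

Lemma weight_hol : exists C, 0 <= C /\ forall i, hol C (weight i).
Proof.
case: ep => _ [c [b [c0 hb]]] [B hB] [H hH] _.
have H0 := hol_ge0 hH; have B0 := hol_ge0 hB.
have e1 i : hol (expR (phi x0 + H) * (H * 1 + 0)) (brop alpha phi i (fun=> 1)).
  apply: brop_hol => // [x _|x y]; first by rewrite normr1.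
  by rewrite subrr normr0 mul0r.
have b1 i x : `|brop alpha phi i (fun=> 1) x| <= expR (phi x0 + H).
  by rewrite /brop mulr1 ger0_norm ?expR_ge0// (expR_phi_le a01 H0 hH).
have e2 i := hol_br i B0 hB.
have gb x : `|g x| <= b.
  by rewrite ger0_norm ?(ltW (eigen_gt0 x))//; case/andP: (hb x).
have e3 i := holM (e1 i) (b1 i) (e2 i) (fun x => gb (br i x)).
have e4 := hol_inv (mulr_gt0 l0 c0) (fun x => ler_wpM2l (ltW l0) (proj1 (andP (hb x)))) (holZ l hB).
pose A1 := expR (phi x0 + H) * (H * 1 + 0) * b + expR (phi x0 + H) * B.
have b3 i x : `|brop alpha phi i (fun=> 1) x * g (br i x)| <= expR (phi x0 + H) * b.
  by rewrite normrM ler_pM.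
have b4 x : `|(l * g x)^-1| <= (l * c)^-1.
  rewrite ger0_norm ?invr_ge0 ?mulr_ge0 ?(ltW l0) ?(ltW (eigen_gt0 x))//.
  rewrite lef_pV2 ?posrE ?mulr_gt0 ?eigen_gt0// ler_wpM2l ?(ltW l0)//.
  by case/andP: (hb x).
have e5 i := holM (e3 i) (b3 i) e4 b4.
exists (A1 * (l * c)^-1 + expR (phi x0 + H) * b * (`|l| * B / (l * c) ^+ 2)); split.
  exact: hol_ge0 (e5 true).
by move=> i x y; have := e5 i x y; rewrite /brop/= ![expR _ * 1]mulr1.
Qed.

Definition osc (w : R) (h : T -> R) := forall x y, `|h x - h y| <= w.

Lemma hol_osc A h : hol A h -> osc A h.
Proof.
move=> hA x y; apply: le_trans (hA x y) _.
by rewrite ler_piMr ?da_le1//; exact: hol_ge0 hA.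
Qed.

(** Two combinations of equal mass [s] of values pairwise within [w] are compared through an extreme
    value of the second pair. The mass is 1 for the full Markov operator and [1 - d] once a common
    part has been split off. *)
Lemma convex_osc (p0 p1 q0 q1 s u0 u1 v0 v1 w : R) :
  0 <= p0 -> 0 <= p1 -> 0 <= q0 -> 0 <= q1 -> p0 + p1 = s -> q0 + q1 = s ->
  `|u0 - v0| <= w -> `|u0 - v1| <= w -> `|u1 - v0| <= w -> `|u1 - v1| <= w ->
  `|p0 * u0 + p1 * u1 - (q0 * v0 + q1 * v1)| <= s * w.
Proof.
move=> P0 P1 Q0 Q1 hp hq /ler_normlP[a1 a2] /ler_normlP[b1 b2] /ler_normlP[c1 c2]
  /ler_normlP[d1 d2].
have up : forall u v z : R, u <= z -> v <= z -> p0 * u + p1 * v <= s * z.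
  by move=> u v z uz vz; rewrite -hp mulrDl lerD// ler_wpM2l.
have lo : forall u v z : R, z <= u -> z <= v -> s * z <= q0 * u + q1 * v.
  by move=> u v z uz vz; rewrite -hq mulrDl lerD// ler_wpM2l.
have up' : forall u v z : R, u <= z -> v <= z -> q0 * u + q1 * v <= s * z.
  by move=> u v z uz vz; rewrite -hq mulrDl lerD// ler_wpM2l.
have lo' : forall u v z : R, z <= u -> z <= v -> s * z <= p0 * u + p1 * v.
  by move=> u v z uz vz; rewrite -hp mulrDl lerD// ler_wpM2l.
apply/ler_normlP; split; [have [vv|vv] := leP v0 v1|have [vv|vv] := leP v0 v1].
- have := up' v0 v1 v1 vv (lexx _); have := lo' u0 u1 (v1 - w) ltac:(lra) ltac:(lra).
  by rewrite mulrBr; lra.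
- have := up' v0 v1 v0 (lexx _) (ltW vv); have := lo' u0 u1 (v0 - w) ltac:(lra) ltac:(lra).
  by rewrite mulrBr; lra.
- have := lo v0 v1 v0 (lexx _) vv; have := up u0 u1 (v0 + w) ltac:(lra) ltac:(lra).
  by rewrite mulrDr; lra.
- have := lo v0 v1 v1 (ltW vv) (lexx _); have := up u0 u1 (v1 + w) ltac:(lra) ltac:(lra).
  by rewrite mulrDr; lra.
Qed.

Lemma markov_osc w h : osc w h -> osc w (M h).
Proof.
move=> hO x y; rewrite -[w]mul1r.
by apply: convex_osc; rewrite ?weight_sum ?(ltW (weight_gt0 _ _)).
Qed.

Lemma iter_markov_osc n w h : osc w h -> osc w (iter n M h).
Proof. by move=> hO; elim: n => //= n IH; exact: markov_osc. Qed.

Lemma iter_markov_near n w h x y : osc w h -> `|iter n M h x - h y| <= w.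
Proof.
move=> hO; elim: n x => [|n IH] x; first exact: hO.
have -> : h y = weight false x * h y + weight true x * h y by rewrite -mulrDl weight_sum mul1r.
rewrite -[w]mul1r iterS.
by apply: convex_osc; rewrite ?weight_sum ?(ltW (weight_gt0 _ _)).
Qed.

(** Doeblin-Fortet inequality. Only the right branch contracts uniformly, but its weight is at least
    [d], whence [th = 1 - d (1 - kappa)]. The variation of the weights meets only the oscillation of
    [h]: their sum is 1, so the constant [h x0] may be subtracted. *)
Lemma markov_hol : exists th K, [/\ 0 < th < 1, 0 < K &
  forall A w h, hol A h -> osc w h -> hol (th * A + K * w) (M h)].
Proof.
have [d [/andP[d0 d2] hd]] := weight_ge; have [C [C0 hC]] := weight_hol.
have k0 := kappa_gt0 a01; have k1 := kappa_lt1 a01.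
exists (1 - d * (1 - kappa alpha)), (2 * C + 1); split=> //.
- by nra.
- by lra.
move=> A w h hA hO x y.
have A0 := hol_ge0 hA; have O0 : 0 <= w := le_trans (normr_ge0 _) (hO x0 x0).
have D0 := da_ge0 alpha x y.
have -> : M h x - M h y = (weight false x * (h (br false x) - h (br false y)) +
    weight true x * (h (br true x) - h (br true y))) +
    ((weight false x - weight false y) * (h (br false y) - h x0) +
     (weight true x - weight true y) * (h (br true y) - h x0)).
  rewrite /markov_op; have := weight_sum x; have := weight_sum y.
  set a := weight false x; set b := weight true x.
  set a' := weight false y; set b' := weight true y => e1 e2.
  have -> : b = 1 - a by lra. have -> : b' = 1 - a' by lra. ring.
have e1 : `|weight false x * (h (br false x) - h (br false y)) +
    weight true x * (h (br true x) - h (br true y))| <=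
    (1 - d * (1 - kappa alpha)) * A * da x y.
  apply: le_trans (ler_normD _ _) _; rewrite (normrM (weight false x)) (normrM (weight true x)).
  rewrite !(ger0_norm (ltW (weight_gt0 _ x))).
  have f1 : `|h (br false x) - h (br false y)| <= A * da x y.
    by apply: le_trans (hA _ _) _; rewrite ler_wpM2l// da_br_le.
  have f2 : `|h (br true x) - h (br true y)| <= kappa alpha * (A * da x y).
    by apply: le_trans (hA _ _) _; rewrite mulrCA ler_wpM2l// da_br1.
  have ws := weight_sum x; have dw := hd true x.
  have w0 := weight_gt0 false x; have w1 := weight_gt0 true x.
  apply: le_trans (lerD (ler_wpM2l (ltW w0) f1) (ler_wpM2l (ltW w1) f2)) _.
  set t := A * da x y; have t0 : 0 <= t by rewrite mulr_ge0.
  rewrite -mulrA -/t.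
  have -> : weight false x = 1 - weight true x by lra.
  have : d * ((1 - kappa alpha) * t) <= weight true x * ((1 - kappa alpha) * t).
    by rewrite ler_wpM2r// mulr_ge0// subr_ge0 ltW.
  by lra.
have e2 i : `|(weight i x - weight i y) * (h (br i y) - h x0)| <= C * da x y * w.
  by rewrite (normrM (weight i x - weight i y)) ler_pM//; exact: hC.
apply: le_trans (ler_normD _ _) _.
have := ler_normD ((weight false x - weight false y) * (h (br false y) - h x0))
     ((weight true x - weight true y) * (h (br true y) - h x0)).
have := e2 false; have := e2 true; rewrite mulrDl.
have : 0 <= w * da x y by rewrite mulr_ge0.
by lra.
Qed.

(** A coupling: at each step mass [d] of the right branch is moved jointly for [x] and [y]. With
    weight [d ^+ n] both follow the right branch [n] times and come within [kappa ^+ n]; the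
    remaining mass is bounded by the oscillation. *)
Lemma markov_osc_hol : exists2 d, 0 < d <= 2^-1 & forall n A w h, hol A h -> osc w h ->
  forall x y, `|iter n M h x - iter n M h y| <=
    (1 - d ^+ n) * w + d ^+ n * (kappa alpha ^+ n * A * da x y).
Proof.
have [d [d01 hd]] := weight_ge; have [d0 d2] := andP d01.
exists d => // n A w h hA hO.
have A0 := hol_ge0 hA; have k0 := kappa_gt0 a01.
elim: n => [|n IH] x y.
  by rewrite !expr0 subrr mul0r add0r !mul1r; exact: hA.
set u := iter n M h in IH *.
have uO : osc w u by exact: iter_markov_osc.
rewrite !iterS -/u.
have -> : M u x - M u y = d * (u (br true x) - u (br true y)) +
   ((weight false x * u (br false x) + (weight true x - d) * u (br true x)) -
    (weight false y * u (br false y) + (weight true y - d) * u (br true y))).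
  by rewrite /markov_op; ring.
apply: le_trans (ler_normD _ _) _; rewrite normrM (gtr0_norm d0).
have e1 : `|(weight false x * u (br false x) + (weight true x - d) * u (br true x)) -
    (weight false y * u (br false y) + (weight true y - d) * u (br true y))| <= (1 - d) * w.
  have ws z : weight false z + (weight true z - d) = 1 - d by rewrite addrA weight_sum.
  apply: convex_osc; [exact/ltW/weight_gt0|rewrite subr_ge0; exact: hd|exact/ltW/weight_gt0
    |rewrite subr_ge0; exact: hd|exact: ws|exact: ws|exact: uO|exact: uO|exact: uO|exact: uO].
have e2 := IH (br true x) (br true y).
have e3 : kappa alpha ^+ n * A * da (br true x) (br true y) <= kappa alpha ^+ n.+1 * A * da x y.
  rewrite exprSr -!mulrA ler_wpM2l ?exprn_ge0 ?(ltW k0)//.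
  by rewrite mulrCA ler_wpM2l// da_br1.
have e4 : d ^+ n * (kappa alpha ^+ n * A * da (br true x) (br true y)) <=
    d ^+ n * (kappa alpha ^+ n.+1 * A * da x y).
  by rewrite ler_wpM2l// exprn_ge0// ltW.
rewrite exprS; have := ler_wpM2l (ltW d0) (le_trans e2 (lerD (lexx _) e4)); lra.
Qed.

(* A weighted sum of the oscillation and of the Hoelder constant contracts. *)
Lemma markov_gap : exists K r : R, [/\ 0 < K, 0 < r < 1 &
  forall A h, hol A h -> forall n, hol (K * r ^+ n * A) (iter n M h)].
Proof.
have [th [K0 [/andP[t0 t1] K00 hM]]] := markov_hol.
have [d /andP[d0 d2] hO] := markov_osc_hol.
have k0 := kappa_gt0 a01; have k1 := kappa_lt1 a01.
pose K3 := K0 / (1 - th).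
have K30 : 0 < K3 by rewrite divr_gt0 // subr_gt0.
have K3E : th * K3 + K0 = K3 by rewrite /K3; field; rewrite subr_eq0 gt_eqF.
have hMn n A w h : hol A h -> osc w h -> hol (th ^+ n * A + K3 * w) (iter n M h).
  move=> hA ho; have O0 : 0 <= w := le_trans (normr_ge0 _) (ho x0 x0).
  elim: n => [|n IH].
    by rewrite expr0 mul1r; apply: hol_le hA _; rewrite lerDl mulr_ge0// ltW.
  rewrite iterS; apply: hol_le (hM _ _ _ IH (iter_markov_osc n ho)) _.
  by rewrite exprS -{2}K3E mulrDr; lra.
have [N1 hN1] : exists n, kappa alpha ^+ n <= (8 * K3)^-1.
  by apply: expr_small; rewrite ?(ltW k0)// invr_gt0 mulr_gt0.
have [N2 hN2] : exists n, th ^+ n <= 2^-1 by apply: expr_small; rewrite ?(ltW t0)// invr_gt0.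
pose N := (N1 + N2).+1.
have hk : kappa alpha ^+ N * K3 <= 8^-1.
  have : kappa alpha ^+ N <= (8 * K3)^-1.
    apply: le_trans hN1; apply: ler_wiXn2l; rewrite ?(ltW k0) ?(ltW k1)//.
    by rewrite /N ltnW// ltnS leq_addr.
  by rewrite invfM -ler_pdivlMr.
have ht : th ^+ N <= 2^-1.
  apply: le_trans hN2; apply: ler_wiXn2l; rewrite ?(ltW t0) ?(ltW t1)//.
  by rewrite /N ltnW// ltnS leq_addl.
pose dN := d ^+ N; have dN0 : 0 < dN by exact: exprn_gt0.
have dN1 : dN <= 1 by rewrite exprn_ile1// ?(ltW d0)//; lra.
(* Weight of the Hoelder constant in the combined norm w + b A. With it, the Hoelder part entering
   the new oscillation is b A / 4 and the oscillation entering the new Hoelder part costs at most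
   [dN / 2 * w], so both coefficients end below [rho]. *)
pose b := 4 * dN * kappa alpha ^+ N.
have kN0 : 0 < kappa alpha ^+ N by exact: exprn_gt0.
have b0 : 0 < b by rewrite !mulr_gt0.
pose rho := 1 - dN / 4.
have rho0 : 0 < rho by rewrite /rho; lra.
have step A w h : hol A h -> osc w h -> 0 <= A -> 0 <= w -> exists A' w',
    [/\ hol A' (iter N M h), osc w' (iter N M h), 0 <= A', 0 <= w' &
        w' + b * A' <= rho * (w + b * A)].
  move=> hA ho A0 O0; have tN0 : 0 < th ^+ N by exact: exprn_gt0.
  exists (th ^+ N * A + K3 * w), ((1 - dN) * w + dN * (kappa alpha ^+ N * A)); split.
  - exact: hMn.
  - move=> x y; apply: le_trans (hO N A w h hA ho x y) _; rewrite lerD2l.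
    rewrite ler_wpM2l ?(ltW dN0)// ler_piMr ?da_le1//.
    by rewrite mulr_ge0// ltW.
  - by rewrite addr_ge0// mulr_ge0// ltW.
  - by rewrite addr_ge0// ?mulr_ge0 ?subr_ge0// ltW.
  have e1 : b * (K3 * w) <= dN / 2 * w.
    rewrite mulrA ler_wpM2r// /b -mulrA.
    by have := ler_wpM2l (ltW dN0) hk; lra.
  have e2 : b * (th ^+ N * A) <= b * A / 2.
    by rewrite mulrCA [leRHS]mulrC ler_wpM2r// mulr_ge0// ltW.
  have e3 : dN * (kappa alpha ^+ N * A) = b * A / 4 by rewrite /b; field.
  have : 0 <= dN * w by rewrite mulr_ge0// ltW.
  have : dN * (b * A) <= b * A by rewrite ler_piMl// mulr_ge0// ltW.
  by rewrite mulrDr e3 /rho; lra.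
have stepk k A h : hol A h -> exists A' w', [/\ hol A' (iter (k * N) M h),
    osc w' (iter (k * N) M h), 0 <= A', 0 <= w' & w' + b * A' <= rho ^+ k * ((1 + b) * A)].
  move=> hA; have A0 := hol_ge0 hA; elim: k => [|k [A' [w' [h1 h2 h3 h4 h5]]]].
    exists A, A; rewrite mul0n expr0 mul1r; split => //; last by rewrite mulrDl mul1r.
    exact: hol_osc.
  have [A'' [w'' [g1 g2 g3 g4 g5]]] := step _ _ _ h1 h2 h3 h4.
  exists A'', w''; rewrite mulSn iterD; split => //.
  by rewrite exprS -mulrA; apply: le_trans g5 _; rewrite ler_wpM2l// ltW.
(* A rate per single step: by the Bernoulli inequality its N-th power is at least [rho]. *)
pose r := 1 - dN / 4 / N%:R.
have N0 : (0 : R) < N%:R by rewrite ltr0n.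
have u0 : 0 < dN / 4 / N%:R by rewrite !divr_gt0.
have u1 : dN / 4 / N%:R <= 4^-1.
  rewrite ler_pdivrMr//; have : (1 : R) <= N%:R by rewrite ler1n.
  by lra.
have r01 : 0 < r < 1 by rewrite /r; apply/andP; split; lra.
have [r0 r1] := andP r01.
have rN : rho <= r ^+ N.
  have bern m : 1 - m%:R * (dN / 4 / N%:R) <= r ^+ m.
    elim: m => [|m IH]; first by rewrite mul0r subr0 expr0.
    rewrite exprSr -natr1; have := ler_wpM2r (ltW r0) IH; apply: le_trans.
    have : 0 <= m%:R * (dN / 4 / N%:R) * (dN / 4 / N%:R) by rewrite !mulr_ge0// ltW.
    by rewrite /r; set t := dN / 4 / N%:R; lra.
  apply: le_trans (bern N).
  have -> : N%:R * (dN / 4 / N%:R) = dN / 4 by field; rewrite gt_eqF.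
  exact: lexx.
have bK : 0 < (b^-1 + K3) * (1 + b).
  by rewrite mulr_gt0 ?addr_gt0 ?invr_gt0.
exists ((b^-1 + K3) * (1 + b) * r ^- N), r; split => //.
  by rewrite mulr_gt0// invr_gt0 exprn_gt0.
move=> A h hA n; have [A' [w' [h1 h2 h3 h4 h5]]] := stepk (n %/ N)%N A h hA.
rewrite {2}(divn_eq n N) addnC iterD.
apply: hol_le (hMn _ _ _ _ h1 h2) _.
have A0 := hol_ge0 hA.
apply: le_trans (_ : (b^-1 + K3) * (w' + b * A') <= _).
  have : th ^+ (n %% N) * A' <= A' by rewrite ler_piMl// exprn_ile1// ltW.
  have -> : (b^-1 + K3) * (w' + b * A') = A' + K3 * w' + (b^-1 * w' + K3 * b * A').
    by field; rewrite gt_eqF.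
  have : 0 <= b^-1 * w' + K3 * b * A'.
    apply: addr_ge0; first by apply: mulr_ge0 h4; rewrite invr_ge0 ltW.
    by apply: mulr_ge0 h3; rewrite ltW// mulr_gt0.
  by lra.
have -> : (b^-1 + K3) * (1 + b) * r ^- N * r ^+ n * A =
   (b^-1 + K3) * (r ^- N * r ^+ n * ((1 + b) * A)) by ring.
apply: ler_wpM2l; first by rewrite addr_ge0 ?invr_ge0// ltW.
apply: le_trans h5 _; apply: ler_wpM2r; first by rewrite mulr_ge0// addr_ge0// ltW.
rewrite mulrC ler_pdivlMr ?exprn_gt0//.
apply: le_trans (_ : (r ^+ N) ^+ (n %/ N) * r ^+ N <= _).
  by rewrite ler_wpM2r ?exprn_ge0 ?(ltW r0)// lerXn2r// nnegrE ltW// exprn_gt0.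
rewrite -exprM mulnC -exprD; apply: ler_wiXn2l; rewrite ?(ltW r0) ?(ltW r1)//.
by rewrite {1}(divn_eq n N) leq_add2l ltnW// ltn_pmod.
Qed.

End spectral_gap.

(** * Measures from functionals *)

Section functionals.
Variable R : realType.
Variable alpha : R.
Hypothesis a01 : 0 < alpha <= 1.
Local Notation T := (I01 R).
Local Notation hol := (hol alpha).

Lemma Rint_cvg (nu : probability T R) (u : nat -> T -> R) (v : T -> R) (C : R) :
  (forall n, measurable_fun setT (u n)) -> (forall n x, `|u n x| <= C) -> bm v ->
  (forall x, u n x @[n --> \oo] --> v x) ->
  \int[nu]_x u n x @[n --> \oo] --> \int[nu]_x v x.
Proof.
move=> mu uC bv uv.
have bu n : bm (u n) by split; [exact: mu|exists C; exact: uC].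
have [_ _ h] := @dominated_convergence _ T R nu setT measurableT
  (fun n x => (u n x)%:E) (fun x => (v x)%:E) (fun=> C%:E)
  ltac:(by move=> n; apply/measurable_EFinP; exact: mu)
  ltac:(by apply/measurable_EFinP; case: bv)
  ltac:(by apply: aeW => x _; apply: cvg_EFin; [exact: nearW|exact: uv])
  ltac:(exact: (bm_integrable nu (bm_cst C)))
  ltac:(by apply: aeW => x n _; rewrite lee_fin).
have e w : bm w -> (\int[nu]_x (w x)%:E)%E = (\int[nu]_x w x)%:E.
  move=> bw; rewrite /Rintegral fineK//.
  exact: (integrable_fin_num measurableT (bm_integrable nu bw)).
by rewrite (e v bv) in h; exact: (fine_cvg h).
Qed.

Definition clamp (s : R) : R := if s < 0 then 0 else if s <= 1 then s else 1.

Lemma clamp_dist s t : `|clamp s - clamp t| <= `|s - t|.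
Proof.
rewrite /clamp ler_norml.
by case: (ltP s 0) => ?; case: (ltP t 0) => ?; case: (leP s 1) => ?; case: (leP t 1) => ?;
  case: (ger0P (s - t)) => ?; apply/andP; split; lra.
Qed.

Lemma clamp_le s t : s <= t -> clamp s <= clamp t.
Proof.
move=> st; rewrite /clamp.
by case: (ltP s 0) => ?; case: (ltP t 0) => ?; case: (leP s 1) => ?; case: (leP t 1) => ?; lra.
Qed.

Lemma clamp01 s : 0 <= clamp s <= 1.
Proof.
by rewrite /clamp; case: (ltP s 0) => ?; case: (leP s 1) => ?; apply/andP; split; lra.
Qed.

Lemma clampE0 s : s <= 0 -> clamp s = 0.
Proof. by move=> s0; rewrite /clamp; case: (ltP s 0) => ?; case: (leP s 1) => ?; lra. Qed.

Lemma clampE1 s : 1 <= s -> clamp s = 1.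
Proof. by move=> s0; rewrite /clamp; case: (ltP s 0) => ?; case: (leP s 1) => ?; lra. Qed.

Lemma clampE s : 0 <= s <= 1 -> clamp s = s.
Proof.
by move=> /andP[? ?]; rewrite /clamp; case: (ltP s 0) => ?; case: (leP s 1) => ?; lra.
Qed.

Definition ramp (a c : R) (x : T) : R := clamp (1 - c * (I01_val x - a)).

Lemma ramp01 a c x : 0 <= ramp a c x <= 1. Proof. exact: clamp01. Qed.

Lemma hol_ramp a c : 0 <= c -> hol c (ramp a c).
Proof.
move=> c0 x y; apply: le_trans (clamp_dist _ _) _.
have -> : 1 - c * (I01_val x - a) - (1 - c * (I01_val y - a)) =
  c * (I01_val y - I01_val x) by ring.
by rewrite normrM ger0_norm// ler_wpM2l// distrC dist_le_da.
Qed.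

Lemma ramp_le1 a c x : 0 <= c -> I01_val x <= a -> ramp a c x = 1.
Proof. by move=> c0 xa; apply: clampE1; nra. Qed.

Lemma ramp_ge0 a c x : 1 <= c * (I01_val x - a) -> ramp a c x = 0.
Proof. by move=> h; apply: clampE0; lra. Qed.

Definition below (a : R) : set T := [set x | I01_val x <= a].

Lemma measurable_below a : measurable (below a).
Proof.
have := @measurable_I01_val R measurableT `]-oo, a]%classic (measurable_itv _).
rewrite setTI; suff -> : @I01_val R @^-1` `]-oo, a]%classic = below a by [].
by apply/seteqP; split => x; rewrite /below /= in_itv.
Qed.

Lemma cvg_ramp a x : ramp a n.+1%:R x @[n --> \oo] --> (\1_(below a) x : R).
Proof.
rewrite indicE; have [xa|xa] := leP (I01_val x) a.
  rewrite mem_set//; rewrite (_ : (fun _ => _) = fun=> 1); first exact: cvg_cst.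
  by apply/funext => n; apply: ramp_le1.
rewrite memNset; last by rewrite /below/=; lra.
apply: (@cvg_near_cst _ R^o); near=> n; apply: ramp_ge0.
have d0 : 0 < I01_val x - a by rewrite subr_gt0.
rewrite -ler_pdivrMr// mul1r.
apply: le_trans (_ : n%:R <= _); last by rewrite ler_nat.
by near: n; exact: nbhs_infty_ger.
Unshelve. all: by end_near. Qed.

(* Step functions with values in a finite arithmetic progression. *)
Lemma staircase (y : R) (m : nat) : 0 <= y <= m%:R ->
  y <= \sum_(k < m) (k%:R < y)%R%:R <= y + 1.
Proof.
elim: m => [|m IH] /andP[y0 ym].
  by rewrite big_ord0; apply/andP; split; lra.
rewrite big_ord_recr/=; have [ym'|ym'] := ltP m%:R y.
  rewrite (eq_bigr (fun=> 1)) => [|k _]; last first.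
    by rewrite (lt_le_trans _ (ltW ym'))// ltr_nat.
  rewrite sumr_const card_ord; rewrite -natr1 in ym.
  by apply/andP; split; rewrite /=; lra.
have /andP[h1 h2] : y <= \sum_(k < m) (k%:R < y)%R%:R <= y + 1.
  by apply: IH; rewrite y0 ym'.
by rewrite addr0 h1.
Qed.

(** Monotone class argument, meant for the difference of two integrals. Ramps give the indicators of
    [below a], the pi-lambda theorem on half-open intervals gives all Borel sets, and staircases
    give bounded measurable functions. *)
Lemma functional_eq0 (F : (T -> R) -> R) :
  (forall u v, bm u -> bm v -> F (fun x => u x + v x) = F u + F v) ->
  (forall c u, bm u -> F (fun x => c * u x) = c * F u) ->
  (forall (u : nat -> T -> R) v C, (forall n, measurable_fun setT (u n)) ->
     (forall n x, `|u n x| <= C) -> bm v -> (forall x, u n x @[n --> \oo] --> v x) ->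
     F (u n) @[n --> \oo] --> F v) ->
  (forall A u, hol A u -> F u = 0) ->
  forall u, bm u -> F u = 0.
Proof.
move=> FD FZ Fc F0.
have F1 c : F (fun=> c) = 0 by apply: (F0 0); exact: hol_cst.
have Fsum n (v : 'I_n -> T -> R) : (forall k, bm (v k)) -> (forall k, F (v k) = 0) ->
    F (fun x => \sum_(k < n) v k x) = 0.
  elim: n v => [|n IH] v bv hv.
    by rewrite (_ : (fun _ => _) = fun=> 0)//; apply/funext => x; rewrite big_ord0.
  rewrite (_ : (fun _ => _) = fun x => \sum_(k < n) v (widen_ord (leqnSn n) k) x + v ord_max x).
    by rewrite FD ?hv ?addr0 ?IH//; apply: bm_sum.
  by apply/funext => x; rewrite big_ord_recr.
have Fcvg0 u (v : nat -> T -> R) C : (forall n, bm (v n)) ->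
    (forall n x, `|v n x| <= C) -> bm u -> (forall x, v n x @[n --> \oo] --> u x) ->
    (forall n, F (v n) = 0) -> F u = 0.
  move=> bv vC bu vu v0; have := Fc v u C (fun n => (bv n).1) vC bu vu.
  under eq_fun do rewrite v0.
  move=> h; apply/eqP; rewrite eq_le; apply/andP; split.
    exact: (ler_cvg_to h (cvg_cst (0 : R)) (nearW _ (fun=> lexx _))).
  exact: (ler_cvg_to (cvg_cst (0 : R)) h (nearW _ (fun=> lexx _))).
have Fbelow a : F (\1_(below a)) = 0.
  apply: (Fcvg0 _ (fun n => ramp a n.+1%:R) 1).
  - by move=> n; exact: bm_hol (hol_ramp _ _).
  - by move=> n x; have /andP[h1 h2] := ramp01 a n.+1%:R x; rewrite ger0_norm.
  - exact: bm_indic (measurable_below a).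
  - exact: cvg_ramp.
  - by move=> n; apply: (F0 n.+1%:R); exact: hol_ramp.
have Find (A : set T) : measurable A -> F (\1_A) = 0.
  move=> /measurable_I01P[B mB ->].
  pose v (B : set R) : set T := @I01_val R @^-1` B.
  have mv (S : set R) : measurable S -> measurable (v S).
    by move=> mS; have := @measurable_I01_val R measurableT S mS; rewrite setTI.
  apply: (@dynkin_induction _ (measurableTypeR R) (@ocitv R)
    (fun B => F (\1_(v B)) = 0)) => //.
  - exact: ocitvI.
  - rewrite (_ : \1_(v setT) = fun=> 1)//; apply/funext => x.
    by rewrite indicE mem_set.
  - move=> _ [[a b] _ <-]/=; have [ba|ab] := ltP b a.
      rewrite (_ : \1_(_) = fun=> 0)//; apply/funext => x.
      rewrite indicE memNset// /v/= in_itv/=; lra.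
    rewrite (_ : \1_(_) = fun x => \1_(below b) x + (-1) * \1_(below a) x).
      rewrite FD ?FZ ?Fbelow ?mulr0 ?addr0//; [|exact: bm_indic (measurable_below _)..|].
        exact: bm_indic (measurable_below _).
      by apply: bmZ; exact: bm_indic (measurable_below _).
    apply/funext => x; rewrite !indicE /v/= /below/= mulN1r.
    have [xa|xa] := leP (I01_val x) a.
      rewrite memNset ?mem_set//=; [lra| |].
        by apply: le_trans xa ab.
      by rewrite in_itv/=; lra.
    rewrite [in X in _ = _ - X]memNset/= ?subr0; last by lra.
    have [xb|xb] := leP (I01_val x) b; first by rewrite !mem_set//= in_itv/= xa xb.
    by rewrite !memNset//= ?in_itv/=; lra.
  - move=> S mS hS; rewrite (_ : \1_(_) = fun x => 1 + (-1) * \1_(v S) x).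
      rewrite FD ?FZ ?hS ?F1 ?mulr0 ?addr0//; [exact: bm_indic (mv _ _)|exact: bm_cst|].
      by apply: bmZ; exact: bm_indic (mv _ _).
    apply/funext => x; rewrite !indicE mulN1r.
    have [xS|xS] := boolP (x \in v S).
      by rewrite memNset ?subrr// => h; apply: h; move: xS; rewrite inE.
    by rewrite mem_set ?subr0//; move=> h; move/negP: xS; apply; rewrite inE.
  - move=> G mG tG hG.
    apply: (Fcvg0 _ (fun n x => \sum_(k < n) \1_(v (G k)) x) 1).
    + by move=> n; apply: bm_sum => k; exact: bm_indic (mv _ (mG k)).
    + move=> n x; rewrite ger0_norm ?sumr_ge0//.
      have [[k Gk]|nk] := pselect (exists k : 'I_n, G k (I01_val x)).
        rewrite (bigD1 k)//= big1 ?addr0 ?indicE ?lern1 ?leq_b1// => j jk.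
        rewrite indicE memNset// => Gj; move/eqP: jk; apply; apply: val_inj.
        by apply: (tG _ _ I I); exists (I01_val x).
      by rewrite big1// => k _; rewrite indicE memNset// => Gk; apply: nk; exists k.
    + apply: bm_indic; apply: mv; exact: bigcupT_measurable.
    + move=> x; rewrite indicE; have [xG|xG] := boolP (x \in v (\bigcup_k G k)).
        have [k _ Gk] : (\bigcup_k G k) (I01_val x) by move: xG; rewrite inE.
        apply: (@cvg_near_cst _ R^o); near=> n.
        have kn : (k < n)%N by near: n; exact: nbhs_infty_gt.
        rewrite (bigD1 (Ordinal kn))//= indicE mem_set// big1 ?addr0// => j jk.
        rewrite indicE memNset// => Gj; move/eqP: jk; apply; apply: val_inj.
        by apply: (tG _ _ I I); exists (I01_val x).
      apply: (@cvg_near_cst _ R^o); apply: nearW => n.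
      rewrite big1// => k _; rewrite indicE memNset// => Gk; move/negP: xG; apply.
      by rewrite inE; exists k.
    + by move=> n; apply: Fsum => // k; exact: bm_indic (mv _ (mG k)).
move=> u [mu [C uC]].
pose K := (Num.truncn C).+1.
have CK : C <= K%:R by apply/ltW/truncnS_gt.
pose step n k : set T := [set x | k%:R < n.+1%:R * (u x + K%:R)].
have mstep n k : measurable (step n k).
  have n0 : (0 : R) < n.+1%:R by rewrite ltr0n.
  have -> : step n k = setT `&` u @^-1` `]k%:R / n.+1%:R - K%:R, +oo[%classic.
    apply/seteqP; split => x; rewrite /step/= in_itv/= andbT ltrBlDr ltr_pdivrMr// mulrC.
      by [].
    by case.
  exact: mu.
(* Rounding of [u] up to a multiple of [1 / (n + 1)]; the shift by [K] makes the argument of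
   [staircase] nonnegative. *)
pose w n x : R := n.+1%:R^-1 * \sum_(k < (n.+1 * (2 * K))%N) \1_(step n k) x + (- K%:R).
have hw n x : u x <= w n x <= u x + n.+1%:R^-1.
  have n0 : (0 : R) < n.+1%:R by rewrite ltr0n.
  have ux := uC x; rewrite ler_norml in ux; have [u1 u2] := andP ux.
  have /staircase : 0 <= n.+1%:R * (u x + K%:R) <= (n.+1 * (2 * K))%:R.
    by rewrite !natrM ler_pM2l// mulr_ge0//=; lra.
  rewrite (eq_bigr (fun k : 'I__ => \1_(step n k) x)) => [|k _]; last first.
    rewrite indicE; case: (ltP k%:R) => h; first by rewrite mem_set.
    by rewrite memNset// /step/=; apply/negP; rewrite -leNgt.
  rewrite /w; set S := \sum_(_ < _) _ => /andP[h1 h2].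
  have i0 : 0 < (n.+1%:R : R)^-1 by rewrite invr_gt0.
  have h3 := ler_wpM2l (ltW i0) h1; have h4 := ler_wpM2l (ltW i0) h2.
  rewrite mulKf ?gt_eqF// in h3; rewrite mulrDr mulKf ?gt_eqF// mulr1 in h4.
  by set i := n.+1%:R^-1 in h3 h4 *; apply/andP; split; lra.
have bw n : bm (w n).
  apply: bmD; last exact: bm_cst.
  by apply: bmZ; apply: bm_sum => k; exact: bm_indic (mstep _ _).
have inv1 n : 0 < (n.+1%:R : R)^-1 <= 1 by rewrite invr_gt0 ltr0n invf_le1// ler1n.
apply: (Fcvg0 _ w (C + 1)) => //.
- move=> n x; have /andP[h1 h2] := hw n x; have /andP[_ h3] := inv1 n.
  have := uC x; rewrite !ler_norml => /andP[h4 h5]; set i := n.+1%:R^-1 in h2 h3.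
  by apply/andP; split; lra.
- by split=> //; exists C.
- move=> x; apply/(@cvgrPdist_le _ R^o) => e e0; near=> n.
  have /andP[h1 h2] := hw n x; rewrite distrC ger0_norm ?subr_ge0//.
  apply: le_trans (_ : n.+1%:R^-1 <= _); first by rewrite lerBlDl.
  by apply/ltW; near: n; exact: (near_infty_natSinv_lt (PosNum e0)).
- move=> n; rewrite FD ?F1 ?addr0; [|by apply: bmZ; apply: bm_sum => k; exact: bm_indic (mstep _ _)|exact: bm_cst].
  rewrite FZ ?Fsum ?mulr0//; [by move=> k; exact: bm_indic (mstep _ _)|by move=> k; exact: Find|].
  by apply: bm_sum => k; exact: bm_indic (mstep _ _).
Unshelve. all: by end_near. Qed.

(** * Representation of a positive normalized functional on Hoelder functions *)

Section riesz.
Variable Lam : (T -> R) -> R.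
Hypothesis LamD : forall A B u v, hol A u -> hol B v -> Lam (fun x => u x + v x) = Lam u + Lam v.
Hypothesis LamZ : forall A c u, hol A u -> Lam (fun x => c * u x) = c * Lam u.
Hypothesis Lam1 : Lam (fun=> 1) = 1.
Hypothesis Lam_ge0 : forall A u, hol A u -> (forall x, 0 <= u x) -> 0 <= Lam u.

Lemma Lam_cst c : Lam (fun=> c) = c.
Proof.
rewrite (_ : (fun=> c) = fun x : T => c * 1); last by apply/funext => x; rewrite mulr1.
by rewrite (LamZ c (hol_cst alpha 1)) Lam1 mulr1.
Qed.

Lemma Lam_le A B u v : hol A u -> hol B v -> (forall x, u x <= v x) -> Lam u <= Lam v.
Proof.
move=> hA hB uv; have hv : hol (B + `|-1| * A) (fun x => v x + (-1) * u x).
  by apply: holD => //; exact: holZ.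
have : 0 <= Lam (fun x => v x + (-1) * u x).
  by apply: (Lam_ge0 hv) => x; rewrite mulN1r subr_ge0.
by rewrite (LamD hB (holZ (-1) hA)) (LamZ _ hA) mulN1r subr_ge0.
Qed.

Lemma Lam_dist A B u v e : hol A u -> hol B v -> (forall x, `|u x - v x| <= e) ->
  `|Lam u - Lam v| <= e.
Proof.
move=> hA hB uv.
have h1 : Lam u <= Lam (fun x => v x + e).
  apply: Lam_le hA (holD hB (hol_cst alpha e)) _ => x.
  by have := uv x; rewrite ler_norml; lra.
have h2 : Lam v <= Lam (fun x => u x + e).
  apply: Lam_le hB (holD hA (hol_cst alpha e)) _ => x.
  by have := uv x; rewrite ler_norml; lra.
rewrite (LamD hB (hol_cst alpha e)) Lam_cst in h1.
rewrite (LamD hA (hol_cst alpha e)) Lam_cst in h2.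
by rewrite ler_norml; lra.
Qed.

Lemma Lam_sum n (A : 'I_n -> R) (u : 'I_n -> T -> R) : (forall i, hol (A i) (u i)) ->
  hol (\sum_i A i) (fun x => \sum_i u i x) /\
  Lam (fun x => \sum_i u i x) = \sum_i Lam (u i).
Proof.
elim: n A u => [|n IH] A u hA.
  rewrite !big_ord0 (_ : (fun _ => _) = fun=> 0); last by apply/funext => x; rewrite big_ord0.
  by split; [exact: hol_cst|exact: Lam_cst].
rewrite !big_ord_recr/=.
rewrite (_ : (fun _ => _) = fun x => \sum_(i < n) u (widen_ord (leqnSn n) i) x + u ord_max x).
  have [h1 h2] := IH _ (fun i => u (widen_ord (leqnSn n) i)) (fun i => hA (widen_ord (leqnSn n) i)).
  by split; [exact: holD|rewrite (LamD h1 (hA ord_max)) h2].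
by apply/funext => x; rewrite big_ord_recr.
Qed.

(** The future distribution function. The indicator of [below a] is not Hoelder, so the functional
    is evaluated on the ramps above it, which decrease to it as the slope grows. *)
Definition rdf (a : R) : R := inf [set Lam (ramp a c) | c in [set c | 0 < c]].

Let rdf_has_inf a : has_inf [set Lam (ramp a c) | c in [set c | 0 < c]].
Proof.
split; first by exists (Lam (ramp a 1)), 1 => //; exact: ltr01.
exists 0 => _ [c c0 <-]; apply: (Lam_ge0 (hol_ramp a (ltW c0))) => x.
by case/andP: (ramp01 a c x).
Qed.

Lemma rdf_le a c : 0 < c -> rdf a <= Lam (ramp a c).
Proof. by move=> c0; apply: ge_inf; [case: (rdf_has_inf a)|exists c]. Qed.

Lemma rdf_ge a b : (forall c, 0 < c -> b <= Lam (ramp a c)) -> b <= rdf a.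
Proof.
by move=> h; apply: lb_le_inf; [case: (rdf_has_inf a)|move=> _ [c c0 <-]; exact: h].
Qed.

Lemma rdf_approx a e : 0 < e -> exists2 c, 0 < c & Lam (ramp a c) < rdf a + e.
Proof. by move=> e0; have [_ [c c0 <-] h] := inf_adherent e0 (rdf_has_inf a); exists c. Qed.

Lemma rdf_nd : nondecreasing rdf.
Proof.
move=> a b ab; apply: rdf_ge => c c0; apply: le_trans (rdf_le a c0) _.
apply: Lam_le (hol_ramp _ (ltW c0)) (hol_ramp _ (ltW c0)) _ => x.
by apply: clamp_le; nra.
Qed.

Lemma rdf_rc : right_continuous rdf.
Proof.
move=> a; apply/(@cvgrPdist_le _ R^o) => e e0.
have [c c0 hc] := rdf_approx a (divr_gt0 e0 (ltr0Sn R 1)).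
near=> b; have ab : a <= b by apply/ltW; near: b; exact: nbhs_right_gt.
rewrite distrC ger0_norm ?subr_ge0 ?rdf_nd// lerBlDl.
have bc : b <= a + e / 2 / c.
  near: b; apply: nbhs_right_le; rewrite ltrDl.
  by apply: divr_gt0 => //; exact: divr_gt0.
apply: le_trans (rdf_le b c0) _.
have h1 : Lam (ramp b c) <= Lam (fun x => ramp a c x + e / 2).
  apply: Lam_le (hol_ramp _ (ltW c0)) (holD (hol_ramp _ (ltW c0)) (hol_cst _ _)) _ => x.
  have := clamp_dist (1 - c * (I01_val x - b)) (1 - c * (I01_val x - a)).
  have -> : 1 - c * (I01_val x - b) - (1 - c * (I01_val x - a)) = c * (b - a) by ring.
  rewrite (ger0_norm (mulr_ge0 (ltW c0) _)) ?subr_ge0// ler_norml => /andP[_].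
  have : c * (b - a) <= e / 2 by rewrite mulrC -ler_pdivlMr// lerBlDl.
  by rewrite /ramp; lra.
rewrite (LamD (hol_ramp _ (ltW c0)) (hol_cst _ _)) Lam_cst in h1.
by lra.
Unshelve. all: by end_near. Qed.

Lemma rdf_cvg a : Lam (ramp a n.+1%:R) @[n --> \oo] --> rdf a.
Proof.
apply/(@cvgrPdist_le _ R^o) => e e0; have [c c0 hc] := rdf_approx a e0.
near=> n; have n0 : (0 : R) < n.+1%:R by rewrite ltr0n.
have h1 := rdf_le a n0; rewrite distrC ger0_norm ?subr_ge0// lerBlDl.
apply: le_trans (ltW hc); apply: Lam_le (hol_ramp _ (ltW n0)) (hol_ramp _ (ltW c0)) _ => x.
have [xa|xa] := leP (I01_val x) a; first by rewrite !ramp_le1// ltW.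
apply: clamp_le; rewrite lerD2l lerN2 ler_wpM2r ?subr_ge0 ?(ltW xa)//.
apply: le_trans (_ : n%:R <= _); last by rewrite ler_nat.
by near: n; exact: nbhs_infty_ger.
Unshelve. all: by end_near. Qed.

Lemma rdf_lt0 a : a < 0 -> rdf a = 0.
Proof.
move=> a0; apply/eqP; rewrite eq_le; apply/andP; split; last first.
  apply: rdf_ge => c c0; apply: (Lam_ge0 (hol_ramp a (ltW c0))) => x.
  by case/andP: (ramp01 a c x).
have c0 : 0 < - a^-1 by rewrite oppr_gt0 invr_lt0.
apply: le_trans (rdf_le a c0) _; rewrite (_ : ramp a (- a^-1) = fun=> 0) ?Lam_cst//.
apply/funext => x; apply: ramp_ge0.
have : 0 <= - a^-1 * I01_val x by rewrite mulr_ge0 ?(ltW c0) ?I01_ge0.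
by rewrite mulrBr mulNr [X in _ - X]mulNr mulVf ?lt_eqF//; lra.
Qed.

Lemma rdf_ge1 a : 1 <= a -> rdf a = 1.
Proof.
move=> a1; have E c : 0 < c -> Lam (ramp a c) = 1.
  move=> c0; rewrite (_ : ramp a c = fun=> 1)//; apply/funext => x.
  by apply: ramp_le1; rewrite ?(ltW c0)// (le_trans _ a1)// I01_le1.
apply/eqP; rewrite eq_le; apply/andP; split; first by rewrite -(E 1 ltr01) rdf_le.
by apply: rdf_ge => c c0; rewrite E.
Qed.

HB.instance Definition _ := isCumulative.Build R _ R rdf rdf_nd rdf_rc.

Lemma rdfNy : rdf @ -oo --> (0 : R).
Proof.
apply: (@cvg_near_cst _ R^o); near=> a; apply: rdf_lt0; near: a.
exact: nbhs_ninfty_lt.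
Unshelve. all: by end_near. Qed.

Lemma rdfy : rdf @ +oo --> (1 : R).
Proof.
apply: (@cvg_near_cst _ R^o); near=> a; apply: rdf_ge1; near: a.
exact: nbhs_pinfty_ge.
Unshelve. all: by end_near. Qed.

HB.instance Definition _ := isCumulativeBounded.Build R 0 1 rdf rdfNy rdfy.

Definition clampT (x : measurableTypeR R) : T := insubd (I01_0 R) (clamp x).

Lemma clampTE x : I01_val (clampT x) = clamp x.
Proof. by rewrite /clampT val_insubd clamp01. Qed.

Lemma measurable_clampT : measurable_fun setT clampT.
Proof.
apply: measurable_to_I01; under eq_fun do rewrite clampTE.
by apply: nondecreasing_measurable => // x y xy; exact: clamp_le.
Qed.

HB.instance Definition _ := isMeasurableFun.Build _ _ _ _ clampT measurable_clampT.

(** The Lebesgue-Stieltjes measure of [rdf] lives on the line; its image under [clampT] lands in the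
    interval. Nothing moves in effect, as [rdf] is 0 before 0 and 1 from 1 on. *)
Definition riesz : probability T R :=
  distribution (lebesgue_stieltjes_measure rdf) clampT.

Lemma riesz_below a : fine (riesz (below a)) = rdf a.
Proof.
have E r : lebesgue_stieltjes_measure rdf `]-oo, r]%classic = (rdf r)%:E.
  by have := cdf_lebesgue_stieltjes_id rdf r; rewrite /cdf /distribution /pushforward/=.
rewrite /riesz /distribution /pushforward/=.
have [a0|a0] := ltP a 0.
  rewrite (_ : clampT @^-1` below a = set0) ?measure0 ?rdf_lt0//.
  apply/seteqP; split => // x; rewrite /below/= clampTE.
  by have /andP[] := clamp01 x; lra.
have [a1|a1] := leP 1 a.
  rewrite (_ : clampT @^-1` below a = setT) ?probability_setT ?rdf_ge1//.
  apply/seteqP; split => // x _; rewrite /below/= clampTE.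
  by have /andP[_ h] := clamp01 x; exact: le_trans h a1.
rewrite (_ : clampT @^-1` below a = `]-oo, a]%classic) ?E//.
apply/seteqP; split => x; rewrite /below/= clampTE in_itv/= /clamp.
  by case: (ltP x 0) => ?; case: (leP x 1) => ?; lra.
by case: (ltP x 0) => ?; case: (leP x 1) => ?; lra.
Qed.

(** The grid starts at [- 1 / N], left of the interval, so that a possible atom at 0 is counted. *)
Let grid (N i : nat) : R := (i%:R - 1) / N%:R.
Let gridT (N i : nat) : T := insubd (I01_0 R) (clamp (i%:R / N%:R)).

Let gridTE N i : (i <= N)%N -> (0 < N)%N -> I01_val (gridT N i) = grid N i + N%:R^-1.
Proof.
move=> iN N0; rewrite /gridT val_insubd clamp01 clampE.
  by rewrite /grid; field; rewrite pnatr_eq0 -lt0n.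
by rewrite divr_ge0//= ler_pdivrMr ?ltr0n// mul1r ler_nat.
Qed.

(** Summation over a partition of unity made of the increments of [p]. The family [p] is left
    abstract to serve both for indicators of [below a], on the side of the measure, and for steep
    ramps, on the side of the functional. *)
Let grid_approx A h (p : R -> T -> R) N x : hol A h -> (0 < N)%N ->
  {homo p^~ x : a b / a <= b} ->
  (forall a, I01_val x <= a -> p a x = 1) ->
  (forall a, a + N%:R^-1 <= I01_val x -> p a x = 0) ->
  `|h x - \sum_(i < N.+1) h (gridT N i) * (p (grid N i.+1) x - p (grid N i) x)| <=
  A * (2 / N%:R) `^ alpha.
Proof.
move=> hA N0 pm p1 p0; have NR : (0 : R) < N%:R by rewrite ltr0n.
have a0 : 0 < alpha by case/andP: a01.
have iN : 0 < (N%:R : R)^-1 by rewrite invr_gt0.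
have gS i : grid N i.+1 = grid N i + N%:R^-1 by rewrite /grid -natr1; field; rewrite gt_eqF.
have d0 i : 0 <= p (grid N i.+1) x - p (grid N i) x.
  by rewrite subr_ge0 pm// gS lerDl ltW.
have S1 : \sum_(i < N.+1) (p (grid N i.+1) x - p (grid N i) x) = 1.
  rewrite -(big_mkord xpredT (fun i => p (grid N i.+1) x - p (grid N i) x)) telescope_sumr//.
  rewrite p1 ?p0 ?subr0//.
    rewrite (_ : grid N 0 + _ = 0) ?I01_ge0// /grid sub0r mulN1r addrC subrr//.
  by rewrite (_ : grid N _ = 1) ?I01_le1// /grid -natr1 addrK divff// gt_eqF.
have -> : h x - \sum_(i < N.+1) h (gridT N i) * (p (grid N i.+1) x - p (grid N i) x) =
    \sum_(i < N.+1) (h x - h (gridT N i)) * (p (grid N i.+1) x - p (grid N i) x).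
  rewrite -[X in X - _]mulr1 -S1 mulr_sumr -sumrB; apply: eq_bigr => i _.
  by rewrite mulrBl.
apply: le_trans (ler_norm_sum _ _ _) _.
rewrite -[leRHS]mulr1 -[X in _ <= _ * X]S1 mulr_sumr; apply: ler_sum => i _.
rewrite normrM [X in _ * X]ger0_norm//.
have [h1|h1] := leP `|I01_val x - I01_val (gridT N i)| (2 / N%:R).
  rewrite ler_wpM2r//; apply: le_trans (hA _ _) _.
  by rewrite ler_wpM2l ?(hol_ge0 hA)//; apply: le_powR_alpha.
suff -> : p (grid N i.+1) x - p (grid N i) x = 0 by rewrite !mulr0.
have leiN : (i <= N)%N by rewrite -ltnS; exact: ltn_ord.
move: h1; rewrite (gridTE leiN N0) => h1.
have h2 : 2 / N%:R = N%:R^-1 + N%:R^-1 :> R by ring.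
rewrite gS; move: iN p0 h1; rewrite h2.
move: (grid N i) (N%:R^-1) => t w w0 p0.
by case: ger0P => _ h1; [rewrite !p0 ?subrr//|rewrite !p1 ?subrr//]; lra.
Qed.

(** The integral and the functional are both compared with the same Riemann-Stieltjes sum [S];
    letting [N] grow removes the error. *)
Lemma riesz_int A h : hol A h -> \int[riesz]_x h x = Lam h.
Proof.
move=> hA; have A0 := hol_ge0 hA; have /andP[a0 _] := a01.
have key N : (0 < N)%N -> `|\int[riesz]_x h x - Lam h| <= 2 * (A * (2 / N%:R) `^ alpha).
  move=> N0; have NR : (0 : R) < N%:R by rewrite ltr0n.
  pose S := \sum_(i < N.+1) h (gridT N i) * (rdf (grid N i.+1) - rdf (grid N i)).
  have bb a : bm (\1_(below a) : T -> R) by exact: bm_indic (measurable_below a).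
  have h1 : `|\int[riesz]_x h x - S| <= A * (2 / N%:R) `^ alpha.
    have bt i : bm (fun x => h (gridT N i) * (\1_(below (grid N i.+1)) x - \1_(below (grid N i)) x)).
      by apply: bmZ; exact: bmB.
    have -> : S = \int[riesz]_x (\sum_(i < N.+1) h (gridT N i) *
        (\1_(below (grid N i.+1)) x - \1_(below (grid N i)) x)).
      rewrite Rint_sum => [|i]; last exact: bt.
      apply: eq_bigr => i _; rewrite RintZ; last exact: bmB.
      by rewrite RintB// !Rint_indic ?riesz_below//; exact: measurable_below.
    rewrite -RintB; [|exact: bm_hol hA|by apply: bm_sum => i; exact: bt].
    apply: Rint_norm.
      by apply: bmB; [exact: bm_hol hA|by apply: bm_sum => i; exact: bt].
    move=> x; apply: (grid_approx (p := fun a => \1_(below a)) hA N0).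
    - move=> a b ab; rewrite !indicE ler_nat; have [/set_mem xa|//] := boolP (x \in below a).
      by rewrite mem_set//; exact: le_trans xa ab.
    - by move=> a xa; rewrite indicE mem_set.
    - move=> a xa; rewrite indicE memNset// /below/=; apply/negP; rewrite -ltNge.
      by apply: lt_le_trans xa; rewrite ltrDl invr_gt0.
  pose Sn n := \sum_(i < N.+1) h (gridT N i) *
     (Lam (ramp (grid N i.+1) n.+1%:R) - Lam (ramp (grid N i) n.+1%:R)).
  have h2 : `|Lam h - S| <= A * (2 / N%:R) `^ alpha.
    have cS : `|Lam h - Sn n| @[n --> \oo] --> `|Lam h - S|.
      apply: cvg_norm; apply: (@cvgB _ R^o); first exact: cvg_cst.
      apply: cvg_sum_ord => i; apply: cvgMl_tmp; apply: (@cvgB _ R^o); exact: rdf_cvg.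
    apply: (ler_cvg_to cS (cvg_cst _)); near=> n.
    have n0 : (0 : R) <= n.+1%:R by [].
    have hi (i : 'I_N.+1) : hol (`|h (gridT N i)| * (n.+1%:R + `|-1| * n.+1%:R)) (fun x =>
        h (gridT N i) * (ramp (grid N i.+1) n.+1%:R x + (-1) * ramp (grid N i) n.+1%:R x)).
      by apply: holZ; apply: holD; [|apply: holZ]; exact: hol_ramp.
    have [g1 g2] := Lam_sum hi.
    have -> : Sn n = Lam (fun x => \sum_(i < N.+1)
        h (gridT N i) * (ramp (grid N i.+1) n.+1%:R x + (-1) * ramp (grid N i) n.+1%:R x)).
      rewrite g2; apply: eq_bigr => i _.
      have hr a : hol n.+1%:R (ramp a n.+1%:R) by exact: hol_ramp.
      rewrite (LamZ _ (holD (hr _) (holZ (-1) (hr _)))) (LamD (hr _) (holZ (-1) (hr _))).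
      by rewrite (LamZ _ (hr _)) mulN1r.
    apply: (Lam_dist hA g1) => x.
    under eq_bigr do rewrite mulN1r.
    have Nn : N%:R^-1 * n.+1%:R >= 1 :> R.
      rewrite mulrC ler_pdivlMr// mul1r ler_nat.
      by apply: leqW; near: n; exists N.
    apply: (grid_approx (p := fun a => ramp a n.+1%:R) hA N0).
    - by move=> a b ab; apply: clamp_le; nra.
    - by move=> a xa; apply: ramp_le1.
    - move=> a xa; apply: ramp_ge0; apply: le_trans Nn _; rewrite mulrC ler_wpM2l//; lra.
  have -> : \int[riesz]_x h x - Lam h = (\int[riesz]_x h x - S) - (Lam h - S) by ring.
  by apply: le_trans (ler_normB _ _) _; lra.
apply/eqP; rewrite -subr_eq0 -normr_le0; apply/ler_addgt0Pr => e e0; rewrite add0r.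
pose e' := e / (2 * (A + 1)).
have A1 : 0 < A + 1 by rewrite ltr_wpDl.
have e'0 : 0 < e' by rewrite divr_gt0// mulr_gt0.
pose N := (Num.truncn (2 / (e' `^ alpha^-1))).+1.
have N0 : (0 < N)%N by [].
apply: le_trans (key N N0) _.
have : (2 / N%:R) `^ alpha < e'.
  apply: powR_lt => //.
  rewrite ltr_pdivrMr ?ltr0n// mulrC -ltr_pdivrMr ?powR_gt0//.
  exact: truncnS_gt.
have : e' * (A + 1) * 2 = e by rewrite /e'; field; rewrite gt_eqF.
by move=> h1 h2; have := ler_wpM2l A0 (ltW h2); lra.
Unshelve. all: by end_near. Qed.

End riesz.

End functionals.

(** * The Gibbs measure of an eigenpair *)

Section gibbs_measure.
Variables (R : realType) (alpha : R).
Hypothesis a01 : 0 < alpha <= 1.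
Local Notation T := (I01 R).
Local Notation br := (br alpha).
Local Notation hol := (hol alpha).
Local Notation f := (@intermittent R alpha).
Local Notation x0 := (I01_0 R).
Local Notation x1 := (I01_1 R).

Lemma riesz_exists (Lam : (T -> R) -> R) :
  (forall A B u v, hol A u -> hol B v -> Lam (fun x => u x + v x) = Lam u + Lam v) ->
  (forall A c u, hol A u -> Lam (fun x => c * u x) = c * Lam u) ->
  Lam (fun=> 1) = 1 -> (forall A u, hol A u -> (forall x, 0 <= u x) -> 0 <= Lam u) ->
  exists nu : probability T R, forall A h, hol A h -> \int[nu]_x h x = Lam h.
Proof.
move=> h1 h2 h3 h4; exists (riesz a01 h1 h2 h3 h4) => A h hA.
exact: riesz_int hA.
Qed.

(* The limit is sup_n (u n - e n). *)
Lemma cvg_of_gap (u e : nat -> R) : e n @[n --> \oo] --> 0 ->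
  (forall n m, `|u (n + m)%N - u n| <= e n) -> exists l, forall n, `|u n - l| <= e n.
Proof.
move=> e0 ue.
have e_ge0 n : 0 <= e n by apply: le_trans (ue n 0%N).
have h n m : u n - e n <= u m + e m.
  have [nm|mn] := leqP n m.
    by have := ue n (m - n)%N; rewrite subnKC// ler_norml; have := e_ge0 m; lra.
  by have := ue m (n - m)%N; rewrite subnKC ?(ltnW mn)// ler_norml; have := e_ge0 n; lra.
have hs : has_sup [set u n - e n | n in setT].
  split; first by exists (u 0%N - e 0%N), 0%N.
  by exists (u 0%N + e 0%N) => _ [n _ <-].
exists (sup [set u n - e n | n in setT]) => n.
have h1 : u n - e n <= sup [set u n - e n | n in setT].
  by apply: ub_le_sup; [case: hs|exists n].
have h2 : sup [set u n - e n | n in setT] <= u n + e n.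
  by apply: ge_sup; [case: hs|move=> _ [m _ <-]].
by rewrite ler_norml; lra.
Qed.

Variables (phi g : T -> R) (l : R).
Hypothesis ep : eigenpair alpha phi g l.
Local Notation M := (markov_op alpha phi g l).
Local Notation W := (weight alpha phi g l).

Lemma iter_markovD n u v x :
  iter n M (fun x => u x + v x) x = iter n M u x + iter n M v x.
Proof.
elim: n x => //= n IH x; rewrite /markov_op !IH; ring.
Qed.

Lemma iter_markovZ n c u x : iter n M (fun x => c * u x) x = c * iter n M u x.
Proof. by elim: n x => //= n IH x; rewrite /markov_op !IH; ring. Qed.

Lemma iter_markov_cst n c x : iter n M (fun=> c) x = c.
Proof.
by elim: n x => //= n IH x; rewrite /markov_op !IH -mulrDl (weight_sum ep) mul1r.
Qed.

Lemma iter_markov_ge0 n u : (forall x, 0 <= u x) -> forall x, 0 <= iter n M u x.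
Proof.
move=> u0; elim: n => //= n IH x; rewrite /markov_op addr_ge0// mulr_ge0//.
  exact/ltW/weight_gt0.
exact/ltW/weight_gt0.
Qed.

Lemma weight_bm i : bm (W i).
Proof. by have [C [C0 hC]] := weight_hol a01 ep; exact: bm_hol (hC i). Qed.

Lemma markov_bm h : bm h -> bm (M h).
Proof.
by move=> bh; apply: bmD; apply: bmM; [exact: weight_bm| |exact: weight_bm|];
  apply: bm_comp => //; exact: measurable_br.
Qed.

Lemma iter_markov_bm n h : bm h -> bm (iter n M h).
Proof. by move=> bh; elim: n => //= n; exact: markov_bm. Qed.

(** By [markov_gap] the iterates of a Hoelder function converge to a constant, and this constant is
    a positive normalized functional, hence an integral. Invariance under [M] is clear on Hoelder
    functions and passes to bounded measurable ones by [functional_eq0]. *)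
Lemma eigen_measure : exists nu : probability T R, exists K r : R, [/\ 0 < K, 0 < r < 1,
  forall h, bm h -> \int[nu]_x M h x = \int[nu]_x h x &
  forall A h, hol A h -> forall n x, `|iter n M h x - \int[nu]_x h x| <= K * r ^+ n * A].
Proof.
have [K [r [K0 r01 gap]]] := markov_gap a01 ep; have /andP[r0 r1] := r01.
have egap A : K * r ^+ n * A @[n --> \oo] --> (0 : R).
  rewrite -[X in _ --> X](mul0r A); apply: cvgMr_tmp.
  rewrite -[X in _ --> X](mulr0 K); apply: cvgMl_tmp.
  by apply: cvg_expr; rewrite gtr0_norm.
pose ell h := lim (iter n M h x1 @[n --> \oo]).
have ellP A h : hol A h -> forall n x, `|iter n M h x - ell h| <= K * r ^+ n * A.
  move=> hA.
  have near n m x y : `|iter (n + m) M h x - iter n M h y| <= K * r ^+ n * A.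
    rewrite addnC iterD; apply: (iter_markov_near ep).
    exact: hol_osc (gap _ _ hA n).
  have [L hL] := cvg_of_gap (egap A) (fun n m => near n m x1 x1).
  have cL : iter n M h x1 @[n --> \oo] --> L.
    apply/(@cvgrPdist_le _ R^o) => e e0.
    have := egap A => /(@cvgrPdist_le _ R^o) /(_ e e0); apply: filterS => n.
    rewrite sub0r normrN => hn; rewrite distrC; apply: le_trans (hL n) _.
    exact: le_trans (ler_norm _) hn.
  have -> : ell h = L by exact: (@cvg_lim _ _ _ _ eventually_filter).
  move=> n x; apply/ler_addgt0Pr => e e0.
  have [N _ /(_ N (leqnn N))/=] := (@cvgrPdist_le _ R^o _ _ _ _ _).1 cL e e0.
  move=> h1; have := cL => /(@cvgrPdist_le _ R^o) /(_ e e0)[N' _ /(_ (n + N')%N (leq_addl _ _))/= h2].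
  have := near n N' x1 x; have -> : iter n M h x - L =
     - (iter (n + N') M h x1 - iter n M h x) - (L - iter (n + N') M h x1) by ring.
  move=> h3; apply: le_trans (ler_normB _ _) _; rewrite normrN; exact: lerD.
have ell_cvg A h : hol A h -> iter n M h x1 @[n --> \oo] --> ell h.
  move=> hA; apply/(@cvgrPdist_le _ R^o) => e e0.
  have := egap A => /(@cvgrPdist_le _ R^o) /(_ e e0); apply: filterS => n.
  rewrite sub0r normrN => hn; rewrite distrC; apply: le_trans (ellP _ _ hA n x1) _.
  exact: le_trans (ler_norm _) hn.
have uniq u (a b : R) : u n @[n --> \oo] --> a -> u n @[n --> \oo] --> b -> a = b.
  by move=> h1 h2; apply: (@cvg_unique _ (@Rhausdorff R) _ _ a b h1 h2).
have [nu hnu] : exists nu : probability T R, forall A h, hol A h -> \int[nu]_x h x = ell h.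
  apply: riesz_exists.
  - move=> A B u v hA hB; apply: (uniq (fun n => iter n M (fun x => u x + v x) x1)).
      exact: ell_cvg (holD hA hB).
    under eq_fun do rewrite iter_markovD.
    by apply: (@cvgD _ R^o); [exact: ell_cvg hA|exact: ell_cvg hB].
  - move=> A c u hA; apply: (uniq (fun n => iter n M (fun x => c * u x) x1)).
      exact: ell_cvg (holZ c hA).
    under eq_fun do rewrite iter_markovZ.
    by apply: cvgMl_tmp; exact: ell_cvg hA.
  - apply: (uniq (fun n => iter n M (fun=> 1) x1)); first exact: ell_cvg (hol_cst alpha 1).
    by under eq_fun do rewrite iter_markov_cst; exact: cvg_cst.
  - move=> A u hA u0; apply: (ler_cvg_to (cvg_cst 0) (ell_cvg _ _ hA)).
    by apply: nearW => n; exact: iter_markov_ge0.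
exists nu, K, r; split => //; last first.
  by move=> A h hA n x; rewrite (hnu _ _ hA); exact: ellP.
move=> h bh; apply/eqP; rewrite -subr_eq0; apply/eqP.
pose F h := \int[nu]_x M h x - \int[nu]_x h x.
rewrite -/(F h); apply: (functional_eq0 a01) bh.
- move=> u v bu bv; rewrite /F RintD//.
  have -> : M (fun x => u x + v x) = fun x => M u x + M v x.
    by apply/funext => x; exact: (iter_markovD 1).
  by rewrite RintD//; [ring|exact: markov_bm..].
- move=> c u bu; rewrite /F RintZ//.
  have -> : M (fun x => c * u x) = fun x => c * M u x.
    by apply/funext => x; exact: (iter_markovZ 1).
  by rewrite RintZ ?mulrBr//; exact: markov_bm.
- move=> u v C mu uC bv uv.
  have bu n : bm (u n) by split; [exact: mu|exists C; exact: uC].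
  apply: (@cvgB _ R^o); last exact: Rint_cvg uC bv uv.
  apply: (@Rint_cvg _ _ (fun n => M (u n)) _ C) => //.
  + by move=> n; case: (markov_bm (bu n)).
  + move=> n x; rewrite /markov_op; apply: le_trans (ler_normD _ _) _; rewrite (normrM (W false x)) (normrM (W true x)).
    rewrite !(gtr0_norm (weight_gt0 ep _ _)) -[C]mul1r -(weight_sum ep x) mulrDl.
    by apply: lerD; rewrite ler_wpM2l ?(ltW (weight_gt0 ep _ _)).
  + exact: markov_bm.
  + by move=> x; apply: (@cvgD _ R^o); apply: cvgMl_tmp; exact: uv.
- move=> A u hA; rewrite /F (hnu _ _ hA).
  have hM : hol (K * r ^+ 1 * A) (M u) by exact: (gap _ _ hA 1%N).
  rewrite (hnu _ _ hM); apply/eqP; rewrite subr_eq0; apply/eqP.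
  apply: (uniq (fun n => iter n M (M u) x1)); first exact: ell_cvg hM.
  rewrite (_ : (fun n => _) = [sequence iter (n + 1) M u x1]_n); last first.
    by apply/funext => n; rewrite /= addn1 iterSr.
  by rewrite (cvg_shiftn 1 (fun n => iter n M u x1)); exact: ell_cvg hA.
Qed.

Section eigen_measure_properties.
Variable nu : probability T R.
Hypothesis nuM : forall h, bm h -> \int[nu]_x M h x = \int[nu]_x h x.

Let bb a : bm (\1_(below a) : T -> R). Proof. exact: bm_indic (measurable_below a). Qed.

Let below0 (x : T) : (\1_(below 0) x : R) = (x == x0)%:R.
Proof.
rewrite indicE; have [->|xn0] := eqVneq x x0; first by rewrite mem_set//; exact: lexx.
rewrite memNset// /below/= => h; move/eqP: xn0; apply; apply: I01_inj.
by apply/eqP; rewrite eq_le h I01_ge0.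
Qed.

(** No right inverse image is 0, and [br false x] is 0 only for [x] equal to 0, so [M] multiplies
    the indicator of 0 by [W false x0], which is less than 1. Integrals may then be compared on
    positive points, where the branch identities hold. *)
Lemma eigen_measure0 : fine (nu (below 0)) = 0.
Proof.
have := nuM (bb 0); rewrite Rint_indic; last exact: measurable_below.
have -> : M (\1_(below 0)) = fun x => W false x0 * \1_(below 0) x.
  apply/funext => x; rewrite /markov_op !below0.
  have -> : (br true x == x0) = false.
    by apply/negbTE/eqP => e; have := br1_gt0 a01 x; rewrite e ltxx.
  rewrite mulr0 addr0; have [->|xn0] := eqVneq x x0; first by rewrite br0_0// eqxx.
  suff -> : (br false x == x0) = false by rewrite !mulr0.
  apply/negbTE/eqP => e; move/eqP: xn0; apply; apply: I01_inj.
  by have := brE a01 false x; rewrite e Fmap0/= addr0.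
rewrite RintZ// Rint_indic; last exact: measurable_below.
have /= := weight_sum ep x0; have := weight_gt0 ep true x0; set t := fine _ => h1 h2 h3.
have : W true x0 * t = 0 by have := h2; rewrite -[W false x0](addrK (W true x0)) h2 in h3 *; lra.
by move=> /eqP; rewrite mulf_eq0 (gt_eqF h1)/= => /eqP.
Qed.

Lemma Rint_le_pos u v : bm u -> bm v -> (forall x : T, 0 < I01_val x -> u x <= v x) ->
  \int[nu]_x u x <= \int[nu]_x v x.
Proof.
move=> bu bv uv; have [_ [C hC]] := bmB bu bv.
have bC : bm (fun x : T => C * \1_(below 0) x : R) by exact: bmZ.
have IC : \int[nu]_x (C * \1_(below 0) x) = 0.
  by rewrite RintZ// Rint_indic ?eigen_measure0 ?mulr0//; exact: measurable_below.
rewrite -[leRHS]addr0 -IC -RintD//; apply: Rint_le => [//||x]; first exact: bmD.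
rewrite below0; have [->|xn0] := eqVneq x x0.
  by have := hC x0; rewrite mulr1 ler_norml => /andP[_]; lra.
rewrite mulr0 addr0; apply: uv; rewrite lt_neqAle I01_ge0 andbT eq_sym.
by apply: contra xn0 => /eqP e; apply/eqP/I01_inj.
Qed.

Lemma Rint_eq_pos u v : bm u -> bm v -> (forall x : T, 0 < I01_val x -> u x = v x) ->
  \int[nu]_x u x = \int[nu]_x v x.
Proof.
move=> bu bv uv; apply/eqP; rewrite eq_le !Rint_le_pos// => x xp; rewrite uv//.
Qed.

Lemma Rint_iter_markov n h : bm h -> \int[nu]_x iter n M h x = \int[nu]_x h x.
Proof.
by move=> bh; elim: n => //= n <-; exact: nuM (iter_markov_bm n bh).
Qed.

(** At positive points, [M] of the product of [psi \o f] and [h] is [psi * M h]. *)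
Lemma Rint_dual n psi h : bm psi -> bm h ->
  \int[nu]_x (psi (iter n f x) * h x) = \int[nu]_x (psi x * iter n M h x).
Proof.
move=> bpsi; elim: n h => [//|n IH] h bh.
rewrite iterSr -IH; last exact: markov_bm.
under eq_Rintegral do rewrite iterSr.
have bn : bm (fun x => psi (iter n f x)).
  by apply: bm_comp => //; exact: measurable_iter_intermittent.
have bf : bm (fun x => psi (iter n f (f x)) * h x).
  apply: bmM => //; apply: (bm_comp (h := fun x => psi (iter n f x))) => //.
  exact: measurable_intermittent.
rewrite -nuM//; apply: Rint_eq_pos; [exact: markov_bm|by apply: bmM => //; exact: markov_bm|].
by move=> x xp; rewrite /markov_op !intermittent_br//; ring.
Qed.

Lemma eigen_measure_invariant : invariant_measure f nu.
Proof.
move=> A mA.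
have mfA : measurable (f @^-1` A).
  by rewrite -[_ @^-1` _]setTI; exact: measurable_intermittent.
rewrite (prob_fin nu mfA) (prob_fin nu mA) -!Rint_indic//; congr EFin.
have := @Rint_dual 1 (\1_A) (fun=> 1) (bm_indic mA) (bm_cst 1).
under eq_Rintegral do rewrite mulr1/=.
under [X in _ = X -> _]eq_Rintegral do rewrite iter_markov_cst mulr1.
by [].
Qed.

Lemma eigen_measure_mixing (K r : R) : 0 < K -> 0 < r < 1 ->
  (forall A h, hol A h -> forall n x, `|iter n M h x - \int[nu]_x h x| <= K * r ^+ n * A) ->
  exponentially_mixing alpha nu.
Proof.
move=> K0 r01 hK; exists K, r; split => // psi psi' mpsi [C hC] hpsi' n.
set A := hoelder_seminorm 1 psi'.
have hA : hol A psi'.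
  move=> x y; apply: le_trans (hoelder_quotientP x y hpsi') _.
  rewrite powRr1// ler_wpM2l ?dist_le_da//.
  have [q hq] := hoelder_quotients_nonempty 1 psi'.
  exact: le_trans (hoelder_quotients_ge0 hq) (ub_le_sup hpsi' hq).
have bpsi : bm psi by split=> //; exists C.
have bpsi' : bm psi' by exact: bm_hol hA.
rewrite Rint_dual// -[X in _ - X]mulrC -RintZ// -RintB//; last 2 first.
- by apply: bmM => //; exact: iter_markov_bm.
- exact: bmZ.
apply: Rint_norm.
  by apply: bmB; [apply: bmM => //; exact: iter_markov_bm|exact: bmZ].
move=> x; rewrite -[X in _ - X]mulrC -mulrBr normrM.
have -> : K * sup_norm psi * A * r ^+ n = sup_norm psi * (K * r ^+ n * A) by ring.
by apply: ler_pM => //; [exact: sup_norm_ge hC|exact: hK].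
Qed.

(* The bad set where the probability of the cell vanishes is negligible. *)
Lemma shannon_ge (A : finType) (X : T -> A) (u : T -> R) :
  (forall a, measurable [set x | X x = a]) -> bm u ->
  (forall x, fine (nu [set y | X y = X x]) <= expR (u x)) ->
  - (\int[nu]_x u x) <= shannon nu X.
Proof.
move=> mX bu hu; have [_ [C hC]] := bu.
pose p a := fine (nu [set y | X y = a]).
pose F a := if p a == 0 then - C else ln (p a).
rewrite /shannon lerN2.
have -> : \sum_a fine (nu [set x | X x = a]) * ln (fine (nu [set x | X x = a])) =
    \int[nu]_x F (X x).
  rewrite (Rint_finite_valued nu mX F); apply: eq_bigr => a _; rewrite /F -/(p a).
  by have [->|_] := eqVneq (p a) 0; [rewrite mul0r mulr0|rewrite mulrC].
apply: Rint_le => [|//|x]; first exact: (bm_finite_valued mX F).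
rewrite /F; have [_|p0] := eqVneq (p (X x)) 0.
  by have := hC x; rewrite ler_norml => /andP[].
have pp : 0 < p (X x) by rewrite lt_neqAle eq_sym p0 prob_ge0.
by rewrite -ler_expR lnK//; exact: hu.
Qed.

(** Two branches with arbitrary weights, to treat at once the Markov operator and the transfer
    operator. *)
Definition wop (p : bool -> T -> R) (h : T -> R) : T -> R :=
  fun x => p false x * h (br false x) + p true x * h (br true x).

Lemma iter_wop_le_pos (p : bool -> T -> R) n (u v : T -> R) : (forall i x, 0 <= p i x) ->
  (forall x : T, 0 < I01_val x -> u x <= v x) ->
  forall x : T, 0 < I01_val x -> iter n (wop p) u x <= iter n (wop p) v x.
Proof.
move=> p0 uv; elim: n => //= n IH x xp.
by rewrite /wop lerD// ler_wpM2l// IH// br_gt0.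
Qed.

Definition cyl n (y : T) : set T := [set x | itint alpha n x = itint alpha n y].

Lemma measurable_cyl n y : measurable (cyl n y).
Proof. exact: measurable_itint. Qed.

Lemma cylE n y x : (\1_(cyl n y) x : R) = (itin alpha n x == itin alpha n y)%:R.
Proof.
rewrite indicE; congr (nat_of_bool _)%:R; apply/idP/eqP => [/set_mem/(congr1 val)//|h].
by apply: mem_set; exact: val_inj.
Qed.

(** Applied to the indicator of a cylinder, each step keeps only the branch prescribed by the digit
    of [y]. The index of [a] counts the digits still shared after that one, which decides how
    precisely the weight is known. *)
Lemma wop_cyl (p : bool -> T -> R) (a : nat -> T -> R) : (forall i x, 0 <= p i x) ->
  (forall k y, 0 <= a k y) ->
  (forall k y z, itin alpha k z = itin alpha k (f y) -> p (digit alpha y) z <= a k y) ->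
  forall n y (x : T), 0 < I01_val x ->
  iter n (wop p) (\1_(cyl n y)) x <= \prod_(j < n) a (n - j.+1)%N (iter j f y).
Proof.
move=> p0 a0 pa; elim=> [|n IH] y x xp.
  have -> : iter 0 (wop p) (\1_(cyl 0 y)) x = 1 by rewrite [LHS]cylE.
  by rewrite big_ord0.
have scale m c (h : T -> R) z : iter m (wop p) (fun x => c * h x) z = c * iter m (wop p) h z.
  by elim: m z => //= m IHm z; rewrite /wop !IHm; ring.
rewrite big_ord_recl subn1/= -iterS iterSr.
apply: le_trans (_ : a n y * iter n (wop p) (\1_(cyl n (f y))) x <= _).
  rewrite -scale; apply: iter_wop_le_pos => // z zp; rewrite /wop !cylE/=.
  rewrite !digit_br// !intermittent_br// !eqseq_cons.
  have [e|_] := eqVneq (itin alpha n z) _; last by rewrite !andbF !mulr0 addr0.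
  by rewrite !andbT; have := pa n y z e; case: (digit alpha y); rewrite /=; lra.
rewrite ler_wpM2l//; apply: le_trans (IH (f y) x xp) _.
by rewrite le_eqVlt; apply/orP; left; apply/eqP; apply: eq_bigr => j _; rewrite -iterSr.
Qed.

Lemma eigen_measure_cyl_le (p : R) : (forall i x, W i x <= p) ->
  forall n y, fine (nu (cyl n y)) <= p ^+ n.
Proof.
move=> Wp n y; have p0 : 0 <= p by apply: le_trans (Wp true x0); exact/ltW/weight_gt0.
rewrite -Rint_indic; last exact: measurable_cyl.
have bc := @bm_indic _ _ R _ (measurable_cyl n y).
rewrite -(Rint_iter_markov n)// -[leRHS](Rint_cst nu); apply: Rint_le_pos => [| |x xp].
- exact: iter_markov_bm.
- exact: bm_cst.
have := @wop_cyl W (fun _ _ => p) _ _ _ n y x xp; rewrite prodr_const card_ord; apply=> //.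
by move=> i z; exact/ltW/weight_gt0.
Qed.

Lemma iter_markovE n h x :
  iter n M h x = iter n (tr alpha phi) (fun z => g z * h z) x / (l ^+ n * g x).
Proof.
have l0 : 0 < l by case: ep.
have gn z : g z != 0 by rewrite gt_eqF// (eigen_gt0 ep).
have ln m : l ^+ m != 0 by rewrite gt_eqF// exprn_gt0.
elim: n x => [|n IH] x.
  by rewrite expr0 mul1r /=; field; rewrite gn.
rewrite !iterS {1}/markov_op !IH /tr /brop /weight exprS; field.
by rewrite !gn ln gt_eqF.
Qed.

Lemma eigen_measure_cyl_le_birkhoff H : hol H phi -> exists c : R, forall n y,
  fine (nu (cyl n y)) <= expR (c - n%:R * ln l + \sum_(j < n) phi (iter j f y) +
    \sum_(j < n) H * (1 + qa alpha * (n - j)%:R)^-1).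
Proof.
move=> hH; have H0 := hol_ge0 hH; have l0 : 0 < l by case: ep.
case: (ep) => _ [c [b [c0 hb]]] _ _ _.
have b0 : 0 < b by have /andP[h1 h2] := hb x0; apply: lt_le_trans c0 (le_trans h1 h2).
exists (ln (b / c)) => n y.
rewrite -Rint_indic; last exact: measurable_cyl.
have bc := @bm_indic _ _ R _ (measurable_cyl n y).
rewrite -(Rint_iter_markov n)// -[leRHS](Rint_cst nu); apply: Rint_le_pos => [| |x xp].
- exact: iter_markov_bm.
- exact: bm_cst.
have E : expR (ln (b / c) - n%:R * ln l + \sum_(j < n) phi (iter j f y) +
    \sum_(j < n) H * (1 + qa alpha * (n - j)%:R)^-1) = b / c / l ^+ n *
    \prod_(j < n) expR (phi (iter j f y) + H * (1 + qa alpha * (n - j)%:R)^-1).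
  rewrite -expR_sum big_split/= -addrA (expRD (_ - _)); congr (_ * _).
  by rewrite expRD expRN lnK ?posrE ?divr_gt0// expRM_natl lnK.
rewrite E iter_markovE.
have hp : iter n (tr alpha phi) (\1_(cyl n y)) x <=
    \prod_(j < n) expR (phi (iter j f y) + H * (1 + qa alpha * (n - j)%:R)^-1).
  have := @wop_cyl (fun i x => expR (phi (br i x)))
    (fun k y => expR (phi y + H * (1 + qa alpha * k.+1%:R)^-1)) _ _ _ n y x xp.
  move=> h; apply: le_trans (h _ _ _) _ => //.
  - move=> k y' z e; rewrite ler_expR.
    have := hH (br (digit alpha y') z) y'; rewrite ler_norml => /andP[_].
    have := da_brw a01 (itin alpha k.+1 y') (iter k f z) (iter k.+1 f y').
    rewrite brw_itin// size_itin /= -e brw_itin//.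
    by move=> /(ler_wpM2l H0); lra.
  - rewrite le_eqVlt; apply/orP; left; apply/eqP; apply: eq_bigr => j _.
    by rewrite subnSK.
have hg : iter n (tr alpha phi) (fun z => g z * \1_(cyl n y) z) x <=
    b * iter n (tr alpha phi) (\1_(cyl n y)) x.
  rewrite -iter_tr_scale; apply: iter_tr_le => z; rewrite ler_wpM2r//.
  by case/andP: (hb z).
have P0 : 0 <= \prod_(j < n) expR (phi (iter j f y) + H * (1 + qa alpha * (n - j)%:R)^-1).
  by apply: prodr_ge0 => j _; exact: expR_ge0.
have ln0 : 0 < l ^+ n by exact: exprn_gt0.
set P := \prod_(j < n) _ in hp P0 *.
have -> : b / c / l ^+ n * P = (b * P) * (l ^+ n * c)^-1 by field; rewrite !gt_eqF.
apply: ler_pM.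
- apply: iter_tr_ge0 => z; rewrite mulr_ge0 ?(ltW (eigen_gt0 ep _))// indicE ler0n//.
- by rewrite invr_ge0 mulr_ge0 ?(ltW ln0) ?(ltW (eigen_gt0 ep _)).
- by apply: le_trans hg _; rewrite ler_wpM2l// ltW.
rewrite lef_pV2 ?posrE ?mulr_gt0 ?(eigen_gt0 ep)// ler_wpM2l ?(ltW ln0)//.
by case/andP: (hb x).
Qed.

Let idx (x : T) : 'I_2 := inord (digit alpha x).

Let idxE x y : (idx x = idx y) <-> digit alpha x = digit alpha y.
Proof.
split=> [/(congr1 val)|]; last by rewrite /idx => ->.
by rewrite /idx /= !inordK; case: (digit alpha x); case: (digit alpha y).
Qed.

Let midx i : measurable [set x | idx x = i].
Proof.
have := measurable_itin a01 1 (fun w => inord (head false w) == i :> 'I_2).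
suff -> : [set x | inord (head false (itin alpha 1 x)) == i] = [set x | idx x = i] by [].
by apply/seteqP; split => x /= /eqP.
Qed.

Let xi (i : 'I_2) : set T := [set x | idx x = i].

Let xi_part : finite_mpartition xi.
Proof.
split=> [i| |]; first exact: midx.
  by move=> i j _ _ [x [/= <- <-]].
by apply/seteqP; split => // x _; exists (idx x).
Qed.

Let idx_cyl n x : [set y | itidx alpha idx n y = itidx alpha idx n x] = cyl n x.
Proof.
have E m y z : (forall j, (j < m)%N -> digit alpha (iter j f y) = digit alpha (iter j f z)) <->
    itin alpha m y = itin alpha m z.
  elim: m y z => [|m IH] y z //=; split=> [h|[e1 e2] [|j]//= jm].
    congr (_ :: _); first exact: (h 0%N).
    by apply/IH => j jm; have := h j.+1 jm; rewrite !iterSr.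
  by rewrite -!iterS !iterSr; apply: (IH _ _).2.
apply/seteqP; split => y /= h.
  apply: val_inj; apply/E => j jn; apply/idxE.
  by have := congr1 (fun s : {ffun 'I_n -> 'I_2} => s (Ordinal jn)) h; rewrite !ffunE.
apply/ffunP => j; rewrite !ffunE; apply/idxE.
by move: h => /(congr1 val)/E; apply.
Qed.

Let xi_entropy n : join_entropy f nu xi n = shannon nu (itidx alpha idx n).
Proof.
rewrite /join_entropy /shannon; congr (- _); apply: eq_bigr => u _.
suff -> : join_cell f xi u = [set x | itidx alpha idx n x = u] by [].
apply/seteqP; split => x /= h; first by apply/ffunP => j; rewrite ffunE; exact: h.
by move=> j; rewrite -h ffunE.
Qed.

Lemma sum_inv_affine_le (q e : R) : 0 < q -> 0 < e -> exists C, 0 <= C /\ forall n,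
  \sum_(j < n) (1 + q * (n - j)%:R)^-1 <= C + n%:R * e.
Proof.
move=> q0 e0; pose N := (Num.truncn (e * q)^-1).+1; exists N%:R; split=> [|n]//.
have q1 m : 0 < 1 + q * m%:R by rewrite ltr_wpDr// mulr_ge0// ltW.
have -> : \sum_(j < n) (1 + q * (n - j)%:R)^-1 = \sum_(j < n) (1 + q * j.+1%:R)^-1.
  rewrite (reindex_inj rev_ord_inj)/=; apply: eq_bigr => j _.
  by rewrite subKn.
elim: n => [|n IH]; first by rewrite big_ord0 mul0r addr0.
have [nN|Nn] := leqP n.+1 N.
  apply: le_trans (_ : \sum_(j < n.+1) 1 <= _).
    by apply: ler_sum => j _; rewrite invf_le1// lerDl mulr_ge0// ltW.
  rewrite sumr_const card_ord; apply: le_trans (_ : N%:R <= _); first by rewrite ler_nat.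
  by rewrite lerDl mulr_ge0// ltW.
rewrite big_ord_recr/= -natr1 mulrDl mul1r addrA lerD//.
rewrite -[leRHS]invrK lef_pV2 ?posrE ?invr_gt0 ?natr1//.
have : (e * q)^-1 <= n.+1%:R.
  apply: le_trans (ltW (truncnS_gt _)) _; by rewrite ler_nat ltnW.
rewrite invfM => h; have : e^-1 <= q * n.+1%:R by rewrite -ler_pdivrMl// mulrC.
lra.
Qed.

(** All is read on the digit partition. The Birkhoff bound on cylinders from below and
    [shannon_growth] from above squeeze the entropies of the joins, so that [lim] is a true limit,
    equal to [h]. Positivity comes from the cruder bound (1 - d)^n on cylinders. *)
Lemma eigen_measure_entropy :
  (entropy f nu + (\int[nu]_x phi x)%:E = (ln l)%:E)%E /\ (0 < entropy f nu)%E.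
Proof.
have l0 : 0 < l by case: ep.
have nu_inv := eigen_measure_invariant.
case: (ep) => _ [c [b [c0 hb]]] _ [H hH] hL; have H0 := hol_ge0 hH.
have hs : insup alpha phi l.
  by apply: (insup_subinvariant c0 hb) => x; rewrite hL.
have bphi : bm phi by exact: bm_hol hH.
have up := entropy_le a01 H0 hH nu_inv hs.
have [d [/andP[d0 d2] hd]] := weight_ge a01 ep.
pose h := ln l - \int[nu]_x phi x.
have mit n := measurable_itidx a01 midx (n := n).
have low1 n : n%:R * - ln (1 - d) <= join_entropy f nu xi n.
  rewrite xi_entropy; have := @shannon_ge _ (itidx alpha idx n) (fun=> n%:R * ln (1 - d)) (mit n) (bm_cst _).
  rewrite Rint_cst mulrN; apply => x; rewrite idx_cyl expRM_natl lnK ?posrE; last by lra.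
  apply: eigen_measure_cyl_le => i z; have := weight_sum ep z; have := hd (~~ i) z.
  by case: i => /=; lra.
have low2 e : 0 < e -> exists C, forall n, n%:R * (h - e) - C <= join_entropy f nu xi n.
  move=> e0; have [k hk] := eigen_measure_cyl_le_birkhoff hH.
  have H1 : 0 < H + 1 by rewrite ltr_wpDl.
  have [C [C0 hC]] := sum_inv_affine_le (qa_gt0 a01) (divr_gt0 e0 H1).
  exists (k + H * C) => n; rewrite xi_entropy.
  pose v := \sum_(j < n) H * (1 + qa alpha * (n - j)%:R)^-1.
  have biter j : bm (fun x => phi (iter j f x)).
    by apply: bm_comp => //; exact: measurable_iter_intermittent.
  have bS : bm (fun x => \sum_(j < n) phi (iter j f x)) by apply: bm_sum => j.
  have := @shannon_ge _ (itidx alpha idx n)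
    (fun x => (k - n%:R * ln l + v) + \sum_(j < n) phi (iter j f x)) (mit n)
    (bmD (bm_cst _) bS).
  rewrite RintD//; last exact: bm_cst.
  rewrite Rint_cst Rint_sum//.
  under eq_bigr do rewrite (Rint_iter_invariant a01 nu_inv)//.
  rewrite sumr_const card_ord -[_ *+ n]mulr_natl => hh; apply: le_trans (hh _); last first.
    move=> x; rewrite idx_cyl; apply: le_trans (hk n x) _; rewrite ler_expR -/v; lra.
  have : v <= H * C + n%:R * e.
    rewrite /v -mulr_sumr; apply: le_trans (ler_wpM2l H0 (hC n)) _.
    rewrite mulrDr lerD2l mulrCA ler_wpM2l//.
    by rewrite mulrA ler_pdivrMr// mulrC; have := mulr_ge0 (ltW e0) H0; lra.
  by rewrite /h; lra.
have high e : 0 < e -> exists C, forall n, join_entropy f nu xi n <= C + n%:R * (h + e).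
  move=> e0; have [C hC] := shannon_growth a01 H0 hH nu_inv midx hs e0 (isT : (0 < 2)%N).
  by exists C => n; rewrite xi_entropy; exact: hC.
have cv : join_entropy f nu xi n / n%:R @[n --> \oo] --> h.
  apply/(@cvgrPdist_le _ R^o) => e e0; have e2 : 0 < e / 2 by rewrite divr_gt0.
  have [C hC] := low2 _ e2; have [C' hC'] := high _ e2.
  near=> n; have n0 : (0 : R) < n%:R by rewrite ltr0n; near: n; exact: nbhs_infty_gt.
  have h1 : C <= n%:R * (e / 2) by rewrite -ler_pdivrMr//; near: n; exact: nbhs_infty_ger.
  have h2 : C' <= n%:R * (e / 2) by rewrite -ler_pdivrMr//; near: n; exact: nbhs_infty_ger.
  rewrite ler_norml lerBlDr -lerBlDl lerBrDr -lerBrDl ler_pdivrMr// ler_pdivlMr//.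
  by have := hC n; have := hC' n; rewrite /= => h3 h4; apply/andP; split; lra.
have PE : partition_entropy f nu xi = h by exact: (@cvg_lim _ _ _ _ eventually_filter).
have ent_ge : (h%:E <= entropy f nu)%E.
  by apply: ereal_sup_ubound; exists 2%N, xi; rewrite PE; split.
have h0 : 0 < h.
  apply: (@lt_le_trans _ _ (- ln (1 - d))).
    by rewrite oppr_gt0 ln_lt0//; apply/andP; split; lra.
  rewrite -PE; apply: limr_ge; first by apply/cvg_ex; exists h.
  near=> n; have n0 : (0 : R) < n%:R by rewrite ltr0n; near: n; exact: nbhs_infty_gt.
  by rewrite ler_pdivlMr// mulrC.
split; last by apply: lt_le_trans ent_ge; rewrite lte_fin.
apply/eqP; rewrite eq_le up/=.
rewrite (_ : ln l = h + \int[nu]_x phi x); last by rewrite /h; ring.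
by rewrite EFinD leeD2r.
Unshelve. all: by end_near. Qed.

End eigen_measure_properties.

End gibbs_measure.

(** * Pressure *)

Section pressure.
Variables (R : realType) (alpha : R).
Hypothesis a01 : 0 < alpha <= 1.
Local Notation T := (I01 R).
Local Notation hol := (hol alpha).
Local Notation f := (@intermittent R alpha).
Local Notation x0 := (I01_0 R).
Local Notation insup := (insup alpha).
Implicit Types (phi psi : T -> R) (nu : probability T R).

Lemma entropy_ge0 nu : (0 <= entropy f nu)%E.
Proof.
apply: ereal_sup_ubound; exists 1%N, (fun=> setT); split.
  split=> [i|i j _ _ _|]; [exact: measurableT|by rewrite !ord1|].
  by apply/seteqP; split => // x _; exists ord0.
congr EFin; rewrite /partition_entropy.
rewrite (_ : (fun n => _) = fun=> 0); first by apply/esym/cvg_lim => //; exact: cvg_cst.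
apply/funext => n; rewrite /join_entropy big1 ?oppr0 ?mul0r// => u _.
have -> : join_cell f (fun _ : 'I_1 => [set: T]) u = setT by apply/seteqP.
by rewrite probability_setT ln1 mulr0.
Qed.

Lemma delta0_invariant : invariant_measure f (delta0 R).
Proof.
move=> A mA; rewrite /delta0 /= !diracE; congr (_%:R%:E).
by have [h|h] := pselect (A x0); [rewrite !mem_set|rewrite !memNset]; rewrite //= intermittent0.
Qed.

Lemma Rint_delta0 phi : bm phi -> \int[delta0 R]_x phi x = phi x0.
Proof.
move=> [mphi _]; rewrite /Rintegral integral_dirac//; last exact/measurable_EFinP.
by rewrite diracT mul1e.
Qed.

Definition pr phi : R := fine (pressure alpha phi).

Section one_potential.
Variables (phi : T -> R) (H : R).
Hypothesis hH : hol H phi.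
Let H0 : 0 <= H. Proof. exact: hol_ge0 hH. Qed.
Let bphi : bm phi. Proof. exact: (bm_hol a01 hH). Qed.

Lemma pressure_le_insup s : insup phi s -> (pressure alpha phi <= (ln s)%:E)%E.
Proof.
move=> hs; apply: ub_ereal_sup => _ [nu nui <-].
exact: (entropy_le a01 H0 hH nui hs).
Qed.

Lemma pressure_ge nu : invariant_measure f nu ->
  (entropy f nu + (\int[nu]_x phi x)%:E <= pressure alpha phi)%E.
Proof. by move=> nui; apply: ereal_sup_ubound; exists nu. Qed.

Lemma pressureE : pressure alpha phi = (pr phi)%:E.
Proof.
rewrite /pr fineK// fin_numElt; apply/andP; split.
  apply: lt_le_trans (pressure_ge delta0_invariant).
  apply: (@lt_le_trans _ _ (\int[delta0 R]_x phi x)%:E); first exact: ltNyr.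
  by rewrite leeDr// entropy_ge0.
apply: le_lt_trans (pressure_le_insup (insup_big a01 H0 hH)) _; exact: ltry.
Qed.

Lemma pr_ge nu : invariant_measure f nu ->
  (entropy f nu + (\int[nu]_x phi x)%:E <= (pr phi)%:E)%E.
Proof. by move=> /pressure_ge; rewrite pressureE. Qed.

Lemma Rint_le_pr nu : invariant_measure f nu -> \int[nu]_x phi x <= pr phi.
Proof.
move=> /pr_ge h; rewrite -lee_fin; apply: le_trans h.
by rewrite leeDr// entropy_ge0.
Qed.

Lemma phi0_le_pr : phi x0 <= pr phi.
Proof. by rewrite -(Rint_delta0 bphi); apply: Rint_le_pr; exact: delta0_invariant. Qed.

Lemma pr_le_insup s : insup phi s -> pr phi <= ln s.
Proof. by move=> /pressure_le_insup; rewrite pressureE lee_fin. Qed.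

Lemma pr_le b : (forall nu, invariant_measure f nu ->
  (entropy f nu + (\int[nu]_x phi x)%:E <= b%:E)%E) -> pr phi <= b.
Proof.
by move=> h; rewrite -lee_fin -pressureE; apply: ub_ereal_sup => _ [nu nui <-]; exact: h.
Qed.

Lemma pr_eigen g l : eigenpair alpha phi g l ->
  pr phi = ln l /\ exists nu, [/\ gibbs_state alpha phi nu, exponentially_mixing alpha nu
    & (0 < entropy f nu)%E].
Proof.
move=> ep; have [nu [K [r [K0 r01 nuM hK]]]] := eigen_measure a01 ep.
have nui := eigen_measure_invariant a01 ep nuM.
have [e1 e2] := eigen_measure_entropy a01 ep nuM.
case: (ep) => l0 [c [b [c0 hb]]] _ _ hL.
have hs : insup phi l by apply: (insup_subinvariant c0 hb) => x; rewrite hL.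
have E : pr phi = ln l.
  by apply/eqP; rewrite eq_le pr_le_insup//= -lee_fin -e1; exact: pr_ge.
split=> //; exists nu; split => //; last exact: (eigen_measure_mixing a01 ep nuM K0 r01 hK).
by split => //; rewrite pressureE e1 E.
Qed.

Lemma lam_le_expR_pr : expR (phi x0) < lam alpha phi -> exists g, eigenpair alpha phi g (lam alpha phi).
Proof.
move=> El; have [g [c [M [B [c0 gc gB gL]]]]] := eigenfunction a01 H0 hH El.
exists g; split => //; [by apply: lt_trans El; exact: expR_gt0|by exists c, M|by exists B|by exists H].
Qed.

Lemma pr_le_insupP b : (forall s, expR b < s -> insup phi s) -> pr phi <= b.
Proof.
move=> h; apply/ler_addgt0Pr => e e0; rewrite -[b + e]expRK; apply: pr_le_insup; apply: h.
by rewrite ltr_expR ltrDl.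
Qed.

(** If [lam] were at most [expR (phi x0)], every rate above the latter would be in [insup], and the
    entropy bound would give pressure at most [phi x0]. *)
Lemma pr_gt_eigen : phi x0 < pr phi -> exists g, eigenpair alpha phi g (expR (pr phi)).
Proof.
move=> h; have El : expR (phi x0) < lam alpha phi.
  rewrite ltNge; apply/negP => le; have : pr phi <= phi x0.
    apply: pr_le_insupP => s hs; apply: (lam_insup a01 H0 hH); exact: le_lt_trans hs.
  by rewrite leNgt h.
have [g ep] := lam_le_expR_pr El; exists g; have [-> _] := pr_eigen ep.
by rewrite lnK//; case: ep.
Qed.

Lemma pr_gt_gibbs : phi x0 < pr phi -> exists nu,
  [/\ gibbs_state alpha phi nu, exponentially_mixing alpha nu & (0 < entropy f nu)%E].
Proof. by move=> /pr_gt_eigen[g /pr_eigen[_]]. Qed.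

Lemma lam_le_phi0 : pr phi <= phi x0 -> lam alpha phi <= expR (phi x0).
Proof.
move=> h; rewrite leNgt; apply/negP => El.
have [g ep] := lam_le_expR_pr El; have [e _] := pr_eigen ep.
move: El; rewrite -[lam _ _]lnK; last by case: ep.
by rewrite -e ltr_expR ltNge h.
Qed.

End one_potential.

Lemma pr_mono phi psi A B c : hol A phi -> hol B psi ->
  (forall x, phi x <= psi x + c) -> pr phi <= pr psi + c.
Proof.
move=> hA hB h; apply: (pr_le hA) => nu nui.
have bphi := bm_hol a01 hA; have bpsi := bm_hol a01 hB.
apply: le_trans (_ : entropy f nu + (\int[nu]_x psi x)%:E + c%:E <= _)%E; last first.
  by rewrite EFinD leeD2r// (pr_ge hB).
rewrite -addeA leeD2l// -EFinD lee_fin -[X in _ + X](Rint_cst nu) -RintD//.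
  by apply: Rint_le => //; apply: bmD => //; exact: bm_cst.
exact: bm_cst.
Qed.

Lemma pr_addr phi A c : hol A phi -> pr (fun x => phi x + c) = pr phi + c.
Proof.
move=> hA; have hc : hol (A + 0) (fun x => phi x + c) by apply: holD => //; exact: hol_cst.
apply/eqP; rewrite eq_le (pr_mono hc hA)//=.
rewrite -lerBrDr; apply: (pr_mono hA hc) => x; lra.
Qed.

Lemma pr_dist phi psi A B e : hol A phi -> hol B psi ->
  (forall x, `|phi x - psi x| <= e) -> `|pr phi - pr psi| <= e.
Proof.
move=> hA hB h; rewrite ler_distl; apply/andP; split.
  rewrite lerBlDr; apply: (pr_mono hB hA) => x; have := h x; rewrite ler_norml; lra.
by apply: (pr_mono hA hB) => x; have := h x; rewrite ler_norml; lra.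
Qed.

(** Passing from [b] to [b'] adds [b' - b] times the integral of [phi] to the free energy of a
    measure, and this integral is at most [phi x0]. *)
Lemma pr_freeze phi A b b' : hol A phi -> b <= b' -> 
  pr (fun x => b * phi x) <= b * phi x0 ->
  (forall nu, invariant_measure f nu -> \int[nu]_x phi x <= phi x0) ->
  pr (fun x => b' * phi x) = b' * phi x0.
Proof.
move=> hA bb h hi; have bphi := bm_hol a01 hA.
apply/eqP; rewrite eq_le (phi0_le_pr (holZ b' hA)) andbT.
apply: (pr_le (holZ b' hA)) => nu nui.
have h1 : (entropy f nu + (\int[nu]_x (b * phi x))%:E <= (b * phi x0)%:E)%E.
  by apply: le_trans (pr_ge (holZ b hA) nui) _; rewrite lee_fin.
rewrite RintZ// -leeBrDr// in h1; rewrite RintZ// -leeBrDr//.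
apply: le_trans h1 _; rewrite -!EFinB lee_fin.
have := ler_wpM2l (_ : 0 <= b' - b) (hi nu nui); rewrite subr_ge0 => /(_ bb); lra.
Qed.

(** For the potential 0 the operator counts the two branches: the constant 1 has eigenvalue 2. *)
Lemma pr0_gt0 : 0 < pr (fun=> 0).
Proof.
have ep : eigenpair alpha (fun=> 0) (fun=> 1) 2.
  split => //; [by exists 1, 1; split=> // x; rewrite lexx|by exists 0; exact: hol_cst|by exists 0; exact: hol_cst|].
  by move=> x; rewrite /tr /brop expR0; ring.
have [-> _] := pr_eigen (hol_cst alpha 0) ep; rewrite ln_gt0// ltr1n//.
Qed.

End pressure.

(** * Estimates for the induced map *)

Section induced.
Variables (R : realType) (alpha : R).
Hypothesis a01 : 0 < alpha <= 1.
Local Notation T := (I01 R).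
Local Notation hol := (hol alpha).
Local Notation f := (@intermittent R alpha).
Local Notation x0 := (I01_0 R).
Local Notation x1 := (I01_1 R).
Local Notation b0 := (br alpha false).
Local Notation b1 := (br alpha true).
Local Notation inJ := (inJ alpha).
Local Notation insup := (insup alpha).
Local Notation pr := (pr alpha).
Local Notation qa := (qa alpha).
Implicit Types (phi psi : T -> R) (nu : probability T R).

Let q0 : 0 < qa. Proof. exact: qa_gt0. Qed.

Definition ret k (x : T) : T := b1 (iter k b0 x).

(** Birkhoff sum of [phi] over the [k.+1] points of an excursion whose inverse branch is [ret k];
    its exponential is the weight of the induced operator, see [iter_induced]. *)
Definition retsum phi k x : R := nsum alpha phi k x + phi (ret k x).

Lemma inJ_ret k x : inJ (ret k x). Proof. exact: inJ_br1. Qed.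

Lemma iter_induced phi v k x :
  iter k (brop alpha phi false) (brop alpha phi true v) x =
  expR (retsum phi k x) * v (ret k x).
Proof. by rewrite iter_brop0 /brop mulrA -expRD. Qed.

Lemma retsumD phi psi k x :
  retsum (fun y => phi y + psi y) k x = retsum phi k x + retsum psi k x.
Proof. by rewrite /retsum /nsum big_split/=; ring. Qed.

Lemma retsumZ c phi k x : retsum (fun y => c * phi y) k x = c * retsum phi k x.
Proof. by rewrite /retsum /nsum -mulr_sumr; ring. Qed.

Definition neutral_harmonic k : R := \sum_(j < k) (1 + qa * j.+1%:R)^-1.

Lemma harmonic_le_ln k : \sum_(j < k) (j.+1%:R : R)^-1 <= 1 + ln k.+1%:R.
Proof.
case: k => [|k]; first by rewrite big_ord0 ln1 addr0.
apply: (@le_trans _ _ (1 + ln k.+1%:R)); last first.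
  by rewrite lerD2l ler_ln ?posrE// ler_nat.
elim: k => [|k IH]; first by rewrite big_ord_recr big_ord0/= ln1 invr1; lra.
rewrite big_ord_recr/=; apply: le_trans (lerD IH (lexx _)) _.
have k0 : (0 : R) < k.+1%:R by rewrite ltr0n.
have k20 : (0 : R) < k.+2%:R by rewrite ltr0n.
rewrite -addrA lerD2l -lerBrDl.
have -> : ln (k.+2%:R : R) - ln k.+1%:R = - ln (k.+1%:R / k.+2%:R).
  by rewrite ln_div ?posrE// opprB.
have -> : (k.+1%:R / k.+2%:R : R) = 1 + - k.+2%:R^-1.
  have -> : k.+1%:R = k.+2%:R - 1 :> R by rewrite -[k.+2%:R]natr1 addrK.
  by move: k20; set z := k.+2%:R => z0; field; rewrite gt_eqF.
by rewrite lerNr le_ln1Dx// ltrN2 invf_lt1// ltr1n.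
Qed.

Lemma ln_le_sum_inv (A : R) k : 0 < A -> ln ((A + k%:R + 1) / (A + 1)) <=
  \sum_(j < k) (A + j.+1%:R)^-1.
Proof.
move=> A0; have Ak m : 0 < A + m%:R + 1 by rewrite ltr_wpDl// addr_ge0// ltW.
elim: k => [|k IH]; first by rewrite big_ord0 addr0 divff ?ln1// gt_eqF// ltr_wpDl// ltW.
rewrite big_ord_recr/=; apply: le_trans (lerD IH (lexx _)).
have A1 : 0 < A + 1 by rewrite ltr_wpDl// ltW.
rewrite !ln_div ?posrE// [leRHS]addrAC lerD2r -lerBlDl -ln_div ?posrE//.
have -> : A + k.+1%:R = A + k%:R + 1 by rewrite -natr1 addrA.
set z := A + k%:R + 1; have z0 : 0 < z by exact: Ak.
have -> : (z + 1) / z = 1 + z^-1 by field; rewrite gt_eqF.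
by rewrite le_ln1Dx// (lt_trans _ (_ : 0 < z^-1)) ?invr_gt0// oppr_lt0.
Qed.

Lemma neutral_harmonic_le k : neutral_harmonic k <= (1 + ln k.+1%:R) / qa.
Proof.
rewrite ler_pdivlMr//; apply: le_trans (harmonic_le_ln k).
rewrite /neutral_harmonic mulr_suml; apply: ler_sum => j _.
have j0 : 0 < j.+1%:R :> R by rewrite ltr0n.
have p0 : 0 < qa * j.+1%:R by rewrite mulr_gt0.
rewrite mulrC ler_pdivrMr; last by lra.
by rewrite mulrDr mulr1 mulrCA mulVf ?gt_eqF// mulr1 lerDr invr_ge0 ltW.
Qed.

Lemma dist0_le e psi y : hol e psi -> psi x0 = 0 -> `|psi y| <= e * I01_val y `^ alpha.
Proof. by move=> he p0; have := he y x0; rewrite p0 subr0 da0E. Qed.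

Lemma nsum_bound e psi i k x : hol e psi -> psi x0 = 0 ->
  `|\sum_(i <= j < k) psi (iter j.+1 b0 x)| <= e * \sum_(i <= j < k) (1 + qa * j.+1%:R)^-1.
Proof.
move=> he p0; have e0 := hol_ge0 he; apply: le_trans (ler_norm_sum _ _ _) _.
rewrite mulr_sumr; apply: ler_sum => j _; apply: le_trans (dist0_le _ he p0) _.
by rewrite ler_wpM2l// iter_br0_upper.
Qed.

Lemma retsum_bound e psi k x : hol e psi -> psi x0 = 0 ->
  `|retsum psi k x| <= e * (1 + neutral_harmonic k).
Proof.
move=> he p0; have e0 := hol_ge0 he; apply: le_trans (ler_normD _ _) _.
rewrite mulrDr mulr1 addrC lerD//.
  apply: le_trans (dist0_le _ he p0) _; rewrite ler_piMr//.
  by have := da_le1 a01 (ret k x) x0; rewrite da0E.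
by have := nsum_bound 0 k x he p0; rewrite !big_mkord.
Qed.

(** The logarithm of the subinvariant function acts as a coboundary: it normalizes the induced
    weights to total mass at most 1 while changing their logarithms by a bounded amount. *)
Lemma induced_log phi H : hol H phi -> phi x0 = 0 -> pr phi <= 0 ->
  exists D (u : T -> R), 0 <= D /\ (forall x, inJ x -> `|u x| <= D) /\
  forall n x, inJ x -> \sum_(k < n) expR (retsum phi k x + u (ret k x) - u x) <= 1.
Proof.
move=> hH p0 pr0; have H0 := hol_ge0 hH.
have lE : lam alpha phi <= expR (phi x0) by apply: (lam_le_phi0 a01 hH); rewrite p0.
have [v [vD vs]] := induced_subinvariant a01 H0 hH lE.
exists (Dcone alpha H), (fun x => ln (v x)).
have v0 x : inJ x -> 0 < v x by move=> /vD/andP[h _]; exact: lt_le_trans (expR_gt0 _) h.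
split; first exact: Dcone_ge0.
split=> [x xJ|n x xJ].
  have /andP[h1 h2] := vD x xJ; rewrite ler_norml -ler_expR lnK ?h1 ?posrE ?v0//=.
  by rewrite -ler_expR lnK ?posrE ?v0.
rewrite -(ler_pM2r (v0 _ xJ)) mul1r mulr_suml; apply: le_trans (vs n x xJ).
rewrite le_eqVlt; apply/orP; left; apply/eqP; apply: eq_bigr => k _.
rewrite p0 expR0 expr1n invr1 mul1r iter_induced -addrA expRD expRB.
by rewrite !lnK ?posrE ?v0//; [field; rewrite gt_eqF ?v0|exact: inJ_ret].
Qed.

(** Converse direction, used to bound pressures from above: a normalization with a definite loss
    [eta] at the rate [t] certifies that rate. *)
Lemma insup_log phi H (t eta D : R) (u : T -> R) : hol H phi -> phi x0 < t -> 0 < eta ->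
  (forall x, inJ x -> `|u x| <= D) ->
  (forall n x, inJ x ->
    \sum_(k < n) expR (retsum phi k x + u (ret k x) - u x - k.+1%:R * t) <= 1 - eta) ->
  insup phi (expR t).
Proof.
move=> hH pt e0 uD hs; have H0 := hol_ge0 hH.
apply: (@insup_induced _ _ a01 phi H H0 hH (expR t) eta (expR (- D)) (expR D)
  (fun x => expR (u x))) => //.
- by rewrite ltr_expR.
- exact: expR_gt0.
- by move=> x /uD; rewrite ler_norml !ler_expR.
move=> n x xJ; rewrite -ler_pdivrMr ?expR_gt0// mulr_suml; apply: le_trans (hs n x xJ).
rewrite le_eqVlt; apply/orP; left; apply/eqP; apply: eq_bigr => k _.
by rewrite iter_induced -expRM_natl -!expRN -!expRD; congr expR; ring.
Qed.

Section persistence.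
Variables (phi : T -> R) (H : R).
Hypothesis hH : hol H phi.
Hypothesis phi0 : phi x0 = 0.
Variables (D : R) (u : T -> R).
Hypothesis D0 : 0 <= D.
Hypothesis uD : forall x, inJ x -> `|u x| <= D.
Hypothesis us : forall n x, inJ x ->
  \sum_(k < n) expR (retsum phi k x + u (ret k x) - u x) <= 1.
Let A k x := retsum phi k x + u (ret k x) - u x.
Let H0 : 0 <= H. Proof. exact: hol_ge0 hH. Qed.

Lemma induced_log_ge k x : inJ x -> - (H * (1 + neutral_harmonic k)) - 2 * D <= A k x.
Proof.
move=> xJ; have := retsum_bound k x hH phi0; have := uD xJ; have := uD (inJ_ret k x).
by rewrite /A !ler_norml; lra.
Qed.

(** The weights of indices 0 and 1 are both at least [d], and the total is at most 1, so each weight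
    leaves room for one of these two and is at most [1 - d]. *)
Lemma induced_log_lt0 : exists2 m, 0 < m & forall k x, inJ x -> A k x <= - m.
Proof.
pose d := expR (- (2 * H) - 2 * D) / 2.
have d0 : 0 < d by rewrite divr_gt0 ?expR_gt0.
have d1 : d < 1.
  rewrite ltr_pdivrMr// mul1r; apply: (@le_lt_trans _ _ 1); last by rewrite ltr1n.
  by rewrite -[leRHS]expR0 ler_expR; have := H0; have := D0; lra.
have dk k x : inJ x -> (k <= 1)%N -> d < expR (A k x).
  move=> xJ k1; apply: (@lt_le_trans _ _ (expR (- (2 * H) - 2 * D))).
    by rewrite ltr_pdivrMr// ltr_pMr ?expR_gt0// ltr1n.
  rewrite ler_expR; apply: le_trans (induced_log_ge k xJ).
  have h : neutral_harmonic k <= 1.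
    case: k k1 => [|[|//]] _; first by rewrite /neutral_harmonic big_ord0.
    rewrite /neutral_harmonic big_ord_recr big_ord0/= add0r mulr1 invf_le1; have := q0; lra.
  by have := ler_wpM2l H0 h; lra.
exists (- ln (1 - d)).
  by rewrite oppr_gt0 ln_lt0//; apply/andP; split; lra.
move=> k x xJ; rewrite opprK -ler_expR lnK ?posrE; last by lra.
case: k => [|k].
  have := us 2 xJ; rewrite !big_ord_recr big_ord0/= add0r.
  by have := dk 1%N x xJ isT; rewrite /A; lra.
have := us k.+2 xJ; rewrite big_ord_recr big_ord_recl/= => h.
have : 0 <= \sum_(i < k) expR (retsum phi (bump 0 i) x + u (ret (bump 0 i) x) - u x).
  by apply: sumr_ge0 => i _; exact: expR_ge0.
by have := dk 0%N x xJ isT; rewrite /A; lra.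
Qed.

(* The terms with index in [k/2, k] are comparable, so each is at most C/(k+1). *)
Lemma induced_log_decay : exists C, forall k x, inJ x -> ln k.+1%:R <= C - A k x.
Proof.
pose C1 := H / qa + H + 2 * D.
exists (ln 2 + C1) => k x xJ.
have slow i : (i <= k <= i.*2)%N -> A k x - C1 <= A i x.
  move=> /andP[ik ki].
  have E : A k x - A i x = \sum_(i <= j < k) phi (iter j.+1 b0 x) +
      (phi (ret k x) - phi (ret i x)) + (u (ret k x) - u (ret i x)).
    rewrite /A /retsum /nsum -!(big_mkord xpredT (fun j => phi (iter j.+1 b0 x))).
    by rewrite (big_cat_nat (leq0n i) ik)/=; ring.
  have h1 := nsum_bound i k x hH phi0; rewrite ler_norml in h1; have [_ h2] := andP h1.
  have h3 : \sum_(i <= j < k) (1 + qa * j.+1%:R)^-1 <= qa^-1.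
    apply: le_trans (_ : \sum_(i <= j < k) (qa * i.+1%:R)^-1 <= _).
      apply: ler_sum_nat => j /andP[ij _].
      have i0 : 0 < i.+1%:R :> R by rewrite ltr0n.
      have j0 : 0 < j.+1%:R :> R by rewrite ltr0n.
      have ij' : i.+1%:R <= j.+1%:R :> R by rewrite ler_nat.
      have := ler_wpM2l (ltW q0) ij'; have := mulr_gt0 q0 i0; have := mulr_gt0 q0 j0.
      by move=> g1 g2 g3; rewrite lef_pV2 ?posrE; lra.
    rewrite sumr_const_nat -[_ *+ _]mulr_natr invfM -mulrA ler_piMr ?invr_ge0 ?(ltW q0)//.
    rewrite mulrC ler_pdivrMr ?ltr0n// mul1r ler_nat leq_subLR.
    by rewrite (leq_trans ki)// -addnn leq_add2l leqnSn.
  have h4 := hH (ret k x) (ret i x); rewrite ler_norml in h4; have [_ h5] := andP h4.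
  have h6 := ler_wpM2l H0 (da_le1 a01 (ret k x) (ret i x)).
  have := uD (inJ_ret k x); have := uD (inJ_ret i x); rewrite !ler_norml => /andP[g1 g2] /andP[g3 g4].
  by have := ler_wpM2l H0 h3; rewrite /C1; lra.
have := us k.+1 xJ; rewrite -(big_mkord xpredT (fun k => expR (A k x))).
have um : (uphalf k <= k.+1)%N by rewrite uphalf_half; have := odd_double_half k; lia.
rewrite (big_cat_nat (leq0n _) um)/= => h.
have h1 : 0 <= \sum_(0 <= i < uphalf k) expR (A i x) by apply: sumr_ge0 => i _; exact: expR_ge0.
have h2 : \sum_(uphalf k <= i < k.+1) expR (A k x - C1) <= \sum_(uphalf k <= i < k.+1) expR (A i x).
  apply: ler_sum_nat => i /andP[ui ik]; rewrite ler_expR; apply: slow.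
  rewrite -ltnS ik/= -leq_uphalf_double//.
rewrite sumr_const_nat -[_ *+ _]mulr_natl in h2.
have h3 : k.+1%:R / 2 <= (k.+1 - uphalf k)%:R :> R.
  rewrite ler_pdivrMr// -natrM ler_nat uphalf_half; have := odd_double_half k.
  by rewrite muln2 -!addnn; lia.
have h4 : k.+1%:R / 2 * expR (A k x - C1) <= 1.
  by have := ler_wpM2r (expR_ge0 (A k x - C1)) h3; lra.
have k0 : (0 : R) < k.+1%:R by rewrite ltr0n.
have : ln (k.+1%:R / 2 * expR (A k x - C1)) <= 0.
  by apply: ln_le0.
rewrite lnM ?posrE ?divr_gt0 ?expR_gt0// ln_div ?posrE// expRK; lra.
Qed.

End persistence.

(** Multiplication by [b] adds [(b - 1) * A k x] to the normalized logarithms, a negative quantity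
    bounded away from 0 and of order at most - log k. Half of it pays for the perturbation, whose
    growth in [k] is compared with [- A k x] through [induced_log_decay]; the rest leaves the loss
    [eta]. *)
Lemma pr_freeze_near phi H b : hol H phi -> pr phi <= phi x0 -> 1 < b ->
  exists2 e, 0 < e & forall psi A, hol A psi -> hol e (fun x => psi x - phi x) ->
    pr (fun x => b * psi x) <= b * psi x0.
Proof.
move=> hH prp b1; pose phi' x := phi x + (- phi x0).
have hH' : hol H phi' by rewrite -[H]addr0; apply: holD => //; exact: hol_cst.
have p0 : phi' x0 = 0 by rewrite /phi' subrr.
have pr' : pr phi' <= 0 by rewrite (pr_addr a01 _ hH); lra.
have [D [u [D0 [uD us]]]] := induced_log hH' p0 pr'.
have [m m0 hm] := induced_log_lt0 hH' p0 D0 uD us.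
have [C hC] := induced_log_decay hH' p0 D0 uD us.
pose C2 := Num.max 1 (1 + (1 + C) / qa).
have C20 : 0 < C2 by rewrite lt_max ltr01.
have K0 : 0 < 2 / qa + 4 * C2 / m by rewrite addr_gt0// divr_gt0// mulr_gt0.
(* Chosen to have both [e * (2 / qa) <= b - 1], against the part growing with [k], and
   [e * (4 * C2 / m) <= b - 1], against the constant part. *)
pose e := (b - 1) / (2 / qa + 4 * C2 / m).
have e0 : 0 < e by rewrite divr_gt0// subr_gt0.
have bp : 0 < b by exact: lt_trans b1.
exists (e / b); first by rewrite divr_gt0.
move=> psi B hB hpsi.
pose chi x := (psi x - phi x) + - (psi x0 - phi x0).
have hchi : hol (e / b) chi by rewrite -[e / b]addr0; apply: holD => //; exact: hol_cst.
have chi0 : chi x0 = 0 by rewrite /chi subrr.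
have E : (fun x => b * psi x) = fun x => b * (phi' x + chi x) + b * psi x0.
  by apply/funext => x; rewrite /phi' /chi; ring.
have hPhi : hol (`|b| * (H + e / b)) (fun x => b * (phi' x + chi x)).
  by apply: holZ; exact: holD.
rewrite E (pr_addr a01 _ hPhi) gerDr; apply: (pr_le_insupP a01 hPhi) => s.
rewrite expR0 => s1; have t0 : 0 < ln s by rewrite ln_gt0.
rewrite -[s]lnK ?posrE ?(lt_trans _ s1)//.
pose eta := (b - 1) * m / 4; have eta0 : 0 < eta by rewrite divr_gt0// mulr_gt0// subr_gt0.
apply: (@insup_log _ _ (ln s) (1 - expR (- eta)) (b * D) (fun x => b * u x) hPhi).
- by rewrite p0 chi0 addr0 mulr0.
- by rewrite subr_gt0 expR_lt1 oppr_lt0.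
- by move=> x /uD; rewrite normrM (gtr0_norm bp) ler_pM2l.
move=> n x xJ; rewrite subKr.
apply: le_trans (_ : \sum_(k < n) expR (- eta) *
    expR (retsum phi' k x + u (ret k x) - u x) <= _).
  apply: ler_sum => k _; rewrite -expRD ler_expR.
  set Ak := retsum phi' k x + u (ret k x) - u x.
  have -> : retsum (fun y => b * (phi' y + chi y)) k x + b * u (ret k x) - b * u x =
      b * Ak + b * retsum chi k x.
    by rewrite retsumZ retsumD /Ak; ring.
  have h1 : 0 <= k.+1%:R * ln s by rewrite mulr_ge0// ltW.
  have h2 := retsum_bound k x hchi chi0; rewrite ler_norml in h2; have [_ h3] := andP h2.
  have h4 : b * retsum chi k x <= e * (1 + neutral_harmonic k).
    by rewrite mulrC -ler_pdivlMr// mulrAC.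
  have h5 : 1 + neutral_harmonic k <= C2 - Ak / qa.
    have g1 : 1 + (1 + C) / qa <= C2 by rewrite le_max lexx orbT.
    have g2 := neutral_harmonic_le k.
    have g3 : (1 + ln k.+1%:R) / qa <= (1 + (C - Ak)) / qa.
      by rewrite ler_pM2r ?invr_gt0// lerD2l; exact: hC.
    have g4 : (1 + (C - Ak)) / qa = (1 + C) / qa - Ak / qa by ring.
    by lra.
  have h6 := ler_wpM2l (ltW e0) h5.
  have h7 : Ak <= - m by exact: hm.
  have e1 : e * (2 / qa) <= b - 1.
    by rewrite /e mulrAC ler_pdivrMr// ler_wpM2l ?subr_ge0 ?(ltW b1)// lerDl divr_ge0// ?mulr_ge0// ltW.
  have e2 : e * (4 * C2 / m) <= b - 1.
    by rewrite /e mulrAC ler_pdivrMr// ler_wpM2l ?subr_ge0 ?(ltW b1)// lerDr divr_ge0// ltW.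
  have e3 : e * C2 <= (b - 1) * m / 4.
    have := ler_wpM2r (ltW m0) e2; have -> : e * (4 * C2 / m) * m = 4 * (e * C2) by field; rewrite gt_eqF.
    lra.
  have e4 : e * (- Ak / qa) <= (b - 1) / 2 * - Ak.
    have A0 : 0 <= - Ak by lra.
    have := ler_wpM2r A0 e1; have -> : e * (2 / qa) * - Ak = 2 * (e * (- Ak / qa)) by ring.
    lra.
  have e5 : e * (C2 - Ak / qa) = e * C2 + e * (- Ak / qa) by ring.
  have b10 : 0 <= b - 1 by lra.
  have e6 := ler_wpM2l b10 h7.
  by rewrite /eta; lra.
rewrite -mulr_sumr ler_piMr ?expR_ge0//; exact: us.
Qed.

Lemma hol_cusp : hol 1 (fun x : T => I01_val x `^ alpha).
Proof.
by move=> x y; rewrite mul1r; apply: powR_dist; [exact: a01|exact: I01_ge0|exact: I01_ge0].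
Qed.

Let pow0 : I01_val x0 `^ alpha = 0.
Proof. by rewrite powR0// gt_eqF//; case/andP: a01. Qed.

(** With [u = 0], the return sum of [x^alpha] is at least the logarithm of an affine function of
    [k], by [iter_br0_lower], plus [tau] at the return point. The summand 2 of [B] makes the weights
    decay like 1 / k^2, and [ln Q / tau] brings their sum down to 1/2. *)
Lemma cusp_pressure : exists2 B, 0 < B & pr (fun x => - B * I01_val x `^ alpha) <= 0.
Proof.
have a0 : 0 < alpha by case/andP: a01.
pose tau := cutp alpha `^ alpha; have tau0 : 0 < tau by exact: cuta_gt0.
have tau1 : tau <= 1 by have := da_le1 a01 (br alpha true x0) x0; rewrite da0E.
pose A := tau^-1; have A1 : 1 <= A by rewrite invf_ge1.
have A0 : 0 < A by exact: lt_le_trans A1.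
(* Twice [(A + 1)^2 / A], the telescoped bound for the sum of the weights. *)
pose Q := 2 * (A + 1) ^+ 2 / A.
have Q1 : 1 <= Q by rewrite ler_pdivlMr// mul1r; nra.
have Q0 : 0 < Q by exact: lt_le_trans Q1.
pose B := 2 + ln Q / tau; have B2 : 2 <= B.
  by rewrite lerDl; apply: divr_ge0; [exact: ln_ge0|exact: ltW].
have B0 : 0 < B by exact: lt_le_trans B2.
exists B => //; pose pw (x : T) := I01_val x `^ alpha.
have hB : hol (`|- B| * 1) (fun x => - B * pw x) by exact: (holZ _ hol_cusp).
apply: (pr_le_insupP a01 hB) => s; rewrite expR0 => s1.
have t0 : 0 < ln s by rewrite ln_gt0.
rewrite -[s]lnK ?posrE ?(lt_trans _ s1)//.
apply: (@insup_log _ _ (ln s) (1 / 2) 0 (fun=> 0) hB) => //.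
- by rewrite /pw pow0 mulr0.
- by move=> x _; rewrite normr0.
move=> n x xJ; rewrite (_ : 1 - 1 / 2 = 1 / 2 :> R); last by lra.
have term k : retsum (fun y => - B * pw y) k x + 0 - 0 - k.+1%:R * ln s <=
    - ln Q + - (2 * ln ((A + k%:R + 1) / (A + 1))).
  have h1 : ln ((A + k%:R + 1) / (A + 1)) + tau <= retsum pw k x.
    apply: lerD; last by apply: le_powR_alpha => //; [exact/ltW/cut_gt0|exact: inJ_ret].
    apply: le_trans (ln_le_sum_inv k A0) _; apply: ler_sum => j _.
    apply: iter_br0_lower => //; rewrite /A invrK; apply: le_powR_alpha => //.
    exact/ltW/cut_gt0.
  have h2 : 0 <= k.+1%:R * ln s by rewrite mulr_ge0// ltW.
  have h3 : 0 <= ln ((A + k%:R + 1) / (A + 1)).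
    rewrite ln_ge0// ler_pdivlMr ?addr_gt0// mul1r lerD2r lerDl//.
  rewrite retsumZ; have h4 := ler_wpM2l (ltW B0) h1; rewrite mulrDr in h4.
  have h5 : ln Q <= B * tau.
    by rewrite /B mulrDl divfK ?gt_eqF// lerDr; apply: mulr_ge0; rewrite ?(ltW tau0).
  have h6 := ler_wpM2r h3 B2; lra.
apply: le_trans (_ : \sum_(k < n) Q^-1 * ((A + 1) ^+ 2 * ((A + k%:R)^-1 - (A + k.+1%:R)^-1)) <= _).
  apply: ler_sum => k _; have -> : Q^-1 = expR (- ln Q) by rewrite expRN lnK ?posrE.
  apply: le_trans (_ : expR (- ln Q + - (2 * ln ((A + k%:R + 1) / (A + 1)))) <= _).
    by rewrite ler_expR; exact: term.
  rewrite expRD ler_wpM2l ?expR_ge0// expRN.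
  have k0 : 0 <= k%:R :> R by [].
  rewrite expRM_natl lnK ?posrE; last by apply: divr_gt0; lra.
  rewrite -natr1 addrA; move: (A + k%:R) (ltr_wpDr k0 A0 : 0 < A + k%:R) => z z0.
  have z1 : 0 < z + 1 by lra.
  have -> : (((z + 1) / (A + 1)) ^+ 2)^-1 = (A + 1) ^+ 2 * ((z + 1) ^+ 2)^-1.
    by field; rewrite !gt_eqF//; lra.
  rewrite ler_wpM2l ?sqr_ge0//.
  have -> : z^-1 - (z + 1)^-1 = (z * (z + 1))^-1 by field; rewrite !gt_eqF.
  by rewrite lef_pV2 ?posrE ?exprn_gt0 ?mulr_gt0// expr2 ler_wpM2r ?ltW//; lra.
rewrite -!mulr_sumr.
have -> : \sum_(k < n) ((A + k%:R)^-1 - (A + k.+1%:R)^-1) = A^-1 - (A + n%:R)^-1.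
  elim: n => [|m IH]; first by rewrite big_ord0 addr0 subrr.
  by rewrite big_ord_recr/= IH; ring.
have h : A^-1 - (A + n%:R)^-1 <= A^-1 by rewrite gerBl invr_ge0 addr_ge0// ltW.
have h2 := ler_wpM2l (sqr_ge0 (A + 1)) h.
apply: le_trans (ler_wpM2l _ h2) _; first by rewrite invr_ge0 ltW.
by rewrite /Q le_eqVlt; apply/orP; left; apply/eqP; field; rewrite !gt_eqF//; lra.
Qed.

(* Left end of the n-th fundamental interval of the neutral branch. *)
Let xn n : R := I01_val (iter n b0 x1).

Let xn_gt0 n : 0 < xn n.
Proof. by elim: n => [|n IH]; [exact: ltr01|exact: br_gt0]. Qed.

Let xn_pow n : (n.+1%:R)^-1 <= xn n `^ alpha.
Proof.
rewrite -natr1 addrC; apply: (iter_br0_lower a01 n (lexx 1)).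
by rewrite invr1 powR1.
Qed.

(** The upper rate [1 / (qa j)] of neutral orbits against the lower rate [1 / (n + 1)] of [xn n]
    shows that an index [j] of order [n] suffices to reach the left half of the dip. *)
Lemma ramp_iter_br0 n j x : 2 * n.+1%:R <= 1 + qa * j%:R ->
  1 / 2 <= ramp 0 (xn n)^-1 (iter j b0 x).
Proof.
move=> hj; have /andP[a0 a1] := a01; set y := iter j b0 x.
have n0 : (0 : R) < n.+1%:R by rewrite ltr0n.
have h1 : I01_val y `^ alpha <= (2 * n.+1%:R)^-1.
  apply: le_trans (iter_br0_upper a01 j x) _.
  by rewrite lef_pV2 ?posrE ?mulr_gt0//; apply: lt_le_trans hj; rewrite mulr_gt0.
have h2 : (2 * n.+1%:R)^-1 <= (xn n / 2) `^ alpha.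
  rewrite powRM ?invr_ge0 ?(ltW (xn_gt0 _))// invfM mulrC ler_pM ?invr_ge0 ?xn_pow//.
  by apply: (powR_ge_id a01); apply/andP; split; lra.
have hy : I01_val y <= xn n / 2.
  rewrite leNgt; apply/negP => hlt; have := le_trans h1 h2; rewrite leNgt => /negP; apply.
  apply: gt0_ltr_powR => //; rewrite nnegrE ?I01_ge0// divr_ge0// ltW//.
rewrite /ramp -[1 / 2]clampE; last by apply/andP; split; lra.
apply: clamp_le; rewrite subr0.
have : (xn n)^-1 * I01_val y <= 1 / 2.
  by rewrite mulrC ler_pdivrMr//; lra.
lra.
Qed.

(* Lowering the potential near the neutral point by a dip of width xn n decreases the
   pressure by at least a negative power of n. *)
Lemma pr_dip phi H : hol H phi -> phi x0 = 0 -> pr phi <= 0 -> exists c p, [/\ 0 < c, 0 <= p &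
  forall n, pr (fun x => phi x - ramp 0 (xn n)^-1 x) <= - (c * expR (- (p * ln n.+1%:R)))].
Proof.
move=> hH p0 prp; have H0 := hol_ge0 hH.
have [D [u [D0 [uD us]]]] := induced_log hH p0 prp.
have hge := induced_log_ge hH p0 uD.
pose Q := 2 / qa + 3; have Q0 : 0 < Q by rewrite addr_gt0// divr_gt0.
pose C := H * (1 + (1 + ln Q) / qa) + 2 * D.
pose ka : R := 1 - expR (- (1 / 2)).
have ka01 : 0 < ka < 1.
  by rewrite subr_gt0 expR_lt1 gtrBl expR_gt0 oppr_lt0 divr_gt0.
have [ka0 ka1] := andP ka01.
exists (ka * expR (- C) / (2 * Q)), (H / qa + 1); split.
- by rewrite divr_gt0 ?mulr_gt0 ?expR_gt0.
- by rewrite addr_ge0// divr_ge0// ltW.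
move=> n; have n0 : (0 : R) < n.+1%:R by rewrite ltr0n.
(* Beyond the index [N] each neutral point loses at least 1/2 to the dip, so the return of index [K]
   has lost at least 1/2, while [K] is still of order [n]. *)
pose N := (Num.truncn (2 * n.+1%:R / qa)).+1; pose K := N.+1.
have qn0 : 0 <= 2 * n.+1%:R / qa by apply: divr_ge0; [exact: mulr_ge0|exact: ltW].
have K0 : (0 : R) < K.+1%:R by rewrite ltr0n.
have KQ : K.+1%:R <= Q * n.+1%:R.
  have h := truncn_le (2 * n.+1%:R / qa).
  have n1 : 1 <= n.+1%:R :> R by rewrite ler1n.
  rewrite /K /N -addn3 natrD /Q (mulrDl (2 / qa)).
  have -> : 2 / qa * n.+1%:R = 2 * n.+1%:R / qa by rewrite mulrAC.
  rewrite qn0 in h; apply: lerD => //; lra.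
have lnKQ : ln K.+1%:R <= ln Q + ln n.+1%:R.
  by rewrite -lnM ?posrE// ler_ln ?posrE ?mulr_gt0.
pose ast := expR (- C - H / qa * ln n.+1%:R).
have ln0 : 0 <= ln n.+1%:R :> R by rewrite ln_ge0// ler1n.
have AK x : inJ x -> ast <= expR (retsum phi K x + u (ret K x) - u x).
  move=> xJ; rewrite ler_expR; apply: le_trans (hge K x xJ).
  have h1 : neutral_harmonic K <= (1 + ln Q + ln n.+1%:R) / qa.
    apply: le_trans (neutral_harmonic_le K) _.
    by rewrite ler_pM2r ?invr_gt0// -addrA lerD2l.
  have h2 := ler_wpM2l H0 h1.
  have -> : H / qa * ln n.+1%:R = H * (ln n.+1%:R / qa) by ring.
  have e1 : (1 + ln Q + ln n.+1%:R) / qa = (1 + ln Q) / qa + ln n.+1%:R / qa by ring.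
  by rewrite e1 in h2; rewrite /C; lra.
have ast0 : 0 < ast by exact: expR_gt0.
have ast1 : ast <= 1.
  have J1 : inJ x1 by exact: I01_le1.
  apply: le_trans (AK x1 J1) _; apply: le_trans (us K.+1 x1 J1).
  by rewrite big_ord_recr/= lerDr; apply: sumr_ge0 => i _; exact: expR_ge0.
pose t := ka * ast / 2; have t0 : 0 < t by rewrite divr_gt0// mulr_gt0.
have t2 : t <= 1 / 2.
  by have := ler_pM (ltW ka0) (ltW ast0) (ltW ka1) ast1; rewrite mulr1 /t; lra.
pose e := t / K.+1%:R; have e0 : 0 < e by exact: divr_gt0.
have et : K.+1%:R * e = t by rewrite /e mulrC divfK// gt_eqF.
have e2 : e <= 1 / 2.
  apply: le_trans t2; rewrite /e ler_piMr ?(ltW t0)// invf_le1// ler1n//.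
pose om := ramp 0 (xn n)^-1.
have ic0 : 0 <= (xn n)^-1 by rewrite invr_ge0 ltW.
have hom : hol (xn n)^-1 om by exact: hol_ramp.
have hpsi : hol (H + `|-1| * (xn n)^-1) (fun x => phi x + (-1) * om x).
  by apply: holD => //; exact: holZ.
have -> : (fun x => phi x - om x) = fun x => phi x + (-1) * om x.
  by apply/funext => x; rewrite mulN1r.
apply: (@le_trans _ _ (- e)); last first.
  rewrite lerN2; apply: le_trans (_ : t / (Q * n.+1%:R) <= _); last first.
    by rewrite /e ler_wpM2l ?(ltW t0)// lef_pV2 ?posrE// mulr_gt0.
  have -> : t = ka * (expR (- C) * expR (- (H / qa * ln n.+1%:R))) / 2 by rewrite /t /ast expRD.
  have -> : expR (- ((H / qa + 1) * ln n.+1%:R)) = expR (- (H / qa * ln n.+1%:R)) / n.+1%:R.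
    by rewrite mulrDl mul1r opprD expRD [X in _ * X]expRN lnK ?posrE.
  by rewrite le_eqVlt !invfM; apply/orP; left; apply/eqP; ring.
rewrite -[leRHS]expRK; apply: (pr_le_insup a01 hpsi).
have om0 : om x0 = 1 by apply: ramp_le1.
have om_ge0 y : 0 <= om y by case/andP: (ramp01 0 (xn n)^-1 y).
apply: (@insup_log _ _ (- e) t D u hpsi) => //.
  by rewrite p0 om0 mulr1 add0r ltrN2; lra.
move=> m x xJ.
pose W k := retsum om k x.
have W0 k : 0 <= W k by rewrite addr_ge0// sumr_ge0.
have WN k : (N <= k)%N -> (k%:R - N%:R) / 2 <= W k.
  move=> Nk; apply: (@le_trans _ _ (nsum alpha om k x)); last by rewrite lerDl.
  rewrite /nsum -(big_mkord xpredT (fun j => om (iter j.+1 b0 x))) (big_cat_nat (leq0n N) Nk)/=.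
  apply: (@le_trans _ _ (\sum_(N <= j < k) (1 / 2))).
    by rewrite sumr_const_nat -natrB// mulr_natl mul1r.
  apply: ler_wpDl; first by apply: sumr_ge0.
  apply: ler_sum_nat => j /andP[Nj _]; apply: (@ramp_iter_br0 n j.+1 x).
  have h1 : 2 * n.+1%:R / qa <= j.+1%:R.
    by apply: le_trans (ltW (truncnS_gt _)) _; rewrite ler_nat ltnW.
  by rewrite ler_pdivrMr// in h1; rewrite mulrC; lra.
pose a k := expR (retsum phi k x + u (ret k x) - u x).
have a0 k : 0 < a k by exact: expR_gt0.
(* The rate [- e] raises terms by at most [expR t] in total: up to [K] since [k.+1 * e <= t], beyond
   since the dip loses 1/2, at least [e], per extra step. The term [K] alone also loses the fraction
   [ka], worth at least [2 * t], which pays for the increase. *)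
have term k : expR (retsum (fun y => phi y + (-1) * om y) k x + u (ret k x) - u x
     - k.+1%:R * - e) <= expR t * (a k - (k == K)%:R * ka * a K).
  have -> : retsum (fun y => phi y + (-1) * om y) k x + u (ret k x) - u x - k.+1%:R * - e =
      (k.+1%:R * e - W k) + (retsum phi k x + u (ret k x) - u x).
    by rewrite retsumD retsumZ -/(W k); ring.
  rewrite expRD -/(a k); have [->|kK] := eqVneq k K.
    have -> : expR t * (a K - 1%:R * ka * a K) = expR (t - 1 / 2) * a K.
      by rewrite expRD /ka; ring.
    rewrite ler_wpM2r ?(ltW (a0 _))// ler_expR et lerD2l lerN2.
    by have := WN K (leqnSn N); rewrite /K -natr1; lra.
  rewrite mul0r mul0r subr0 ler_wpM2r ?(ltW (a0 _))// ler_expR -et.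
  have [kK'|Kk] := leqP k K.
    have : k.+1%:R <= K.+1%:R :> R by rewrite ler_nat.
    by move=> /(ler_wpM2r (ltW e0)); have := W0 k; lra.
  have h := WN k (ltnW (ltnW Kk)).
  have h3 : 0 <= k%:R - K%:R :> R by rewrite subr_ge0 ler_nat ltnW.
  have h4 := ler_wpM2l h3 e2; have eK : K%:R = N%:R + 1 :> R by rewrite /K -natr1.
  by rewrite -[k.+1%:R]natr1 -[K.+1%:R]natr1; lra.
apply: le_trans (_ : \sum_(k < m + K.+1) expR (retsum (fun y => phi y + (-1) * om y) k x
     + u (ret k x) - u x - k.+1%:R * - e) <= _).
  by rewrite big_split_ord/= lerDl; apply: sumr_ge0 => i _; exact: expR_ge0.
apply: le_trans (_ : \sum_(k < m + K.+1) expR t * (a k - (k == K :> nat)%:R * ka * a K) <= _).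
  by apply: ler_sum => k _; exact: term.
rewrite -mulr_sumr sumrB.
have Km : (K < m + K.+1)%N by rewrite addnS ltnS leq_addl.
have -> : \sum_(k < m + K.+1) ((k == K :> nat)%:R * ka * a K) = ka * a K.
  rewrite (bigD1 (Ordinal Km))//= eqxx mul1r big1 ?addr0// => k kK.
  by rewrite (_ : (k == K :> nat) = false) ?mul0r//; apply: contraNF kK => /eqP E; apply/eqP/val_inj.
have h1 : \sum_(k < m + K.+1) a k - ka * a K <= 1 - 2 * t.
  have := us (m + K.+1)%N x xJ; have := ler_wpM2l (ltW ka0) (AK x xJ).
  by rewrite /t -/(a K); lra.
apply: le_trans (ler_wpM2l (expR_ge0 t) h1) _.
have h2 : expR t * (1 - t) <= 1.
  have := expR_ge1Dx (- t) => h3; have := ler_wpM2l (expR_ge0 t) h3.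
  by rewrite -expRD subrr expR0.
have h3 : 1 - 2 * t <= (1 - t) * (1 - t) by have := mulr_ge0 (ltW t0) (ltW t0); lra.
apply: le_trans (ler_wpM2l (expR_ge0 t) h3) _; rewrite mulrA ler_piMl//; lra.
Qed.

Lemma expR_dominates_power (r P c : R) : 0 < r < 1 -> 0 <= P -> 0 < c ->
  exists m, expR (P * ln m.+2%:R + m%:R * ln r) < c.
Proof.
move=> r01 P0 c0; have lr : 0 < - ln r by rewrite oppr_gt0 ln_lt0.
set lb := - ln r in lr.
pose M := (P + 1) * 2 / lb; have M0 : 0 < M.
  by apply: divr_gt0 => //; apply: mulr_gt0 => //; lra.
pose m := (Num.truncn `|2 * (lb + P * ln M - ln c) / lb|).+1; exists m.
have m0 : (0 : R) < m.+2%:R by rewrite ltr0n.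
rewrite -[ltRHS]lnK ?posrE// ltr_expR.
have h1 : ln m.+2%:R <= m.+2%:R / M + ln M.
  have := le_ln1Dx (x := m.+2%:R / M - 1); rewrite [1 + _]addrC subrK ln_div ?posrE//.
  have h : 0 < m.+2%:R / M by rewrite divr_gt0.
  move=> /(_ ltac:(lra)); lra.
have h2 := ler_wpM2l P0 h1.
have h3 : P * (m.+2%:R / M) <= lb * m.+2%:R / 2.
  have -> : P * (m.+2%:R / M) = (P / (P + 1)) * (lb * m.+2%:R / 2).
    by rewrite /M; field; rewrite !gt_eqF//; lra.
  rewrite ler_piMl//; first by rewrite divr_ge0// mulr_ge0// ltW.
  by rewrite ler_pdivrMr ?mul1r; lra.
have h4 : 2 * (lb + P * ln M - ln c) < m%:R * lb.
  rewrite -ltr_pdivrMr//; apply: le_lt_trans (ler_norm _) _; exact: truncnS_gt.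
have -> : ln r = - lb by rewrite /lb opprK.
have h5 : lb * m.+2%:R = m%:R * lb + 2 * lb by rewrite -addn2 natrD; ring.
by lra.
Qed.

Lemma mixing_pr_gt phi H nu : hol H phi -> gibbs_state alpha phi nu ->
  exponentially_mixing alpha nu -> (0 < entropy f nu)%E -> phi x0 < pr phi.
Proof.
move=> hH [nui nug] [C [r [C0 r01 mix]]] ent; rewrite ltNge; apply/negP => prp.
have /andP[a0 a1] := a01; have bphi := bm_hol a01 hH.
pose dg : set T := [set x | digit alpha x].
have mdg : measurable dg by exact: measurable_digit.
pose d := fine (nu dg).
(* If the right branch had mass 0, almost every orbit would stay in the neutral branch and the
   integral of [x^alpha] would vanish; [cusp_pressure] would then bound the entropy by 0. *)
have d0 : 0 < d.
  rewrite lt_neqAle prob_ge0 andbT; apply/eqP => dE.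
  have [B B0 prB] := cusp_pressure.
  pose pw (x : T) := I01_val x `^ alpha.
  have bpw : bm pw by exact: (bm_hol a01 hol_cusp).
  have bd j : bm (fun x => \1_dg (iter j f x) : R).
    by apply: (bm_comp (h := \1_dg)); [exact: measurable_iter_intermittent|exact: bm_indic].
  have Ipw n : \int[nu]_x pw x <= (1 + qa * n%:R)^-1.
    have sE : \int[nu]_x (\sum_(j < n) \1_dg (iter j f x)) = 0.
      rewrite Rint_sum => [|j]; last exact: bd.
      rewrite big1// => j _; rewrite (Rint_iter_invariant a01 nui j (bm_indic mdg)).
      by rewrite Rint_indic.
    rewrite -[leRHS](Rint_cst nu) -[leRHS]addr0 -sE -RintD; [|exact: bm_cst|by apply: bm_sum => j].
    apply: Rint_le => [//||x].
      by apply: bmD; [exact: bm_cst|by apply: bm_sum => j].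
    have ii0 m : 0 <= (1 + qa * m%:R)^-1.
      by rewrite invr_ge0 addr_ge0// mulr_ge0// ltW.
    have [[j hj]|hn] := pselect (exists j : 'I_n, digit alpha (iter j f x)).
      apply: (@le_trans _ _ 1); first by have := da_le1 a01 x x0; rewrite da0E.
      apply: ler_wpDl => //; rewrite (bigD1 j)//= indicE mem_set// lerDl.
      by apply: sumr_ge0 => i _; rewrite indicE.
    have E m z : (forall j, (j < m)%N -> ~~ digit alpha (iter j f z)) ->
        iter m b0 (iter m f z) = z.
      elim: m z => [//|m IH] z hz; rewrite iterS iterSr IH.
        by have := br_intermittent a01 z; rewrite (negbTE (hz 0%N isT)).
      by move=> j jm; rewrite -iterSr; exact: hz.
    apply: ler_wpDr; first by apply: sumr_ge0 => i _; rewrite indicE.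
    rewrite /pw -[in leLHS](E n x); first exact: iter_br0_upper.
    by move=> j jn; apply/negP => hj; apply: hn; exists (Ordinal jn).
  have Ip0 : \int[nu]_x pw x <= 0.
    rewrite leNgt; apply/negP => I0.
    pose N := (Num.truncn ((\int[nu]_x pw x)^-1 / qa)).+1.
    have hN : (\int[nu]_x pw x)^-1 / qa < N%:R by exact: truncnS_gt.
    rewrite ltr_pdivrMr// in hN; have := Ipw N; rewrite leNgt => /negP; apply.
    rewrite -[ltRHS]invrK ltf_pV2 ?posrE ?invr_gt0//; rewrite mulrC in hN; [lra|].
    by rewrite (lt_trans _ (_ : (\int[nu]_x pw x)^-1 < _)) ?invr_gt0//; lra.
  have hB : hol (`|- B| * 1) (fun x => - B * pw x) by exact: (holZ _ hol_cusp).
  have := pr_ge a01 hB nui; rewrite RintZ//.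
  have h1 : 0 <= - B * \int[nu]_x pw x by rewrite mulNr -mulrN; apply: mulr_ge0; [exact: ltW|rewrite oppr_ge0].
  move=> h2; have : (entropy f nu + (- B * \int[nu]_x pw x)%:E <= 0%:E)%E.
    by apply: le_trans h2 _; rewrite lee_fin.
  apply/negP; rewrite -ltNge; apply: lt_le_trans ent _.
  by rewrite leeDl// lee_fin.
pose phi' x := phi x + (- phi x0).
have hH' : hol H phi' by rewrite -[H]addr0; apply: holD => //; exact: hol_cst.
have p0 : phi' x0 = 0 by rewrite /phi' subrr.
have pr' : pr phi' <= 0 by rewrite (pr_addr a01 _ hH); lra.
have [c [p [c0 pp dip]]] := pr_dip hH' p0 pr'.
pose om n := ramp 0 (xn n)^-1.
have xi0 n : 0 <= (xn n)^-1 by rewrite invr_ge0 ltW.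
have hom n : hol (xn n)^-1 (om n) by exact: hol_ramp.
have bom n : bm (om n) by exact: (bm_hol a01 (hom n)).
(* Tested on the lowered potential, the Gibbs state [nu] gives a free energy of minus the mass of
   the dip up to a nonnegative term; [pr_dip] bounds that pressure from above. *)
have low n : c * expR (- (p * ln n.+1%:R)) <= \int[nu]_x om n x.
  have hpsi : hol (H + `|-1| * (xn n)^-1) (fun x => phi' x + (-1) * om n x).
    by apply: holD => //; exact: holZ.
  have hd := dip n.
  have E : (fun x => phi' x - om n x) = fun x => phi' x + (-1) * om n x.
    by apply/funext => x; rewrite mulN1r.
  rewrite -/(om n) E in hd; have := pr_ge a01 hpsi nui.
  have bphi' : bm phi' by exact: (bm_hol a01 hH').
  rewrite RintD//; last exact: bmZ.
  rewrite RintZ// RintD//; last exact: bm_cst.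
  rewrite Rint_cst -addrA EFinD addeA nug (pressureE a01 hH) -EFinD lee_fin.
  by have := phi0_le_pr a01 hH; lra.
(* At time [m] no point of the dip of width [xn m.+1] lies in the right branch, so the correlation
   integral is 0 and mixing bounds the product of the two means. *)
have up m : d * \int[nu]_x om m.+1 x <= C * (xn m.+1)^-1 * r ^+ m.
  have far z k : I01_val z < xn k.+1 -> ~~ digit alpha (iter k f z).
    elim: k z => [|k IH] z hz.
      rewrite /digit -leNgt; apply: ltW; apply: lt_le_trans hz _.
      by rewrite /xn/=; exact: br0_le.
    have dz : digit alpha z = false.
      apply/negbTE; rewrite /digit -leNgt; apply: ltW; apply: lt_le_trans hz _.
      by rewrite /xn/=; exact: br0_le.
    rewrite iterSr; apply: IH; rewrite ltNge; apply/negP => hle.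
    move: hz; rewrite ltNge => /negP; apply.
    rewrite -[in leRHS](br_intermittent a01 z) dz /xn iterS.
    by rewrite -(Fmap_le a01 (I01_ge0 _) (I01_ge0 _)) !brE//= !addr0.
  have mdi : measurable_fun setT (\1_dg : T -> R) by exact: measurable_indic.
  have hl : is_hoelder 1 (om m.+1) /\ hoelder_seminorm 1 (om m.+1) <= (xn m.+1)^-1.
    apply: hoelder_seminorm_le => x y; rewrite powRr1//.
    apply: le_trans (clamp_dist _ _) _; rewrite subr0.
    have -> : 1 - (xn m.+1)^-1 * (I01_val x) - (1 - (xn m.+1)^-1 * (I01_val y - 0)) =
      (xn m.+1)^-1 * (I01_val y - I01_val x) by ring.
    by rewrite normrM (ger0_norm (xi0 _)) distrC.
  have i1 x : `|\1_dg x : R| <= 1 by rewrite indicE ger0_norm// lern1 leq_b1.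
  have := mix (\1_dg) (om m.+1) mdi (ex_intro _ 1 i1) hl.1 m.
  have -> : \int[nu]_x (\1_dg (iter m f x) * om m.+1 x) = 0.
    rewrite -[RHS](Rint_cst nu); apply: eq_Rintegral => x _.
    rewrite indicE; have [/set_mem hx|_] := boolP (_ \in _); last by rewrite mul0r.
    rewrite mul1r; apply: ramp_ge0; rewrite subr0 mulrC ler_pdivlMr// mul1r leNgt.
    by apply/negP => /far; rewrite hx.
  rewrite sub0r normrN Rint_indic// => /(le_trans (ler_norm _)) h; apply: le_trans h _.
  apply: ler_wpM2r; first by rewrite exprn_ge0// ltW//; case/andP: r01.
  rewrite -mulrA ler_pM2l//.
  have s1 : sup_norm (\1_dg : T -> R) <= 1 by exact: sup_norm_le.
  have q1 : 0 <= hoelder_seminorm 1 (om m.+1).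
    have [q hq] := hoelder_quotients_nonempty 1 (om m.+1).
    exact: le_trans (hoelder_quotients_ge0 hq) (ub_le_sup hl.1 hq).
  by apply: le_trans (ler_wpM2r q1 s1) _; rewrite mul1r; exact: hl.2.
have xi n : (xn n)^-1 <= expR (alpha^-1 * ln n.+1%:R).
  have n0 : (0 : R) < n.+1%:R by rewrite ltr0n.
  rewrite -[leLHS]lnK ?posrE ?invr_gt0// ler_expR lnV ?posrE// mulrC ler_pdivlMr// mulNr lerNl.
  rewrite -lnV ?posrE// mulrC -ln_powR ler_ln ?posrE ?invr_gt0 ?powR_gt0//; exact: xn_pow.
have P0 : 0 <= p + alpha^-1 by rewrite addr_ge0// invr_ge0 ltW.
have [m hm] := expR_dominates_power r01 P0 (divr_gt0 (mulr_gt0 c0 d0) C0).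
have r0 : 0 < r by case/andP: r01.
have h1 := up m; have h2 := ler_wpM2l (ltW d0) (low m.+1).
have h3 : C * (xn m.+1)^-1 * r ^+ m <= C * expR (alpha^-1 * ln m.+2%:R) * r ^+ m.
  by apply: ler_wpM2r; [rewrite exprn_ge0// ltW|rewrite ler_pM2l].
have : c * d / C <= expR ((p + alpha^-1) * ln m.+2%:R + m%:R * ln r).
  rewrite ler_pdivrMr// expRD expRM_natl lnK// mulrDl expRD.
  have := le_trans h2 (le_trans h1 h3).
  rewrite expRN mulrA ler_pdivrMr ?expR_gt0// => h.
  rewrite mulrC; apply: le_trans h _.
  by rewrite le_eqVlt; apply/orP; left; apply/eqP; ring.
by rewrite leNgt hm.
Qed.

End induced.

(** * Power series *)

Section power_series.
Variable R : realType.
Implicit Types (a x y : nat -> R) (C q X Y r t : R).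

(** Course-of-values recursion: the value at [k] is fixed after [k.+1] iterations of [F], and the
    diagonal is the solution. *)
Lemma strong_rec (X : Type) (x0 : X) (F : (nat -> X) -> nat -> X) :
  (forall v w k, (forall j, (j < k)%N -> v j = w j) -> F v k = F w k) ->
  exists u, forall k, u k = F u k.
Proof.
move=> FE; pose U n := iter n F (fun=> x0).
have st n k : (k < n)%N -> U n.+1 k = U n k.
  elim: n k => [//|n IH] k kn; apply: FE => j jk; apply: IH.
  exact: leq_trans jk _.
have eqU n k : (k < n)%N -> U n k = U k.+1 k.
  by elim: n => [//|n IH] kn; move: kn; rewrite ltnS leq_eqVlt => /predU1P[->//|kn]; rewrite st ?IH.
exists (fun k => U k.+1 k) => k; apply: FE => j jk; exact: eqU.
Qed.

Definition geo (C q : R) a := forall k, `|a k| <= C * q ^+ k.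

Lemma geo_ge0 C q a : geo C q a -> 0 <= C.
Proof. by move=> /(_ 0%N); rewrite expr0 mulr1; apply: le_trans. Qed.

Lemma geo_pow C q a t : geo C q a -> geo C (q * `|t|) (fun k => a k * t ^+ k).
Proof. by move=> h k; rewrite normrM normrX exprMn mulrA ler_wpM2r ?exprn_ge0. Qed.

Lemma geo_le C q C' q' a : geo C q a -> 0 <= q -> C <= C' -> q <= q' -> geo C' q' a.
Proof.
move=> h q0 CC qq k; apply: le_trans (h k) _; apply: ler_pM => //; [exact: geo_ge0 h|exact: exprn_ge0|].
by rewrite lerXn2r// nnegrE// (le_trans q0).
Qed.

Lemma geo_cvg C q a : 0 <= q < 1 -> geo C q a -> cvgn (series a).
Proof.
move=> /andP[q0 q1] h; apply: (@normed_cvg R R^o).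
apply: (@series_le_cvg _ _ (fun k => C * q ^+ k)).
- by move=> k /=.
- by move=> k; exact: le_trans (h k).
- exact: h.
- by apply: is_cvg_geometric_series; rewrite ger0_norm.
Qed.

Lemma geo_sum C q a n : 0 <= q < 1 -> geo C q a -> \sum_(k < n) `|a k| <= C / (1 - q).
Proof.
move=> q01 h; apply: le_trans (_ : \sum_(k < n) C * q ^+ k <= _); first exact: ler_sum.
by rewrite -mulr_sumr ler_wpM2l ?sum_geometric_le// (geo_ge0 h).
Qed.

Lemma natM_geo_cvg0 (q : R) : 0 <= q < 1 -> n%:R * q ^+ n @[n --> \oo] --> 0.
Proof.
move=> /andP[q0 q1]; pose s := Num.sqrt q.
have s0 : 0 <= s by exact: sqrtr_ge0.
have s1 : s < 1 by rewrite -sqrtr1 ltr_sqrt.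
have sq : s ^+ 2 = q by rewrite sqr_sqrtr.
have c0 : (1 - s)^-1 * s ^+ n @[n --> \oo] --> 0.
  by apply: cvg_geometric; rewrite ger0_norm.
apply: (@squeeze_cvgr _ _ _ _ (fun=> 0) (fun n => (1 - s)^-1 * s ^+ n)) => //; last exact: cvg_cst.
apply: nearW => n; rewrite mulr_ge0 ?exprn_ge0//= -sq -exprM mul2n -addnn exprD mulrA.
rewrite ler_wpM2r ?exprn_ge0//; apply: le_trans (sum_geometric_le n _); last by rewrite s0.
apply: le_trans (_ : \sum_(k < n) s ^+ n <= _); first by rewrite sumr_const card_ord mulr_natl.
by apply: ler_sum => k _; apply: ler_wiXn2l; [exact: s0|exact: ltW s1|exact: ltnW].
Qed.

Lemma triangular_sum x y n :
  \sum_(k < n) \sum_(j < k.+1) x j * y (k - j)%N = \sum_(j < n) x j * \sum_(i < n - j) y i.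
Proof.
elim: n => [|n IH]; first by rewrite !big_ord0.
rewrite big_ord_recr/= IH [RHS]big_ord_recr/= subSnn big_ord1 big_ord_recr/= subnn addrA.
congr (_ + _); rewrite -big_split/=; apply: eq_bigr => j _.
have jn : (j <= n)%N by exact: ltnW.
by rewrite (subSn jn) big_ord_recr/= mulrDr.
Qed.

Lemma triangular_sum_le x y n : (forall k, 0 <= x k) -> (forall k, 0 <= y k) ->
  \sum_(k < n) \sum_(j < k.+1) x j * y (k - j)%N <= (\sum_(j < n) x j) * \sum_(i < n) y i.
Proof.
move=> x0 y0; rewrite triangular_sum mulr_suml; apply: ler_sum => j _.
rewrite ler_wpM2l//.
rewrite -!(big_mkord xpredT y) (big_cat_nat (leq0n (n - j)) (leq_subr j n))/=.
by rewrite lerDl sumr_ge0.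
Qed.

Lemma triangular_sumS_le x y n : (forall k, 0 <= x k) -> (forall k, 0 <= y k) ->
  \sum_(k < n.+1) \sum_(j < k) x j.+1 * y (k - j.+1)%N <=
  (\sum_(j < n) x j.+1) * \sum_(i < n) y i.
Proof.
move=> x0 y0; rewrite big_ord_recl big_ord0 add0r.
exact: (@triangular_sum_le (fun k => x k.+1)).
Qed.

(** The square of partial sums and the triangle of the convolution differ by at most a multiple of
    [n * q ^+ n]. *)
Lemma cauchy_product C q x y X Y : 0 <= q < 1 -> geo C q x -> geo C q y ->
  series x @ \oo --> X -> series y @ \oo --> Y ->
  series (fun k => \sum_(j < k.+1) x j * y (k - j)%N) @ \oo --> X * Y.
Proof.
move=> q01 hx hy cx cy; have /andP[q0 q1] := q01; have C0 := geo_ge0 hx.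
pose D n := series x n * series y n - series (fun k => \sum_(j < k.+1) x j * y (k - j)%N) n.
have q10 : 0 < 1 - q by rewrite subr_gt0.
have D_le n : `|D n| <= C * (C / (1 - q)) * (n%:R * q ^+ n).
  rewrite /D /series/= !big_mkord triangular_sum mulr_suml -sumrB.
  apply: le_trans (ler_norm_sum _ _ _) _.
  apply: (@le_trans _ _ (\sum_(j < n) C * (C / (1 - q)) * q ^+ n)); last first.
    by rewrite sumr_const card_ord -[_ *+ n]mulr_natr -!mulrA [q ^+ n * _]mulrC.
  apply: ler_sum => j _; rewrite -mulrBr normrM.
  have -> : q ^+ n = q ^+ j * q ^+ (n - j) by rewrite -exprD subnKC// ltnW.
  have -> : C * (C / (1 - q)) * (q ^+ j * q ^+ (n - j)) =
    (C * q ^+ j) * (C * q ^+ (n - j) / (1 - q)) by ring.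
  apply: ler_pM => //; rewrite -!(big_mkord xpredT y).
  rewrite [X in X - _](big_cat_nat (leq0n (n - j)) (leq_subr j n))/= addrAC subrr add0r.
  apply: le_trans (ler_norm_sum _ _ _) _.
  rewrite -{1}[(n - j)%N]add0n big_addn big_mkord.
  apply: le_trans (geo_sum (C := C * q ^+ (n - j)) (q := q) (a := fun i => y (i + (n - j))%N) _ q01 _) _ => //.
  by move=> i; apply: le_trans (hy _) _; rewrite addnC exprD mulrA.
have D0 : D n @[n --> \oo] --> 0.
  have h : C * (C / (1 - q)) * (n%:R * q ^+ n) @[n --> \oo] --> 0.
    by rewrite -[X in _ --> X](mulr0 (C * (C / (1 - q)))); apply: cvgMl_tmp; exact: natM_geo_cvg0.
  apply/norm_cvg0P; apply: (squeeze_cvgr _ (cvg_cst 0) h).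
  by apply: nearW => n; rewrite D_le normr_ge0.
have -> : series (fun k => \sum_(j < k.+1) x j * y (k - j)%N) =
    fun n => series x n * series y n - D n by apply/funext => n; rewrite /D; ring.
rewrite -[X * Y]subr0; apply: (@cvgB _ R^o) => //.
by apply: (@cvgM R).
Qed.

Lemma constant_on_ball (G : R -> R) r : (forall t : R, `|t| < r -> is_derive t 1 G 0) ->
  forall t : R, `|t| < r -> G t = G 0.
Proof.
move=> hG t tr.
have seg (u v : R) : u <= v -> `|u| < r -> `|v| < r -> G v = G u.
  move=> uv ur vr; have ball z : z \in `[u, v]%R -> `|z| < r.
    rewrite in_itv/= => /andP[uz zv]; move: ur vr; rewrite !ltr_norml => /andP[h1 h2] /andP[h3 h4].
    by apply/andP; split; lra.
  have [| |_ _] := MVT_segment uv (f := G) (df := fun=> 0).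
  - by move=> z zI; apply: hG; apply: ball; exact: subset_itv_oo_cc zI.
  - apply: derivable_within_continuous => z zI; apply: ex_derive.
    exact: hG (ball _ zI).
  by rewrite mul0r => /eqP; rewrite subr_eq0 => /eqP.
have r0 : `|(0 : R)| < r by rewrite normr0; exact: le_lt_trans tr.
by have [t0|/ltW t0] := leP 0 t; [exact: seg|apply/esym; exact: seg].
Qed.

Lemma geo_diffs C q a : 0 <= q -> geo C q a -> geo (C * q) (2 * q) (pseries_diffs a).
Proof.
move=> q0 h k; have C0 := geo_ge0 h; rewrite /pseries_diffs normrM ger0_norm//.
apply: le_trans (_ : 2 ^+ k * (C * q ^+ k.+1) <= _).
  by apply: ler_pM => //; rewrite -natrX ler_nat ltn_expl.
by rewrite exprMn exprS le_eqVlt; apply/orP; left; apply/eqP; ring.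
Qed.

Lemma geo_pseries_cvg C q a t : 0 <= q -> geo C q a -> q * `|t| < 1 -> cvgn (pseries a t).
Proof.
move=> q0 h qt; apply: (@geo_cvg C (q * `|t|)); last exact: geo_pow.
by rewrite qt andbT mulr_ge0.
Qed.

(** Each formal derivative doubles the rate, so the second one has rate 4 q; the radius [1 / (8 q)]
    keeps it convergent as well. *)
Lemma geo_is_derive C q a t : 0 < q -> geo C q a -> 8 * q * `|t| < 1 ->
  is_derive t 1 (fun s : R => limn (pseries a s)) (limn (pseries (pseries_diffs a) t)).
Proof.
move=> q0 h ht; have q00 := ltW q0.
pose K := (8 * q)^-1; have K0 : 0 < K by rewrite invr_gt0 mulr_gt0.
have KE : q * K = 8^-1 by rewrite /K; field; rewrite gt_eqF.
have h1 := geo_diffs q00 h; have h2 := geo_diffs (mulr_ge0 (ler0n R 2) q00) h1.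
apply: (@pseries_snd_diffs _ a K).
- by apply: (geo_pseries_cvg q00 h); rewrite (gtr0_norm K0) KE; lra.
- apply: (geo_pseries_cvg _ h1); rewrite ?mulr_ge0// (gtr0_norm K0) -mulrA KE; lra.
- apply: (geo_pseries_cvg _ h2); rewrite ?mulr_ge0// (gtr0_norm K0) -!mulrA KE; lra.
- rewrite (gtr0_norm K0) /K -[ltRHS]mul1r ltr_pdivlMr ?mulr_gt0// mulrC; exact: ht.
Qed.

(* The coefficients nu of the logarithmic derivative solve nu * lambda = lambda'. *)
Lemma log_power_series C q l : l 0%N = 1 -> 0 < q -> geo C q l ->
  exists (b : nat -> R) r C' q', [/\ 0 < r, 0 < q', geo C' q' b &
    forall t : R, `|t| < r -> limn (pseries l t) = expR (limn (pseries b t))].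
Proof.
move=> l0 q0 hl; have C0 := geo_ge0 hl.
have C1 : 1 <= C by have := hl 0%N; rewrite l0 normr1 expr0 mulr1.
have ltk (k : nat) (j : 'I_k) : (k - j.+1 < k)%N.
  by rewrite ltn_subrL/= (leq_ltn_trans (leq0n j)).
have [nu hnu] : exists nu : nat -> R, forall k, nu k = k.+1%:R * l k.+1 -
    \sum_(j < k) l j.+1 * nu (k - j.+1)%N.
  apply: (@strong_rec R 0 (fun v k => k.+1%:R * l k.+1 - \sum_(j < k) l j.+1 * v (k - j.+1)%N)).
  by move=> v w k vw; congr (_ - _); apply: eq_bigr => j _; rewrite vw// ltk.
(* At this radius the coefficients of [l] of positive order have weighted sum at most 1/2 ([LP]), so
   the recursion for [nu] closes in [NP] as S + (2 S) / 2 = 2 S. *)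
pose r := (4 * C * q)^-1.
have r0 : 0 < r by rewrite invr_gt0 !mulr_gt0// (lt_le_trans _ C1).
have Cp : 0 < C by rewrite (lt_le_trans _ C1).
have qr : q * r = (4 * C)^-1 by rewrite /r; field; rewrite !gt_eqF.
have qr4 : q * r <= 4^-1.
  by rewrite qr lef_pV2 ?posrE ?mulr_gt0// ler_peMr.
have qr0 : 0 < q * r by rewrite mulr_gt0.
pose S := 2 * (C * q).
have SP n : \sum_(k < n) `|k.+1%:R * l k.+1| * r ^+ k <= S.
  have hd := geo_diffs (ltW q0) hl.
  apply: le_trans (_ : \sum_(k < n) (C * q) * (2 * (q * r)) ^+ k <= _).
    apply: ler_sum => k _; apply: le_trans (ler_wpM2r (exprn_ge0 _ (ltW r0)) (hd k)) _.
    by rewrite -[leLHS]mulrA -exprMn mulrA.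
  have -> : S = (C * q) * 2 by rewrite /S mulrC.
  rewrite -mulr_sumr ler_wpM2l ?mulr_ge0 ?(ltW q0)//.
  apply: le_trans (sum_geometric_le n _) _; first by apply/andP; split; lra.
  by rewrite -[leRHS]invrK lef_pV2 ?posrE ?invr_gt0//; lra.
have LP n : \sum_(j < n) `|l j.+1| * r ^+ j.+1 <= 2^-1.
  apply: le_trans (_ : \sum_(j < n) (C * (q * r)) * (q * r) ^+ j <= _).
    apply: ler_sum => k _; apply: le_trans (ler_wpM2r (exprn_ge0 _ (ltW r0)) (hl k.+1)) _.
    by rewrite -[leLHS]mulrA -exprMn -[leRHS]mulrA -exprS.
  rewrite -mulr_sumr qr.
  have -> : C * (4 * C)^-1 = 4^-1 by field; rewrite gt_eqF.
  have h : \sum_(i < n) ((4 * C)^-1) ^+ i <= (1 - 4^-1)^-1.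
    apply: le_trans (sum_geometric_le n _) _; rewrite -qr; first by apply/andP; split; lra.
    by rewrite lef_pV2 ?posrE; lra.
  have q40 : 0 <= 4^-1 :> R by [].
  have := ler_wpM2l q40 h.
  have -> : 4^-1 * (1 - 4^-1)^-1 = 3^-1 :> R by field.
  by lra.
have NP n : \sum_(k < n) `|nu k| * r ^+ k <= 2 * S.
  elim: n => [|n IH]; first by rewrite big_ord0 mulr_ge0// mulr_ge0// mulr_ge0// ltW.
  apply: le_trans (_ : \sum_(k < n.+1) (`|k.+1%:R * l k.+1| * r ^+ k +
      \sum_(j < k) (`|l j.+1| * r ^+ j.+1) * (`|nu (k - j.+1)%N| * r ^+ (k - j.+1))) <= _).
    apply: ler_sum => k _; rewrite {1}hnu.
    apply: le_trans (ler_wpM2r (exprn_ge0 _ (ltW r0)) (ler_normB _ _)) _.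
    rewrite mulrDl lerD2l; apply: le_trans (ler_wpM2r (exprn_ge0 _ (ltW r0)) (ler_norm_sum _ _ _)) _.
    rewrite mulr_suml; apply: ler_sum => j _; rewrite normrM.
    have -> : r ^+ k = r ^+ j.+1 * r ^+ (k - j.+1) by rewrite -exprD subnKC.
    by rewrite le_eqVlt; apply/orP; left; apply/eqP; ring.
  rewrite big_split/=; have h1 := SP n.+1.
  have h2 := @triangular_sumS_le (fun j => `|l j| * r ^+ j) (fun j => `|nu j| * r ^+ j) n.
  have h3 : (\sum_(j < n) `|l j.+1| * r ^+ j.+1) * (\sum_(i < n) `|nu i| * r ^+ i) <= 2^-1 * (2 * S).
    by apply: ler_pM => //; apply: sumr_ge0 => i _; rewrite mulr_ge0// exprn_ge0// ltW.
  have := le_trans (h2 _ _) h3 => /(_ _ _)h4; apply: le_trans (lerD h1 (h4 _ _)) _; last by lra.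
  - by move=> k; rewrite mulr_ge0// exprn_ge0// ltW.
  - by move=> k; rewrite mulr_ge0// exprn_ge0// ltW.
have nuG : geo (2 * S) r^-1 nu.
  move=> k; rewrite exprVn ler_pdivlMr ?exprn_gt0//; apply: le_trans (NP k.+1).
  by rewrite big_ord_recr/= lerDr sumr_ge0// => i _; rewrite mulr_ge0// exprn_ge0// ltW.
pose b k : R := if k is k'.+1 then nu k' / k'.+1%:R else 0.
have bG : geo (2 * S * r) r^-1 b.
  move=> [|k]; rewrite /b.
    by rewrite normr0 expr0 mulr1 !mulr_ge0// ?(ltW r0)// (ltW q0).
  rewrite normrM exprS mulrA mulfK ?gt_eqF//; apply: le_trans (nuG k); rewrite ler_piMr//.
  by rewrite ger0_norm ?invr_ge0// invf_le1 ?ler1n.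
have bD : pseries_diffs b = nu.
  by apply/funext => k; rewrite /pseries_diffs /b mulrC divfK// pnatr_eq0.
have qri : q <= r^-1.
  rewrite -(ler_pM2r r0) mulVf ?gt_eqF//; lra.
have ir0 : 0 < r^-1 by rewrite invr_gt0.
exists b, (r / 8), (2 * S * r), r^-1; split => //; first by rewrite divr_gt0.
have rec k : \sum_(j < k.+1) l j * nu (k - j)%N = pseries_diffs l k.
  rewrite big_ord_recl/= l0 mul1r subn0 {1}hnu /pseries_diffs.
  by rewrite subrK.
pose L t := limn (pseries l t); pose Q t := limn (pseries b t).
have small t : `|t| < r / 8 -> 8 * r^-1 * `|t| < 1.
  by move=> tr; rewrite mulrC mulrA ltr_pdivrMr// mul1r -ltr_pdivlMr.
have small2 t : `|t| < r / 8 -> 8 * q * `|t| < 1.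
  move=> /small; apply: le_lt_trans; rewrite ler_wpM2r// ler_wpM2l//.
have dL t : `|t| < r / 8 -> is_derive t 1 L (L t * limn (pseries nu t)).
  move=> tr; have := geo_is_derive q0 hl (small2 t tr).
  have -> // : limn (pseries (pseries_diffs l) t) = L t * limn (pseries nu t).
  have s1 : 0 <= r^-1 * `|t| < 1.
    rewrite mulr_ge0 ?(ltW ir0)//=; have := small t tr; have := mulr_ge0 (ltW ir0) (normr_ge0 t).
    lra.
  pose C2 := Num.max C (2 * S).
  have g1 : geo C2 r^-1 l by apply: geo_le hl _ _ _; rewrite ?(ltW q0)// le_max lexx.
  have g2 : geo C2 r^-1 nu by apply: geo_le nuG _ _ _; rewrite ?(ltW ir0)// le_max lexx orbT.
  have := @cauchy_product C2 (r^-1 * `|t|) (fun k => l k * t ^+ k) (fun k => nu k * t ^+ k)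
    (L t) (limn (pseries nu t)) s1 (geo_pow _ g1) (geo_pow _ g2).
  have c1 : cvgn (pseries l t) by apply: geo_pseries_cvg g1 _; rewrite ?(ltW ir0)//; case/andP: s1.
  have c2 : cvgn (pseries nu t) by apply: geo_pseries_cvg g2 _; rewrite ?(ltW ir0)//; case/andP: s1.
  move=> /(_ c1 c2); rewrite (_ : (fun k => _) = fun k => pseries_diffs l k * t ^+ k).
    by move=> hc; apply: (@cvg_lim _ _ _ _ eventually_filter).
  apply/funext => k; rewrite -rec mulr_suml; apply: eq_bigr => j _.
  have -> : t ^+ k = t ^+ j * t ^+ (k - j) by rewrite -exprD subnKC// -ltnS.
  by ring.
have dQ t : `|t| < r / 8 -> is_derive t 1 Q (limn (pseries nu t)).
  by move=> tr; have := geo_is_derive ir0 bG (small t tr); rewrite bD.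
(* The quotient of the two sides has zero derivative, hence keeps its value 1 at 0. *)
have dG t : `|t| < r / 8 -> is_derive t 1 (fun s => L s * expR (- Q s)) 0.
  move=> tr; have h1 := dL t tr; have h2 := dQ t tr.
  have h3 : is_derive t 1 (fun s => expR (- Q s)) (- limn (pseries nu t) * expR (- Q t)).
    have h4 : is_derive t 1 (- Q) (- limn (pseries nu t)) by exact: is_deriveN.
    have h5 := is_derive_expR (- Q t).
    by have := @is_derive1_comp R expR (- Q) t _ _ h5 h4; rewrite mulrC.
  apply: (is_derive_eq (is_deriveM h1 h3)).
  rewrite /GRing.scale/=; ring.
have at0 c : limn (pseries c 0) = c 0%N.
  apply: (@cvg_lim _ _ _ _ eventually_filter) => //; rewrite -cvg_shiftS.
  apply: cvg_near_cst; apply: nearW => n.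
  rewrite /pseries/series/= big_nat_recl//= expr0 mulr1 big1 ?addr0// => i _.
  by rewrite expr0n mulr0.
have L0 : L 0 = 1 by rewrite /L at0.
have Q0 : Q 0 = 0 by rewrite /Q at0.
move=> t tr; have := constant_on_ball dG tr; rewrite /= L0 Q0 oppr0 expR0 mulr1 -/(L t) -/(Q t) => e.
by rewrite -[L t](mulfK (x := expR (- Q t))) ?gt_eqF ?expR_gt0// e mul1r -expRN opprK.
Qed.

(** Stated for nonnegative [h] only, since the pressure is known to be affine just to the right of
    the critical parameter. *)
Lemma power_series_eq0 a r : 0 < r ->
  (forall h : R, 0 <= h < r -> series (fun k => a k * h ^+ k) @ \oo --> (0 : R)) ->
  forall k, a k = 0.
Proof.
move=> r0 ha; pose h0 := r / 2; have h00 : 0 < h0 by rewrite divr_gt0.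
have [C hC] : exists C, geo C h0^-1 a.
  have c0 : cvgn (series (fun k => a k * h0 ^+ k)).
    by apply/cvg_ex; exists 0; apply: ha; rewrite /h0; apply/andP; split; lra.
  have /cvg_series_cvg_0 c1 := c0.
  have [C [_ /(_ (C + 1))]] : bounded_fun (fun k => a k * h0 ^+ k).
    by apply: cvg_seq_bounded; apply/cvg_ex; exists 0.
  rewrite ltrDl ltr01 => /(_ isT) hC; exists (C + 1) => k.
  rewrite exprVn ler_pdivlMr ?exprn_gt0//.
  by have := hC k I; rewrite /= normrM [X in _ * X]ger0_norm// exprn_ge0// ltW.
have C0 := geo_ge0 hC; have i0 : 0 < h0^-1 by rewrite invr_gt0.
elim/ltn_ind => m IH; apply/eqP; rewrite -normr_le0; apply/ler_addgt0Pr => e e0; rewrite add0r.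
pose K := 2 * C * h0^-1 ^+ m.+1.
have K0 : 0 <= K by rewrite !mulr_ge0// exprn_ge0// ltW.
(* For this [h] the terms of order above [m] sum to at most [e * h ^+ m], while those below vanish
   by induction. *)
pose h := Num.min (h0 / 2) (e / (K + 1)).
have h_gt0 : 0 < h by rewrite lt_min !divr_gt0// ltr_wpDl.
have hh : h <= h0 / 2 by rewrite ge_min lexx.
have he : K * h <= e.
  apply: le_trans (_ : (K + 1) * h <= _); first by rewrite ler_wpM2r ?(ltW h_gt0)// lerDl.
  by rewrite mulrC -ler_pdivlMr ?ltr_wpDl// ge_min lexx orbT.
apply: le_trans he; rewrite -(ler_pM2r (exprn_gt0 m h_gt0)).
have hr : 0 <= h < r by rewrite (ltW h_gt0)/=; rewrite /h0 in hh; lra.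
have hq : h0^-1 * h <= 2^-1 by rewrite mulrC ler_pdivrMr// mulrC; lra.
have hq0 : 0 <= h0^-1 * h by rewrite mulr_ge0// ltW.
have key : \forall n \near \oo, `|series (fun k => a k * h ^+ k) n - a m * h ^+ m| <= K * h * h ^+ m.
  near=> n; have mn : (m < n)%N by near: n; exact: nbhs_infty_gt.
  rewrite /series/= (big_cat_nat (leq0n m) (ltnW mn))/=.
  rewrite big_nat big1 => [|k /andP[_ km]]; last by rewrite IH// mul0r.
  rewrite add0r big_ltn// addrAC subrr add0r -{1}[m.+1]add0n big_addn big_mkord.
  apply: le_trans (ler_norm_sum _ _ _) _.
  apply: le_trans (_ : \sum_(i < n - m.+1) C * (h0^-1 * h) ^+ m.+1 * (h0^-1 * h) ^+ i <= _).
    apply: ler_sum => i _; have := geo_pow h hC (i + m.+1)%N.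
    by rewrite (ger0_norm (ltW h_gt0)) -mulrA -exprD [(m.+1 + i)%N]addnC.
  rewrite -mulr_sumr; apply: le_trans (_ : C * (h0^-1 * h) ^+ m.+1 * 2 <= _).
    rewrite ler_wpM2l//; first by rewrite mulr_ge0// exprn_ge0.
    apply: le_trans (sum_geometric_le _ _) _; first by apply/andP; split; lra.
    by rewrite -[leRHS]invrK lef_pV2 ?posrE ?invr_gt0//; lra.
  by rewrite /K exprMn [h ^+ m.+1]exprS le_eqVlt; apply/orP; left; apply/eqP; ring.
have cv : `|series (fun k => a k * h ^+ k) n - a m * h ^+ m| @[n --> \oo] --> `|0 - a m * h ^+ m|.
  by apply: cvg_norm; apply: (@cvgB _ R^o); [exact: ha|exact: cvg_cst].
have := ler_cvg_to cv (cvg_cst (K * h * h ^+ m)) key.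
by rewrite sub0r normrN normrM [X in _ * X]ger0_norm ?exprn_ge0 ?(ltW h_gt0)//; apply.
Unshelve. all: by end_near. Qed.

End power_series.

(** * Analyticity of the pressure *)

Section perturbation.
Variables (R : realType) (alpha : R).
Hypothesis a01 : 0 < alpha <= 1.
Local Notation T := (I01 R).
Local Notation br := (br alpha).
Local Notation da := (da alpha).
Local Notation hol := (hol alpha).
Local Notation x0 := (I01_0 R).

(** The bound B on the sum of sup norm and Hoelder constant, as a predicate; this norm is
    submultiplicative ([nbM]), which the majorant method needs. *)
Definition nb (B : R) (h : T -> R) : Prop :=
  exists a A, [/\ a + A <= B, forall x, `|h x| <= a & hol A h].

Lemma nb_sup B h x : nb B h -> `|h x| <= B.
Proof.
by move=> [a [A [aA ha hA]]]; apply: le_trans (ha x) _; have := hol_ge0 hA; lra.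
Qed.

Lemma nb_hol B h : nb B h -> hol B h.
Proof.
move=> [a [A [aA ha hA]]]; apply: hol_le hA _.
have := le_trans (normr_ge0 _) (ha x0); lra.
Qed.

Lemma nb_ge0 B h : nb B h -> 0 <= B.
Proof. by move=> /(nb_sup x0); apply: le_trans. Qed.

Lemma nb_le B B' h : nb B h -> B <= B' -> nb B' h.
Proof. by move=> [a [A [aA ha hA]]] BB; exists a, A; split => //; exact: le_trans BB. Qed.

Lemma nb_bm B h : nb B h -> bm h.
Proof. by move=> /nb_hol; exact: bm_hol. Qed.

Lemma nbM B B' h h' : nb B h -> nb B' h' -> nb (B * B') (fun x => h x * h' x).
Proof.
move=> [a [A [aA ha hA]]] [b [A' [bA hb hA']]].
have a0 := le_trans (normr_ge0 _) (ha x0); have b0 := le_trans (normr_ge0 _) (hb x0).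
have A0 := hol_ge0 hA; have A'0 := hol_ge0 hA'.
exists (a * b), (A * b + a * A'); split; last exact: holM hA ha hA' hb.
  apply: (@le_trans _ _ ((a + A) * (b + A'))).
    by have := mulr_ge0 A0 A'0; rewrite mulrDl !mulrDr; lra.
  by apply: ler_pM; rewrite ?addr_ge0.
by move=> x; rewrite normrM ler_pM.
Qed.

Lemma nbD B B' h h' : nb B h -> nb B' h' -> nb (B + B') (fun x => h x + h' x).
Proof.
move=> [a [A [aA ha hA]]] [b [A' [bA hb hA']]].
exists (a + b), (A + A'); split; [lra| |exact: holD].
by move=> x; apply: le_trans (ler_normD _ _) _; exact: lerD.
Qed.

Lemma nb_cst (c : R) : nb `|c| (fun=> c).
Proof. by exists `|c|, 0; rewrite addr0; split => //; exact: hol_cst. Qed.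

Lemma nbZ B c h : nb B h -> nb (`|c| * B) (fun x => c * h x).
Proof. by move=> hB; apply: nbM (nb_cst c) hB. Qed.

Lemma nb_sum n (B : 'I_n -> R) (h : 'I_n -> T -> R) : (forall i, nb (B i) (h i)) ->
  nb (\sum_i B i) (fun x => \sum_i h i x).
Proof.
elim: n B h => [|n IH] B h hB.
  rewrite big_ord0 (_ : (fun _ => _) = fun=> 0); last by apply/funext => x; rewrite big_ord0.
  by have := nb_cst 0; rewrite normr0.
rewrite big_ord_recr/= (_ : (fun _ => _) = fun x => \sum_(i < n) h (widen_ord (leqnSn n) i) x + h ord_max x).
  by apply: nbD => //; apply: IH.
by apply/funext => x; rewrite big_ord_recr.
Qed.

Lemma nbX B h n : nb B h -> nb (B ^+ n) (fun x => h x ^+ n).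
Proof.
move=> hB; elim: n => [|n IH].
  by rewrite expr0 -(normr1 R); apply: (nb_cst 1).
rewrite exprS (_ : (fun _ => _) = fun x => h x * h x ^+ n); first exact: nbM.
by apply/funext => x; rewrite exprS.
Qed.

Lemma nb_exp_coef B h j : nb B h -> nb (B ^+ j) (fun x => j`!%:R^-1 * h x ^+ j).
Proof.
move=> hB; apply: nb_le (nbZ _ (nbX j hB)) _.
rewrite ler_piMl ?exprn_ge0 ?(nb_ge0 hB)//.
by rewrite ger0_norm ?invr_ge0// invf_le1 ?ltr0n ?fact_gt0// ler1n fact_gt0.
Qed.

Variables (Phi phi g : T -> R) (l : R).
Hypothesis ep : eigenpair alpha Phi g l.
Local Notation M := (markov_op alpha Phi g l).
Local Notation W := (weight alpha Phi g l).
Variable nu : probability T R.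
Hypothesis nuM : forall h, bm h -> \int[nu]_x M h x = \int[nu]_x h x.

Lemma markov_nb : exists2 m, 0 < m & forall B h, nb B h -> nb (m * B) (M h).
Proof.
have [th [K [/andP[t0 t1] K0 hM]]] := markov_hol a01 ep.
exists (1 + 2 * K); first lra.
move=> B h [a [A [aA ha hA]]]; have A0 := hol_ge0 hA.
have a0 := le_trans (normr_ge0 _) (ha x0).
exists a, (th * A + K * (2 * a)); split.
- apply: (@le_trans _ _ ((1 + 2 * K) * (a + A))); last by rewrite ler_wpM2l//; lra.
  have := ler_wpM2r A0 (ltW t1); have := mulr_ge0 (ltW K0) A0; lra.
- move=> x; rewrite /markov_op; apply: le_trans (ler_normD _ _) _.
  rewrite (normrM (W false x)) (normrM (W true x)) !(gtr0_norm (weight_gt0 ep _ _)).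
  rewrite -[a]mul1r -(weight_sum ep x) mulrDl.
  by apply: lerD; rewrite ler_wpM2l ?(ltW (weight_gt0 ep _ _)).
- apply: hM => // x y; apply: le_trans (ler_normB _ _) _.
  by have := ha x; have := ha y; lra.
Qed.

Lemma lim_le (u : nat -> R) C : cvgn u -> (forall n, `|u n| <= C) -> `|limn u| <= C.
Proof.
move=> cu h; have h1 : `|u n| @[n --> \oo] --> `|limn u| by exact: cvg_norm.
exact: (ler_cvg_to h1 (cvg_cst C) (nearW _ h)).
Qed.

(** [Rp h] is the sum of the iterates of [M] on [h]. Its sup norm is controlled by the convergence
    to the mean, its Hoelder constant by [markov_gap]. Subtracting the integral keeps the equation,
    as [M] fixes constants, and makes the mean 0 without exchanging sum and integral. *)
Lemma neumann : (exists K r : R, [/\ 0 < K, 0 < r < 1 &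
    forall A h, hol A h -> forall n x, `|iter n M h x - \int[nu]_x h x| <= K * r ^+ n * A]) ->
  exists2 k, 0 < k & exists Rp : (T -> R) -> T -> R,
    forall B h, nb B h -> \int[nu]_x h x = 0 ->
    [/\ nb (k * B) (Rp h), forall x, Rp h x = M (Rp h) x + h x & \int[nu]_x Rp h x = 0].
Proof.
move=> [K [r [K0 r01 hK]]]; have [K' [r' [K'0 r'01 hK']]] := markov_gap a01 ep.
have /andP[r0 r1] := r01; have /andP[r'0 r'1] := r'01.
have r10 : 0 < 1 - r by rewrite subr_gt0.
have r'10 : 0 < 1 - r' by rewrite subr_gt0.
pose k1 := K / (1 - r); pose k2 := K' / (1 - r').
have k10 : 0 < k1 by exact: divr_gt0.
have k20 : 0 < k2 by exact: divr_gt0.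
exists (2 * k1 + k2); first lra.
pose S h x := limn (series (fun n => iter n M h x)).
exists (fun h x => S h x - \int[nu]_y S h y) => B h hB h0.
have hh := nb_hol hB; have B0 := nb_ge0 hB.
have gx x : geo (K * B) r (fun n => iter n M h x).
  by move=> n; have := hK _ _ hh n x; rewrite h0 subr0 mulrAC.
have r01' : 0 <= r < 1 by rewrite (ltW r0).
have r'01' : 0 <= r' < 1 by rewrite (ltW r'0).
have cS x : cvgn (series (fun n => iter n M h x)) by exact: geo_cvg r01' (gx x).
have Sb x : `|S h x| <= k1 * B.
  apply: lim_le => // n; rewrite /series/= big_mkord; apply: le_trans (ler_norm_sum _ _ _) _.
  by rewrite /k1 mulrAC; exact: geo_sum r01' (gx x).
have Sh : hol (k2 * B) (S h).
  move=> x y; rewrite -limB//; apply: lim_le; first exact: is_cvgB.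
  move=> n; rewrite /series/= !fctE !big_mkord -sumrB; apply: le_trans (ler_norm_sum _ _ _) _.
  have -> : k2 * B * da x y = (K' * B * da x y) / (1 - r') by rewrite /k2; ring.
  apply: (geo_sum (a := fun n => iter n M h x - iter n M h y)) => // i.
  by have := hK' _ _ hh i x y; have -> : K' * r' ^+ i * B * da x y = K' * B * da x y * r' ^+ i by ring.
have bS : bm (S h) by exact: bm_hol Sh.
split.
- exists (k1 * B + k1 * B), (k2 * B); split; first lra.
    move=> x; apply: le_trans (ler_normB _ _) _; rewrite lerD//.
    exact: Rint_norm.
  by move=> x y; rewrite opprB addrA subrK; exact: Sh.
- move=> x; have MS : S h x = M (S h) x + h x.
    rewrite {1}/S; apply: (@cvg_lim _ _ _ _ eventually_filter) => //; rewrite -cvg_shiftS.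
    have -> : [sequence series (fun n => iter n M h x) n.+1]_n = fun n =>
        (W false x * series (fun n => iter n M h (br false x)) n +
         W true x * series (fun n => iter n M h (br true x)) n) + h x.
      apply/funext => n; rewrite /series/= big_nat_recl//= addrC; congr (_ + _).
      by rewrite !mulr_sumr -big_split.
    apply: cvgD; last exact: cvg_cst.
    by apply: cvgD; apply: cvgMl_tmp; exact: cS.
  rewrite [LHS](_ : _ = M (S h) x + h x - \int[nu]_y S h y); last by rewrite -MS.
  rewrite /markov_op -[X in _ - X = _]mul1r -(weight_sum ep x); ring.
- rewrite RintB//; last exact: bm_cst.
  by rewrite Rint_cst subrr.
Qed.

Section formal_eigenpair.
Variables (k m P : R) (Rp : (T -> R) -> T -> R).
Hypothesis k0 : 0 < k.
Hypothesis m0 : 0 < m.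
Hypothesis P1 : 1 <= P.
Hypothesis hphi : nb P phi.
Hypothesis hM : forall B h, nb B h -> nb (m * B) (M h).
Hypothesis hR : forall B h, nb B h -> \int[nu]_x h x = 0 ->
    [/\ nb (k * B) (Rp h), forall x, Rp h x = M (Rp h) x + h x & \int[nu]_x Rp h x = 0].

(** Coefficient of [t ^+ j] in [M (expR (t * phi) * h)]. *)
Definition mkj j (h : T -> R) : T -> R := M (fun x => j`!%:R^-1 * phi x ^+ j * h x).

Let P0 : 0 < P. Proof. exact: lt_le_trans P1. Qed.

Lemma mkj_nb j B h : nb B h -> nb (m * P ^+ j * B) (mkj j h).
Proof. by move=> hB; rewrite -mulrA; apply: hM; apply: nbM => //; exact: nb_exp_coef. Qed.

(* Order n of the formal eigenvalue (fl) and eigenfunction (fstep) of the operator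
   h |-> M (exp (t phi) h), normalized by \int v 0 = 1; Rp inverts 1 - M on mean zero. *)
Definition fl (v : nat -> T -> R) n : R :=
  if n is 0 then 1 else \int[nu]_x (\sum_(j < n) mkj j.+1 (v (n - j.+1)%N) x).

Definition frhs (v : nat -> T -> R) n x : R :=
  \sum_(j < n) (mkj j.+1 (v (n - j.+1)%N) x - fl v j.+1 * v (n - j.+1)%N x).

Definition fstep (v : nat -> T -> R) n : T -> R :=
  if n is 0 then fun=> 1 else Rp (frhs v n).

Lemma fstep_exists : exists u, forall n, u n = fstep u n.
Proof.
have ltk (n : nat) (j : 'I_n) : (n - j.+1 < n)%N.
  by rewrite ltn_subrL/= (leq_ltn_trans (leq0n j)).
apply: (@strong_rec (T -> R) (fun=> 0) fstep) => v w [|n] vw //.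
rewrite /fstep; congr Rp; apply/funext => x; rewrite /frhs; apply: eq_bigr => j _.
rewrite vw//; congr (_ - _ * _); rewrite /fl; apply: eq_Rintegral => y _.
apply: eq_bigr => i _; rewrite vw//; apply: leq_trans (ltk _ i) _.
exact: ltn_ord.
Qed.

Variable u : nat -> T -> R.
Hypothesis uE : forall n, u n = fstep u n.
Local Notation la := (fl u).

Let D j : R := m * P ^+ j.

(** Majorant sequence: the recursion of [fstep] with [Rp] and [mkj] replaced by their norm bounds
    [k] and [D], with the bound this gives for [fl], and with all signs positive. *)
Let bd_spec : exists b : nat -> R, b 0%N = 1 /\ forall n, b n.+1 = k * \sum_(j < n.+1)
  (D j.+1 + \sum_(i < j.+1) D i.+1 * b (j.+1 - i.+1)%N) * b (n.+1 - j.+1)%N.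
Proof.
have ltk (n : nat) (j : 'I_n) : (n - j.+1 < n)%N.
  by rewrite ltn_subrL/= (leq_ltn_trans (leq0n j)).
have [b hb] := @strong_rec R 0 (fun v n => if n is 0 then 1 else k * \sum_(j < n)
  (D j.+1 + \sum_(i < j.+1) D i.+1 * v (j.+1 - i.+1)%N) * v (n - j.+1)%N) ltac:(
  move=> v w [//|n] vw; congr (_ * _); apply: eq_bigr => j _; rewrite vw//;
  congr ((_ + _) * _); apply: eq_bigr => i _; rewrite vw//;
  exact: leq_trans (ltk _ i) (ltn_ord j)).
by exists b; split=> [|n]; rewrite hb.
Qed.

Let D_ge0 j : 0 <= D j. Proof. by rewrite mulr_ge0 ?exprn_ge0 ?(ltW m0) ?(ltW P0). Qed.

(** Radius at which the weighted sum of the [D j], [j >= 1], is at most [1 / (6 k)]. Adding twice as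
    much for the eigenvalue terms, the induction for the majorant closes at 2, as 1 + k * (3 / (6
    k)) * 2 = 2. *)
Let rad : R := (2 * P * (1 + 6 * k * m))^-1.

Let rad0 : 0 < rad.
Proof. by rewrite invr_gt0 !mulr_gt0//; have := mulr_gt0 k0 m0; lra. Qed.

Let Dsum n : \sum_(j < n) D j.+1 * rad ^+ j.+1 <= (6 * k)^-1.
Proof.
have km := mulr_gt0 k0 m0.
have Pr : P * rad = (2 * (1 + 6 * k * m))^-1.
  by rewrite /rad; field; rewrite !gt_eqF//; lra.
have Pr2 : P * rad <= 2^-1 by rewrite Pr lef_pV2 ?posrE; lra.
have Pr0 : 0 <= P * rad by rewrite mulr_ge0 ?(ltW P0) ?(ltW rad0).
apply: le_trans (_ : \sum_(j < n) m * (P * rad) * (P * rad) ^+ j <= _).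
  apply: ler_sum => j _; rewrite le_eqVlt; apply/orP; left; apply/eqP.
  by rewrite /D exprMn !exprS; ring.
rewrite -mulr_sumr; apply: le_trans (_ : m * (P * rad) * 2 <= _).
  apply: ler_wpM2l; first by apply: mulr_ge0 Pr0; exact: ltW.
  apply: le_trans (sum_geometric_le _ _) _.
    by rewrite Pr0/=; lra.
  by rewrite -[leRHS]invrK lef_pV2 ?posrE ?invr_gt0//; lra.
rewrite Pr -[leLHS]mulrA.
have -> : m * ((2 * (1 + 6 * k * m))^-1 * 2) = m / (1 + 6 * k * m) by field; rewrite gt_eqF//; lra.
rewrite ler_pdivrMr; last by lra.
have -> : (6 * k)^-1 * (1 + 6 * k * m) = (6 * k)^-1 + m by field; rewrite gt_eqF.
by rewrite lerDr invr_ge0 mulr_ge0// ltW.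
Qed.

(** The choice of [fl] is exactly the condition that the right side [frhs] has mean 0, so [Rp]
    applies; the other terms of its integral vanish because [u n] has mean 0 for positive [n]. *)
Lemma formal_bound : exists q : R, [/\ 0 < q, geo (2 + (3 * k)^-1) q la,
  exists b, geo 2 q b /\ forall n, nb (b n) (u n) &
  forall n x, \sum_(j < n.+1) mkj j (u (n - j)%N) x = \sum_(j < n.+1) la j * u (n - j)%N x].
Proof.
have ltk (n : nat) (j : 'I_n) : (n - j.+1 < n)%N.
  by rewrite ltn_subrL/= (leq_ltn_trans (leq0n j)).
have [b [b0 bS]] := bd_spec.
pose La n := \sum_(i < n) D i.+1 * b (n - i.+1)%N.
have b_ge0 n : 0 <= b n.
  elim/ltn_ind: n => [[|n] IH]; first by rewrite b0.
  rewrite bS mulr_ge0 ?(ltW k0)// sumr_ge0// => j _; rewrite mulr_ge0 ?addr_ge0 ?IH ?ltk//.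
  rewrite sumr_ge0// => i _; rewrite mulr_ge0// IH//; exact: leq_trans (ltk _ i) (ltn_ord j).
have La_ge0 n : 0 <= La n by apply: sumr_ge0 => i _; rewrite mulr_ge0.
have u0 : u 0%N = fun=> 1 by rewrite uE.
have key n : nb (b n) (u n) /\ ((0 < n)%N -> [/\ `|la n| <= La n, \int[nu]_x u n x = 0 &
    forall x, u n x = M (u n) x + frhs u n x]).
  elim/ltn_ind: n => [[|n] IH].
    split => //; rewrite u0 b0; have := nb_cst 1; rewrite normr1; exact.
  have mb (i j : nat) : (j <= n)%N -> nb (m * P ^+ i * b j) (mkj i (u j)).
    by move=> jn; apply: mkj_nb; apply: (IH j _).1.
  have hl i : (i <= n)%N -> nb (La i.+1) (fun x => \sum_(j < i.+1) mkj j.+1 (u (i.+1 - j.+1)%N) x).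
    move=> i_n; apply: nb_sum => j; apply: mb; rewrite -ltnS.
    exact: leq_trans (ltk _ j) _.
  have hla i : (i <= n)%N -> `|la i.+1| <= La i.+1.
    move=> i_n; rewrite /fl; apply: Rint_norm; first exact: nb_bm (hl i i_n).
    by move=> x; exact: nb_sup (hl i i_n).
  have hr : nb (\sum_(j < n.+1) (D j.+1 + La j.+1) * b (n.+1 - j.+1)%N) (frhs u n.+1).
    rewrite /frhs; apply: nb_sum => j.
    have jn : (n.+1 - j.+1 <= n)%N by rewrite subSS leq_subr.
    have jn' : (j <= n)%N by rewrite -ltnS.
    rewrite mulrDl; apply: nbD; first exact: mb.
    under eq_fun do rewrite -mulNr.
    apply: nb_le (nbZ _ (IH _ _).1) _ => //.
    by rewrite normrN; apply: ler_wpM2r => //; exact: hla.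
  have I0 : \int[nu]_x frhs u n.+1 x = 0.
    rewrite /frhs; under eq_Rintegral do rewrite sumrB.
    have h2 j : (j <= n)%N -> nb (`|la j.+1| * b (n.+1 - j.+1)%N) (fun x => la j.+1 * u (n.+1 - j.+1)%N x).
      by move=> jn; apply: nbZ; apply: (IH _ _).1; rewrite subSS ltnS leq_subr.
    rewrite RintB; [|exact: nb_bm (hl n (leqnn n))|]; last first.
      by apply: bm_sum => j; apply: nb_bm (h2 j _); rewrite -ltnS.
    rewrite -/(la n.+1) Rint_sum => [|j]; last by apply: nb_bm (h2 j _); rewrite -ltnS.
    rewrite big_ord_recr/= subnn u0 mulr1 Rint_cst big1 ?add0r ?subrr// => j _.
    have jn : (n.+1 - j.+1 < n.+1)%N by rewrite subSS ltnS leq_subr.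
    rewrite RintZ; last exact: nb_bm (IH _ jn).1.
    have [_ /(_ _)[|_ -> _]] := IH _ jn; last by rewrite mulr0.
    by rewrite subSS subn_gt0.
  have [r1 r2 r3] := hR hr I0.
  rewrite {1}uE bS; split; first exact: r1.
  move=> _; split; [exact: hla| |].
    by rewrite uE.
  by move=> x; rewrite uE; exact: r2.
have rX j : 0 <= rad ^+ j by rewrite exprn_ge0// ltW.
have LaP n : \sum_(j < n) b j * rad ^+ j <= 2 ->
    \sum_(j < n) La j.+1 * rad ^+ j.+1 <= (6 * k)^-1 * 2.
  move=> IH; apply: le_trans (_ : (\sum_(j < n) D j.+1 * rad ^+ j.+1) * \sum_(i < n) b i * rad ^+ i <= _); last first.
    by apply: ler_pM; [apply: sumr_ge0 => i _; rewrite mulr_ge0|apply: sumr_ge0 => i _; rewrite mulr_ge0|exact: Dsum|].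
  apply: le_trans (triangular_sumS_le (x := fun j => D j * rad ^+ j)
    (y := fun j => b j * rad ^+ j) n _ _) => [|j|j]; last 2 first.
  - by rewrite mulr_ge0.
  - by rewrite mulr_ge0.
  rewrite [leRHS]big_ord_recl big_ord0 add0r; apply: ler_sum => j _.
  rewrite lift0 /La mulr_suml; apply: ler_sum => i _.
  have -> : rad ^+ j.+1 = rad ^+ i.+1 * rad ^+ (j.+1 - i.+1) by rewrite -exprD subnKC.
  by rewrite le_eqVlt; apply/orP; left; apply/eqP; ring.
have BP n : \sum_(j < n) b j * rad ^+ j <= 2.
  elim: n => [|n IH]; first by rewrite big_ord0.
  rewrite big_ord_recl/= b0 expr0 mulr1.
  apply: (@le_trans _ _ (1 + k * ((\sum_(j < n) (D j.+1 + La j.+1) * rad ^+ j.+1) *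
      \sum_(i < n) b i * rad ^+ i))).
    rewrite lerD2l.
    apply: (@le_trans _ _ (k * \sum_(i < n.+1) \sum_(j < i) ((D j.+1 + La j.+1) * rad ^+ j.+1) *
       (b (i - j.+1)%N * rad ^+ (i - j.+1)))).
      rewrite [in leRHS]big_ord_recl big_ord0 add0r mulr_sumr; apply: ler_sum => i _.
      rewrite lift0 bS -mulrA; apply: ler_wpM2l; first exact: ltW.
      rewrite mulr_suml; apply: ler_sum => j _.
      have -> : rad ^+ i.+1 = rad ^+ j.+1 * rad ^+ (i.+1 - j.+1) by rewrite -exprD subnKC.
      by rewrite le_eqVlt; apply/orP; left; apply/eqP; rewrite /La; ring.
    apply: ler_wpM2l; first exact: ltW.
    apply: (triangular_sumS_le (x := fun j => (D j + La j) * rad ^+ j)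
      (y := fun j => b j * rad ^+ j)) => j; rewrite mulr_ge0 ?addr_ge0//.
  have h1 : \sum_(j < n) (D j.+1 + La j.+1) * rad ^+ j.+1 <= 3 * (6 * k)^-1.
    under eq_bigr do rewrite mulrDl.
    by rewrite big_split/=; have := Dsum n; have := LaP n IH; lra.
  have h2 : (\sum_(j < n) (D j.+1 + La j.+1) * rad ^+ j.+1) * (\sum_(i < n) b i * rad ^+ i) <=
      3 * (6 * k)^-1 * 2.
    by apply: ler_pM => //; apply: sumr_ge0 => i _; rewrite mulr_ge0 ?addr_ge0.
  apply: le_trans (_ : 1 + k * (3 * (6 * k)^-1 * 2) <= _); first by rewrite lerD2l ler_wpM2l// ltW.
  have -> : k * (3 * (6 * k)^-1 * 2) = 1 by field; rewrite gt_eqF.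
  by [].
have mk0 h x : mkj 0 h x = M h x.
  by rewrite /mkj /markov_op !expr0 invr1 !mul1r.
exists rad^-1; split; first by rewrite invr_gt0.
- move=> n; rewrite exprVn ler_pdivlMr ?exprn_gt0//; case: n => [|n].
    have i3 : 0 <= (3 * k)^-1 by rewrite invr_ge0 mulr_ge0// ltW.
    by rewrite expr0 mulr1 /fl normr1; lra.
  have [_ /(_ isT)[h1 _ _]] := key n.+1.
  have h2 := LaP n.+1 (BP n.+1); rewrite big_ord_recr/= in h2.
  have h3 : 0 <= \sum_(i < n) La i.+1 * rad ^+ i.+1 by apply: sumr_ge0 => i _; rewrite mulr_ge0.
  have h4 := ler_wpM2r (rX n.+1) h1.
  have -> : (3 * k)^-1 = (6 * k)^-1 * 2 by field; rewrite gt_eqF.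
  by lra.
- exists b; split=> [n|n]; last by case: (key n).
  rewrite exprVn ger0_norm// ler_pdivlMr ?exprn_gt0//; apply: le_trans (BP n.+1).
  by rewrite big_ord_recr/= lerDr sumr_ge0// => i _; rewrite mulr_ge0.
- move=> [|n] x.
    by rewrite !big_ord1 subnn mk0 u0 /fl mul1r /markov_op !mulr1; exact: weight_sum.
  have -> : \sum_(j < n.+2) mkj j (u (n.+1 - j)%N) x =
      M (u n.+1) x + \sum_(j < n.+1) mkj j.+1 (u (n.+1 - j.+1)%N) x.
    by rewrite big_ord_recl subn0 mk0.
  have -> : \sum_(j < n.+2) la j * u (n.+1 - j)%N x =
      u n.+1 x + \sum_(j < n.+1) la j.+1 * u (n.+1 - j.+1)%N x.
    by rewrite big_ord_recl subn0 [la ord0]/= mul1r.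
  have [_ /(_ isT)[_ _ h]] := key n.+1.
  by rewrite [X in _ = X + _]h /frhs sumrB; ring.
Qed.

End formal_eigenpair.

End perturbation.

(** * Convergence of the formal eigenpair, and analyticity of the pressure along lines *)

Section pressure_analytic.
Variables (R : realType) (alpha : R).
Hypothesis a01 : 0 < alpha <= 1.
Local Notation T := (I01 R).
Local Notation hol := (hol alpha).
Local Notation pr := (pr alpha).
Local Notation x0 := (I01_0 R).

Lemma hol_nb A h : hol A h -> exists2 P, 1 <= P & nb alpha P h.
Proof.
move=> hA; have A0 := hol_ge0 hA; exists (1 + (`|h x0| + A) + A).
  have := normr_ge0 (h x0); lra.
exists (`|h x0| + A), A; split => //; first lra.
by move=> x; exact: hol_bounded hA A0.
Qed.

(** The formal series sum to [lt] and [ut], and [l * lt], [g * ut] is an eigenpair of the perturbed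
    potential. Hence the pressure is [pr Phi + ln lt], and [log_power_series] expands the
    logarithm. *)
Lemma pr_analytic Phi phi H P : hol H Phi -> hol P phi -> Phi x0 < pr Phi ->
  exists (b : nat -> R) (r : R), 0 < r /\ forall t : R, `|t| < r ->
    series (fun k => b k * t ^+ k) @ \oo --> pr (fun x => Phi x + t * phi x).
Proof.
move=> hH hP hgt; have [g ep] := pr_gt_eigen a01 hH hgt.
set l := expR (pr Phi) in ep; have l0 : 0 < l by exact: expR_gt0.
have [nu [K [r [K0 r01 nuM hK]]]] := eigen_measure a01 ep.
have [m m0 hM] := markov_nb a01 ep.
have [k k0 [Rp hR]] := neumann a01 ep (ex_intro _ K (ex_intro _ r (And3 K0 r01 hK))).
have [Q Q1 hphi] := hol_nb hP.
have [u uE] := fstep_exists alpha Phi phi g l nu Rp.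
have [q [q0 hla [b [hb hbu]] hE]] := formal_bound a01 ep k0 m0 Q1 hphi hM hR uE.
set la := fl alpha Phi phi g l nu u in hla hE.
have la0 : la 0%N = 1 by [].
have [c [rc [C' [q' [rc0 q'0 hc hlog]]]]] := log_power_series la0 q0 hla.
have Q0 : 0 < Q by exact: lt_le_trans Q1.
pose S := q + Q + q'; have S0 : 0 < S by rewrite !addr_gt0.
pose rr := Num.min rc (8 * S)^-1.
exists (fun i => if i is 0 then pr Phi + c 0%N else c i), rr; split.
  by rewrite lt_min rc0 invr_gt0 mulr_gt0.
move=> t; rewrite lt_min => /andP[trc].
rewrite -[X in _ < X]mul1r ltr_pdivlMr ?mulr_gt0// => tS.
have St : S * `|t| < 8^-1 by lra.
have S0t : 0 <= S * `|t| by rewrite mulr_ge0// ltW.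
have qS : q <= S by rewrite /S; lra.
have QS : Q <= S by rewrite /S; lra.
have q'S : q' <= S by rewrite /S; lra.
have St1 : 0 <= S * `|t| < 1 by rewrite S0t/=; lra.
pose C := 2 + (3 * k)^-1; have C2 : 2 <= C by rewrite lerDl invr_ge0 mulr_ge0// ltW.
have M0 := weight_gt0 ep; have q00 := ltW q0.
have geS q1 : q1 <= S -> q1 * `|t| <= S * `|t| by move=> ?; rewrite ler_wpM2r.
have gu x : geo C S (fun n => u n x).
  apply: (@geo_le _ 2 q) => // n; apply: le_trans (hb n); apply: le_trans (nb_sup x (hbu n)) _.
  exact: ler_norm.
have gut x := geo_pow t (gu x).
have gla : geo C S la by exact: geo_le hla q00 (lexx _) qS.
have glat := geo_pow t gla.
have gphi y : geo C (S * `|t|) (fun j => j`!%:R^-1 * phi y ^+ j * t ^+ j).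
  move=> j; have h := nb_sup y (nb_exp_coef j hphi).
  rewrite normrM normrX exprMn mulrA; apply: ler_wpM2r; first exact: exprn_ge0.
  apply: le_trans h _; apply: le_trans (_ : S ^+ j <= _).
    by rewrite lerXn2r// nnegrE ltW.
  by rewrite ler_peMl ?exprn_ge0 ?(ltW S0)//; lra.
pose ut (x : T) : R := limn (pseries (fun n => u n x) t).
pose lt : R := limn (pseries la t).
have cut x : series (fun n => u n x * t ^+ n) @ \oo --> ut x by exact: geo_cvg St1 (gut x).
have clt : series (fun n => la n * t ^+ n) @ \oo --> lt by exact: geo_cvg St1 glat.
have cexp y : series (fun j => j`!%:R^-1 * phi y ^+ j * t ^+ j) @ \oo --> expR (t * phi y).
  have := is_cvg_series_exp_coeff (t * phi y); rewrite /expR; congr (cvg_to (series _ @ \oo) _).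
  by apply/funext => j; rewrite /exp_coeff/= exprMn; ring.
have eig x : markov_op alpha Phi g l (fun y => expR (t * phi y) * ut y) x = lt * ut x.
  pose p y := fun n => \sum_(j < n.+1) (j`!%:R^-1 * phi y ^+ j * t ^+ j) * (u (n - j)%N y * t ^+ (n - j)).
  have cp y : series (p y) @ \oo --> expR (t * phi y) * ut y.
    exact: cauchy_product St1 (gphi y) (gut y) (cexp y) (cut y).
  pose W := weight alpha Phi g l.
  have h1 : W false x * series (p (br alpha false x)) n + W true x * series (p (br alpha true x)) n
      @[n --> \oo] --> markov_op alpha Phi g l (fun y => expR (t * phi y) * ut y) x.
    by apply: (@cvgD _ R^o); apply: cvgMl_tmp; exact: cp.
  have h2 := cauchy_product St1 glat (gut x) clt (cut x).
  have E : (fun n => W false x * series (p (br alpha false x)) n + W true x * series (p (br alpha true x)) n) =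
      series (fun n => \sum_(j < n.+1) la j * t ^+ j * (u (n - j)%N x * t ^+ (n - j))).
    apply/funext => n; rewrite /series/= !mulr_sumr -big_split/=; apply: eq_bigr => i _.
    have tE j : (j < i.+1)%N -> t ^+ i = t ^+ j * t ^+ (i - j) by move=> ji; rewrite -exprD subnKC.
    transitivity ((\sum_(j < i.+1) mkj alpha Phi phi g l j (u (i - j)%N) x) * t ^+ i).
      rewrite /p !mulr_sumr -big_split/= mulr_suml; apply: eq_bigr => j _.
      by rewrite (tE j (ltn_ord j)) /mkj /markov_op /W; ring.
    rewrite hE mulr_suml; apply: eq_bigr => j _; rewrite (tE j (ltn_ord j)); ring.
  by rewrite E in h1; exact: (@cvg_unique _ (@Rhausdorff R) _ _ _ _ h1 h2).
have u0 : u 0%N = fun=> 1 by rewrite uE.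
(* An eigenpair needs a function bounded away from 0; the small radius keeps [ut] within 1/2 of its
   zeroth term 1. *)
have ut1 x : `|ut x - 1| <= 2^-1.
  have h : (fun n => series (fun n => u n x * t ^+ n) n.+1 - 1) @ \oo --> ut x - 1.
    by apply: (@cvgB _ R^o); [rewrite cvg_shiftS; exact: cut|exact: cvg_cst].
  have <- : limn (fun n => series (fun n => u n x * t ^+ n) n.+1 - 1) = ut x - 1.
    exact: (@cvg_lim _ _ _ _ eventually_filter).
  apply: lim_le => [|n]; first by apply/cvg_ex; exists (ut x - 1).
  rewrite /series/= big_nat_recl// u0 expr0 mulr1 addrC addrA addNr add0r big_mkord.
  apply: le_trans (ler_norm_sum _ _ _) _.
  apply: le_trans (_ : \sum_(i < n) (2 * (q * `|t|)) * (q * `|t|) ^+ i <= _).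
    apply: ler_sum => i _; rewrite normrM normrX.
    have -> : 2 * (q * `|t|) * (q * `|t|) ^+ i = (2 * q ^+ i.+1) * `|t| ^+ i.+1.
      by rewrite exprMn !exprS; ring.
    apply: ler_wpM2r; first exact: exprn_ge0.
    by apply: le_trans (nb_sup x (hbu _)) _; apply: le_trans (ler_norm _) (hb _).
  have qt := geS _ qS; have qt0 : 0 <= q * `|t| by rewrite mulr_ge0.
  rewrite -mulr_sumr; apply: le_trans (_ : 2 * (q * `|t|) * 2 <= _); last by lra.
  apply: ler_wpM2l; first by rewrite mulr_ge0.
  apply: le_trans (sum_geometric_le _ _) _; first by rewrite qt0/=; lra.
  by rewrite -[leRHS]invrK lef_pV2 ?posrE ?invr_gt0//; lra.
have uth : hol (2 / (1 - S * `|t|)) ut.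
  move=> x y; rewrite -limB; [|exact: geo_cvg St1 (gut x)|exact: geo_cvg St1 (gut y)].
  apply: lim_le; first by apply: is_cvgB; [exact: geo_cvg St1 (gut x)|exact: geo_cvg St1 (gut y)].
  move=> n; rewrite !fctE /pseries /series/= !big_mkord -sumrB; apply: le_trans (ler_norm_sum _ _ _) _.
  rewrite mulrAC; apply: (geo_sum (a := fun n => u n x * t ^+ n - u n y * t ^+ n)) => // i.
  rewrite -mulrBl normrM normrX exprMn mulrA; apply: ler_wpM2r; first exact: exprn_ge0.
  apply: le_trans (nb_hol (hbu i) x y) _; rewrite mulrAC; apply: ler_wpM2r; first exact: da_ge0.
  apply: le_trans (le_trans (ler_norm _) (hb i)) _; rewrite ler_wpM2l// lerXn2r// nnegrE// ltW//.
have utb x : 2^-1 <= ut x <= 2.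
  by have := ut1 x; rewrite ler_norml => /andP[h1 h2]; apply/andP; split; lra.
have utp x : 0 < ut x by case/andP: (utb x); lra.
have lt0 : 0 < lt.
  rewrite -(pmulr_lgt0 _ (utp x0)) -eig /markov_op.
  by apply: addr_gt0; (apply: mulr_gt0; [exact: M0|apply: mulr_gt0; [exact: expR_gt0|exact: utp]]).
have ep' : eigenpair alpha (fun x => Phi x + t * phi x) (fun x => g x * ut x) (l * lt).
  case: (ep) => _ [c1 [b1 [c10 gb]]] [B gB] [H' hH'] gL.
  split.
  - exact: mulr_gt0 l0 lt0.
  - exists (c1 * 2^-1), (b1 * 2); split=> [|x]; first by rewrite mulr_gt0.
    have /andP[g1 g2] := gb x; have /andP[u1 u2] := utb x.
    by apply/andP; split; apply: ler_pM => //; [exact: ltW|apply: le_trans g1; exact: ltW|exact: ltW].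
  - have hg x : `|g x| <= b1.
      have /andP[g1 g2] := gb x; rewrite ger0_norm//; apply: le_trans g1; exact: ltW.
    have hu x : `|ut x| <= 2 by rewrite gtr0_norm//; case/andP: (utb x).
    by eexists; exact: holM gB hg uth hu.
  - by exists (H + `|t| * P); apply: holD => //; exact: holZ.
  move=> x; have := eig x; rewrite /markov_op /weight /tr /brop !expRD => e.
  have lg0 : l * g x != 0 by rewrite mulf_neq0 ?gt_eqF// (eigen_gt0 ep).
  rewrite -[l * lt * _]/(l * lt * (g x * ut x)).
  have -> : l * lt * (g x * ut x) = (l * g x) * (lt * ut x) by ring.
  rewrite -e; field; move: lg0; rewrite mulf_eq0 negb_or => /andP[-> ->] //.
have hH2 : hol (H + `|t| * P) (fun x => Phi x + t * phi x) by apply: holD => //; exact: holZ.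
have [-> _] := pr_eigen a01 hH2 ep'.
rewrite lnM ?posrE// expRK /lt hlog// expRK.
have cc : series (fun i => c i * t ^+ i) @ \oo --> limn (pseries c t).
  by apply: (geo_pseries_cvg (ltW q'0) hc); have := geS _ q'S; lra.
rewrite -cvg_shiftS.
rewrite (_ : [sequence _]_n = fun n => pr Phi + series (fun i => c i * t ^+ i) n.+1); last first.
  by apply/funext => n; rewrite /series/= !big_nat_recl// expr0 !mulr1 addrA.
by apply: (@cvgD _ R^o); [exact: cvg_cst|rewrite cvg_shiftS].
Qed.

End pressure_analytic.

(** * Phase transitions *)

Section transition.
Variables (R : realType) (alpha : R).
Hypothesis a01 : 0 < alpha <= 1.
Local Notation T := (I01 R).
Local Notation hol := (hol alpha).
Local Notation f := (@intermittent R alpha).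
Local Notation pr := (pr alpha).
Local Notation x0 := (I01_0 R).
Implicit Types (phi psi : T -> R) (b c : R).

Definition frozen phi b : Prop := pr (fun x => b * phi x) <= b * phi x0.

Definition critical phi b : Prop :=
  [/\ 0 < b, frozen phi b & forall c, 0 < c < b -> ~ frozen phi c].

Section one_potential.
Variables (phi : T -> R) (H : R).
Hypothesis hH : hol H phi.
Let F := pressure_fun alpha phi.
Let hZ b : hol (`|b| * H) (fun x => b * phi x). Proof. exact: holZ. Qed.

Lemma frozenE b : frozen phi b -> F b = b * phi x0.
Proof. by move=> h; apply/eqP; rewrite eq_le h (phi0_le_pr a01 (hZ b)). Qed.

Lemma frozen_ground b nu : 0 < b -> frozen phi b -> invariant_measure f nu ->
  \int[nu]_x phi x <= phi x0.
Proof.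
move=> b0 h nui; rewrite -(ler_pM2l b0) -RintZ; last exact: (bm_hol a01 hH).
by apply: le_trans h; exact: (Rint_le_pr a01 (hZ b)).
Qed.

Lemma frozen_le b c : 0 < b -> b <= c -> frozen phi b -> frozen phi c.
Proof.
move=> b0 bc h; rewrite /frozen (pr_freeze a01 hH bc h) // => nu nui.
exact: frozen_ground h nui.
Qed.

Lemma pr_scale_dist : exists C, 0 <= C /\ 
  forall b c, `|pr (fun x => b * phi x) - pr (fun x => c * phi x)| <= C * `|b - c|.
Proof.
have H0 := hol_ge0 hH; exists (`|phi x0| + H); split; first exact: addr_ge0.
move=> b' c'; apply: (pr_dist a01 (hZ b') (hZ c')) => x.
by rewrite -mulrBl normrM mulrC ler_wpM2r// (hol_bounded a01 _ hH).
Qed.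

Lemma frozen_lim b : (forall e, 0 < e -> exists2 c, frozen phi c & `|b - c| <= e) -> frozen phi b.
Proof.
move=> h; have [C [C0 hC]] := pr_scale_dist.
apply/ler_addgt0Pr => e e0; pose D := C + `|phi x0| + 1.
have D0 : 0 < D by rewrite ltr_wpDl// addr_ge0.
have [c hc bc] := h (e / D) (divr_gt0 e0 D0).
have h1 := hC b c; rewrite ler_norml in h1; have [_ h2] := andP h1.
have h3 : (c - b) * phi x0 <= `|b - c| * `|phi x0|.
  by apply: le_trans (ler_norm _) _; rewrite normrM distrC.
have h4 : D * `|b - c| <= e by rewrite mulrC -ler_pdivlMr.
have := normr_ge0 (b - c); rewrite /frozen in hc; rewrite /D in h4; lra.
Qed.

(** At [b = 0] the pressure is positive while [b * phi x0] is 0, and both sides are Lipschitz in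
    [b]. *)
Lemma frozen_pos : exists2 e, 0 < e & forall b, `|b| < e -> ~ frozen phi b.
Proof.
have [C [C0 hC]] := pr_scale_dist.
have p0 := pr0_gt0 a01; pose D := C + `|phi x0| + 1.
have D0 : 0 < D by rewrite ltr_wpDl// addr_ge0.
have E : pr (fun x => 0 * phi x) = pr (fun=> 0).
  by congr pr; apply/funext => x; rewrite mul0r.
exists (pr (fun=> 0) / D) => [|b]; first exact: divr_gt0.
rewrite ltr_pdivlMr// => bD hb; have := hC 0 b.
rewrite sub0r normrN E ler_norml => /andP[_ h2].
have h3 : b * phi x0 <= `|b| * `|phi x0|.
  by apply: le_trans (ler_norm _) _; rewrite normrM.
have := normr_ge0 b; rewrite /frozen in hb; rewrite /D in bD; lra.
Qed.

Lemma critical_exists b : 0 < b -> frozen phi b -> exists c, critical phi c.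
Proof.
move=> b0 hb; pose S := [set c | 0 < c /\ frozen phi c].
have [e e0 he] := frozen_pos.
have lS : lbound S e.
  move=> c [c0 hc]; rewrite leNgt; apply/negP => ce.
  by apply: he hc; rewrite gtr0_norm.
have iS : has_inf S by split; [exists b | exists e].
have ei : e <= inf S by apply: lb_le_inf => //; exists b.
exists (inf S); split; first exact: lt_le_trans ei.
  apply: frozen_lim => d d0; have [c [c0 hc] ci] := inf_adherent d0 iS.
  have ic : inf S <= c by apply: ge_inf => //; exists e.
  by exists c => //; rewrite distrC ger0_norm ?subr_ge0//; lra.
move=> c /andP[c0 ci] hc; have : inf S <= c by apply: ge_inf; [exists e|].
by rewrite leNgt ci.
Qed.

Lemma critical_uniq b c : critical phi b -> critical phi c -> b = c.
Proof.
move=> [b0 hb bb] [c0 hc cc]; have [bc|cb|//] := ltgtP b c.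
  by case: (cc b) => //; rewrite b0.
by case: (bb c) => //; rewrite c0.
Qed.

Definition affine_coef (p q : R) (k : nat) : R :=
  match k with 0%N => p | 1%N => q | _ => 0 end.

Lemma affine_series p q h :
  series (fun k => affine_coef p q k * h ^+ k) @ \oo --> p + q * h.
Proof.
apply: cvg_near_cst; exists 2%N => //= -[|[|n]] // _.
rewrite /series/= big_ltn// big_ltn// big_nat big1/=; first by ring.
by case=> [|[|k]] // _; rewrite mul0r.
Qed.

Lemma unfrozen_analytic b : ~ frozen phi b -> real_analytic_at F b.
Proof.
move=> /negP; rewrite -ltNge => hb.
have [a [r [r0 h]]] := pr_analytic a01 (hZ b) hH hb.
exists a, r; split => // x xr; have := h _ xr; congr (_ --> pr _).
by apply/funext => y; rewrite -mulrDl addrC subrK.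
Qed.

Lemma frozen_analytic b c : 0 < c < b -> frozen phi c -> real_analytic_at F b.
Proof.
move=> /andP[c0 cb] hc; exists (affine_coef (b * phi x0) (phi x0)), (b - c).
split=> [|x]; first by rewrite subr_gt0.
rewrite ltr_norml => /andP[xc _].
rewrite (frozenE (frozen_le c0 _ hc)); last by lra.
by rewrite (_ : x * _ = b * phi x0 + phi x0 * (x - b)); [exact: affine_series|ring].
Qed.

(** A power series at [b] would be affine, because the pressure is affine to the right of [b]; it
    would then be affine to the left too, which makes [phi] frozen before [b]. *)
Lemma critical_not_analytic b : critical phi b -> ~ real_analytic_at F b.
Proof.
move=> [b0 hb bb] [a [r [r0 ha]]].
pose a' k := a k - affine_coef (b * phi x0) (phi x0) k.
have cvg_a' h : `|h| < r ->
    series (fun k => a' k * h ^+ k) @ \oo --> F (b + h) - (b + h) * phi x0.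
  move=> hr; have := ha (b + h); rewrite addrC addKr => /(_ hr) h1.
  have := @cvgB _ R^o _ _ _ _ _ _ _ h1 (@affine_series (b * phi x0) (phi x0) h).
  rewrite (_ : b * phi x0 + phi x0 * h = (b + h) * phi x0); last by ring.
  rewrite (_ : _ - _ = series (fun k => a' k * h ^+ k)); first by apply.
  apply/funext => n; rewrite !fctE.
  by rewrite /series/= -sumrB; apply: eq_bigr => k _; rewrite mulrBl.
have a'0 : forall k, a' k = 0.
  apply: (power_series_eq0 r0) => h /andP[h0 hr]; have := cvg_a' h.
  by rewrite ger0_norm// (frozenE (frozen_le b0 _ hb)) ?lerDl// subrr; apply.
pose d := Num.min (r / 2) (b / 2).
have d0 : 0 < d by rewrite lt_min !divr_gt0.
have [dr db] : d <= r / 2 /\ d <= b / 2 by rewrite !ge_min !lexx orbT.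
apply: (bb (b - d)); first by apply/andP; split; lra.
have := cvg_a' (- d); rewrite normrN gtr0_norm// => /(_ _) h1.
have {}h1 := h1 ltac:(lra).
have h2 : series (fun k => a' k * (- d) ^+ k) @ \oo --> (0 : R).
  rewrite (_ : series _ = cst 0); first exact: cvg_cst.
  by apply/funext => n; rewrite /series/= big1// => k _; rewrite a'0 mul0r.
have := @cvg_unique _ (@Rhausdorff R) _ _ _ _ h1 h2.
move=> /(_ _) /eqP; rewrite subr_eq0 => /eqP h3; by rewrite /frozen -[leLHS]/(F (b - d)) h3.
Qed.

Lemma transition_critical : phase_transition alpha phi <-> exists b, critical phi b.
Proof.
split=> [/existsNP[b /not_implyP[b0 nb]]|[b hb] /(_ b)].
  by apply: (critical_exists b0); apply: contrapT => /unfrozen_analytic.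
by case: (hb) => b0 _ _ /(_ b0); exact: critical_not_analytic.
Qed.

Lemma transition_parameterE b : critical phi b -> transition_parameter alpha phi = b.
Proof.
move=> hb; have [b0 fb bb] := hb; rewrite /transition_parameter.
case: xgetP => [c _ [c0 hc]|/(_ b)]; last first.
  by case; split => //; exact: critical_not_analytic.
have [cb|bc|//] := ltgtP c b.
  by case: hc; apply/unfrozen_analytic/bb; rewrite c0.
by case: hc; apply: frozen_analytic fb; rewrite b0.
Qed.

End one_potential.

Local Notation X := (hoelder_fct alpha).
Implicit Types u v : X.

Lemma norm_hol u : hol `|u| u.
Proof.
move=> x y; apply: le_trans (hoelder_quotientP x y (hoelderP u)) _.
rewrite ler_wpM2r ?powR_ge0// -[leRHS]/(sup_norm u + hoelder_seminorm alpha u).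
by rewrite lerDr (le_trans _ (hoelder_le_sup_norm u x0)).
Qed.

Lemma le_hoelder_norm u x : `|u x| <= `|u|.
Proof.
apply: le_trans (hoelder_le_sup_norm u x) _.
rewrite -[leRHS]/(sup_norm u + hoelder_seminorm alpha u) lerDl.
have [q hq] := hoelder_quotients_nonempty alpha u.
exact: le_trans (hoelder_quotients_ge0 hq) (ub_le_sup (hoelderP u) hq).
Qed.

Lemma hoelder_near u (P : X -> Prop) e : 0 < e ->
  (forall v, `|v - u| < e -> P v) -> \forall v \near u, P v.
Proof.
move=> e0 h; apply/nbhs_ballP; exists e => // v.
by rewrite -ball_normE/= distrC; exact: h.
Qed.

Lemma unfrozen_near u b : ~ frozen u b -> \forall v \near u, ~ frozen (v : X) b.
Proof.
move=> /negP; rewrite -ltNge => hb.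
pose g := pr (fun x => b * u x) - b * u x0.
have g0 : 0 < g by rewrite subr_gt0.
have B0 : 0 < 2 * (`|b| + 1) by rewrite mulr_gt0// ltr_wpDl.
apply: (@hoelder_near _ _ (g / (2 * (`|b| + 1)))) => [|v]; first exact: divr_gt0.
rewrite ltr_pdivlMr// => uv hv.
have h x : `|b * v x - b * u x| <= `|b| * `|v - u|.
  by rewrite -mulrBr normrM ler_wpM2l// (le_hoelder_norm (v - u)).
have h1 := pr_dist a01 (holZ b (@norm_hol v)) (holZ b (@norm_hol u)) h.
have h0 := h x0; have n0 := normr_ge0 (v - u).
rewrite !ler_norml in h0 h1; move: h0 h1 => /andP[_ h0] /andP[h1 _].
rewrite /frozen in hv; rewrite /g in uv; nra.
Qed.

(** [pr_freeze_near] for the potential b u with the factor [b' / b]; the strict increase of the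
    parameter is the price of openness. *)
Lemma frozen_near u b b' : 0 < b < b' -> frozen u b -> \forall v \near u, frozen (v : X) b'.
Proof.
move=> /andP[b0 bb'] hu; have c1 : 1 < b' / b by rewrite ltr_pdivlMr// mul1r.
have [e e0 he] := pr_freeze_near a01 (holZ b (@norm_hol u)) hu c1.
apply: (@hoelder_near _ _ (e / b)) => [|v]; first exact: divr_gt0.
rewrite ltr_pdivlMr// => uv; have := he (fun x => b * v x) _ (holZ b (@norm_hol v)).
have E x : b' / b * (b * v x) = b' * v x by rewrite mulrA divfK// gt_eqF.
rewrite /frozen E (_ : (fun x => b' / b * _) = fun x => b' * v x); last exact/funext.
apply => x y; have := holZ b (@norm_hol (v - u)) x y.
rewrite -!mulrBr => h; apply: le_trans h _.
by rewrite ler_wpM2r ?powR_ge0// gtr0_norm// mulrC ltW.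
Qed.

Lemma critical_near u b e : critical u b -> 0 < e ->
  \forall v \near u, exists2 c, critical (v : X) c & `|b - c| <= e.
Proof.
move=> [b0 fb bb] e0; pose d := Num.min e (b / 2).
have d0 : 0 < d by rewrite lt_min e0 divr_gt0.
have [de db] : d <= e /\ d <= b / 2 by rewrite !ge_min !lexx orbT.
have n1 : \forall v \near u, frozen (v : X) (b + d).
  by apply: frozen_near fb; rewrite b0 ltrDl.
have n2 : \forall v \near u, ~ frozen (v : X) (b - d).
  by apply/unfrozen_near/bb/andP; split; lra.
apply: filterS2 n1 n2 => v h1 h2.
have [c hc] := critical_exists (@norm_hol v) (addr_gt0 b0 d0) h1.
have [c0 fc cc] := hc; exists c => //; rewrite ler_distl.
have h3 : c <= b + d.
  rewrite leNgt; apply/negP => h; apply: (cc _ _ h1).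
  by rewrite h addr_gt0.
have h4 : b - d <= c.
  rewrite leNgt; apply/negP => h; apply: h2.
  exact: (frozen_le (@norm_hol v) c0 (ltW h) fc).
by apply/andP; split; lra.
Qed.

Lemma transition_parameter_cvg u : phase_transition alpha u ->
  transition_parameter alpha (v : X) @[v --> u] --> transition_parameter alpha u.
Proof.
move=> /(transition_critical (@norm_hol u))[b hb].
rewrite (transition_parameterE (@norm_hol u) hb).
apply/(@cvgrPdist_le _ R^o _ _ (nbhs_filter u)) => e e0; apply: filterS (critical_near hb e0) => v [c hc].
by rewrite (transition_parameterE (@norm_hol v) hc).
Qed.

Lemma phase_transition_near u : phase_transition alpha u ->
  \forall v \near u, phase_transition alpha (v : X).
Proof.
move=> /(transition_critical (@norm_hol u))[b hb].
apply: filterS (critical_near hb ltr01) => v [c hc _].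
by apply/(transition_critical (@norm_hol v)); exists c.
Qed.

Lemma beta_critP u b : beta_crit alpha u = b%:E <-> critical u b.
Proof.
rewrite /beta_crit; case: asboolP => [/(transition_critical (@norm_hol u))[c hc]|h].
  rewrite (transition_parameterE (@norm_hol u) hc).
  by split=> [[<-]//|hb]; rewrite (critical_uniq hb hc).
by split=> // hb; case: h; apply/(transition_critical (@norm_hol u)); exists b.
Qed.

(** At a potential of value +oo no parameter is frozen. Being unfrozen at a large [b] persists
    nearby, and frozen parameters form a half-line, so neighbours have critical value above [b]. *)
Lemma beta_crit_continuous : continuous (fun u : X => beta_crit alpha u).
Proof.
move=> u; rewrite /continuous_at {2}/beta_crit; case: asboolP => hu.
  apply: (@cvg_EFin _ _ _ (nbhs_filter u)).
    apply: filterS (phase_transition_near hu) => v hv.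
    by rewrite /beta_crit asboolT.
  apply: cvg_trans (transition_parameter_cvg hu); apply: near_eq_cvg.
  apply: filterS (phase_transition_near hu) => v hv.
  by rewrite /= /beta_crit asboolT.
apply/(@cvgeyPge _ _ _ (nbhs_filter u)) => A; pose b := Num.max A 1.
have b0 : 0 < b by rewrite lt_max ltr01 orbT.
have hb : ~ frozen u b.
  by move=> /(critical_exists (@norm_hol u) b0) /(transition_critical (@norm_hol u)).
apply: filterS (unfrozen_near hb) => v hv.
rewrite /beta_crit; case: asboolP => [|_]; last exact: leey.
move=> /(transition_critical (@norm_hol v))[c hc].
rewrite (transition_parameterE (@norm_hol v) hc) lee_fin.
apply: (@le_trans _ _ b); first by rewrite le_max lexx.
rewrite leNgt; apply/negP => cb; apply: hv; case: hc => c0 fc _.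
exact: (frozen_le (@norm_hol v) c0 (ltW cb) fc).
Qed.

Lemma intermittent_phaseE u : intermittent_phase alpha alpha u <-> ~ frozen u 1.
Proof.
rewrite /frozen mul1r (_ : (fun x => 1 * u x) = u); last first.
  by apply/funext => x; rewrite mul1r.
split=> [[nu [gu mu eu]]|/negP].
  by apply/negP; rewrite -ltNge; exact: mixing_pr_gt (@norm_hol u) gu mu eu.
by rewrite -ltNge => /(pr_gt_gibbs a01 (@norm_hol u)).
Qed.

(** Freezing at some [c < 1] would persist at 1 in a neighbourhood, out of reach of the intermittent
    phase. Conversely, when 1 is critical, the multiples (1 - d) u are unfrozen at 1 and converge to
    u. *)
Lemma phase_transition_locusE u : phase_transition_locus alpha alpha u <-> critical u 1.
Proof.
split=> [[cu nu]|[_ f1 b1]].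
  have f1 : frozen u 1.
    apply: contrapT => /unfrozen_near h; apply: nu.
    by apply: filterS h => v; exact: (intermittent_phaseE v).2.
  split=> // c c1 /(frozen_near c1) /cu[v [/intermittent_phaseE]]; exact.
split=> [U /nbhs_ballP[e /= e0 eU]|/interior_subset/intermittent_phaseE//].
pose M := 2 * (`|u| + 1); have M0 : 0 < M by rewrite mulr_gt0// ltr_wpDl.
pose d := Num.min (2^-1) (e / M).
have d0 : 0 < d by rewrite lt_min invr_gt0 ltr0n divr_gt0.
have [d2 dM] : d <= 2^-1 /\ d * M <= e.
  by rewrite -ler_pdivlMr// !ge_min !lexx orbT.
exists ((1 - d) *: u); split.
  apply/intermittent_phaseE => hf; apply: (b1 (1 - d)); first by apply/andP; split; lra.
  move: hf; rewrite /frozen mul1r; congr (is_true (pr _ <= _)).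
  by apply/funext => x; rewrite mul1r.
apply: eU; rewrite -ball_normE/= scalerBl scale1r subKr normrZ gtr0_norm//.
by apply: lt_le_trans dM; rewrite ltr_pM2l// /M; have := normr_ge0 u; lra.
Qed.

Lemma ground_setE u : ground_set alpha alpha u <->
  forall nu : probability T R, invariant_measure f nu -> \int[nu]_x u x <= u x0.
Proof.
have bu := bm_hol a01 (@norm_hol u).
rewrite /ground_set/= /ground_state Rint_delta0//.
set S := [set _ | nu in _]; have S0 : S (u x0).
  by exists (delta0 R); [exact: delta0_invariant | exact: Rint_delta0].
have uS : has_ubound S.
  by exists (pr u) => _ [nu nui <-]; exact: (Rint_le_pr a01 (@norm_hol u) nui).
split=> [[_ E] nu nui|h].
  by rewrite E; apply: ub_le_sup => //; exists nu.
split; first exact: delta0_invariant.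
apply/eqP; rewrite eq_le ub_le_sup//=; apply: ge_sup; first by exists (u x0).
by move=> _ [nu nui <-]; exact: h.
Qed.

Lemma critical_ground u b : critical u b -> (ground_set alpha alpha)° u.
Proof.
move=> [b0 fb _]; have b1 : 0 < b + 1 by rewrite addr_gt0.
have := @frozen_near u b (b + 1); rewrite b0 ltrDl ltr01 => /(_ isT fb).
apply: filterS => v hv; apply/ground_setE => nu nui.
exact: (frozen_ground (@norm_hol v) b1 hv nui).
Qed.

Lemma ground_critical u : (ground_set alpha alpha)° u -> exists b, critical u b.
Proof.
move=> /nbhs_ballP[e /= e0 he]; have [B B0 hB] := cusp_pressure a01.
have w_in : (fun x : T => I01_val x `^ alpha) \in hoelder_pred alpha.
  apply/asboolP; apply: (hoelder_seminorm_le (C := 1) _).1; exact: (hol_cusp a01).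
pose w : X := Hoelder w_in; pose d := e / (2 * (`|w| + 1)).
have W0 : 0 < 2 * (`|w| + 1) by rewrite mulr_gt0// ltr_wpDl.
have d0 : 0 < d by rewrite divr_gt0.
have /he/ground_setE hg : ball u e (u + d *: w).
  rewrite -ball_normE/= opprD addNKr normrN normrZ gtr0_norm//.
  rewrite /d mulrAC ltr_pdivrMr// ltr_pM2l//; have := normr_ge0 w; lra.
apply: (@critical_exists _ _ (@norm_hol u) (B / d)); first exact: divr_gt0.
have bu := bm_hol a01 (@norm_hol u); have bw := bm_hol a01 (@norm_hol w).
apply: (pr_le a01 (holZ (B / d) (@norm_hol u))) => nu nui.
have := hg nu nui; rewrite -[(u + d *: w) x0]/(u x0 + d * (I01_val x0 `^ alpha)).
rewrite powR0 ?gt_eqF//; last by case/andP: a01.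
rewrite mulr0 addr0 (_ : \int[nu]_x _ = \int[nu]_x u x + d * \int[nu]_x w x); last first.
  by rewrite -RintZ// -RintD//; exact: bmZ.
move=> h1; rewrite RintZ//.
have h2 := pr_ge a01 (holZ (- B) (@norm_hol w)) nui.
rewrite RintZ// in h2.
(* [B / d] times the ground state inequality for [u + d *: w] trades the integral of [u] for that of
   [- B * w], whose pressure is at most 0. *)
have h3 : B / d * \int[nu]_x u x <= - B * \int[nu]_x w x + B / d * u x0.
  rewrite -subr_ge0 (_ : _ - _ = B / d * (u x0 - (\int[nu]_x u x + d * \int[nu]_x w x))).
    by rewrite mulr_ge0 ?subr_ge0// ltW// divr_gt0.
  by field; rewrite gt_eqF.
apply: (@le_trans _ _ (entropy f nu + (- B * \int[nu]_x w x)%:E + (B / d * u x0)%:E)%E).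
  by rewrite -addeA -EFinD leeD2l// lee_fin.
by apply: le_trans (leeD2r _ h2) _; rewrite -EFinD lee_fin gerDr.
Qed.

End transition.

Theorem theoremD (R : realType) (alpha : R) (alpha_gt0 : 0 < alpha)
    (alpha_le1 : alpha <= 1) :
  (forall phi : hoelder_fct alpha,
     phase_transition alpha phi -> persistent alpha phi) /\
  continuous (fun phi : hoelder_fct alpha => beta_crit alpha phi) /\
  (fun phi : hoelder_fct alpha => beta_crit alpha phi) @^-1` [set 1%E]
    = phase_transition_locus alpha alpha /\
  phase_transition_locus alpha alpha `<=` (ground_set alpha alpha)° /\
  (fun phi : hoelder_fct alpha => beta_crit alpha phi) @^-1`
      [set b | (0 < b < +oo)%E]
    = (ground_set alpha alpha)°.
Proof.
have a01 : 0 < alpha <= 1 by rewrite alpha_gt0.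
split=> [phi hphi|].
  by split; [exact: phase_transition_near|exact: transition_parameter_cvg].
split; first exact: beta_crit_continuous.
split.
  apply/seteqP; split=> phi.
    by move=> /(beta_critP a01 phi 1) /(phase_transition_locusE a01).
  by move=> /(phase_transition_locusE a01) /(beta_critP a01 phi 1).
split=> [phi /(phase_transition_locusE a01)|]; first exact: critical_ground.
apply/seteqP; split=> phi /=.
  rewrite beta_crit_gt0/=; case E : (beta_crit alpha phi) => [b| |]//= _.
    by apply: (critical_ground a01 (b := b)); apply/beta_critP.
  by have := beta_crit_gt0 alpha phi; rewrite E.
move=> /(ground_critical a01)[b /(beta_critP a01) E].
by rewrite beta_crit_gt0 E ltry.
Qed.
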